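(* Let $n\geq 2$ be an integer and let $g=e^{2u}|dx|^2$ be a smooth, complete conformal metric on $\mathbb{R}^n$ with finite total Q-curvature. Then $g$ is normal if and only if $\tau(g)$ is finite. Moreover, if $\tau(g)$ is finite, then $$\tau(g)=1-\frac{2}{(n-1)!|\mathbb{S}^n|}\int_{\mathbb{R}^n}Qe^{nu}\,\mathrm{d}x.$$
   Context: For a smooth function $u$ on $\mathbb{R}^n$, the Q-curvature $Q$ of $g=e^{2u}|dx|^2$ is defined by the equation $(-\Delta)^{n/2}u=Qe^{nu}$ on $\mathbb{R}^n$. When $n$ is odd, $(-\Delta)^{n/2}$ means $(-\Delta)^{1/2}\circ(-\Delta)^{(n-1)/2}$, where it is assumed that $(-\Delta)^{(n-1)/2}u\in L_{1/2}(\mathbb{R}^n):=\{\varphi\in L^1_{loc}(\mathbb{R}^n): \int_{\mathbb{R}^n}\frac{|\varphi(x)|}{1+|x|^{n+1}}dx<\infty\}$, and for such $f$, $(-\Delta)^{1/2}f(x)=C(n)\,\mathrm{P.V.}\int_{\mathbb{R}^n}\frac{f(x)-f(y)}{|x-y|^{n+1}}dy$ (equivalently $\widehat{(-\Delta)^{1/2}f}(\xi)=|\xi|\hat f(\xi)$). The metric has finite total Q-curvature if $Q$ is well defined in this sense and $Qe^{nu}\in L^1(\mathbb{R}^n)$. The metric is called normal if $$u(x)=\frac{2}{(n-1)!|\mathbb{S}^n|}\int_{\mathbb{R}^n}\log\frac{|y|}{|x-y|}Q(y)e^{nu(y)}\,dy+C$$ for some constant $C$, where $|\mathbb{S}^n|$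 is the volume of the standard unit sphere $\mathbb{S}^n$. The volume entropy is $\tau(g):=\limsup_{R\to\infty}\frac{\log V_g(B_R(0))}{\log|B_R(0)|}$, where $B_R(0)$ is the Euclidean ball of radius $R$ centered at the origin, $V_g(B_R(0))=\int_{B_R(0)}e^{nu}dx$ is its $g$-volume and $|B_R(0)|$ its Euclidean volume. Complete means $(\mathbb{R}^n,g)$ is complete as a Riemannian manifold. *)

(* Defs.v *)
From HB Require Import structures.
From mathcomp Require Import all_boot all_order all_algebra.
From mathcomp Require Import all_classical all_reals all_analysis.
Set Implicit Arguments. Unset Strict Implicit. Unset Printing Implicit Defensive.
Import Order.TTheory GRing.Theory Num.Theory.
Import numFieldNormedType.Exports.
Local Open Scope classical_set_scope.
Local Open Scope ring_scope.

Section Defs.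
Context {R : realType} {n : nat}.
Notation V := 'rV[R]_n.

(* Euclidean norm |x| on R^n (the library norm on 'rV is the sup norm). *)
Definition enorm (x : V) : R := Num.sqrt (\sum_(i < n) x ord0 i ^+ 2).

Definition eball (r : R) : set V := [set x | enorm x < r].

Definition ebasis (i : 'I_n) : V := delta_mx ord0 i.

Definition partial (i : 'I_n) (f : V -> R) : V -> R :=
  fun x => derive f x (ebasis i).

Fixpoint iter_partial (l : seq 'I_n) (f : V -> R) : V -> R :=
  match l with [::] => f | i :: l' => partial i (iter_partial l' f) end.

Definition smooth (f : V -> R) : Prop :=
  forall l : seq 'I_n, continuous (iter_partial l f) /\
    forall (i : 'I_n) (x : V), derivable (iter_partial l f) x (ebasis i).

Definition Lap (f : V -> R) : V -> R := fun x => \sum_(i < n) partial i (partial i f) x.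

Definition upd (x : V) (k : nat) (t : R) : V :=
  \row_(j < n) (if (j : nat) == k then t else x ord0 j).

Fixpoint iter_int (k : nat) (F : V -> \bar R) (x : V) : \bar R :=
  match k with
  | 0%N => F x
  | k'.+1 => (\int[lebesgue_measure]_(t in [set: R]) iter_int k' F (upd x k' t))%E
  end.

(* integral over R^n of a nonnegative function (Tonelli: iterated integrals) *)
Definition Rn_int (F : V -> \bar R) : \bar R := iter_int n F 0.

Definition Rn_measurable (A : set V) : Prop :=
  g_sigma_preimage (fun (i : 'I_n) (x : V) => x ord0 i) A.

Definition Rn_measurable_fun (f : V -> R) : Prop :=
  forall B : set R, measurable B -> Rn_measurable (f @^-1` B).

Definition Rn_integrable (f : V -> R) : Prop :=
  Rn_measurable_fun f /\ (Rn_int (fun y => (`|f y|)%:E) < +oo)%E.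

Definition Rn_integral (f : V -> R) : R :=
  fine (Rn_int (fun y => (Num.max (f y) 0)%:E)) -
  fine (Rn_int (fun y => (Num.max (- f y) 0)%:E)).

Definition Rn_vol (A : set V) : R := fine (Rn_int (fun y => (\1_A y)%:E)).

Definition L_half (f : V -> R) : Prop :=
  Rn_measurable_fun f /\
  (Rn_int (fun y => (`|f y| / (1 + enorm y ^+ n.+1))%:E) < +oo)%E.

(* C(n) = Gamma((n+1)/2) / pi^((n+1)/2), written for odd n where (n+1)/2 = n./2 + 1 *)
Definition Chalf : R := (n./2)`!%:R / pi ^+ (n./2).+1.

Definition trunc_pv (f : V -> R) (x : V) (e : R) : R :=
  Rn_integral (fun y => if e < enorm (x - y)
                        then (f x - f y) / enorm (x - y) ^+ n.+1 else 0).

(* frac_lap_eq u P : "(-Delta)^{n/2} u is well defined and equals P".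
   n even: (-Delta)^{n/2} = (-1)^{n/2} Delta^{n/2};
   n odd : (-Delta)^{1/2} o (-Delta)^{(n-1)/2}, with (-Delta)^{(n-1)/2}u in L_{1/2}
           and (-Delta)^{1/2} given by the principal value integral. *)
Definition frac_lap_eq (u P : V -> R) : Prop :=
  let f := fun x => (-1) ^+ (n./2) * iter (n./2) Lap u x in
  if ~~ odd n then forall x, P x = f x
  else L_half f /\
       forall x, (fun e => Chalf * trunc_pv f x e) @ 0^'+ --> P x.

Fixpoint sphere_vol (k : nat) : R :=
  match k with
  | 0%N => 2
  | 1%N => 2 * pi
  | (k'.+1 as k1).+1 => 2 * pi / k1%:R * sphere_vol k'
  end.

Definition gvol (u : V -> R) (r : R) : R :=
  fine (Rn_int (fun y => (\1_(eball r) y * expR (n%:R * u y))%:E)).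

Definition vol_entropy (u : V -> R) : \bar R :=
  limf_esup (fun r : R => (ln (gvol u r) / ln (Rn_vol (eball r)))%:E) +oo%R.

Definition admissible (x y : V) (c : R -> V) : Prop :=
  c 0 = x /\ c 1 = y /\ (forall t, derivable c t 1) /\ continuous (c^`())%classic.

Definition glength (u : V -> R) (c : R -> V) : \bar R :=
  (\int[lebesgue_measure]_(t in `[0%R, 1%R]) (expR (u (c t)) * enorm ((c^`())%classic t))%:E)%E.

Definition gdist (u : V -> R) (x y : V) : \bar R :=
  ereal_inf [set glength u c | c in admissible x y].

Definition gcomplete (u : V -> R) : Prop :=
  forall a : nat -> V,
    (forall e : R, 0 < e -> exists N, forall m k, (N <= m)%N -> (N <= k)%N ->
        (gdist u (a m) (a k) < e%:E)%E) ->
    exists L : V, forall e : R, 0 < e -> exists N, forall k, (N <= k)%N ->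
        (gdist u (a k) L < e%:E)%E.

Definition normal (u Q : V -> R) : Prop :=
  exists C : R, forall x : V,
    Rn_integrable (fun y => ln (enorm y / enorm (x - y)) * (Q y * expR (n%:R * u y))) /\
    u x = 2 / ((n.-1)`!%:R * sphere_vol n) *
          Rn_integral (fun y => ln (enorm y / enorm (x - y)) * (Q y * expR (n%:R * u y))) + C.

End Defs.

(* Main.v *)
(** Write F = Q e^{nu}, alpha = c_n \int F and v for the logarithmic potential
    of F.  If the volume of balls grows polynomially, the moments of u against
    compactly supported weights satisfy an ODE driven by those of F, so that
    |u| is integrable against a power of 1 + |x|; hence u and F can be tested
    against high finite differences D^k (in a coordinate direction) of the
    Poisson kernel P_t, and (-Delta)^{n/2} becomes d^n/dt^n on P_t.
    Integrating n times in t from 0 to infinity gives D^k u = D^k v pointwise.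
    So H = u - v is polynomial along coordinate lines.  If H were not constant
    it would grow linearly to +oo or to -oo along a tube of parallel rays: the
    first contradicts the polynomial volume growth (Jensen on balls), the
    second makes some ray of the tube have finite length and contradicts
    completeness.  Conversely, v = -alpha log|x| + o(log|x|) + Lam * F with
    Lam = log(1/|.|) on the unit ball and 0 elsewhere; exp(p Lam * F) is controlled by
    Jensen, completeness forces alpha <= 1 by the same ray argument, and the
    volume of B_R is R^{n(1 - alpha) + o(1)}. *)
Require Import Defs.
From HB Require Import structures.
From mathcomp Require Import all_boot all_order all_algebra finmap.
From mathcomp Require Import all_classical all_reals all_analysis.
From mathcomp Require Import measurable_realfun measurable_fun_approximation simple_functions ring lra zify.
Set Implicit Arguments. Unset Strict Implicit. Unset Printing Implicit Defensive.
Import Order.TTheory GRing.Theory Num.Theory.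
Import numFieldNormedType.Exports.
Local Open Scope classical_set_scope.
Local Open Scope ring_scope.

(** * Lebesgue measure on R^n *)

(** The only a priori control on [u] is integrability against some power q of 1/(1 + |x|), while P_t
    decays like |x|^(-n-1); each finite difference buys one more power, so k is taken at least q.
    Harmonicity of P_t in (t, x) gives Delta P_t = - d^2/dt^2 P_t, and the semigroup law gives
    (-Delta)^(1/2) P_t = - d/dt P_t. Even and odd n thus lead to the same d^n/dt^n, and no Fourier
    transform appears: the semigroup law is itself proved by differentiating convolutions in time.
    Undoing the n derivatives produces the weight t^(n-1)/(n-1)! in front of P_t, whose primitive in
    t tends to a logarithm at t = 0; this is the origin of c_n = 2 / ((n-1)! |S^n|). The other
    obstacle is that F is merely integrable and locally bounded, without sign, so Lam * F has no
    global pointwise bound. Lower bounds on volume therefore use its mean over balls, and upper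
    bounds on volume and length use an integrable majorant of its exponential. Such a majorant says
    nothing about one prescribed ray, hence the tubes of rays and Tonelli. *)

(* The sigma-algebra is the one of [Rn_measurable]. *)
Definition rV_display : measure_display -> measure_display.
Proof. exact. Qed.

Section rV_measurable.
Context {R : realType} {n : nat}.
Let coor (i : 'I_n) (x : 'rV[R]_n) : R := x ord0 i.

Let rV_set0 : g_sigma_preimage coor set0.
Proof. exact: sigma_algebra0. Qed.

Let rV_setC A : g_sigma_preimage coor A -> g_sigma_preimage coor (~` A).
Proof. exact: sigma_algebraC. Qed.

Let rV_bigcup (F : _^nat) : (forall i, g_sigma_preimage coor (F i)) ->
  g_sigma_preimage coor (\bigcup_i (F i)).
Proof. exact: sigma_algebra_bigcup. Qed.

HB.instance Definition _ := @isMeasurable.Build (rV_display default_measure_display)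
  'rV[R]_n (g_sigma_preimage coor) rV_set0 rV_setC rV_bigcup.

End rV_measurable.

Section rV_measure.
Context {R : realType} {n : nat}.
Notation V := 'rV[R]_n.
Lemma measurable_coord (i : 'I_n) : measurable_fun [set: V] (fun x => x ord0 i).
Proof.
move=> _ Y mY; rewrite setTI; apply: sub_sigma_algebra => /=.
rewrite -bigcup_seq/=; exists i => /=; first by rewrite mem_index_enum.
by exists Y => //; rewrite setTI.
Qed.

Lemma measurable_rVP d (T : measurableType d) (f : T -> V) :
  (forall i, measurable_fun [set: T] (fun x => f x ord0 i)) -> measurable_fun [set: T] f.
Proof.
move=> mf.
suff H : g_sigma_preimage (fun i (x : V) => x ord0 i) `<=`
   [set A | measurable (f @^-1` A)].
  by move=> _ A mA; rewrite setTI; exact: H.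
apply: smallest_sub.
  split => /=.
  - by rewrite preimage_set0.
  - by move=> A mA; rewrite setTD preimage_setC; exact: measurableC.
  - by move=> F mF; rewrite preimage_bigcup; by apply: bigcupT_measurable => i; have := mF i.
rewrite -bigcup_seq; apply: bigcup_sub => i _ A [B mB <-] /=.
by have := mf i measurableT B mB; rewrite !setTI.
Qed.

Lemma measurable_upd (k : nat) : measurable_fun [set: V * R] (fun p => upd p.1 k p.2).
Proof.
apply: measurable_rVP => i; rewrite /upd.
have [ik|ik] := eqVneq (i : nat) k.
  rewrite (_ : (fun _ => _) = snd) //.
  by apply/funext => -[x t]; rewrite mxE ik eqxx.
rewrite (_ : (fun _ => _) = (fun x : V => x ord0 i) \o fst).
  by apply: measurableT_comp; [exact: measurable_coord|exact: measurable_fst].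
by apply/funext => -[x t]; rewrite mxE (negbTE ik).
Qed.

Local Open Scope ereal_scope.

Lemma iter_int_ge0 k (F : V -> \bar R) x : (forall x, 0 <= F x) -> 0 <= iter_int k F x.
Proof.
move=> F0; elim: k x => [|k IH] x //=.
by apply: integral_ge0 => t _; exact: IH.
Qed.

Lemma measurable_iter_int k (F : V -> \bar R) :
  (forall x, 0 <= F x) -> measurable_fun [set: V] F ->
  measurable_fun [set: V] (iter_int k F).
Proof.
move=> F0 mF; elim: k => [|k IH] //=.
have := @measurable_fun_fubini_tonelli_F _ _ V (measurableTypeR R) R lebesgue_measure
  (fun p => iter_int k F (upd p.1 k p.2)).
apply.
- by apply: measurableT_comp => //; exact: measurable_upd.
- by move=> p; exact: iter_int_ge0.
Qed.

Lemma measurable_upd1 k x : measurable_fun [set: R] (fun t => upd x k t : V).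
Proof.
have := measurableT_comp (measurable_upd k) (measurable_pair1 x).
exact.
Qed.

Lemma measurable_iter_int1 k (F : V -> \bar R) x j :
  (forall x, 0 <= F x) -> measurable_fun [set: V] F ->
  measurable_fun [set: R] (fun t => iter_int k F (upd x j t)).
Proof.
move=> F0 mF; apply: measurableT_comp; first exact: measurable_iter_int.
exact: measurable_upd1.
Qed.

Lemma iter_int_nneseries k (F : nat -> V -> \bar R) x :
  (forall j x, 0 <= F j x) -> (forall j, measurable_fun [set: V] (F j)) ->
  iter_int k (fun x => \sum_(j <oo) F j x) x = \sum_(j <oo) iter_int k (F j) x.
Proof.
move=> F0 mF; elim: k x => [|k IH] x //=.
under eq_integral do rewrite IH.
rewrite integral_nneseries //.
- by move=> j; apply: measurable_iter_int1.
- by move=> j t _; exact: iter_int_ge0.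
Qed.

Lemma eq_iter_int k (F G : V -> \bar R) x : F =1 G -> iter_int k F x = iter_int k G x.
Proof. by move=> /funext ->. Qed.

Lemma iter_int_sum k (I : Type) (s : seq I) (F : I -> V -> \bar R) x :
  (forall j x, 0 <= F j x) -> (forall j, measurable_fun [set: V] (F j)) ->
  iter_int k (fun x => \sum_(j <- s) F j x) x = \sum_(j <- s) iter_int k (F j) x.
Proof.
move=> F0 mF; elim: k x => [|k IH] x //=.
under eq_integral do rewrite IH.
rewrite ge0_integral_sum //.
- by move=> j; apply: measurable_iter_int1.
- by move=> j t _; exact: iter_int_ge0.
Qed.

Lemma iter_intZ k (F : V -> \bar R) x (c : R) : (0 <= c)%R ->
  (forall x, 0 <= F x) -> measurable_fun [set: V] F ->
  iter_int k (fun x => c%:E * F x) x = c%:E * iter_int k F x.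
Proof.
move=> c0 F0 mF; elim: k x => [|k IH] x //=.
under eq_integral do rewrite IH.
rewrite ge0_integralZl_EFin //.
- by move=> t _; exact: iter_int_ge0.
- by apply: measurable_iter_int1.
Qed.

Lemma le_iter_int k (F G : V -> \bar R) x :
  (forall x, 0 <= F x) -> measurable_fun [set: V] F ->
  measurable_fun [set: V] G -> (forall x, F x <= G x) ->
  iter_int k F x <= iter_int k G x.
Proof.
move=> F0 mF mG FG.
have G0 y : 0 <= G y by exact: le_trans (FG y).
elim: k x => [|k IH] x //=.
apply: ge0_le_integral => //.
- by move=> t _; exact: iter_int_ge0.
- by apply: measurable_iter_int1.
- by apply: measurable_iter_int1.
Qed.

Lemma iter_int_lim k (F : nat -> V -> \bar R) x :
  (forall j x, 0 <= F j x) -> (forall j, measurable_fun [set: V] (F j)) ->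
  (forall x, nondecreasing_seq (F ^~ x)) ->
  iter_int k (fun x => limn (F ^~ x)) x = limn (fun j => iter_int k (F j) x).
Proof.
move=> F0 mF ndF; elim: k x => [|k IH] x //=.
under eq_integral do rewrite IH.
rewrite -monotone_convergence //.
- by move=> j; apply: measurable_iter_int1.
- by move=> j t _; exact: iter_int_ge0.
- by move=> t _ i j ij; apply: le_iter_int => // y; exact: ndF.
Qed.

Lemma iter_int0 k x : iter_int k (fun _ : V => 0) x = 0.
Proof.
elim: k x => [|k IH] x //=.
by under eq_integral do rewrite IH; rewrite integral0.
Qed.

(** Built from the iterated integral of the statement, so that the integration theory of measures
    applies to it and [int_vmeas] translates back. *)
Definition vmeas (A : set V) : \bar R := Rn_int (fun y => (\1_A y)%:E).

Lemma measurable_indicE (A : set V) : measurable A ->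
  measurable_fun [set: V] (fun y => (\1_A y)%:E : \bar R).
Proof. by move=> mA; apply/measurable_EFinP; exact: measurable_indic. Qed.

Let vmeas0 : vmeas set0 = 0.
Proof.
rewrite /vmeas /Rn_int -[RHS](iter_int0 n 0); apply: eq_iter_int => y.
by rewrite indic0.
Qed.

Let vmeas_ge0 A : 0 <= vmeas A.
Proof. by apply: iter_int_ge0 => y; rewrite lee_fin. Qed.

Let vmeas_semi_sigma_additive : semi_sigma_additive vmeas.
Proof.
move=> F mF tF mU; rewrite /vmeas.
have -> : Rn_int (fun y => (\1_(\bigcup_i F i) y)%:E) =
   \sum_(j <oo) Rn_int (fun y : V => (\1_(F j) y)%:E) :> \bar R.
  rewrite -iter_int_nneseries; [|by move=> j y; rewrite lee_fin
                                |by move=> j; exact: measurable_indicE].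
  by apply: eq_iter_int => y; rewrite indic_bigcup.
by apply: is_cvg_ereal_nneg_natsum => j _; apply: iter_int_ge0 => y; rewrite lee_fin.
Qed.

HB.instance Definition _ := isMeasure.Build _ V R vmeas
  vmeas0 vmeas_ge0 vmeas_semi_sigma_additive.

Import HBNNSimple.

Lemma nnsfun_int (g : {nnsfun V >-> R}) :
  \int[vmeas]_x (g x)%:E = Rn_int (fun x => (g x)%:E).
Proof.
rewrite integralT_nnsfun sintegralE fsbig_finite//=.
have gE x : (g x)%:E = \sum_(y <- fset_set (range g)) (y%:E * (\1_(g @^-1` [set y]) x)%:E).
  by rewrite (fimfunE g x) fsbig_finite// -sumEFin; apply: eq_bigr => y _; rewrite EFinM.
(* [iter_int_sum] asks each summand to be nonnegative for every real [y], not only for the values of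
   [g]; [Num.max y 0] guarantees this and changes nothing on the range. *)
have gE' x : (g x)%:E = \sum_(y <- fset_set (range g)) ((Num.max y 0)%:E * (\1_(g @^-1` [set y]) x)%:E).
  rewrite gE; apply: eq_big_seq => y; rewrite in_fset_set// inE => -[z _ <-].
  by rewrite max_l.
rewrite /Rn_int (eq_iter_int n 0 gE') iter_int_sum.
- apply: eq_big_seq => y; rewrite in_fset_set// inE => -[z _ <-].
  by rewrite max_l // iter_intZ //; exact: measurable_indicE.
- by move=> y x; rewrite mule_ge0// lee_fin// le_max lexx orbT.
- move=> y; apply: measurable_funeM; exact: measurable_indicE.
Qed.

Lemma int_vmeas (F : V -> \bar R) : (forall x, 0 <= F x) ->
  measurable_fun [set: V] F -> \int[vmeas]_x F x = Rn_int F.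
Proof.
move=> F0 mF.
pose g := nnsfun_approx measurableT mF.
have gF x : F x = limn (fun j => (g j x)%:E).
  by apply/esym/cvg_lim => //; exact: cvg_nnsfun_approx.
under eq_integral do rewrite gF.
rewrite monotone_convergence //.
- rewrite /Rn_int (eq_iter_int n 0 gF) iter_int_lim.
  + by congr (limn _); apply/funext => j; rewrite nnsfun_int.
  + by move=> j x; rewrite lee_fin fun_ge0.
  + by move=> j; exact/measurable_EFinP.
  + by move=> x a b ab; rewrite lee_fin; exact/lefP/nd_nnsfun_approx.
- by move=> j; exact/measurable_EFinP.
- by move=> j x _; rewrite lee_fin fun_ge0.
- by move=> x _ a b ab; rewrite lee_fin; exact/lefP/nd_nnsfun_approx.
Qed.

End rV_measure.

(** * Derivative rules *)

Lemma der_eq (R : numFieldType) (V W : normedModType R) (f g : V -> W) x v d d' :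
  is_derive x v f d -> f =1 g -> d = d' -> is_derive x v g d'.
Proof. by move=> + /funext <- <-. Qed.

Lemma der1_comp (R : realType) (f g : R -> R) (x a b : R) : is_derive x 1 g b ->
  is_derive (g x) 1 f a -> is_derive x 1 (fun t => f (g t)) (a * b).
Proof. by move=> H2 H1; exact: is_derive1_comp. Qed.

Lemma der1V (R : realType) (f : R -> R) (x d : R) : is_derive x 1 f d ->
  f x != 0 -> is_derive x 1 (fun y => (f y)^-1) (- d / f x ^+ 2).
Proof.
move=> H fx; apply: (der_eq (@is_deriveV _ f x d 1 fx H)) => //.
by rewrite /GRing.scale /=; ring.
Qed.

Section der_rules.
Context {R : realType} {V : normedModType R}.
Implicit Types (f g : V -> R) (x v : V) (a b : R).

Lemma derD f g x v a b : is_derive x v f a -> is_derive x v g b ->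
  is_derive x v (fun y => f y + g y) (a + b).
Proof. by move=> H1 H2; exact: is_deriveD. Qed.

Lemma derB f g x v a b : is_derive x v f a -> is_derive x v g b ->
  is_derive x v (fun y => f y - g y) (a - b).
Proof. by move=> H1 H2; exact: is_deriveB. Qed.

Lemma derM f g x v a b : is_derive x v f a -> is_derive x v g b ->
  is_derive x v (fun y => f y * g y) (a * g x + f x * b).
Proof.
move=> H1 H2; apply: (der_eq (@is_deriveM _ _ f g x v a b H1 H2)) => //.
by rewrite /GRing.scale /=; ring.
Qed.

Lemma derC x v a : is_derive x v (fun _ => a) 0.
Proof. exact: is_derive_cst. Qed.

Lemma derZ f x v a c : is_derive x v f a -> is_derive x v (fun y => c * f y) (c * a).
Proof.
move=> H; apply: (der_eq (derM (derC x v c) H)) => //.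
by rewrite mul0r add0r.
Qed.

Lemma derX f x v a m : is_derive x v f a ->
  is_derive x v (fun y => f y ^+ m) (m%:R * f x ^+ m.-1 * a).
Proof.
move=> H; apply: (der_eq (@is_deriveX _ _ f m x v a H)) => // y.
by rewrite exprfctE.
Qed.

End der_rules.

(** * One-variable integrals behind the mass of the Poisson kernel *)

Section wallis.
Context {R : realType}.

Lemma cvgy_le (f : R -> R) (l c : R) :
  (forall t, 1 <= t -> `|f t - l| <= c / t) -> f t @[t --> +oo%R] --> l.
Proof.
move=> fl; apply/cvgrPdist_le => e e0; near=> t.
have t0 : 0 < t by near: t; apply: nbhs_pinfty_gt; rewrite num_real.
have ct : c / t <= e.
  by rewrite ler_pdivrMr // mulrC -ler_pdivrMr.
by rewrite distrC (le_trans (fl _ _)).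
Unshelve. all: by end_near. Qed.
Implicit Types (t c : R).

Lemma sqrt1_gt0 t : 0 < Num.sqrt (1 + t ^+ 2).
Proof. by rewrite sqrtr_gt0 ltr_wpDr ?sqr_ge0. Qed.

Lemma is_derive_sqrtD c t : 0 < c ->
  is_derive t 1 (fun t => Num.sqrt (c + t ^+ 2)) (t / Num.sqrt (c + t ^+ 2)).
Proof.
move=> c0; have ct : 0 < c + t ^+ 2 by rewrite ltr_wpDr ?sqr_ge0.
have H1 := is_derive1_sqrt ct.
have H2 : is_derive t 1 (fun t => c + t ^+ 2) (2 * t).
  by apply: is_derive_eq; rewrite /GRing.scale /=; ring.
apply: (der_eq (der1_comp H2 H1)) => //.
by field; rewrite gt_eqF // sqrtr_gt0.
Qed.

(** This is (1 + t^2)^(-(j+1)/2), what remains of the Poisson kernel when one coordinate is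
    integrated and the others are scaled out. *)
Definition wallis (j : nat) t : R := (Num.sqrt (1 + t ^+ 2) ^+ j.+1)^-1.

Lemma wallis_ge0 j t : 0 <= wallis j t.
Proof. by rewrite invr_ge0 exprn_ge0 // sqrtr_ge0. Qed.

Lemma is_derive_wallis j t :
  is_derive t 1 (wallis j) (- j.+1%:R * t * wallis j.+2 t).
Proof.
have H1 := @is_derive_sqrtD 1 t ltr01.
have s0 := sqrt1_gt0 t.
have H2 : is_derive t 1 (fun t => Num.sqrt (1 + t ^+ 2) ^+ j.+1) _ := derX j.+1 H1.
apply: (der_eq (der1V H2 _)) => //; first by rewrite expf_neq0 // gt_eqF.
rewrite /wallis /=; move: s0; set s := Num.sqrt _ => s0.
rewrite !exprS; have : s ^+ j != 0 by rewrite expf_neq0// gt_eqF.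
by move: (s ^+ j) => p p0; field; rewrite p0 gt_eqF.
Qed.

Lemma wallis1 t : wallis 1 t = (1 + t ^+ 2)^-1.
Proof. by rewrite /wallis sqr_sqrtr // addr_ge0 ?sqr_ge0. Qed.

Lemma wallis_S2 j t : (1 + t ^+ 2) * wallis j.+2 t = wallis j t.
Proof.
have s0 := sqrt1_gt0 t.
rewrite -[1 + t ^+ 2]sqr_sqrtr ?addr_ge0 ?sqr_ge0// /wallis.
move: s0; set s := Num.sqrt _ => s0.
rewrite !exprS; have : s ^+ j != 0 by rewrite expf_neq0// gt_eqF.
by move: (s ^+ j) => p p0; field; rewrite p0 gt_eqF.
Qed.

Lemma sphere_vol_gt0 k : 0 < sphere_vol k :> R.
Proof.
elim/ltn_ind: k => -[|[|k]] IH //=; first by rewrite mulr_gt0 ?pi_gt0.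
by rewrite mulr_gt0 ?IH // divr_gt0 // mulr_gt0 // pi_gt0.
Qed.

Lemma sphere_volSS k : sphere_vol k.+2 = 2 * pi / k.+1%:R * sphere_vol k :> R.
Proof. by []. Qed.

(** Turns out to be the integral of [wallis j] over the line ([int_wallis]). As a ratio of
    consecutive sphere volumes it telescopes over the coordinates in [iter_int_poisson]. *)
Definition wconst j : R := sphere_vol j / sphere_vol j.-1.

Lemma wconst_S2 j : (0 < j)%N -> j.+1%:R * wconst j.+2 = j%:R * wconst j.
Proof.
case: j => // j _; rewrite /wconst !succnK !sphere_volSS.
have /lt0r_neq0 h1 := sphere_vol_gt0 j; have /lt0r_neq0 h2 := sphere_vol_gt0 j.+1.
have /lt0r_neq0 p0 := pi_gt0 R.
have j1 : j.+1%:R != 0 :> R by rewrite pnatr_eq0.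
have j2 : j.+2%:R != 0 :> R by rewrite pnatr_eq0.
move: h1 h2 j1 j2 p0; move: (sphere_vol j) (sphere_vol j.+1) (j.+1%:R) (j.+2%:R) pi.
by move=> a b c d p a0 b0 c0 d0 p0; field; rewrite ?p0 ?a0 ?b0 ?c0 ?d0.
Qed.

(** Integration by parts lowers the exponent by two, so an antiderivative of [wallis j.+3] is made
    from one of [wallis j.+1]. The base cases are [atan] and t / sqrt(1 + t^2); the limits obey the
    same recursion as the sphere volumes ([wconst_S2]). *)
Lemma wallis_antiderivative j : (0 < j)%N -> exists A : R -> R,
  [/\ A 0 = 0, forall t, is_derive t 1 A (wallis j t) &
      A t @[t --> +oo%R] --> wconst j / 2].
Proof.
elim/ltn_ind: j => -[//|[|[|j]]] IH _.
- exists atan; split; first by rewrite atan0.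
    by move=> t; rewrite wallis1; exact: is_derive1_atan.
  rewrite /wconst /=.
  rewrite (_ : 2 * pi / 2 / 2 = pi / 2); last by move: pi => p; field.
  exact: cvgy_atan.
- exists (fun t => t / Num.sqrt (1 + t ^+ 2)); split; first by rewrite mul0r.
    move=> t; have H1 := @is_derive_sqrtD 1 t ltr01; have s0 := sqrt1_gt0 t.
    have H2 := der1V H1 (lt0r_neq0 s0).
    have H3 : is_derive t 1 (fun t => t * (Num.sqrt (1 + t ^+ 2))^-1) _ := derM (is_derive_id t (1:R)) H2.
    apply: (der_eq H3) => //.
    have : Num.sqrt (1 + t ^+ 2) ^+ 2 = 1 + t ^+ 2.
      by rewrite sqr_sqrtr ?addr_ge0 ?sqr_ge0.
    rewrite /wallis /GRing.scale /=; move: s0; set s := Num.sqrt _ => s0 s2.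
    have -> : (s ^+ 3)^-1 = (s ^+ 2 - t ^+ 2) / s ^+ 3 by rewrite s2 addrK mul1r.
    by field; rewrite gt_eqF.
  rewrite (_ : wconst 2 / 2 = 1); last first.
    by rewrite /wconst /=; have /lt0r_neq0 := pi_gt0 R; move: pi => p p0; field; rewrite p0.
  apply: (@cvgy_le _ _ 1) => t t1.
  have s0 := sqrt1_gt0 t; set s := Num.sqrt _ in s0 *.
  have t0 : 0 < t by lra.
  have st : t < s.
    by rewrite -[t]ger0_norm ?(ltW t0)// -sqrtr_sqr ltr_sqrt ?ltrDr// ltr_wpDr ?sqr_ge0.
  have st1 : s <= 1 + t.
    rewrite -[1 + t]ger0_norm ?(addr_ge0 _ (ltW t0))// -sqrtr_sqr ler_sqrt ?sqr_ge0//.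
    by nra.
  rewrite distrC ger0_norm; last by rewrite subr_ge0 ler_pdivrMr// mul1r ltW.
  rewrite lerBlDr -[X in X <= _](@divff _ s) ?gt_eqF//.
  rewrite ler_pdivrMr// mulrDl divfK ?gt_eqF//.
  suff : 1 <= 1 / t * s by move: st1; set z := 1 / t * s; lra.
  by rewrite mulrAC mul1r ler_pdivlMr// mul1r ltW.
- have [A [A0 dA Al]] := IH j.+1 (ltnW (ltnSn _)) isT.
  exists (fun t => (j.+1%:R * A t + t * wallis j.+1 t) / j.+2%:R); split.
  + by rewrite A0 mulr0 mul0r addr0 mul0r.
  + move=> t; have := dA t; have := is_derive_wallis j.+1 t => H1 H2.
    have H3 := derD (derZ j.+1%:R H2) (derM (is_derive_id t (1:R)) H1).
    apply: (der_eq (derM H3 (derC t 1 j.+2%:R^-1))) => //.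
    rewrite -(wallis_S2 j.+1 t).
    by field; rewrite -(natrD _ 2) pnatr_eq0.
  + have -> : wconst j.+3 / 2 = (j.+1%:R * (wconst j.+1 / 2) + 0) / j.+2%:R.
      rewrite addr0 mulrA -wconst_S2//.
      by field; rewrite -(natrD _ 2) pnatr_eq0.
    apply: cvgMl; apply: cvgD; first exact: cvgMr.
    apply: (@cvgy_le _ _ 1) => t t1.
    have s0 := sqrt1_gt0 t; set s := Num.sqrt _ in s0 *.
    have t0 : 0 < t by lra.
    have s1 : 1 <= s by rewrite -[X in X <= _]sqrtr1 ler_wsqrtr // lerDl sqr_ge0.
    rewrite subr0 ger0_norm; last by rewrite mulr_ge0 ?wallis_ge0// ltW.
    rewrite ler_pdivlMr // mulrAC -expr2 /wallis -/s ler_pdivrMr ?exprn_gt0// mul1r.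
    apply: (@le_trans _ _ (s ^+ 2)).
      by rewrite sqr_sqrtr ?lerDr// addr_ge0// sqr_ge0.
    by rewrite ler_weXn2l.
Qed.

Lemma der1_continuous (f df : R -> R) : (forall t, is_derive t 1 f (df t)) -> continuous f.
Proof.
move=> H t; apply: differentiable_continuous.
by apply/derivable1_diffP; case: (H t).
Qed.

Lemma int_wallis j : (0 < j)%N ->
  (\int[lebesgue_measure]_t (wallis j t)%:E = (wconst j)%:E)%E.
Proof.
move=> j0; have [A [A0 dA Al]] := wallis_antiderivative j0.
have cw := der1_continuous (is_derive_wallis j).
have cA := der1_continuous dA.
rewrite ge0_symfun_integralT //; last 2 first.
- exact: wallis_ge0.
- by move=> t; rewrite /= /wallis sqrrN.
rewrite -set_itvcy (@ge0_continuous_FTC2y _ _ A _ (wconst j / 2)).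
- by rewrite A0 -EFinB subr0 -EFinM mulrC divfK.
- by move=> t _; exact: wallis_ge0.
- exact: continuous_subspaceT.
- by [].
- by move=> t _; case: (dA t).
- exact/cvg_at_right_filter/cA.
- by move=> t _; rewrite derive1E; apply: derive_val.
Qed.

Lemma measurable_affine (s a : R) :
  measurable_fun [set: measurableTypeR R] (fun t : R => s * t + a : measurableTypeR R).
Proof. by apply: measurable_funD => //; apply: measurable_funM. Qed.

(** The pushforward of Lebesgue measure under t -> s t + a, multiplied by s, gives each interval its
    length; uniqueness of Lebesgue measure then identifies the two measures. *)
Lemma lebesgue_affine_pos (f : R -> \bar R) (s a : R) : 0 < s ->
  measurable_fun [set: R] f -> (forall t, (0 <= f t)%E) ->
  (\int[lebesgue_measure]_t f (s * t + a)%R =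
   (s^-1)%:E * \int[lebesgue_measure]_t f t)%E.
Proof.
move=> s0 mf f0.
pose phi := fun t : R => s * t + a : measurableTypeR R.
have mphi : measurable_fun [set: measurableTypeR R] phi by exact: measurable_affine.
have E A : measurable A -> lebesgue_measure A =
    mscale (NngNum (ltW s0)) (pushforward lebesgue_measure phi) A.
  move=> mA; apply: (@lebesgue_measure_unique R) => //.
  move=> _ [[x y] _ <-] /=; rewrite /mscale /pushforward /=.
  rewrite [X in (_ * lebesgue_measure X)%E](_ : _ = `](x - a) / s, (y - a) / s]%classic); last first.
    apply/seteqP; split => t /=; rewrite !in_itv /= /phi => /andP[h1 h2]; apply/andP; split.
    - by rewrite ltr_pdivrMr// ltrBlDr mulrC.
    - by rewrite ler_pdivlMr// lerBrDr mulrC.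
    - by rewrite -ltrBlDr mulrC -ltr_pdivrMr.
    - by rewrite -lerBrDr mulrC -ler_pdivlMr.
  rewrite !lebesgue_measure_itv /= !lte_fin ltr_pM2r ?invr_gt0// ltrD2r.
  case: ifP => _; last by rewrite mule0.
  rewrite -!EFinB -EFinM; congr EFin.
  by field; rewrite gt_eqF.
rewrite [X in _ = (_ * X)%E](eq_measure_integral _ (fun A mA _ => E mphi A mA)).
rewrite ge0_integral_mscale //.
rewrite muleA -EFinM mulVf ?gt_eqF// mul1e.
have H := ge0_integral_pushforward mphi lebesgue_measure measurableT mf (fun y _ => f0 y).
by rewrite preimage_setT in H; exact: (esym H).
Qed.

Lemma lebesgue_opp (f : R -> \bar R) :
  measurable_fun [set: R] f -> (forall t, (0 <= f t)%E) ->
  (\int[lebesgue_measure]_t f (- t)%R = \int[lebesgue_measure]_t f t)%E.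
Proof.
move=> mf f0.
have mN : measurable_fun [set: measurableTypeR R] (-%R : _ -> measurableTypeR R).
  exact: oppr_measurable.
have H := ge0_integral_pushforward mN lebesgue_measure measurableT mf (fun y _ => f0 y).
rewrite preimage_setT in H; rewrite -[LHS]H.
by apply: eq_measure_integral => //= A mA _; exact: lebesgue_measureN.
Qed.

Lemma lebesgue_affine (f : R -> \bar R) (s a : R) : s != 0 ->
  measurable_fun [set: R] f -> (forall t, (0 <= f t)%E) ->
  (\int[lebesgue_measure]_t f (s * t + a)%R =
   (`|s|^-1)%:E * \int[lebesgue_measure]_t f t)%E.
Proof.
move=> s0 mf f0; have [s1|s1] := ltP 0 s.
  by rewrite lebesgue_affine_pos // gtr0_norm.
have {s0 s1}s1 : s < 0 by rewrite lt_neqAle s0.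
rewrite ltr0_norm// -(lebesgue_affine_pos a _ mf f0) ?oppr_gt0//.
rewrite -[RHS]lebesgue_opp //.
  by apply: eq_integral => t _; rewrite mulrNN.
by apply: measurableT_comp => //; exact: measurable_affine.
Qed.

End wallis.

Section rV_integral.
Context {R : realType} {n : nat}.
Notation V := 'rV[R]_n.
Notation mu := (@vmeas R n).
Local Open Scope ereal_scope.

Lemma mcomp d (T : measurableType d) (f : R -> R) (g : T -> R) :
  measurable_fun [set: R] f -> measurable_fun [set: T] g ->
  measurable_fun [set: T] (fun x => f (g x)).
Proof. by move=> mf mg; exact: (measurableT_comp mf mg). Qed.

Lemma iter_int_indep k (F : V -> \bar R) (x y : V) :
  (forall i : 'I_n, (k <= i)%N -> x ord0 i = y ord0 i) ->
  iter_int k F x = iter_int k F y.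
Proof.
elim: k x y => [|k IH] x y xy /=.
  by congr F; apply/rowP => i; exact: xy.
apply: eq_integral => t _; apply: IH => i ki; rewrite !mxE.
by case: eqVneq => // ik; apply: xy; rewrite ltn_neqAle eq_sym ik.
Qed.

Lemma measurable_affine_rV (s : R) (a : V) :
  measurable_fun [set: V] (fun x => (s *: x + a)%R : V).
Proof.
apply: measurable_rVP => i.
rewrite (_ : (fun _ => _) = (fun x : V => s * x ord0 i + a ord0 i)%R).
  by apply: measurable_funD => //; apply: measurable_funM => //; exact: measurable_coord.
by apply/funext => x; rewrite !mxE.
Qed.

Lemma iter_int_affine k (F : V -> \bar R) (s : R) (a x : V) : (s != 0)%R -> (k <= n)%N ->
  (forall x, 0 <= F x) -> measurable_fun [set: V] F ->
  iter_int k (fun x => F (s *: x + a)%R) x = ((`|s| ^- k)%R)%:E * iter_int k F (s *: x + a)%R.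
Proof.
move=> s0 kn F0 mF; elim: k kn x => [|k IH] kn x /=.
  by rewrite expr0 invr1 mul1e.
have U t : (s *: upd x k t + a = upd (s *: x + a) k (s * t + a ord0 (Ordinal kn)))%R.
  apply/rowP => i; rewrite !mxE; case: eqVneq => // ik.
  by congr (_ + a _ _)%R; apply: val_inj.
under eq_integral do rewrite (IH (ltnW kn)) U.
rewrite ge0_integralZl_EFin //.
- rewrite (lebesgue_affine (f := fun t => iter_int k F (upd (s *: x + a) k t))) //.
  + by rewrite muleA -EFinM -invfM exprSr.
  + by apply: measurable_iter_int1.
  + by move=> t; exact: iter_int_ge0.
- by move=> t _; exact: iter_int_ge0.
- apply: (measurableT_comp (f := fun t => iter_int k F (upd (s *: x + a) k t))).
    by apply: measurable_iter_int1.
  exact: measurable_affine.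
Qed.

Lemma int_affine (F : V -> \bar R) (s : R) (a : V) : (s != 0)%R ->
  (forall x, 0 <= F x) -> measurable_fun [set: V] F ->
  \int[mu]_x F (s *: x + a)%R = ((`|s| ^- n)%R)%:E * \int[mu]_x F x.
Proof.
move=> s0 F0 mF.
rewrite int_vmeas //; last first.
  by apply: measurableT_comp => //; exact: measurable_affine_rV.
rewrite int_vmeas // /Rn_int iter_int_affine //; congr (_ * _).
by apply: iter_int_indep => i; rewrite leqNgt ltn_ord.
Qed.

Lemma measurable_sqrt : measurable_fun [set: R] (@Num.sqrt R).
Proof. by apply: continuous_measurable_fun; exact: sqrt_continuous. Qed.

Lemma measurable_sumsq : measurable_fun [set: V] (fun x : V => \sum_(i < n) x ord0 i ^+ 2)%R.
Proof. by apply: measurable_sum => i; apply: measurable_funX; exact: measurable_coord. Qed.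

Lemma measurable_enorm : measurable_fun [set: V] (@enorm R n).
Proof.
exact: (measurableT_comp measurable_sqrt measurable_sumsq).
Qed.

(** The norm of the point (s, x) of the half space over R^n: the Poisson kernel is a constant times
    s / rho^(n+1). *)
Definition rho (s : R) (x : V) : R := (Num.sqrt (s ^+ 2 + \sum_(i < n) x ord0 i ^+ 2))%R.

Lemma measurable_rho s : measurable_fun [set: V] (rho s).
Proof.
have m : measurable_fun [set: V] (fun x : V => s ^+ 2 + \sum_(i < n) x ord0 i ^+ 2)%R.
  by apply: measurable_funD => //; exact: measurable_sumsq.
exact: (measurableT_comp measurable_sqrt m).
Qed.

Lemma measurable_inv : measurable_fun [set: R] (@GRing.inv R).
Proof.
(* [powR] is a measurable inverse on nonnegative reals only, hence the detour 1/x = x (x^2)^(-1),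
   which also gives 0 at x = 0. *)
rewrite (_ : @GRing.inv R = fun x => (x * (x ^+ 2) `^ (-1))%R).
  apply: measurable_funM => //.
  apply: (@mcomp _ R (fun y => y `^ (-1))%R (fun x : R => x ^+ 2)%R).
    exact: measurable_powR.
  exact: exprn_measurable.
apply/funext => x; rewrite powR_inv1 ?sqr_ge0//.
have [->|x0] := eqVneq x 0%R; first by rewrite mul0r invr0.
by rewrite expr2 invfM mulrA divff// mul1r.
Qed.

Lemma measurable_funV d (T : measurableType d) (f : T -> R) :
  measurable_fun [set: T] f -> measurable_fun [set: T] (fun x => (f x)^-1)%R.
Proof. by move=> mf; exact: (measurableT_comp measurable_inv mf). Qed.

Lemma rho_gt0 s x : (s != 0)%R -> (0 < rho s x)%R.
Proof.
move=> s0; rewrite sqrtr_gt0 ltr_wpDr ?exprn_even_gt0//.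
by apply: sumr_ge0 => i _; exact: sqr_ge0.
Qed.

(** Integrating out one coordinate keeps the shape of the integrand: scaling by the square root of
    the remaining sum of squares leaves [wallis (n - k)], the exponent drops by one, and the factors
    [wconst] telescope to the quotient of sphere volumes. *)
Lemma iter_int_poisson (s : R) k x : (s != 0)%R -> (k <= n)%N ->
  iter_int k (fun y => ((rho s y ^+ n.+1)^-1)%:E) x =
  ((sphere_vol n / sphere_vol (n - k) *
   (Num.sqrt (s ^+ 2 + \sum_(i < n | (k <= i)%N) x ord0 i ^+ 2) ^+ (n - k).+1)^-1)%R)%:E.
Proof.
move=> s0; elim: k x => [|k IH] x kn /=.
  by rewrite subn0 divff ?mul1r// gt_eqF// sphere_vol_gt0.
under eq_integral do rewrite (IH _ (ltnW kn)).
pose A := (s ^+ 2 + \sum_(i < n | (k < i)%N) x ord0 i ^+ 2)%R.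
have A0 : (0 < A)%R.
  rewrite /A ltr_wpDr ?exprn_even_gt0//.
  by apply: sumr_ge0 => i _; exact: sqr_ge0.
have E t : (s ^+ 2 + \sum_(i < n | (k <= i)%N) (upd x k t) ord0 i ^+ 2 = A + t ^+ 2)%R.
  rewrite (bigD1 (Ordinal kn)) //= mxE /= eqxx addrCA addrC; congr (_ + _ + _)%R.
  apply: eq_big => [i|i].
    by rewrite ltn_neqAle andbC -val_eqE /= eq_sym.
  by move=> /andP[_ ik]; rewrite mxE -val_eqE /= in ik *; rewrite (negbTE ik).
have m0 : (0 < n - k)%N by rewrite subn_gt0.
have S0 := sqrtr_gt0 A; rewrite A0 in S0.
have W t : ((Num.sqrt (A + t ^+ 2) ^+ (n - k).+1)^-1 =
  (Num.sqrt A ^+ (n - k).+1)^-1 * wallis (n - k) ((Num.sqrt A)^-1 * t + 0))%R.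
  rewrite /wallis -invfM -exprMn -sqrtrM ?(ltW A0)//.
  rewrite mulrDr mulr1 addr0 exprMn exprVn sqr_sqrtr ?(ltW A0)//.
  by rewrite mulrA divff ?gt_eqF// mul1r.
under eq_integral do rewrite E W mulrA EFinM.
rewrite ge0_integralZl_EFin //; last 3 first.
- by move=> t _; rewrite lee_fin wallis_ge0.
- apply/measurable_EFinP.
  have mw : measurable_fun [set: R] (wallis (n - k)).
    apply: continuous_measurable_fun; exact: (der1_continuous (is_derive_wallis _)).
  exact: (measurableT_comp mw (measurable_affine _ 0)).
- by rewrite mulr_ge0 ?divr_ge0 ?(ltW (sphere_vol_gt0 _))// invr_ge0 exprn_ge0 ?sqrtr_ge0.
rewrite (lebesgue_affine (f := fun t => (wallis (n - k) t)%:E)); last 3 first.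
- by rewrite invr_eq0 gt_eqF.
- apply/measurable_EFinP; apply: continuous_measurable_fun.
  exact: (der1_continuous (is_derive_wallis _)).
- by move=> t; rewrite lee_fin wallis_ge0.
rewrite int_wallis// -!EFinM; congr EFin.
rewrite gtr0_norm ?invr_gt0// invrK -/A /wconst -subnS.
rewrite (subnSK kn).
have /lt0r_neq0 h1 := @sphere_vol_gt0 R (n - k).
have /lt0r_neq0 h2 := @sphere_vol_gt0 R (n - k.+1).
rewrite exprS -/A.
have pS : (Num.sqrt A ^+ (n - k) != 0)%R by rewrite expf_neq0// gt_eqF.
move: h1 h2 pS S0.
move: (sphere_vol n) (sphere_vol (n - k)) (sphere_vol (n - k.+1)).
move: (Num.sqrt A ^+ (n - k))%R (Num.sqrt A) => d e a b c b0 c0 d0 e0.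
by field; rewrite ?b0 ?c0 ?d0 ?(gt_eqF e0).
Qed.

Lemma int_poisson (s : R) : (s != 0)%R ->
  \int[mu]_x ((rho s x ^+ n.+1)^-1)%:E = (sphere_vol n / 2 / `|s|)%:E.
Proof.
move=> s0; rewrite int_vmeas; last 2 first.
- by move=> x; rewrite lee_fin invr_ge0 exprn_ge0 // sqrtr_ge0.
- apply/measurable_EFinP/measurable_funV/measurable_funX; exact: measurable_rho.
rewrite /Rn_int iter_int_poisson// subnn big1 ?addr0 ?sqrtr_sqr ?expr1//.
by move=> i; rewrite leqNgt ltn_ord.
Qed.

End rV_integral.

(** * Real-valued integration *)

Section real_integral.
Context d (T : measurableType d) {R : realType} (mu : {measure set T -> \bar R}).
Implicit Types (f g h : T -> R) (c : R).

Definition ibl f : Prop := mu.-integrable [set: T] (fun x => (f x)%:E).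
Definition Ig f : R := \int[mu]_x f x.

Lemma ibl_meas f : ibl f -> measurable_fun [set: T] f.
Proof. by move=> /integrableP[/measurable_EFinP]. Qed.

Lemma ibl_EFin f : ibl f -> (\int[mu]_x (f x)%:E = (Ig f)%:E)%E.
Proof. by move=> fi; rewrite /Ig /Rintegral fineK // integrable_fin_num. Qed.

Lemma eq_ibl f g : f =1 g -> ibl f -> ibl g.
Proof. by move=> /funext ->. Qed.

Lemma eq_Ig f g : f =1 g -> Ig f = Ig g.
Proof. by move=> /funext ->. Qed.

Lemma iblD f g : ibl f -> ibl g -> ibl (fun x => f x + g x).
Proof. by move=> fi gi; have := integrableD measurableT fi gi; apply: eq_integrable. Qed.

Lemma iblB f g : ibl f -> ibl g -> ibl (fun x => f x - g x).
Proof. by move=> fi gi; have := integrableB measurableT fi gi; apply: eq_integrable. Qed.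

Lemma iblZ c f : ibl f -> ibl (fun x => c * f x).
Proof. by move=> fi; have := integrableZl measurableT c fi; apply: eq_integrable. Qed.

Lemma iblN f : ibl f -> ibl (fun x => - f x).
Proof. by move=> fi; have := integrableN fi; apply: eq_integrable. Qed.

Lemma ibl0 : ibl (fun _ => 0).
Proof. exact: integrable0. Qed.

Lemma ibl_le f g : measurable_fun [set: T] f -> (forall x, `|f x| <= g x) ->
  ibl g -> ibl f.
Proof.
move=> mf fg; apply: le_integrable => //; first exact/measurable_EFinP.
by move=> x _; rewrite !abse_EFin lee_fin (le_trans (fg x))// ler_norm.
Qed.

Lemma ibl_norm f : ibl f -> ibl (fun x => `|f x|).
Proof.
move=> fi; have := ibl_meas fi => mf; apply: le_integrable (fi) => //.
  by apply/measurable_EFinP; exact: measurableT_comp.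
by move=> x _; rewrite !abse_EFin lee_fin normr_id.
Qed.

Lemma iblM f g c : measurable_fun [set: T] g -> (forall x, `|g x| <= c) ->
  ibl f -> ibl (fun x => g x * f x).
Proof.
move=> mg gc fi; apply: (ibl_le (g := fun x => c * `|f x|)).
- by apply: measurable_funM => //; exact: ibl_meas.
- by move=> x; rewrite normrM ler_wpM2r.
- by apply: iblZ; exact: ibl_norm.
Qed.

Lemma ibl_ge0 f : measurable_fun [set: T] f -> (forall x, 0 <= f x) ->
  (\int[mu]_x (f x)%:E < +oo)%E -> ibl f.
Proof.
move=> mf f0 fi; apply/integrableP; split; first exact/measurable_EFinP.
by under eq_integral do rewrite abse_EFin ger0_norm//.
Qed.

Lemma iblP f : ibl f <->
  measurable_fun [set: T] f /\ (\int[mu]_x (`|f x|)%:E < +oo)%E.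
Proof.
split=> [/integrableP[mf fi]|[mf fi]].
  by split; [exact/measurable_EFinP|under eq_integral do rewrite -abse_EFin].
by apply/integrableP; split; [exact/measurable_EFinP|under eq_integral do rewrite abse_EFin].
Qed.

Lemma ibl_sum (J : Type) (s : seq J) (F : J -> T -> R) : (forall j, ibl (F j)) ->
  ibl (fun x => \sum_(j <- s) F j x).
Proof.
move=> Fi; elim: s => [|j s IH].
  by apply: (eq_ibl _ ibl0) => x; rewrite big_nil.
by apply: (eq_ibl _ (iblD (Fi j) IH)) => x; rewrite big_cons.
Qed.

Lemma IgD f g : ibl f -> ibl g -> Ig (fun x => f x + g x) = Ig f + Ig g.
Proof. by move=> fi gi; rewrite /Ig RintegralD. Qed.

Lemma IgB f g : ibl f -> ibl g -> Ig (fun x => f x - g x) = Ig f - Ig g.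
Proof. by move=> fi gi; rewrite /Ig RintegralB. Qed.

Lemma IgZ c f : ibl f -> Ig (fun x => c * f x) = c * Ig f.
Proof. by move=> fi; rewrite /Ig RintegralZl. Qed.

Lemma Ig0 : Ig (fun _ => 0) = 0.
Proof. by rewrite /Ig /Rintegral integral0. Qed.

Lemma IgN f : ibl f -> Ig (fun x => - f x) = - Ig f.
Proof.
move=> fi; rewrite -mulN1r -IgZ//; apply: eq_Ig => x; by rewrite mulN1r.
Qed.

Lemma Ig_sum (J : Type) (s : seq J) (F : J -> T -> R) : (forall j, ibl (F j)) ->
  Ig (fun x => \sum_(j <- s) F j x) = \sum_(j <- s) Ig (F j).
Proof.
move=> Fi; elim: s => [|j s IH].
  by rewrite big_nil -[RHS]Ig0; apply: eq_Ig => x; rewrite big_nil.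
rewrite big_cons -IH -IgD //; last exact: ibl_sum.
by apply: eq_Ig => x; rewrite big_cons.
Qed.

Lemma Ig_le f g : ibl f -> ibl g -> (forall x, f x <= g x) -> Ig f <= Ig g.
Proof. by move=> fi gi fg; apply: le_Rintegral. Qed.

Lemma Ig_ge0 f : (forall x, 0 <= f x) -> 0 <= Ig f.
Proof. by move=> f0; apply: Rintegral_ge0. Qed.

Lemma Ig_norm f : ibl f -> `|Ig f| <= Ig (fun x => `|f x|).
Proof. by move=> fi; apply: le_normr_Rintegral. Qed.

Lemma Ig_norm_le f g : ibl f -> ibl g -> (forall x, `|f x| <= g x) -> `|Ig f| <= Ig g.
Proof.
by move=> fi gi fg; apply: le_trans (Ig_norm fi) _; apply: Ig_le => //; exact: ibl_norm.
Qed.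

Lemma Ig_dct (f_ : nat -> T -> R) f g : (forall j, measurable_fun [set: T] (f_ j)) ->
  ibl g -> (forall j x, `|f_ j x| <= g x) -> (forall x, f_ ^~ x @ \oo --> f x) ->
  ibl f /\ (fun j => Ig (f_ j)) @ \oo --> Ig f.
Proof.
move=> mf_ gi fg ff.
have mf : measurable_fun [set: T] f.
  by apply: (measurable_fun_cvg mf_) => x _; exact: ff.
have [] := @dominated_convergence _ _ _ mu _ measurableT (fun j x => (f_ j x)%:E)
  (fun x => (f x)%:E) (fun x => (g x)%:E).
- by move=> j; exact/measurable_EFinP.
- exact/measurable_EFinP.
- by apply: aeW => x _; apply: cvg_EFin; [exact: nearW|exact: ff].
- exact: gi.
- by apply: aeW => x j _; rewrite abse_EFin lee_fin.
move=> fi _ H; split => //.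
have := fine_cvg (_ : _ @ \oo --> (Ig f)%:E); apply.
by move: H; rewrite ibl_EFin.
Qed.

End real_integral.

Section real_fubini.
Context d1 d2 (T1 : measurableType d1) (T2 : measurableType d2) {R : realType}.
Variable m1 : {sigma_finite_measure set T1 -> \bar R}.
Variable m2 : {sigma_finite_measure set T2 -> \bar R}.

(** The majorant [g] of the inner integrals gives integrability on the product. Since every slice is
    integrable, and not merely almost every one, both inner integrals are real numbers everywhere
    and the equality can be stated for [Ig]. *)
Lemma Ig_fubini (f : T1 -> T2 -> R) :
  measurable_fun [set: T1 * T2] (fun p => f p.1 p.2) ->
  (forall x, ibl m2 (f x)) -> (forall y, ibl m1 (f ^~ y)) ->
  (exists2 g, ibl m1 g & forall x, Ig m2 (fun y => `|f x y|) <= g x) ->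
  [/\ ibl m1 (fun x => Ig m2 (f x)), ibl m2 (fun y => Ig m1 (f ^~ y)) &
  Ig m1 (fun x => Ig m2 (f x)) = Ig m2 (fun y => Ig m1 (f ^~ y))].
Proof.
move=> mf f1 f2 [g gi fg].
pose F p := (f p.1 p.2)%:E.
have mF : measurable_fun [set: T1 * T2] F by exact/measurable_EFinP.
have Fi : (m1 \x m2)%E.-integrable [set: T1 * T2] F.
  apply/(integrable12ltyP _ _ mF).
  apply: (@le_lt_trans _ _ (\int[m1]_x (g x)%:E)%E); last exact: integrable_lty.
  apply: ge0_le_integral => //.
  - by move=> x _; apply: integral_ge0.
  - apply: (measurable_fun_fubini_tonelli_F (m2 := m2) (fun p => `|F p|)%E) => //.
    exact: measurableT_comp.
  - by apply/measurable_EFinP; exact: ibl_meas gi.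
  - move=> x _; rewrite /F /=.
    by rewrite ibl_EFin ?lee_fin//; exact: ibl_norm.
have H1 := integrable_fubini_F Fi.
have E1 : (fubini_F m2 F = fun x => (Ig m2 (f x))%:E).
  by apply/funext => x; rewrite /fubini_F /F /= ibl_EFin.
have E2 : (fubini_G m1 F = fun y => (Ig m1 (f^~ y))%:E).
  by apply/funext => y; rewrite /fubini_G /F /= ibl_EFin.
have H := Fubini Fi.
split.
- by rewrite /ibl -E1.
- rewrite /ibl -E2; apply/integrableP; split; first exact: measurable_fubini_G Fi.
  apply: le_lt_trans ((integrable21ltyP _ _ mF).1 Fi).
  apply: ge0_le_integral => //.
  - by apply: measurableT_comp => //; exact: measurable_fubini_G Fi.
  - apply: (measurable_fun_fubini_tonelli_G (m1 := m1) (fun p => `|F p|)%E) => //.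
    exact: measurableT_comp.
  - move=> y _; apply: le_abse_integral => //.
    exact: measurable_int (f2 y).
- rewrite /Ig /Rintegral -/(Ig _ _); congr fine.
  transitivity (\int[m1]_x (fubini_F m2 F x))%E; first by rewrite E1.
  by transitivity (\int[m2]_x (fubini_G m1 F x))%E; last by rewrite E2.
Qed.

Lemma Ig_tonelli (f : T1 -> T2 -> R) :
  measurable_fun [set: T1 * T2] (fun p => f p.1 p.2) -> (forall x y, 0 <= f x y) ->
  (\int[m1]_x \int[m2]_y (f x y)%:E = \int[m2]_y \int[m1]_x (f x y)%:E)%E.
Proof.
move=> mf f0; apply: (@fubini_tonelli _ _ _ _ _ m1 m2 (fun p => (f p.1 p.2)%:E)).
- exact/measurable_EFinP.
- by move=> p; rewrite lee_fin.
Qed.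

End real_fubini.

Section sigma_finite.
Context {R : realType} {n : nat}.
Notation V := 'rV[R]_n.

Lemma enorm_ge0 (x : V) : 0 <= enorm x.
Proof. exact: sqrtr_ge0. Qed.

Lemma measurable_eball r : measurable (eball r : set V).
Proof.
have := @measurable_enorm R n measurableT `]-oo, r[%classic (measurable_itv _).
rewrite setTI; congr measurable; apply/seteqP; split => x /=; by rewrite /eball /= in_itv.
Qed.

Lemma ibl_poisson s : s != 0 -> ibl (@vmeas R n) (fun x => (rho s x ^+ n.+1)^-1).
Proof.
move=> s0; apply: ibl_ge0.
- apply/measurable_funV/measurable_funX; exact: measurable_rho.
- by move=> x; rewrite invr_ge0 exprn_ge0 // sqrtr_ge0.
- by rewrite int_poisson // ltry.
Qed.

Lemma sqr_enorm (x : V) : enorm x ^+ 2 = \sum_(i < n) x ord0 i ^+ 2.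
Proof. by rewrite sqr_sqrtr// sumr_ge0// => i _; exact: sqr_ge0. Qed.

Lemma rhoE s (x : V) : rho s x = Num.sqrt (s ^+ 2 + enorm x ^+ 2).
Proof. by rewrite sqr_enorm. Qed.

(** The Poisson kernel at s = 1 has finite mass and is bounded below on the ball, so a multiple of
    it dominates the indicator. *)
Lemma vmeas_eball_lty r : (vmeas (eball r : set V) < +oo)%E.
Proof.
have [r0|r0] := leP r 0.
  rewrite (_ : eball r = set0) ?measure0 ?ltry//.
  by apply/seteqP; split => x //=; rewrite /eball /= => /(le_lt_trans (enorm_ge0 x)); rewrite ltNge r0.
have := ibl_poisson (oner_neq0 R) => /(iblZ ((Num.sqrt (1 + r ^+ 2)) ^+ n.+1)) Hi.
rewrite -[vmeas _]mul1e -integral_cst; last exact: measurable_eball.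
apply: le_lt_trans (integrable_lty measurableT Hi).
rewrite integral_mkcond; apply: ge0_le_integral => //.
- by move=> x _; rewrite patchE; case: ifP.
- by apply/(measurable_restrictT _ _).1 => //; exact: measurable_eball.
- exact: measurable_int Hi.
move=> x _; rewrite patchE; case: ifPn => [|_]; last first.
  by rewrite lee_fin mulr_ge0 ?invr_ge0 ?exprn_ge0 ?sqrtr_ge0.
rewrite inE /eball /= => xr; rewrite lee_fin.
have p0 : 0 < rho 1 x by rewrite rho_gt0 ?oner_neq0.
rewrite ler_pdivlMr ?exprn_gt0// mul1r ler_pXn2r ?nnegrE ?sqrtr_ge0//.
rewrite rhoE expr1n; apply: ler_wsqrtr; rewrite lerD2l.
by rewrite ler_pXn2r ?nnegrE ?enorm_ge0 ?(ltW r0) ?(ltW xr).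
Qed.

Lemma vmeas_sigma_finite : sigma_finite setT (@vmeas R n).
Proof.
exists (fun j => eball j%:R); last first.
  by move=> j; split; [exact: measurable_eball|exact: vmeas_eball_lty].
apply/seteqP; split => // x _.
exists (Num.truncn (enorm x)).+1 => //; rewrite /eball /=.
exact: truncnS_gt.
Qed.

HB.instance Definition _ := Measure_isSigmaFinite.Build _ V R (@vmeas R n) vmeas_sigma_finite.

End sigma_finite.

(** * The Euclidean norm *)

Section euclid.
Context {R : realType} {n : nat}.
Notation V := 'rV[R]_n.
Implicit Types (x y z : V) (r s c : R).

Lemma cauchy_schwarz x y : (\sum_(i < n) x ord0 i * y ord0 i) <= enorm x * enorm y.
Proof.
set C := \sum_(i < n) _.
have [CL|CL] := leP C 0; first by rewrite (le_trans CL)// mulr_ge0 ?enorm_ge0.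
rewrite -[C]ger0_norm ?(ltW CL)// -sqrtr_sqr -sqrtrM; last first.
  by apply: sumr_ge0 => i _; exact: sqr_ge0.
apply: ler_wsqrtr.
set A := \sum_(i < n) x ord0 i ^+ 2; set B := \sum_(i < n) y ord0 i ^+ 2.
have A0 : 0 <= A by apply: sumr_ge0 => i _; exact: sqr_ge0.
have B0 : 0 <= B by apply: sumr_ge0 => i _; exact: sqr_ge0.
have [B1|B1] := eqVneq B 0.
  have y0 i : y ord0 i = 0.
    have /(_ i isT)/eqP := psumr_eq0P (fun i _ => sqr_ge0 (y ord0 i)) B1.
    by rewrite sqrf_eq0 => /eqP.
  suff -> : C = 0 by rewrite expr0n /= mulr_ge0.
  by apply: big1 => i _; rewrite y0 mulr0.
have : 0 <= \sum_(i < n) (B * x ord0 i - C * y ord0 i) ^+ 2.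
  by apply: sumr_ge0 => i _; exact: sqr_ge0.
have -> : \sum_(i < n) (B * x ord0 i - C * y ord0 i) ^+ 2 = B * (A * B - C ^+ 2).
  transitivity (\sum_(i < n) (B ^+ 2 * x ord0 i ^+ 2 - 2 * B * C * (x ord0 i * y ord0 i) +
     C ^+ 2 * y ord0 i ^+ 2)); first by apply: eq_bigr => i _; ring.
  rewrite big_split /= sumrB -!mulr_sumr -/A -/B -/C; ring.
by rewrite pmulr_rge0 ?subr_ge0// lt_neqAle eq_sym B1.
Qed.

Lemma enorm_triangle x y : enorm (x + y) <= enorm x + enorm y.
Proof.
rewrite -[leRHS]ger0_norm ?addr_ge0 ?enorm_ge0// -sqrtr_sqr; apply: ler_wsqrtr.
rewrite sqrrD !sqr_enorm.
have -> : \sum_(i < n) (x + y) ord0 i ^+ 2 =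
    \sum_(i < n) x ord0 i ^+ 2 + (\sum_(i < n) x ord0 i * y ord0 i) *+ 2 +
    \sum_(i < n) y ord0 i ^+ 2.
  rewrite -sumrMnl -!big_split /=; apply: eq_bigr => i _; rewrite mxE; ring.
by rewrite lerD2r lerD2l lerMn2r /= cauchy_schwarz.
Qed.

Lemma enormZ c x : enorm (c *: x) = `|c| * enorm x.
Proof.
rewrite -sqrtr_sqr -sqrtrM ?sqr_ge0// mulr_sumr; congr Num.sqrt.
by apply: eq_bigr => i _; rewrite mxE exprMn.
Qed.

Lemma enormN x : enorm (- x) = enorm x.
Proof. by rewrite -scaleN1r enormZ normrN1 mul1r. Qed.

Lemma enorm0 : enorm (0 : V) = 0.
Proof. by rewrite -(scale0r (0 : V)) enormZ normr0 mul0r. Qed.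

Lemma enormBC x y : enorm (x - y) = enorm (y - x).
Proof. by rewrite -opprB enormN. Qed.

Lemma enorm_triangleB x y z : enorm (x - z) <= enorm (x - y) + enorm (y - z).
Proof. by apply: le_trans (enorm_triangle _ _); rewrite addrA subrK. Qed.

Lemma enormB_ge x y : enorm x - enorm y <= enorm (x - y).
Proof. by rewrite lerBlDr -{1}(subrK y x) enorm_triangle. Qed.

Lemma coord_le_enorm x i : `|x ord0 i| <= enorm x.
Proof.
rewrite -sqrtr_sqr; apply: ler_wsqrtr; rewrite (bigD1 i)//= lerDl.
by apply: sumr_ge0 => j _; exact: sqr_ge0.
Qed.

Lemma enorm_eq0 x : (enorm x == 0) = (x == 0).
Proof.
apply/eqP/eqP => [x0|->]; last exact: enorm0.
apply/rowP => i; rewrite mxE; apply/eqP; rewrite -normr_le0 -x0.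
exact: coord_le_enorm.
Qed.

Lemma enorm_gt0 x : (0 < enorm x) = (x != 0).
Proof. by rewrite lt_neqAle eq_sym enorm_eq0 enorm_ge0 andbT. Qed.

Lemma enorm_ebasis (i : 'I_n) : enorm (ebasis i : V) = 1.
Proof.
rewrite /enorm (bigD1 i)//= big1 => [|j ji]; first by rewrite mxE !eqxx addr0 expr1n sqrtr1.
by rewrite mxE (negbTE ji) andbF expr0n.
Qed.

Lemma norm_le_enorm x : `|x| <= enorm x.
Proof.
rewrite [leLHS]mx_normrE; apply: bigmax_le => [|[i j] _ /=]; first exact: enorm_ge0.
by rewrite ord1 coord_le_enorm.
Qed.

Lemma coord_le_norm x i : `|x ord0 i| <= `|x|.
Proof. by rewrite [leRHS]mx_normrE; apply: (le_bigmax _ (fun i => `|x i.1 i.2|) (ord0, i)). Qed.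

Lemma enorm_le_sum x : enorm x <= \sum_(i < n) `|x ord0 i|.
Proof.
have H0 : 0 <= \sum_(i < n) `|x ord0 i| by apply: sumr_ge0.
rewrite -[leRHS]ger0_norm// -sqrtr_sqr; apply: ler_wsqrtr.
rewrite expr2 mulr_suml; apply: ler_sum => i _.
rewrite -real_normK ?num_real// expr2; apply: ler_wpM2l => //.
by rewrite (bigD1 i)//= lerDl sumr_ge0.
Qed.

Lemma enorm_le_norm x : enorm x <= n%:R * `|x|.
Proof.
apply: le_trans (enorm_le_sum x) _; rewrite mulr_natl -[X in _ *+ X]card_ord -sumr_const.
by apply: ler_sum => i _; exact: coord_le_norm.
Qed.

Lemma continuousVP (f : V -> R) x : {for x, continuous f} <->
  (forall e : R, 0 < e -> exists2 d : R, 0 < d & forall y, enorm (y - x) < d -> `|f y - f x| < e).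
Proof.
split=> [cf e e0|H].
  have /cvgrPdist_lt/(_ e e0) := cf.
  move=> /nbhs_ballP[d /= d0 dH]; exists d => // y xy.
  rewrite distrC; apply: dH; rewrite -ball_normE /=.
  by rewrite (le_lt_trans (norm_le_enorm _))// enormBC.
have FF := @nbhs_filter V x.
suff : f @ x --> f x by [].
apply/(@cvgrPdist_lt _ R) => e e0; have [d d0 dH] := H e e0.
suff : \forall t \near nbhs (x : V), `|f x - f t| < e by [].
(* The two norms differ by a factor of at most n; dividing by n + 1 keeps the radius meaningful for
   n = 0. *)
apply/nbhs_ballP; exists (d / (n%:R + 1)) => /=; first by rewrite divr_gt0// ltr_wpDl.
move=> y; rewrite -ball_normE /= => xy; rewrite distrC; apply: dH.
rewrite enormBC (le_lt_trans (enorm_le_norm _))//.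
apply: (@le_lt_trans _ _ ((n%:R + 1) * `|x - y|)); first by rewrite ler_wpM2r// lerDl.
by rewrite mulrC -ltr_pdivlMr// ltr_wpDl.
Qed.

Lemma enorm_continuous : continuous (@enorm R n).
Proof.
move=> x; apply/continuousVP => e e0; exists e => // y xy.
apply: le_lt_trans xy; rewrite ler_norml enormB_ge andbT lerNl opprB enormBC.
exact: enormB_ge.
Qed.

Lemma continuous_bounded (f : V -> R) : continuous f -> forall r, exists2 C, 0 < C &
  forall x, enorm x <= r -> `|f x| <= C.
Proof.
move=> cf r; pose K : set V := [set x | enorm x <= r].
have cK : compact K.
  apply: bounded_closed_compact.
    exists r; split => //; first exact: num_real.
    by move=> M rM x /= xr; rewrite (le_trans (norm_le_enorm x))// (le_trans xr)// ltW.
  rewrite (_ : K = enorm @^-1` [set y | y <= r])//.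
  by apply: (closed_comp (fun x _ => @enorm_continuous x)); exact: closed_le.
have := continuous_compact (continuous_subspaceT cf) cK.
move=> /compact_bounded[M [Mr MH]].
exists (`|M| + 1); first by rewrite ltr_wpDl.
move=> x xr; apply: (MH (`|M| + 1)); last by exists x.
by rewrite (le_lt_trans (ler_norm M))// ltrDl.
Qed.

(** The sigma-algebra is generated by the coordinates, so open sets have to be reached indirectly:
    [f] is the pointwise limit of its values at the grid points of mesh 1/(k+1), and such a step
    function is measurable because the grid is countable and each cell is cut out by finitely many
    coordinate conditions. *)
Lemma continuous_measurable (f : V -> R) : continuous f -> measurable_fun [set: V] f.
Proof.
move=> cf.
pose z k (x : V) : 'rV[int]_n := \row_i Num.floor (k.+1%:R * x ord0 i).
pose q k (v : 'rV[int]_n) : V := \row_i ((v ord0 i)%:~R / k.+1%:R).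
apply: (@measurable_fun_cvg _ _ _ _ (fun k x => f (q k (z k x)))).
  move=> k _ B mB; rewrite setTI.
  have -> : (fun x => f (q k (z k x))) @^-1` B =
     \bigcup_(v in [set v | B (f (q k v))]) (z k @^-1` [set v]).
    apply/seteqP; split => [x /= Bx|x [v Bv /= zx]]; last by rewrite /= zx.
    by exists (z k x).
  rewrite bigcup_mkcond; apply: countable_bigcupT_measurable; first exact: countableP.
  move=> v; case: ifP => // _.
  have -> : z k @^-1` [set v] = \bigcap_(i in [set: 'I_n])
      [set x : V | Num.floor (k.+1%:R * x ord0 i) = v ord0 i].
    apply/seteqP; split => [x /= <- i _ /=|x H /=]; first by rewrite mxE.
    by apply/rowP => i; rewrite mxE; exact: H.
  apply: fin_bigcap_measurable => // i _.
  have -> : [set x : V | Num.floor (k.+1%:R * x ord0 i) = v ord0 i] =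
     (fun x : V => k.+1%:R * x ord0 i) @^-1` `[(v ord0 i)%:~R, (v ord0 i + 1)%:~R[%classic.
    apply/seteqP; split => [x /= <-|x /=]; rewrite in_itv /=.
      by rewrite ge_floor floorD1_gt.
    by move=> H; apply: floor_def.
  have := @measurable_funM _ _ _ _ (cst k.+1%:R) (fun x : V => x ord0 i) (measurable_cst _) (measurable_coord i).
  by move=> /(_ measurableT _ (measurable_itv `[(v ord0 i)%:~R, (v ord0 i + 1)%:~R[)); rewrite setTI.
move=> x _; apply/cvgrPdist_lt => e e0.
have [d d0 dH] := (@continuousVP f x).1 (@cf x) e e0.
near=> k; rewrite distrC; apply: dH.
apply: le_lt_trans (enorm_le_sum _) _.
apply: (@le_lt_trans _ _ (\sum_(i < n) k.+1%:R^-1)).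
  apply: ler_sum => i _; rewrite !mxE.
  have k0 : 0 < k.+1%:R :> R by [].
  rewrite -[X in _ - X](mulfK (lt0r_neq0 k0)) -mulrBl normrM [X in _ * X]gtr0_norm ?invr_gt0//.
  rewrite ler_pdivrMr// mulVf ?gt_eqF// distrC mulrC ger0_norm ?subr_ge0 ?ge_floor//.
  by rewrite lerBlDl ltW// -intrD1 floorD1_gt.
have k0 : 0 < k.+1%:R :> R by [].
rewrite sumr_const card_ord -[_ *+ n]mulr_natr mulrC ltr_pdivrMr// -ltr_pdivrMl//.
near: k; exists (Num.truncn (d^-1 * n%:R)) => // k /= hk.
by rewrite (lt_le_trans (truncnS_gt _))// ler_nat.
Unshelve. all: by end_near. Qed.

End euclid.

Section rV_lebesgue.
Context {R : realType} {n : nat}.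
Notation V := 'rV[R]_n.
Implicit Types (r s c : R).

Lemma measurable_coordZ d (T : measurableType d) (f : T -> V) :
  measurable_fun [set: T] f -> forall i, measurable_fun [set: T] (fun x => f x ord0 i).
Proof. by move=> mf i; exact: (measurableT_comp (measurable_coord i) mf). Qed.

Lemma measurable_rVD d (T : measurableType d) (f g : T -> V) :
  measurable_fun [set: T] f -> measurable_fun [set: T] g ->
  measurable_fun [set: T] (fun x => f x + g x).
Proof.
move=> mf mg; apply: measurable_rVP => i.
have -> : (fun x => (f x + g x) ord0 i) = (fun x => f x ord0 i + g x ord0 i).
  by apply/funext => x; rewrite mxE.
by apply: measurable_funD; exact: measurable_coordZ.
Qed.

Lemma measurable_rVZ d (T : measurableType d) (c : T -> R) (f : T -> V) :
  measurable_fun [set: T] c -> measurable_fun [set: T] f ->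
  measurable_fun [set: T] (fun x => c x *: f x).
Proof.
move=> mc mf; apply: measurable_rVP => i.
have -> : (fun x => (c x *: f x) ord0 i) = (fun x => c x * f x ord0 i).
  by apply/funext => x; rewrite mxE.
by apply: measurable_funM => //; exact: measurable_coordZ.
Qed.

Lemma measurable_rVN d (T : measurableType d) (f : T -> V) :
  measurable_fun [set: T] f -> measurable_fun [set: T] (fun x => - f x).
Proof.
move=> mf; have -> : (fun x => - f x) = (fun x => (-1) *: f x).
  by apply/funext => x; rewrite scaleN1r.
exact: measurable_rVZ.
Qed.

Lemma measurable_rVB d (T : measurableType d) (f g : T -> V) :
  measurable_fun [set: T] f -> measurable_fun [set: T] g ->
  measurable_fun [set: T] (fun x => f x - g x).
Proof. by move=> mf mg; apply: measurable_rVD => //; exact: measurable_rVN. Qed.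

Lemma vcomp d (T : measurableType d) (f : V -> R) (g : T -> V) :
  measurable_fun [set: V] f -> measurable_fun [set: T] g ->
  measurable_fun [set: T] (fun x => f (g x)).
Proof. by move=> mf mg; exact: (measurableT_comp mf mg). Qed.

Local Notation mu := (@vmeas R n).

Lemma max_sub (t : R) : Num.max t 0 - Num.max (- t) 0 = t.
Proof.
have [t0|t0] := lerP 0 t; first by rewrite max_r ?oppr_le0// subr0.
by rewrite max_l ?oppr_ge0 ?(ltW t0)// sub0r opprK.
Qed.

Lemma vmeas_affineE (f : V -> R) s (a : V) : s != 0 -> measurable_fun [set: V] f ->
  (forall x, 0 <= f x) ->
  (\int[mu]_x (f (s *: x + a))%:E = (`|s| ^- n)%:E * \int[mu]_x (f x)%:E)%E.
Proof.
move=> s0 mf f0.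
apply: (@int_affine R n (fun x => (f x)%:E) s a s0) => [x|]; first by rewrite lee_fin.
exact/measurable_EFinP.
Qed.

Lemma ibl_affine (f : V -> R) s (a : V) : s != 0 -> ibl mu f ->
  ibl mu (fun x => f (s *: x + a)).
Proof.
move=> s0 /iblP[mf fi]; apply/iblP; split.
  by apply: vcomp => //; exact: measurable_affine_rV.
rewrite (@vmeas_affineE (fun x => `|f x|) s a s0) //.
  by rewrite lte_mul_pinfty// lee_fin invr_ge0 exprn_ge0.
exact: measurableT_comp.
Qed.

Lemma Ig_affine (f : V -> R) s (a : V) : s != 0 -> ibl mu f ->
  Ig mu (fun x => f (s *: x + a)) = `|s| ^- n * Ig mu f.
Proof.
move=> s0 fi; have mf := ibl_meas fi.
have fpE : f = fun x => Num.max (f x) 0 - Num.max (- f x) 0.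
  by apply/funext => x; rewrite max_sub.
have mp : measurable_fun [set: V] (fun x => Num.max (f x) 0) by exact: measurable_maxr.
have mn : measurable_fun [set: V] (fun x => Num.max (- f x) 0).
  by apply: measurable_maxr => //; exact: measurable_funN.
have ip : ibl mu (fun x => Num.max (f x) 0).
  apply: ibl_le (ibl_norm fi) => // x; rewrite /Num.max; case: ltrP => h; rewrite ?normr0//.
have im : ibl mu (fun x => Num.max (- f x) 0).
  apply: ibl_le (ibl_norm fi) => // x; rewrite /Num.max; case: ltrP => h; rewrite ?normr0 ?normrN//.
have pos (g : V -> R) : measurable_fun [set: V] g -> (forall x, 0 <= g x) -> ibl mu g ->
    Ig mu (fun x => g (s *: x + a)) = `|s| ^- n * Ig mu g.
  move=> mg g0 gi; apply: EFin_inj; rewrite EFinM -!ibl_EFin//; last exact: ibl_affine.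
  exact: vmeas_affineE.
rewrite [in LHS]fpE [in RHS]fpE !IgB//; [|exact: ibl_affine ip|exact: ibl_affine im].
rewrite (pos (fun x => Num.max (f x) 0)) // ?(pos (fun x => Num.max (- f x) 0)) //.
- by rewrite mulrBr.
- by move=> x; rewrite le_max lexx orbT.
- by move=> x; rewrite le_max lexx orbT.
Qed.

Lemma ibl_shift (f : V -> R) (a : V) : ibl mu f -> ibl mu (fun x => f (x + a)).
Proof.
by move=> /(ibl_affine a (oner_neq0 R)); apply: eq_ibl => x; rewrite scale1r.
Qed.

Lemma Ig_shift (f : V -> R) (a : V) : ibl mu f -> Ig mu (fun x => f (x + a)) = Ig mu f.
Proof.
move=> /(Ig_affine a (oner_neq0 R)); rewrite normr1 expr1n invr1 mul1r => <-.
by apply: eq_Ig => x; rewrite scale1r.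
Qed.

Lemma ibl_refl (f : V -> R) (a : V) : ibl mu f -> ibl mu (fun x => f (a - x)).
Proof.
have N1 : (-1 : R) != 0 by rewrite oppr_eq0 oner_neq0.
by move=> /(ibl_affine a N1); apply: eq_ibl => x; rewrite scaleN1r addrC.
Qed.

Lemma Ig_refl (f : V -> R) (a : V) : ibl mu f -> Ig mu (fun x => f (a - x)) = Ig mu f.
Proof.
have N1 : (-1 : R) != 0 by rewrite oppr_eq0 oner_neq0.
move=> /(Ig_affine a N1); rewrite normrN1 expr1n invr1 mul1r => <-.
by apply: eq_Ig => x; rewrite scaleN1r addrC.
Qed.

Lemma Rn_integrableP (f : V -> R) : Rn_integrable f <-> ibl mu f.
Proof.
split=> [[mf fi]|fi].
  have mf' : measurable_fun [set: V] f by move=> _ B mB; rewrite setTI; exact: mf.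
  apply/iblP; split => //; rewrite int_vmeas//.
  by apply/measurable_EFinP; exact: measurableT_comp.
have mf := ibl_meas fi; split.
  by move=> B mB; have := mf measurableT B mB; rewrite setTI.
have [_] := (iblP _ _).1 fi; rewrite int_vmeas//.
by apply/measurable_EFinP; exact: measurableT_comp.
Qed.

Lemma Rn_integralE (f : V -> R) : ibl mu f -> Rn_integral f = Ig mu f.
Proof.
move=> fi; have mf := ibl_meas fi; rewrite /Rn_integral.
have mp : measurable_fun [set: V] (fun x => Num.max (f x) 0) by exact: measurable_maxr.
have mn : measurable_fun [set: V] (fun x => Num.max (- f x) 0).
  by apply: measurable_maxr => //; exact: measurable_funN.
have ip : ibl mu (fun x => Num.max (f x) 0).
  apply: ibl_le (ibl_norm fi) => // x; rewrite /Num.max; case: ltrP => h; rewrite ?normr0//.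
have im : ibl mu (fun x => Num.max (- f x) 0).
  apply: ibl_le (ibl_norm fi) => // x; rewrite /Num.max; case: ltrP => h; rewrite ?normr0 ?normrN//.
rewrite -!int_vmeas; first last.
- exact/measurable_EFinP.
- by move=> x; rewrite lee_fin le_max lexx orbT.
- exact/measurable_EFinP.
- by move=> x; rewrite lee_fin le_max lexx orbT.
rewrite -/(Rintegral _ _ _) -/(Rintegral _ _ _) -/(Ig mu _) -/(Ig mu _) -IgB//.
by apply: eq_Ig => x; rewrite max_sub.
Qed.

Lemma measurable_ball r (a : V) : measurable [set x : V | enorm (x - a) < r].
Proof.
have H : measurable_fun [set: V] (fun x : V => enorm (x - a)).
  by apply: vcomp; [exact: measurable_enorm|exact: measurable_rVB].
have := H measurableT `]-oo, r[%classic (measurable_itv _).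
by rewrite setTI; congr measurable; apply/seteqP; split => x /=; rewrite in_itv.
Qed.

Definition ball_ind (a : V) r : V -> R := fun x => (enorm (x - a) < r)%R%:R.

Lemma measurable_ball_ind a r : measurable_fun [set: V] (ball_ind a r).
Proof.
have -> : ball_ind a r = \1_[set x : V | enorm (x - a) < r].
  by apply/funext => x; rewrite indicE mem_setE.
exact: measurable_indic (measurable_ball r a).
Qed.

Lemma ibl_ball_ind a r : ibl mu (ball_ind a r).
Proof.
suff H : ibl mu (ball_ind 0 r).
  by apply: (eq_ibl _ (ibl_shift (- a) H)) => x; rewrite /ball_ind subr0.
apply: ibl_ge0.
- exact: measurable_ball_ind.
- by move=> x; rewrite /ball_ind.
- have := @vmeas_eball_lty R n r; rewrite -[X in vmeas X]setIT -integral_indic//; last exact: measurable_eball.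
  congr (_ < _)%E; apply: eq_integral => x _; rewrite /ball_ind subr0 indicE /=.
  by rewrite mem_setE.
Qed.

Lemma ibl_bounded_ball (f : V -> R) a r C : measurable_fun [set: V] f ->
  (forall x, enorm (x - a) < r -> `|f x| <= C) -> (forall x, r <= enorm (x - a) -> f x = 0) ->
  ibl mu f.
Proof.
move=> mf fC f0; apply: (ibl_le mf _ (iblZ C (ibl_ball_ind a r))) => x.
by rewrite /ball_ind; case: ltP => h /=; [rewrite mulr1 fC|rewrite mulr0 f0// normr0].
Qed.

Definition ballvol : R := Ig mu (ball_ind 0 1).

Lemma Ig_ball_ind a r : 0 < r -> Ig mu (ball_ind a r) = ballvol * r ^+ n.
Proof.
move=> r0; have := Ig_affine (- (r^-1 *: a)) (_ : r^-1 != 0) (ibl_ball_ind 0 1).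
rewrite invr_eq0 gt_eqF// => /(_ isT).
rewrite normfV gtr0_norm// exprVn invrK mulrC -/ballvol => <-.
apply: eq_Ig => x; rewrite /ball_ind subr0 -scalerBr enormZ gtr0_norm ?invr_gt0//.
by rewrite mulrC ltr_pdivrMr// mul1r.
Qed.

(** If the unit ball were null, so would be every ball by scaling, and the Poisson kernel, as a
    limit of its restrictions to balls, would have mass 0 against [int_poisson]. *)
Lemma ballvol_gt0 : 0 < ballvol.
Proof.
have b0 : 0 <= ballvol by apply: Ig_ge0 => x; rewrite /ball_ind.
rewrite lt_neqAle b0 andbT; apply/negP => /eqP b1.
pose f := fun x : V => (rho 1 x ^+ n.+1)^-1.
have f0 x : 0 <= f x by rewrite invr_ge0 exprn_ge0// sqrtr_ge0.
have fi : ibl mu f by apply: ibl_poisson; exact: oner_neq0.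
have f1 x : f x <= 1.
  rewrite invf_le1 ?exprn_gt0 ?rho_gt0 ?oner_neq0// exprn_ege1//.
  by rewrite rhoE expr1n -[leLHS]sqrtr1 ler_wsqrtr// lerDl sqr_ge0.
have bi j : ibl mu (fun x => ball_ind 0 j.+1%:R x * f x).
  apply: (iblM (c := 1)) => //; first exact: measurable_ball_ind.
  by move=> x; rewrite /ball_ind ger0_norm//; case: (_ < _); rewrite ?ler01.
have [||_ H] := @Ig_dct _ _ _ mu (fun j x => ball_ind 0 j.+1%:R x * f x) f f
  (fun j => ibl_meas (bi j)) fi.
- move=> j x; rewrite /ball_ind normrM ger0_norm// ger0_norm//.
  by case: (_ < _); rewrite ?mul1r ?mul0r.
- move=> x; apply/cvgrPdist_lt => e e0; exists (Num.truncn (enorm x)) => // j /= hj.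
  have h : enorm x < j.+1%:R by rewrite (lt_le_trans (truncnS_gt _))// ler_nat.
  by rewrite /ball_ind subr0 h mul1r subrr normr0.
have : Ig mu f = 0.
  apply: (cvg_unique _ H) => //.
  rewrite (_ : (fun _ => _) = fun _ => 0); first exact: cvg_cst.
  apply/funext => j; apply/eqP; rewrite eq_le; apply/andP; split.
    have -> : 0 = Ig mu (ball_ind 0 j.+1%:R) by rewrite Ig_ball_ind// -b1 mul0r.
    apply: Ig_le => //; first exact: ibl_ball_ind.
    by move=> x; rewrite -[leRHS]mulr1 ler_wpM2l// /ball_ind.
  by apply: Ig_ge0 => x; rewrite mulr_ge0// /ball_ind.
apply/eqP; rewrite gt_eqF// -lte_fin -ibl_EFin// int_poisson ?oner_neq0//.
by rewrite lte_fin normr1 divr1 divr_gt0// sphere_vol_gt0.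
Qed.

End rV_lebesgue.

(** * Calculus along coordinate lines *)

Section line_calculus.
Context {R : realType} {n : nat}.
Notation V := 'rV[R]_n.

Lemma is_derive_line (f : V -> R) (x v : V) (t d : R) :
  is_derive (x + t *: v) v f d -> is_derive t 1 (fun s : R => f (x + s *: v)) d.
Proof.
have E : (fun h : R => h^-1 *: ((f \o shift (x + t *: v)) (h *: v) - f (x + t *: v))) =
    (fun h : R => h^-1 *: (((fun s : R => f (x + s *: v)) \o shift t) (h *: (1 : R)) - f (x + t *: v))).
  apply/funext => h /=; congr (_ *: (f _ - _)).
  have -> : (h%:A : R) = h by exact: mulr1.
  by rewrite scalerDl addrCA.
move=> [H1 H2]; constructor.
  by rewrite /derivable -E.
by rewrite -H2 /derive -E.
Qed.

Lemma is_derive_of_line (f : V -> R) (x v : V) (d : R) :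
  is_derive (0 : R) 1 (fun s : R => f (x + s *: v)) d -> is_derive x v f d.
Proof.
have E : (fun h : R => h^-1 *: ((f \o shift x) (h *: v) - f x)) =
    (fun h : R => h^-1 *: (((fun s : R => f (x + s *: v)) \o shift (0:R)) (h *: (1 : R)) - f (x + (0:R) *: v))).
  apply/funext => h /=; rewrite scale0r addr0; congr (_ *: (f _ - f _)); last by rewrite addr0.
  have -> : (h%:A : R) = h by exact: mulr1.
  by rewrite addrC.
move=> [H1 H2]; constructor.
  by rewrite /derivable E.
by rewrite -H2 /derive E.
Qed.

(** A relation rather than a function, so that the rules below assemble a derivative together with
    the proof that it exists; [partial_dpar] returns to [partial]. *)
Definition dpar (i : 'I_n) (f f' : V -> R) := forall x, is_derive x (ebasis i) f (f' x).

Lemma dpar_partial i (f : V -> R) :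
  (forall x, derivable f x (ebasis i)) -> dpar i f (partial i f).
Proof. by move=> H x; exact: derivableP. Qed.

Lemma partial_dpar i f f' : dpar i f f' -> partial i f = f'.
Proof. by move=> H; apply/funext => x; apply: derive_val. Qed.

Lemma dpar_derivable i f f' : dpar i f f' -> forall x, derivable f x (ebasis i).
Proof. by move=> H x; case: (H x). Qed.

Lemma dparD i f f' g g' : dpar i f f' -> dpar i g g' ->
  dpar i (fun x => f x + g x) (fun x => f' x + g' x).
Proof. by move=> H1 H2 x; apply: derD. Qed.

Lemma dparB i f f' g g' : dpar i f f' -> dpar i g g' ->
  dpar i (fun x => f x - g x) (fun x => f' x - g' x).
Proof. by move=> H1 H2 x; apply: derB. Qed.

Lemma dparM i f f' g g' : dpar i f f' -> dpar i g g' ->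
  dpar i (fun x => f x * g x) (fun x => f' x * g x + f x * g' x).
Proof. by move=> H1 H2 x; apply: derM. Qed.

Lemma dparZ i f f' c : dpar i f f' -> dpar i (fun x => c * f x) (fun x => c * f' x).
Proof. by move=> H1 x; apply: derZ. Qed.

Lemma dparC i c : dpar i (fun _ => c) (fun _ => 0).
Proof. by move=> x; exact: derC. Qed.

Lemma dpar_sum i (J : Type) (s : seq J) (F F' : J -> V -> R) :
  (forall j, dpar i (F j) (F' j)) ->
  dpar i (fun x => \sum_(j <- s) F j x) (fun x => \sum_(j <- s) F' j x).
Proof.
move=> H; elim: s => [|j s IH] x.
  apply: (der_eq (derC x (ebasis i) 0)) => [y|]; by rewrite big_nil.
by apply: (der_eq (derD (H j x) (IH x))) => [y|]; rewrite big_cons.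
Qed.

Lemma dpar_shift i f f' a : dpar i f f' ->
  dpar i (fun x => f (x + a)) (fun x => f' (x + a)).
Proof.
move=> H x; apply: is_derive_of_line.
have := @is_derive_line f (x + a) (ebasis i) 0 (f' (x + a)).
rewrite scale0r addr0 => /(_ (H _)) H1.
by apply: (der_eq H1) => // s; rewrite addrAC.
Qed.

Lemma dpar_refl i f f' a : dpar i f f' ->
  dpar i (fun x => f (a - x)) (fun x => - f' (a - x)).
Proof.
move=> H x; apply: is_derive_of_line.
have H0 : is_derive (0:R) 1 (fun s : R => - s) (-1).
  exact: is_deriveNid.
have H1 : is_derive (- (0:R)) 1 (fun s : R => f ((a - x) + s *: ebasis i)) (f' (a - x)).
  by apply: is_derive_line; rewrite oppr0 scale0r addr0; exact: H.
apply: (der_eq (der1_comp H0 H1)); last by rewrite mulrN1.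
by move=> s; rewrite scaleNr opprD addrA.
Qed.

Lemma dpar_coord i j : dpar i (fun x : V => x ord0 j) (fun _ => (i == j)%:R).
Proof.
move=> x; apply: is_derive_of_line.
have H := derD (derC (0:R) 1 (x ord0 j)) (derM (is_derive_id (0:R) 1) (derC (0:R) 1 (i == j)%:R)).
apply: (der_eq H) => [s|]; last by rewrite mul1r mulr0 addr0 add0r.
by rewrite !mxE eqxx /= eq_sym.
Qed.

Lemma mvt_dpar i f f' x h : dpar i f f' ->
  exists2 c : R, 0 <= c <= 1 & f (x + h *: ebasis i) - f x = h * f' (x + (c * h) *: ebasis i).
Proof.
move=> H.
pose g := fun s : R => f (x + (s * h) *: ebasis i).
have dg (s : R) : is_derive s 1 g (h * f' (x + (s * h) *: ebasis i)).
  have H0 : is_derive s 1 (fun s : R => s * h) h.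
    by apply: (der_eq (derM (is_derive_id s (1:R)) (derC s 1 h))) => //; rewrite mul1r mulr0 addr0.
  by apply: (der_eq (der1_comp H0 (is_derive_line (H _)))) => //; rewrite mulrC.
have cg : {within `[0, 1], continuous g}.
  exact/continuous_subspaceT/(der1_continuous dg).
have [c c01 E] := MVT ltr01 (fun s _ => dg s) cg.
exists c; first by move: c01; rewrite in_itv /= => /andP[/ltW -> /ltW ->].
by move: E; rewrite /g mul1r mul0r scale0r addr0 subr0 mulr1.
Qed.

Definition trunc (k : nat) (z : V) : V := \row_j (if (j < k)%N then z ord0 j else 0).

Lemma enorm_le_coord (y z : V) : (forall i, `|y ord0 i| <= `|z ord0 i|) -> enorm y <= enorm z.
Proof.
move=> H; apply: ler_wsqrtr; apply: ler_sum => i _.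
by rewrite -real_normK ?num_real// -[leRHS]real_normK ?num_real// ler_pXn2r ?nnegrE.
Qed.

(** The coordinates of [z] are switched on one at a time ([trunc]), with the mean value theorem on
    each edge. Every point met is within |z| of [x], so the partial derivatives need to be bounded
    only there. *)
Lemma lip_box f (f' : 'I_n -> V -> R) x z C : (forall i, dpar i f (f' i)) ->
  (forall i y, enorm (y - x) <= enorm z -> `|f' i y| <= C) ->
  `|f (x + z) - f x| <= C * \sum_(i < n) `|z ord0 i|.
Proof.
move=> H HC.
have K k : (k <= n)%N -> `|f (x + trunc k z) - f x| <= C * \sum_(i < n | (i < k)%N) `|z ord0 i|.
  elim: k => [|k IH] kn.
    have -> : trunc 0 z = 0 by apply/rowP => j; rewrite !mxE.
    by rewrite addr0 subrr normr0 big_pred0 ?mulr0.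
  pose i := Ordinal kn.
  have E : trunc k.+1 z = trunc k z + z ord0 i *: ebasis i.
    apply/rowP => j; rewrite !mxE eqxx /= ltnS leq_eqVlt.
    have [->|ji] := eqVneq j i; first by rewrite /= eqxx ltnn mulr1 add0r.
    by rewrite (negbTE (_ : (j : nat) != k)) //= mulr0 addr0.
  have [c c01 Ec] := mvt_dpar (x + trunc k z) (z ord0 i) (H i).
  have Hc : `|f' i (x + trunc k z + (c * z ord0 i) *: ebasis i)| <= C.
    apply: HC; rewrite -[x + trunc k z + _]addrA [x + _]addrC addrK.
    apply: enorm_le_coord => j; rewrite !mxE eqxx /=.
    have [->|ji] := eqVneq j i.
      rewrite ltnn add0r mulr1 normrM ger0_norm; last by case/andP: c01.
      by rewrite ler_piMl//; case/andP: c01.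
    by rewrite mulr0 addr0; case: ifP; rewrite ?normr0.
  rewrite (bigD1 i)//= mulrDr E addrA.
  have -> : f (x + trunc k z + z ord0 i *: ebasis i) - f x =
     (f (x + trunc k z + z ord0 i *: ebasis i) - f (x + trunc k z)) + (f (x + trunc k z) - f x) by ring.
  apply: le_trans (ler_normD _ _) _; apply: lerD.
    by rewrite Ec normrM mulrC ler_wpM2r.
  rewrite (eq_bigl (fun j : 'I_n => (j < k)%N)); first exact/IH/ltnW.
  by move=> j; rewrite ltnS [RHS]ltn_neqAle andbC.
have := K n (leqnn n).
have -> : trunc n z = z by apply/rowP => j; rewrite mxE ltn_ord.
by under eq_bigl do rewrite ltn_ord.
Qed.

Lemma sum_le_enorm (z : V) : \sum_(i < n) `|z ord0 i| <= n%:R * enorm z.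
Proof.
rewrite mulr_natl -[X in _ *+ X]card_ord -sumr_const.
by apply: ler_sum => i _; exact: coord_le_enorm.
Qed.

(** The second difference is a first difference of g(y) = f(y + z) - f(y), whose partial derivatives
    are again first differences: [lip_box] is applied twice, which explains the radius 2 |z|. *)
Lemma second_diff f (f' : 'I_n -> V -> R) (f'' : 'I_n -> 'I_n -> V -> R) x z C :
  0 <= C -> (forall i, dpar i f (f' i)) -> (forall i j, dpar j (f' i) (f'' i j)) ->
  (forall i j y, enorm (y - x) <= 2 * enorm z -> `|f'' i j y| <= C) ->
  `|2 * f x - f (x + z) - f (x - z)| <= C * (n%:R * enorm z) ^+ 2.
Proof.
move=> C0 H1 H2 HC.
pose g y := f (y + z) - f y.
pose g' i y := f' i (y + z) - f' i y.
have Hg i : dpar i g (g' i) by apply: dparB; [exact: dpar_shift|].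
have S0 (w : V) : 0 <= \sum_(i < n) `|w ord0 i| by apply: sumr_ge0.
have Sz : \sum_(i < n) `|(- z) ord0 i| = \sum_(i < n) `|z ord0 i|.
  by apply: eq_bigr => i _; rewrite mxE normrN.
have L := @lip_box g g' x (- z) (C * \sum_(i < n) `|z ord0 i|) Hg _.
have -> : 2 * f x - f (x + z) - f (x - z) = g (x - z) - g x.
  by rewrite /g subrK; ring.
apply: le_trans (L _) _.
  move=> i y; rewrite enormN => yx.
  apply: (lip_box (f' := f'' i)) => // j w wy; apply: HC.
  rewrite (le_trans (enorm_triangleB _ y _))// [2]/(1 + 1) mulrDl mul1r lerD//.
rewrite Sz -mulrA ler_wpM2l// -expr2 ler_pXn2r ?nnegrE ?S0 ?mulr_ge0 ?enorm_ge0//.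
exact: sum_le_enorm.
Qed.

Definition fdiff (a : V) (g : V -> R) : V -> R := fun x => g (x + a) - g x.

Lemma dpar_fdiff i a f f' : dpar i f f' -> dpar i (fdiff a f) (fdiff a f').
Proof. by move=> H; apply: dparB => //; exact: dpar_shift. Qed.

Lemma dpar_iter_fdiff i a k f f' : dpar i f f' -> dpar i (iter k (fdiff a) f) (iter k (fdiff a) f').
Proof. by move=> H; elim: k => //= k IH; exact: dpar_fdiff. Qed.

(** Each application of the mean value theorem trades one difference for a factor |h| and the next
    function of the chain [G]; the evaluation point drifts by at most |h| each time, hence the
    segment of half-length k |h|. *)
Lemma fdiff_bound i (h : R) k (G : nat -> V -> R) x C :
  (forall j, (j < k)%N -> dpar i (G j) (G j.+1)) ->
  (forall t : R, `|t| <= k%:R * `|h| -> `|G k (x + t *: ebasis i)| <= C) ->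
  `|iter k (fdiff (h *: ebasis i)) (G 0%N) x| <= `|h| ^+ k * C.
Proof.
elim: k G C => [|k IH] G C H HC /=.
  by rewrite mul1r; have := HC 0; rewrite scale0r addr0; apply; rewrite normr0 mul0r.
rewrite -iterS iterSr.
have -> : `|h| ^+ k.+1 * C = `|h| ^+ k * (`|h| * C) by rewrite exprSr mulrA.
apply: (IH (fun j => fdiff (h *: ebasis i) (G j))) => [j jk|t tk].
  exact/dpar_fdiff/H/ltnW.
rewrite /fdiff.
have [c /andP[c0 c1] ->] := mvt_dpar (x + t *: ebasis i) h (H k (ltnSn k)).
rewrite normrM ler_wpM2l// -addrA -scalerDl; apply: HC.
rewrite (le_trans (ler_normD _ _))// -natr1 mulrDl mul1r lerD//.
by rewrite normrM ger0_norm// ler_piMl.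
Qed.

Lemma iter_fdiffE k : exists2 c : nat -> R, c k = 1 &
  forall (a : V) (f : V -> R) x, iter k (fdiff a) f x = \sum_(j < k.+1) c j * f (x + j%:R *: a).
Proof.
elim: k => [|k [c ck IH]].
  exists (fun _ => 1) => // a f x.
  by rewrite big_ord_recl big_ord0 scale0r !addr0 mul1r.
exists (fun j => (if j is j'.+1 then c j' else 0) - (if (j <= k)%N then c j else 0)).
  by rewrite ck ltnn subr0.
move=> a f x; rewrite iterS /fdiff !IH.
under [RHS]eq_bigr do rewrite mulrBl.
rewrite sumrB; congr (_ - _).
  rewrite [RHS]big_ord_recl /= mul0r add0r; apply: eq_bigr => j _.
  by rewrite /bump /= add1n -addrA -[in RHS]natr1 scalerDl scale1r [a + _]addrC.
rewrite [RHS]big_ord_recr /= ltnn mul0r addr0; apply: eq_bigr => j _.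
by rewrite -ltnS ltn_ord.
Qed.

End line_calculus.

(** * Functions of class C^N *)

Section smooth_functions.
Context {R : realType} {n : nat}.
Notation V := 'rV[R]_n.

(** A finite-order counterpart of [smooth]: the cutoffs used below are powers of a positive part and
    have only finitely many continuous derivatives. *)
Fixpoint CN (N : nat) (f : V -> R) : Prop := continuous f /\
  match N with
  | 0%N => True
  | N'.+1 => forall i, (forall x, derivable f x (ebasis i)) /\ CN N' (partial i f)
  end.

Lemma iter_partial_rcons (l : seq 'I_n) i (f : V -> R) :
  iter_partial l (partial i f) = iter_partial (rcons l i) f.
Proof. by elim: l => //= j l ->. Qed.

Lemma smooth_partial i (f : V -> R) : smooth f -> smooth (partial i f).
Proof. by move=> H l; rewrite iter_partial_rcons; exact: H. Qed.

Lemma smooth_CN N (f : V -> R) : smooth f -> CN N f.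
Proof.
elim: N f => [|N IH] f sf /=; first by split => //; case: (sf [::]).
split; first by case: (sf [::]).
move=> i; split; first by move=> x; case: (sf [::]) => _ /(_ i x).
exact/IH/smooth_partial.
Qed.

Lemma CN_continuous N f : CN N f -> continuous f.
Proof. by case: N => [|N] []. Qed.

Lemma CN_dpar N f i : CN N.+1 f -> dpar i f (partial i f).
Proof. by move=> [_ /(_ i)[H _]]; exact: dpar_partial. Qed.

Lemma CN_partial N f i : CN N.+1 f -> CN N (partial i f).
Proof. by move=> [_ /(_ i)[]]. Qed.

Lemma CNS N f : CN N.+1 f -> CN N f.
Proof.
elim: N f => [|N IH] f [cf H]; first by [].
by split => // i; have [H1 H2] := H i; split => //; exact: IH.
Qed.

Lemma CN_le M N f : (M <= N)%N -> CN N f -> CN M f.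
Proof. by move=> MN; rewrite -(subnK MN); elim: (N - M)%N => //= k IH /CNS. Qed.

Lemma CN_D N f g : CN N f -> CN N g -> CN N (fun x => f x + g x).
Proof.
elim: N f g => [|N IH] f g Hf Hg.
  by split => // x; apply: continuousD; [exact: CN_continuous Hf x|exact: CN_continuous Hg x].
split; first by move=> x; apply: continuousD; [exact: CN_continuous Hf x|exact: CN_continuous Hg x].
move=> i; have H := dparD (CN_dpar i Hf) (CN_dpar i Hg).
split; first exact: dpar_derivable H.
by rewrite (partial_dpar H); apply: IH; exact: CN_partial.
Qed.

Lemma CN_M N f g : CN N f -> CN N g -> CN N (fun x => f x * g x).
Proof.
elim: N f g => [|N IH] f g Hf Hg.
  by split => // x; apply: continuousM; [exact: CN_continuous Hf x|exact: CN_continuous Hg x].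
split; first by move=> x; apply: continuousM; [exact: CN_continuous Hf x|exact: CN_continuous Hg x].
move=> i; have H := dparM (CN_dpar i Hf) (CN_dpar i Hg).
split; first exact: dpar_derivable H.
rewrite (partial_dpar H); apply: CN_D; apply: IH; (try exact: CN_partial); exact: CNS.
Qed.

Lemma CN_C N c : CN N (fun _ => c).
Proof.
elim: N c => [|N IH] c; first by split; [exact: cst_continuous|].
split; first exact: cst_continuous.
move=> i; have H := @dparC R n i c.
by split; [exact: dpar_derivable H|rewrite (partial_dpar H)].
Qed.

Lemma CN_sum N (J : Type) (s : seq J) (F : J -> V -> R) : (forall j, CN N (F j)) ->
  CN N (fun x => \sum_(j <- s) F j x).
Proof.
move=> H; elim: s => [|j s IH].
  rewrite (_ : (fun _ => _) = fun _ => 0); first exact: CN_C.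
  by apply/funext => x; rewrite big_nil.
rewrite (_ : (fun _ => _) = fun x => F j x + \sum_(i <- s) F i x); first exact: CN_D.
by apply/funext => x; rewrite big_cons.
Qed.

Lemma CN_Lap N f : CN N.+2 f -> CN N (Lap f).
Proof.
move=> H; rewrite (_ : Lap f = fun x => \sum_(i < n) partial i (partial i f) x) //.
by apply: CN_sum => i; apply: CN_partial; exact: CN_partial.
Qed.

Lemma CN_iter_Lap m N f : CN (N + m.*2) f -> CN N (iter m Lap f).
Proof.
elim: m N => [|m IH] N; first by rewrite addn0.
by rewrite doubleS !addnS => H /=; apply: CN_Lap; apply: IH; rewrite !addSn.
Qed.

End smooth_functions.

(** * Symbol classes *)

Section symbols.
Context {R : realType} {n : nat}.
Notation V := 'rV[R]_n.
Context (T : Type) (ok : T -> Prop) (w : T -> V -> R).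
Hypothesis w_gt0 : forall t x, ok t -> 0 < w t x.
Implicit Types (g : T -> V -> R) (d e : int).

(** Symbols of order [d] relative to the weight [w]: each of the first N derivatives gains one power
    of [w], uniformly in the parameter [t]. Orders add under products, so no Leibniz expansion is
    ever estimated by hand. Used with w = [rho] for the kernels and with w = 1 + |x| for cutoffs and
    for kernels at a fixed time. *)
Fixpoint Sy (N : nat) (d : int) (g : T -> V -> R) : Prop :=
  [/\ exists C : R, forall t x, ok t -> `|g t x| <= C * w t x ^ d,
      forall t, ok t -> continuous (g t) &
      match N with
      | 0%N => True
      | N'.+1 => forall i, exists2 g', (forall t, ok t -> dpar i (g t) (g' t)) & Sy N' (d - 1) g'
      end].

Lemma Sy_bound N d g : Sy N d g ->
  exists2 C : R, 0 <= C & forall t x, ok t -> `|g t x| <= C * w t x ^ d.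
Proof.
have H : (exists C : R, forall t x, ok t -> `|g t x| <= C * w t x ^ d) ->
   exists2 C : R, 0 <= C & forall t x, ok t -> `|g t x| <= C * w t x ^ d.
  move=> [C HC]; exists `|C| => // t x tk; apply: le_trans (HC t x tk) _.
  by rewrite ler_wpM2r ?ler_norm// exprz_ge0// ltW// w_gt0.
by case: N => [|N] [/H].
Qed.

Lemma Sy_cont N d g : Sy N d g -> forall t, ok t -> continuous (g t).
Proof. by case: N => [|N] []. Qed.

Lemma SyS N d g : Sy N.+1 d g -> Sy N d g.
Proof.
elim: N d g => [|N IH] d g [H1 H2 H3]; split => // i.
by have [g' Hg' Sg'] := H3 i; exists g' => //; apply: IH.
Qed.

Lemma Sy_le M N d g : (M <= N)%N -> Sy N d g -> Sy M d g.
Proof. by move=> MN; rewrite -(subnK MN); elim: (N - M)%N => //= k IH /SyS. Qed.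

Lemma Sy_0 N d : Sy N d (fun _ _ => 0).
Proof.
elim: N d => [|N IH] d; split => //.
- by exists 0 => t x _; rewrite normr0 mul0r.
- by move=> t _; exact: cst_continuous.
- by exists 0 => t x _; rewrite normr0 mul0r.
- by move=> t _; exact: cst_continuous.
- by move=> i; exists (fun _ _ => 0) => // t _; exact: dparC.
Qed.

Lemma Sy_C N c : Sy N 0 (fun _ _ => c).
Proof.
have H : exists C : R, forall t x, ok t -> `|c| <= C * w t x ^ (0 : int).
  by exists `|c| => t x _; rewrite expr0z mulr1.
case: N => [|N]; split => //.
- by move=> t _; exact: cst_continuous.
- by move=> t _; exact: cst_continuous.
- by move=> i; exists (fun _ _ => 0); [move=> t _; exact: dparC|exact: Sy_0].
Qed.

Lemma Sy_D N d f g : Sy N d f -> Sy N d g -> Sy N d (fun t x => f t x + g t x).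
Proof.
have HB f1 g1 d1 : Sy 0 d1 f1 -> Sy 0 d1 g1 ->
    exists C : R, forall t x, ok t -> `|f1 t x + g1 t x| <= C * w t x ^ d1.
  move=> [[C1 H1] _ _] [[C2 H2] _ _]; exists (C1 + C2) => t x tk.
  by rewrite mulrDl (le_trans (ler_normD _ _))// lerD ?H1 ?H2.
elim: N d f g => [|N IH] d f g Hf Hg; split.
- exact: HB.
- by move=> t tk x; apply: continuousD; [exact: Sy_cont Hf t tk x|exact: Sy_cont Hg t tk x].
- by [].
- by apply: HB; [exact: Sy_le Hf|exact: Sy_le Hg].
- by move=> t tk x; apply: continuousD; [exact: Sy_cont Hf t tk x|exact: Sy_cont Hg t tk x].
- move=> i; have [_ _ /(_ i)[f' Df Sf]] := Hf; have [_ _ /(_ i)[g' Dg Sg]] := Hg.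
  exists (fun t x => f' t x + g' t x); last exact: IH.
  by move=> t tk; apply: dparD; [exact: Df|exact: Dg].
Qed.

Lemma Sy_M N d e f g : Sy N d f -> Sy N e g -> Sy N (d + e) (fun t x => f t x * g t x).
Proof.
have HB f1 g1 d1 e1 : Sy 0 d1 f1 -> Sy 0 e1 g1 ->
    exists C : R, forall t x, ok t -> `|f1 t x * g1 t x| <= C * w t x ^ (d1 + e1).
  move=> [[C1 H1] _ _] [[C2 H2] _ _]; exists (C1 * C2) => t x tk.
  rewrite expfzDr ?gt_eqF ?w_gt0// mulrACA normrM.
  by apply: ler_pM => //; [exact: H1|exact: H2].
elim: N d e f g => [|N IH] d e f g Hf Hg; split.
- exact: HB.
- by move=> t tk x; apply: continuousM; [exact: Sy_cont Hf t tk x|exact: Sy_cont Hg t tk x].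
- by [].
- by apply: HB; [exact: Sy_le Hf|exact: Sy_le Hg].
- by move=> t tk x; apply: continuousM; [exact: Sy_cont Hf t tk x|exact: Sy_cont Hg t tk x].
- move=> i; have [_ _ /(_ i)[f' Df Sf]] := Hf; have [_ _ /(_ i)[g' Dg Sg]] := Hg.
  exists (fun t x => f' t x * g t x + f t x * g' t x).
    by move=> t tk; apply: dparM; [exact: Df|exact: Dg].
  apply: Sy_D.
    rewrite (_ : d + e - 1 = (d - 1) + e); last by rewrite addrAC.
    by apply: IH => //; exact: SyS.
  rewrite (_ : d + e - 1 = d + (e - 1)); last by rewrite addrA.
  by apply: IH => //; exact: SyS.
Qed.

Lemma Sy_Z N d c g : Sy N d g -> Sy N d (fun t x => c * g t x).
Proof. by move=> /(Sy_M (Sy_C N c)); rewrite add0r. Qed.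

Lemma Sy_X N d g m : Sy N d g -> Sy N (d * m%:Z) (fun t x => g t x ^+ m).
Proof.
move=> H; elim: m => [|m IH].
  by rewrite mulr0; exact: Sy_C.
rewrite intS mulrDr mulr1.
have := Sy_M H IH; congr (Sy _ _ _).
by apply/funext => t; apply/funext => x; rewrite exprS.
Qed.

Lemma Sy_coordinate N i : (forall t (x : V), ok t -> `|x ord0 i| <= w t x) ->
  Sy N 1 (fun _ x => x ord0 i).
Proof.
move=> Hw.
have cc : forall t, ok t -> continuous (fun x : V => x ord0 i) by move=> t _; exact: coord_continuous.
have H : exists C : R, forall t (x : V), ok t -> `|x ord0 i| <= C * w t x ^ (1 : int).
  by exists 1 => t x tk; rewrite mul1r expr1z Hw.
case: N => [|N]; split => // j; exists (fun _ _ => (j == i)%:R).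
  by move=> t _; exact: dpar_coord.
by rewrite subrr; exact: Sy_C.
Qed.

Lemma Sy_CN N d g : Sy N d g -> forall t, ok t -> CN N (g t).
Proof.
elim: N d g => [|N IH] d g Hg t tk; split => //; first exact: Sy_cont Hg t tk.
  exact: Sy_cont Hg t tk.
move=> i; have [_ _ /(_ i)[g' Dg Sg]] := Hg; split.
  exact: dpar_derivable (Dg t tk).
by rewrite (partial_dpar (Dg t tk)); exact: IH Sg t tk.
Qed.

Lemma Sy_ext N d g h : (forall t, ok t -> h t = g t) -> Sy N d g -> Sy N d h.
Proof.
move=> E; elim: N d g h E => [|N IH] d g h E [[C HC] H2 H3].
  by split => //; [exists C => t x tk; rewrite E// HC|move=> t tk; rewrite E//; exact: H2].
split; [by exists C => t x tk; rewrite E// HC|by move=> t tk; rewrite E//; exact: H2|].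
by move=> j; have [g'' D'' S''] := H3 j; exists g'' => // t tk; rewrite E//; exact: D''.
Qed.

Lemma Sy_partial N d g i : Sy N.+1 d g -> Sy N (d - 1) (fun t => partial i (g t)).
Proof.
move=> [_ _ /(_ i)[g' Dg Sg]].
by apply: Sy_ext Sg => t tk; exact: partial_dpar (Dg t tk).
Qed.

Lemma Sy_sum N d (s : seq 'I_n) (g : 'I_n -> T -> V -> R) : (forall i, Sy N d (g i)) ->
  Sy N d (fun t x => \sum_(i <- s) g i t x).
Proof.
move=> H; elim: s => [|i s IH].
  have := Sy_0 N d; congr (Sy _ _ _).
  by apply/funext => t; apply/funext => x; rewrite big_nil.
have := Sy_D (H i) IH; congr (Sy _ _ _).
by apply/funext => t; apply/funext => x; rewrite big_cons.
Qed.

Lemma Sy_Lap N d g : Sy N.+2 d g -> Sy N (d - 2) (fun t => Lap (g t)).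
Proof.
move=> H.
have := @Sy_sum N (d - 2) (index_enum _) (fun i t => partial i (partial i (g t))).
apply => i; rewrite (_ : d - 2 = d - 1 - 1); last by rewrite -addrA -opprD.
exact/Sy_partial/Sy_partial.
Qed.

Lemma Sy_iter_Lap m N d g : Sy (N + m.*2) d g -> Sy N (d - m.*2%:Z) (fun t => iter m Lap (g t)).
Proof.
elim: m N => [|m IH] N; first by rewrite addn0 subr0.
rewrite doubleS !addnS => H /=.
rewrite (_ : d - m.*2.+2%:Z = d - m.*2%:Z - 2); last by rewrite -addrA -opprD -PoszD addn2.
by apply: Sy_Lap; apply: IH; rewrite !addSn.
Qed.

End symbols.

(** * The Poisson kernel *)

Section poisson_kernel.
Context {R : realType} {n : nat}.
Notation V := 'rV[R]_n.
Implicit Types (s c : R) (x : V).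

Definition rp (k : nat) (s : R) (x : V) : R := (rho s x ^+ k)^-1.

Lemma rho_neq0 s x : s != 0 -> rho s x != 0.
Proof. by move=> s0; rewrite gt_eqF// rho_gt0. Qed.

Lemma sqr_rho s x : rho s x ^+ 2 = s ^+ 2 + \sum_(i < n) x ord0 i ^+ 2.
Proof. by rewrite sqr_sqrtr// addr_ge0 ?sqr_ge0// sumr_ge0// => i _; exact: sqr_ge0. Qed.

Lemma abs_le_rho s x : `|s| <= rho s x.
Proof.
rewrite -sqrtr_sqr; apply: ler_wsqrtr; rewrite lerDl.
by rewrite sumr_ge0// => i _; exact: sqr_ge0.
Qed.

Lemma enorm_le_rho s x : enorm x <= rho s x.
Proof. by apply: ler_wsqrtr; rewrite lerDr sqr_ge0. Qed.

Lemma rho_le s x : rho s x <= `|s| + enorm x.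
Proof.
rewrite -[leRHS]ger0_norm ?addr_ge0 ?enorm_ge0// -sqrtr_sqr; apply: ler_wsqrtr.
rewrite sqrrD real_normK ?num_real// sqr_enorm -addrA lerD2l lerDr.
by rewrite mulrn_wge0// mulr_ge0 ?enorm_ge0.
Qed.

Lemma is_derive_rho_s s x : s != 0 -> is_derive s 1 (fun s : R => rho s x) (s / rho s x).
Proof.
move=> s0.
have p0 : 0 < s ^+ 2 + \sum_(i < n) x ord0 i ^+ 2.
  by rewrite ltr_wpDr ?exprn_even_gt0// sumr_ge0// => i _; exact: sqr_ge0.
have H := derD (derX 2 (is_derive_id s (1:R))) (derC s 1 (\sum_(i < n) x ord0 i ^+ 2)).
apply: (der_eq (der1_comp H (is_derive1_sqrt p0))) => //.
by rewrite expr1 -/(rho s x); field; rewrite rho_neq0.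
Qed.

Lemma dpar_rho s i : s != 0 -> dpar i (rho s) (fun x => x ord0 i / rho s x).
Proof.
move=> s0 x; apply: is_derive_of_line.
have p0 : 0 < s ^+ 2 + \sum_(j < n) (x + (0:R) *: ebasis i) ord0 j ^+ 2.
  by rewrite ltr_wpDr ?exprn_even_gt0// sumr_ge0// => j _; exact: sqr_ge0.
have H0 : dpar i (fun x : V => s ^+ 2 + \sum_(j < n) x ord0 j ^+ 2) (fun x => 2 * x ord0 i).
  move=> y.
  apply: (der_eq (dparD (dparC i (s ^+ 2)) (dpar_sum (index_enum _) (fun j => (fun y => derX 2 (dpar_coord i j y)))) y)) => //.
  rewrite add0r (bigD1 i)//= big1 => [|j ji].
    by rewrite eqxx expr1 mulr1 addr0.
  by rewrite eq_sym (negbTE ji) mulr0.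
have H1 := @is_derive_line _ _ _ x (ebasis i) 0 _ (H0 _).
apply: (der_eq (der1_comp H1 (is_derive1_sqrt p0))) => //.
rewrite scale0r addr0 -/(rho s x); field; rewrite rho_neq0//.
Qed.

Lemma is_derive_rp_s k s x : s != 0 ->
  is_derive s 1 (fun s : R => rp k s x) (- k%:R * s * rp k.+2 s x).
Proof.
move=> s0; have p0 := rho_neq0 x s0.
apply: (der_eq (der1V (derX k (is_derive_rho_s x s0)) _)) => //; first by rewrite expf_neq0.
rewrite /rp; case: k => [|k] /=; first by rewrite !mul0r oppr0 !mul0r.
rewrite !exprS; have : rho s x ^+ k != 0 by rewrite expf_neq0.
by move: (rho s x ^+ k) => q q0; field; rewrite p0 ?q0.
Qed.

Lemma dpar_rp k s i : s != 0 ->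
  dpar i (rp k s) (fun x => - k%:R * x ord0 i * rp k.+2 s x).
Proof.
move=> s0 x; have p0 := rho_neq0 x s0.
apply: is_derive_of_line.
have H1 := @is_derive_line _ _ _ x (ebasis i) 0 _ (derX k (dpar_rho i s0 (x + (0:R) *: ebasis i))).
apply: (der_eq (der1V H1 _)) => //; rewrite scale0r addr0; first by rewrite expf_neq0.
rewrite /rp; case: k H1 => [|k] _ /=; first by rewrite !mul0r oppr0 !mul0r.
rewrite !exprS.
have : rho s x ^+ k != 0 by rewrite expf_neq0.
by move: (rho s x ^+ k) => q q0; field; rewrite p0 ?q0.
Qed.

Lemma rp_S2 k s x : s != 0 -> (s ^+ 2 + \sum_(i < n) x ord0 i ^+ 2) * rp k.+2 s x = rp k s x.
Proof.
move=> s0; have p0 := rho_neq0 x s0; rewrite -sqr_rho /rp !exprS.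
have : rho s x ^+ k != 0 by rewrite expf_neq0.
by move: (rho s x ^+ k) => q q0; field; rewrite p0 q0.
Qed.

Definition pos (s : R) : Prop := 0 < s.
Lemma rho_pos_gt0 s x : pos s -> 0 < rho s x.
Proof. by move=> s0; rewrite rho_gt0// gt_eqF. Qed.

Lemma continuous_of_dpar (f : V -> R) (f' : 'I_n -> V -> R) :
  (forall i, dpar i f (f' i)) ->
  (forall x, exists C : R, forall i y, enorm (y - x) <= 1 -> `|f' i y| <= C) -> continuous f.
Proof.
move=> H HC x; apply/continuousVP => e e0; have [C HCx] := HC x.
have C1 : 0 < `|C| + 1 by rewrite ltr_wpDl.
have n1 : 0 < n%:R + 1 :> R by rewrite ltr_wpDl.
exists (Num.min 1 (e / ((`|C| + 1) * (n%:R + 1)))).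
  by rewrite lt_min ltr01 /= divr_gt0// mulr_gt0.
move=> y; rewrite lt_min => /andP[y1 ye].
have := @lip_box R n f f' x (y - x) (`|C| + 1) H.
rewrite [x + _]addrC subrK => /(_ _)/le_lt_trans; apply.
  move=> i z zx; apply: (@le_trans _ _ C); first by apply: HCx; rewrite (le_trans zx)// ltW.
  by rewrite (le_trans (ler_norm C))// lerDl.
apply: le_lt_trans (ler_wpM2l (ltW C1) (sum_le_enorm _)) _.
apply: (@le_lt_trans _ _ ((`|C| + 1) * ((n%:R + 1) * enorm (y - x)))).
  by rewrite ler_wpM2l ?(ltW C1)// ler_wpM2r ?enorm_ge0// lerDl.
by rewrite mulrA mulrC -ltr_pdivlMr// mulr_gt0.
Qed.

Lemma abs_coord_le_rho s x i : `|x ord0 i| <= rho s x.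
Proof. exact: le_trans (coord_le_enorm x i) (enorm_le_rho s x). Qed.

Lemma rho_continuous s : s != 0 -> continuous (rho s : V -> R).
Proof.
move=> s0; apply: continuous_of_dpar => [i|x]; first exact: dpar_rho.
exists 1 => i y _; rewrite normrM normfV [X in _ / X]ger0_norm ?sqrtr_ge0//.
by rewrite ler_pdivrMr ?rho_gt0// mul1r abs_coord_le_rho.
Qed.

Lemma rp_ge0 k s x : 0 <= rp k s x.
Proof. by rewrite invr_ge0 exprn_ge0// sqrtr_ge0. Qed.

Lemma rp_continuous k s : s != 0 -> continuous (rp k s : V -> R).
Proof.
move=> s0 x; apply: (@continuous_comp _ _ _ (fun x : V => rho s x ^+ k) (@GRing.inv R)); last first.
  by apply: inv_continuous; rewrite expf_neq0// rho_neq0.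
apply: (@continuous_comp _ _ _ (rho s : V -> R) (fun t => t ^+ k)).
  exact: rho_continuous.
exact: exprn_continuous.
Qed.

Local Notation Syr := (@Sy R n R pos rho).

Lemma Sy_coord N i : Syr N 1 (fun _ x => x ord0 i).
Proof. by apply: Sy_coordinate => t x _; exact: abs_coord_le_rho. Qed.

Lemma Sy_rp N k : Syr N (- k%:Z) (rp k).
Proof.
have Hb m : exists C : R, forall t x, pos t -> `|rp m t x| <= C * rho t x ^ (- m%:Z).
  by exists 1 => t x tk; rewrite mul1r ger0_norm ?rp_ge0// /rp exprnN.
have Hc m t : pos t -> continuous (rp m t : V -> R).
  by move=> t0; apply: rp_continuous; rewrite gt_eqF.
elim: N k => [|N IH] k; (split; [exact: Hb|exact: Hc|]) => // i.
exists (fun s x => - k%:R * x ord0 i * rp k.+2 s x).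
  by move=> t tk; apply: dpar_rp; rewrite gt_eqF.
have := Sy_M rho_pos_gt0 (Sy_Z rho_pos_gt0 (- k%:R) (Sy_coord N i)) (IH k.+2).
rewrite (_ : 1 + - k.+2%:Z = - k%:Z - 1) //.
by rewrite -[in k.+2%:Z]addn2 PoszD; ring.
Qed.

Lemma Sy_s N : Syr N 1 (fun s _ => s).
Proof.
have H : exists C : R, forall t (x : V), pos t -> `|t| <= C * rho t x ^ (1 : int).
  by exists 1 => t x _; rewrite mul1r expr1z abs_le_rho.
case: N => [|N]; split => //.
- by move=> t _; exact: cst_continuous.
- by move=> t _; exact: cst_continuous.
- move=> i; exists (fun _ _ => 0); last exact: Sy_0.
  by move=> t _; exact: dparC.
Qed.

(** Combinations of s^a / rho^k that are homogeneous of degree [d] in (s, x) jointly. The class is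
    stable under d/ds and under the Laplacian and contains the Poisson kernel, and homogeneity alone
    gives the decay of its members ([sp_Sy]). *)
Inductive sp : int -> (R -> V -> R) -> Prop :=
| sp_mono c a k : sp (a%:Z - k%:Z) (fun s x => c * s ^+ a * rp k s x)
| sp_0 d : sp d (fun _ _ => 0)
| sp_add d f g : sp d f -> sp d g -> sp d (fun s x => f s x + g s x).

Lemma sp_Sy N d g : sp d g -> Syr N d g.
Proof.
elim=> [c a k|{}d|{}d f {}g _ Hf _ Hg]; [|exact: Sy_0|exact: Sy_D].
apply: Sy_M => //; [exact: rho_pos_gt0| |exact: Sy_rp].
apply: Sy_Z; first exact: rho_pos_gt0.
by have := Sy_X rho_pos_gt0 a (Sy_s N); rewrite mul1r.
Qed.

Definition dsg (g g' : R -> V -> R) := forall s x, s != 0 -> is_derive s 1 (g ^~ x) (g' s x).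
Definition lapg (g L : R -> V -> R) := forall s x, s != 0 -> Lap (g s) x = L s x.

Lemma dsg_mono c a k : dsg (fun s x => c * s ^+ a * rp k s x)
  (fun s x => (c * a%:R) * s ^+ a.-1 * rp k s x + (- k%:R * c) * s ^+ a.+1 * rp k.+2 s x).
Proof.
move=> s x s0.
apply: (der_eq (derM (derZ c (derX a (is_derive_id s (1:R)))) (is_derive_rp_s k x s0))) => //.
by rewrite exprS; ring.
Qed.

Lemma dsgD f f' g g' : dsg f f' -> dsg g g' -> dsg (fun s x => f s x + g s x) (fun s x => f' s x + g' s x).
Proof. by move=> H1 H2 s x s0; apply: derD; [exact: H1|exact: H2]. Qed.

Lemma dpar2_mono b k i s : s != 0 ->
  partial i (partial i (fun x => b * rp k s x)) = fun x =>
   b * (- k%:R * rp k.+2 s x + (k * k.+2)%:R * x ord0 i ^+ 2 * rp k.+4 s x).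
Proof.
move=> s0; rewrite (partial_dpar (dparZ b (dpar_rp k i s0))).
have H := dparM (dparZ (- k%:R) (dpar_coord i i)) (dpar_rp k.+2 i s0).
rewrite (partial_dpar (dparZ b H)); apply/funext => x; rewrite eqxx /= natrM; ring.
Qed.

Lemma lapg_mono c a k : lapg (fun s x => c * s ^+ a * rp k s x)
  (fun s x => (c * (k%:R * (k.+2%:R - n%:R))) * s ^+ a * rp k.+2 s x +
     (- (k * k.+2)%:R * c) * s ^+ a.+2 * rp k.+4 s x).
Proof.
move=> s x s0; rewrite /Lap.
under eq_bigr do rewrite (dpar2_mono _ _ _ s0).
rewrite -mulr_sumr big_split /= sumr_const card_ord -mulr_suml -mulr_sumr.
have E := rp_S2 k.+2 x s0.
have -> : (k * k.+2)%:R * (\sum_(i < n) x ord0 i ^+ 2) * rp k.+4 s x =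
   (k * k.+2)%:R * (rp k.+2 s x - s ^+ 2 * rp k.+4 s x) by rewrite -E; ring.
rewrite -mulr_natr natrM !exprS; ring.
Qed.

Lemma sp_CN N d g s : s != 0 -> sp d g -> CN N (g s).
Proof.
move=> s0; elim=> [c a k|{}d|{}d f {}g _ Hf _ Hg]; [|exact: CN_C|exact: CN_D].
apply: CN_M; first exact: CN_C.
elim: N k => [|N IH] k; split => //; try exact: rp_continuous.
move=> i; have H := dpar_rp k i s0; split; first exact: dpar_derivable H.
rewrite (partial_dpar H); apply: CN_M => //; apply: CN_M; first exact: CN_C.
elim: N {IH} => [|N IH]; split => //; try exact: coord_continuous.
move=> j; have H' := @dpar_coord R n j i; split; first exact: dpar_derivable H'.
by rewrite (partial_dpar H'); exact: CN_C.
Qed.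

Lemma Lap_D (f g : V -> R) : CN 2 f -> CN 2 g -> Lap (fun x => f x + g x) = fun x => Lap f x + Lap g x.
Proof.
move=> Hf Hg; apply/funext => x; rewrite /Lap -big_split /=; apply: eq_bigr => i _.
rewrite (partial_dpar (dparD (CN_dpar i Hf) (CN_dpar i Hg))).
by rewrite (partial_dpar (dparD (CN_dpar i (CN_partial i Hf)) (CN_dpar i (CN_partial i Hg)))).
Qed.

Lemma lapgD d e f L g M : sp d f -> sp e g -> lapg f L -> lapg g M ->
  lapg (fun s x => f s x + g s x) (fun s x => L s x + M s x).
Proof.
move=> sf sg H1 H2 s x s0.
by rewrite (Lap_D (sp_CN 2 s0 sf) (sp_CN 2 s0 sg)) H1// H2.
Qed.

(** The point is the common [L']: it is at once the s-derivative of the Laplacian of [g] and the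
    Laplacian of its s-derivative. The two operators commute on the class because they do so on
    monomials by explicit computation. *)
Lemma sp_all d g : sp d g -> exists g' L L',
  [/\ sp (d - 1) g', sp (d - 2) L, sp (d - 3) L', dsg g g' & lapg g L] /\ dsg L L' /\ lapg g' L'.
Proof.
elim=> [c a k|{}d|{}d f {}g sf [f' [Lf [Lf' [[Hf1 Hf2 Hf3 Hf4 Hf5] [Hf6 Hf7]]]]] sg
   [g' [Lg [Lg' [[Hg1 Hg2 Hg3 Hg4 Hg5] [Hg6 Hg7]]]]]]; last first.
- exists (fun s x => f' s x + g' s x), (fun s x => Lf s x + Lg s x), (fun s x => Lf' s x + Lg' s x).
  split; [split|split]; try exact: sp_add; try exact: dsgD.
  + exact: lapgD sf sg Hf5 Hg5.
  + exact: lapgD Hf1 Hg1 Hf7 Hg7.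
- exists (fun _ _ => 0), (fun _ _ => 0), (fun _ _ => 0).
  have L0 : lapg (fun _ _ => 0) (fun _ _ => 0).
    move=> s x s0; rewrite /Lap big1 // => i _.
    by rewrite !(partial_dpar (dparC i 0)).
  by split; [split|split]; try exact: sp_0; try exact: L0; move=> s x _; exact: derC.
(* A monomial with zero coefficient belongs to every degree. This covers a = 0, where the formal
   derivative keeps the exponent [a.-1] = 0 but has coefficient 0. *)
have sp_mono' c0 a0 k0 e : (c0 != 0 -> a0%:Z - k0%:Z = e) -> sp e (fun s x => c0 * s ^+ a0 * rp k0 s x).
  have [->|c00] := eqVneq c0 0; last by move=> /(_ isT) <-; exact: sp_mono.
  move=> _; rewrite (_ : (fun _ _ => _) = fun _ _ => 0); first exact: sp_0.
  by apply/funext => s; apply/funext => x; rewrite !mul0r.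
have sg' := sp_mono' (c * a%:R) a.-1 k (a%:Z - k%:Z - 1).
have sg'' := sp_mono' (- k%:R * c) a.+1 k.+2 (a%:Z - k%:Z - 1).
have sg1 : sp (a%:Z - k%:Z - 1) (fun s x => (c * a%:R) * s ^+ a.-1 * rp k s x).
  by apply: sg'; case: (a) => [|a'] /=; rewrite ?mulr0 ?eqxx// => _; lia.
have sg2 : sp (a%:Z - k%:Z - 1) (fun s x => (- k%:R * c) * s ^+ a.+1 * rp k.+2 s x).
  by apply: sg'' => _; lia.
set g1 := (X in sp _ X) in sg1; set g2 := (X in sp _ X) in sg2.
set L1 := fun s x => (c * (k%:R * (k.+2%:R - n%:R))) * s ^+ a * rp k.+2 s x.
set L2 := fun s x => (- (k * k.+2)%:R * c) * s ^+ a.+2 * rp k.+4 s x.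
have sL1 : sp (a%:Z - k%:Z - 2) L1 by apply: sp_mono' => _; lia.
have sL2 : sp (a%:Z - k%:Z - 2) L2 by apply: sp_mono' => _; lia.
exists (fun s x => g1 s x + g2 s x), (fun s x => L1 s x + L2 s x).
have dL1 := dsg_mono (c * (k%:R * (k.+2%:R - n%:R))) a k.+2.
have dL2 := dsg_mono (- (k * k.+2)%:R * c) a.+2 k.+4.
have dL := dsgD dL1 dL2.
have Lg1 := lapg_mono (c * a%:R) a.-1 k.
have Lg2 := lapg_mono (- k%:R * c) a.+1 k.+2.
have Lg := lapgD sg1 sg2 Lg1 Lg2.
eexists; split; [split; [exact: sp_add|exact: sp_add| |exact: dsg_mono|exact: lapg_mono]|split; [exact: dL|]].
- apply: sp_add; apply: sp_add; apply: sp_mono'.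
  + by case: (a) => [|a'] /=; rewrite ?mulr0 ?eqxx// => _; lia.
  + by move=> _; lia.
  + by move=> _ /=; lia.
  + by move=> _; lia.
- move=> s x s0; rewrite (Lg s x s0) /=.
  by case: (a) => [|a'] /=; rewrite !natrM ?exprS -!natr1; ring.
Qed.

End poisson_kernel.

Section poisson_chain.
Context {R : realType} {n : nat}.
Notation V := 'rV[R]_n.
Notation spx := {p : int * (R -> V -> R) | sp p.1 p.2}.

Lemma near_neq0 (s : R) : s != 0 -> \near s, s != 0.
Proof.
move=> s0; apply/nbhs_ballP; exists `|s| => /=; first by rewrite normr_gt0.
move=> t; rewrite -ball_normE /= => st; apply/eqP => t0.
by move: st; rewrite t0 subr0 ltxx.
Qed.

Lemma dsg_ext (g h g' h' : R -> V -> R) : (forall s x, s != 0 -> g s x = h s x) ->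
  (forall s x, s != 0 -> g' s x = h' s x) -> dsg g g' -> dsg h h'.
Proof.
move=> gh gh' H s x s0; rewrite -gh'//.
apply: near_eq_is_derive (H s x s0).
by apply: filterS (near_neq0 s0) => t t0; rewrite gh.
Qed.

Lemma dsg_unique (g a b : R -> V -> R) : dsg g a -> dsg g b -> forall s x, s != 0 -> a s x = b s x.
Proof.
move=> H1 H2 s x s0.
have E1 := @derive_val _ _ _ _ _ _ _ (H1 s x s0).
by rewrite -E1 (@derive_val _ _ _ _ _ _ _ (H2 s x s0)).
Qed.

Lemma spnext_subproof (z : spx) : exists g', sp ((sval z).1 - 1) g' /\ dsg (sval z).2 g'.
Proof.
by case: z => -[d g] /= /sp_all[g' [L [L' [[H1 _ _ H2 _] _]]]]; exists g'.
Qed.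

(** An s-derivative inside the class, obtained by choice; for s != 0 any two candidates agree by
    [dsg_unique]. *)
Definition spnext (z : spx) : spx := let H := cid (spnext_subproof z) in
  exist (fun p : int * (R -> V -> R) => sp p.1 p.2) ((sval z).1 - 1, sval H) (proj1 (svalP H)).

(** Normalises the Poisson kernel to mass one ([int_pk0]); for odd n it is also the constant of the
    principal value integral ([ChalfE]). *)
Definition cP : R := 2 / sphere_vol n.

Definition sp0 : spx := exist (fun p : int * (R -> V -> R) => sp p.1 p.2)
  (1%:Z - n.+1%:Z, fun s x => cP * s ^+ 1 * rp n.+1 s x) (sp_mono cP 1 n.+1).

Fact pk_key : unit. Proof. exact: tt. Qed.

(* The j-th derivative in s of the Poisson kernel, sealed to keep simplification from unfolding it. *)
Definition pk : nat -> R -> V -> R := locked_with pk_key (fun j => (sval (iter j spnext sp0)).2).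

Lemma pkE j : pk j = (sval (iter j spnext sp0)).2.
Proof. by rewrite /pk unlock. Qed.

Lemma pk0_mono : pk 0 = fun s x => cP * s ^+ 1 * rp n.+1 s x.
Proof. by rewrite pkE. Qed.

Lemma pk0E s x : pk 0 s x = cP * s * rp n.+1 s x.
Proof. by rewrite pkE /= expr1. Qed.

Lemma pk_sp j : sp (- (n + j)%:Z) (pk j).
Proof.
have E : (sval (iter j spnext sp0)).1 = - (n + j)%:Z.
  by elim: j => [|j IH] /=; [lia|rewrite IH; lia].
by rewrite -E pkE; exact: (svalP (iter j spnext sp0)).
Qed.

Lemma pk_ds j : dsg (pk j) (pk j.+1).
Proof. by rewrite !pkE iterS /spnext /=; case: cid => g' []. Qed.

Lemma cP_gt0 : 0 < cP.
Proof. by rewrite divr_gt0// sphere_vol_gt0. Qed.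

(** Harmonicity of the Poisson kernel in the half space. The case j = 0 is computed from the
    monomial formulas; differentiating in s propagates it, because the derivative commutes with the
    Laplacian by [sp_all]. *)
Lemma pk_lap j : lapg (pk j) (fun s x => - pk j.+2 s x).
Proof.
elim: j => [|j IH].
  have H1 := @dsg_mono R n cP 1 n.+1.
  have D0 := pk_ds 0; rewrite pk0_mono in D0; have E1 := dsg_unique D0 H1.
  have H2 := dsgD (@dsg_mono R n (cP * 1%:R) 0 n.+1) (@dsg_mono R n (- n.+1%:R * cP) 2 n.+3).
  have E2 := dsg_unique (pk_ds 1) (dsg_ext (fun s x s0 => esym (E1 s x s0)) (fun _ _ _ => erefl) H2).
  move=> s x s0; rewrite pk0_mono; transitivity (cP * (n.+1%:R * (n.+3%:R - n%:R)) * s ^+ 1 * rp n.+3 s x +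
     - (n.+1 * n.+3)%:R * cP * s ^+ 3 * rp n.+1.+4 s x); first exact: (@lapg_mono R n cP 1 n.+1 s x s0).
  by rewrite E2//= !natrM -!natr1; ring.
move=> s x s0.
have [g' [L [L' [[Hg1 _ _ Hg2 Hg3] [HL HL']]]]] := sp_all (pk_sp j).
have E1 := dsg_unique (pk_ds j) Hg2.
have -> : Lap (pk j.+1 s) x = L' s x.
  by rewrite (_ : pk j.+1 s = g' s) ?HL'//; apply/funext => y; exact: E1 s y s0.
have HL2 : dsg (fun s x => - pk j.+2 s x) L'.
  by apply: dsg_ext HL => // t y t0; rewrite -Hg3// IH.
have H3 : dsg (fun s x => - pk j.+2 s x) (fun s x => - pk j.+3 s x).
  move=> t y t0; apply: (der_eq (derZ (-1) (pk_ds j.+2 y t0))) => [u|]; by rewrite mulN1r.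
exact: (dsg_unique HL2 H3).
Qed.

Lemma pk_CN N j s : s != 0 -> CN N (pk j s).
Proof. by move=> s0; exact: sp_CN (pk_sp j). Qed.

Lemma Lap_Z c (f : V -> R) : CN 2 f -> Lap (fun x => c * f x) = fun x => c * Lap f x.
Proof.
move=> Hf; apply/funext => x; rewrite /Lap mulr_sumr; apply: eq_bigr => i _.
rewrite (partial_dpar (dparZ c (CN_dpar i Hf))).
by rewrite (partial_dpar (dparZ c (CN_dpar i (CN_partial i Hf)))).
Qed.

Lemma iter_Lap_Z m c (f : V -> R) : CN m.*2 f ->
  iter m Lap (fun x => c * f x) = fun x => c * iter m Lap f x.
Proof.
elim: m => [//|m IH] Hf; rewrite !iterS IH; last by apply: CN_le Hf; rewrite doubleS -addn2 leq_addr.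
by apply: Lap_Z; apply: CN_iter_Lap; rewrite add2n -doubleS.
Qed.

Lemma pk_iter_Lap m j s : s != 0 -> iter m Lap (pk j s) = fun x => (-1) ^+ m * pk (j + m.*2) s x.
Proof.
move=> s0; elim: m => [|m IH]; first by apply/funext => x; rewrite addn0 expr0 mul1r.
rewrite iterS IH Lap_Z; last exact: pk_CN.
apply/funext => x; rewrite pk_lap// doubleS !addnS exprS; ring.
Qed.

Lemma pk_bound j : exists2 C : R, 0 <= C & forall s x, 0 < s ->
  `|pk j s x| <= C * (rho s x ^+ (n + j))^-1.
Proof.
have [C C0 HC] := Sy_bound rho_pos_gt0 (sp_Sy 0 (pk_sp j)).
by exists C => // s x s0; rewrite exprnN; exact: HC.
Qed.

(** The gain on which all the testing rests: k differences lower the order by k. [M] bounds the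
    weight on the whole segment swept by the differences, and the constants of the n directions are
    added up to obtain one for all of them. *)
Lemma fdiff_Sy_bound k d g : Sy pos rho k d g -> exists2 C : R, 0 <= C &
  forall s (i : 'I_n) (h : R) x M, 0 < s ->
  (forall t : R, `|t| <= k%:R * `|h| -> rho s (x + t *: ebasis i) ^ (d - k%:Z) <= M) ->
  `|iter k (fdiff (h *: ebasis i)) (g s) x| <= C * `|h| ^+ k * M.
Proof.
move=> S0.
have H (i : 'I_n) : exists2 G : nat -> R -> V -> R, G 0%N = g &
   (forall m, (m < k)%N -> forall t, pos t -> dpar i (G m t) (G m.+1 t)) /\
   Sy pos rho 0 (d - k%:Z) (G k).
  elim: k d g S0 => [|k IH] d g Hg.
    by exists (fun _ => g) => //; split => //; rewrite subr0.
  have [_ _ /(_ i)[g' Dg Sg]] := Hg.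
  have [G G0 [HG SG]] := IH _ _ Sg.
  exists (fun m => if m is m'.+1 then G m' else g) => //; split.
    by move=> [_ t tk|m mk t tk]; [rewrite G0; exact: Dg|exact: HG].
  by rewrite (_ : d - k.+1%:Z = d - 1 - k%:Z)//; lia.
have HC (i : 'I_n) : exists C : R, 0 <= C /\ forall s (h : R) x M, 0 < s ->
  (forall t : R, `|t| <= k%:R * `|h| -> rho s (x + t *: ebasis i) ^ (d - k%:Z) <= M) ->
  `|iter k (fdiff (h *: ebasis i)) (g s) x| <= C * `|h| ^+ k * M.
  have [G G0 [HG /(Sy_bound rho_pos_gt0)[C C0 SG]]] := H i.
  exists C; split => // s h x M s0 HM.
  rewrite -mulrA mulrCA; rewrite -G0.
  apply: (fdiff_bound (G := fun m => G m s)) => [m mk|t tk]; first exact: HG.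
  by rewrite (le_trans (SG _ _ s0))// ler_wpM2l// HM.
have [C CH] := choice HC.
exists (\sum_i C i); first by apply: sumr_ge0 => i _; case: (CH i).
move=> s i h x M s0 HM; have [_ /(_ s h x M s0 HM)/le_trans] := CH i; apply.
have M0 : 0 <= M.
  apply: le_trans (HM 0 _); first by rewrite exprz_ge0// sqrtr_ge0.
  by rewrite normr0 mulr_ge0.
rewrite ler_wpM2r// ler_wpM2r ?exprn_ge0// (bigD1 i)//= lerDl sumr_ge0// => l _.
by case: (CH l).
Qed.

Lemma fdiff_pk_bound j k : exists2 C : R, 0 <= C & forall s (i : 'I_n) (h : R) x M, 0 < s ->
  (forall t : R, `|t| <= k%:R * `|h| -> (rho s (x + t *: ebasis i) ^+ (n + j + k))^-1 <= M) ->
  `|iter k (fdiff (h *: ebasis i)) (pk j s) x| <= C * `|h| ^+ k * M.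
Proof.
have [C C0 HC] := fdiff_Sy_bound (sp_Sy k (pk_sp j)).
exists C => // s i h x M s0 HM; apply: HC => // t tk.
by rewrite (_ : - (n + j)%:Z - k%:Z = - (n + j + k)%:Z) -?exprnN ?HM//; lia.
Qed.

Lemma int_pk0 s : 0 < s -> ibl (@vmeas R n) (pk 0 s) /\ Ig (@vmeas R n) (pk 0 s) = 1.
Proof.
move=> s0; have sN : s != 0 by rewrite gt_eqF.
have H := ibl_poisson (n := n) sN.
have E : pk 0 s = fun x => (cP * s) * (rho s x ^+ n.+1)^-1.
  by apply/funext => x; rewrite pk0E.
rewrite E; split; first exact: iblZ.
rewrite IgZ//; apply: EFin_inj; rewrite EFinM -ibl_EFin// int_poisson// -EFinM; congr EFin.
rewrite gtr0_norm// /cP; have /lt0r_neq0 := @sphere_vol_gt0 R n.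
by move: (sphere_vol n) => q q0; field; rewrite q0 sN.
Qed.

Lemma pk_even j s x : s != 0 -> pk j s (- x) = pk j s x.
Proof.
move=> s0; have : sp (- (n + j)%:Z) (pk j) by exact: pk_sp.
have rE k : rp k s (- x) = rp k s x by rewrite /rp !rhoE enormN.
by elim=> [c a k|d|d f g _ Hf _ Hg]; rewrite ?rE ?Hf ?Hg.
Qed.

End poisson_chain.

(** * Cutoff functions *)

Section cutoffs.
Context {R : realType} {n : nat}.
Notation V := 'rV[R]_n.

(** A power of the positive part, with K - 1 continuous derivatives for K > 0: compactly supported
    test functions of any finite order come from algebra alone. *)
Definition qpos (K : nat) (t : R) : R := Num.max t 0 ^+ K.

Lemma is_derive_qpos K (t : R) : is_derive t 1 (qpos K.+2) (K.+2%:R * qpos K.+1 t).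
Proof.
have [t0|t0|->] := ltgtP t 0.
- have H : \near t, (fun _ => 0) t = qpos K.+2 t.
    near=> s; rewrite /qpos max_r ?expr0n//.
    by apply: ltW; near: s; exact: lt_nbhsl.
  apply: near_eq_is_derive H _; rewrite /qpos max_r ?(ltW t0)// expr0n mulr0; exact: derC.
- have H : \near t, (fun s => s ^+ K.+2) t = qpos K.+2 t.
    near=> s; rewrite /qpos max_l//.
    by apply: ltW; near: s; exact: lt_nbhsr.
  apply: near_eq_is_derive H _; rewrite /qpos max_l ?(ltW t0)//.
  by apply: (der_eq (derX K.+2 (is_derive_id t (1:R)))) => //; rewrite mulr1.
- rewrite /qpos maxxx expr0n mulr0; apply/is_derive1_caratheodory.
  exists (fun s => Num.max s 0 ^+ K.+1); split.
  + move=> s; rewrite !subr0 maxxx expr0n subr0.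
    have [s0|s0] := leP s 0; last by rewrite exprSr.
    by rewrite !expr0n mul0r.
  + move=> e; apply: (@continuous_comp _ _ _ (fun s : R => Num.max s 0) (fun s => s ^+ K.+1)).
      by apply: continuous_max; [exact: cvg_id|exact: cvg_cst].
    exact: exprn_continuous.
  + by rewrite maxxx expr0n.
Unshelve. all: by end_near. Qed.

Lemma qpos_ge0 K t : 0 <= qpos K t.
Proof. by rewrite exprn_ge0// le_max lexx orbT. Qed.

Lemma qpos_le1 K t : t <= 1 -> qpos K t <= 1.
Proof. by move=> t1; rewrite exprn_ile1// ?le_max ?lexx ?orbT// ge_max t1 ler01. Qed.

Lemma qpos_continuous K : continuous (qpos K).
Proof.
move=> t; apply: (@continuous_comp _ _ _ (fun s : R => Num.max s 0) (fun s => s ^+ K)).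
  by apply: continuous_max; [exact: cvg_id|exact: cvg_cst].
exact: exprn_continuous.
Qed.

Definition sqn (x : V) : R := \sum_(i < n) x ord0 i ^+ 2.

Lemma dpar_sqn i : dpar i sqn (fun x => 2 * x ord0 i).
Proof.
move=> x; apply: (der_eq (dpar_sum (index_enum _) (fun j => (fun y => derX 2 (dpar_coord i j y))) x)) => //.
rewrite (bigD1 i)//= big1 => [|j ji]; first by rewrite eqxx expr1 mulr1 addr0.
by rewrite eq_sym (negbTE ji) mulr0.
Qed.

Definition W (x : V) : R := 1 + enorm x.
Lemma W_gt0 x : 0 < W x. Proof. by rewrite ltr_wpDr// enorm_ge0. Qed.
Lemma W_ge1 x : 1 <= W x. Proof. by rewrite lerDl enorm_ge0. Qed.

Definition cutoff (K : nat) (r : R) (x : V) : R := qpos K (1 - sqn x / r ^+ 2).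

Lemma dpar_cut K r i : dpar i (cutoff K.+2 r) (fun x => (- 2 * K.+2%:R) * x ord0 i * (r ^- 2 * cutoff K.+1 r x)).
Proof.
move=> x; apply: is_derive_of_line.
have H0 : dpar i (fun x => 1 - sqn x / r ^+ 2) (fun x => - (2 * x ord0 i / r ^+ 2)).
  move=> y; apply: (der_eq (derB (derC y (ebasis i) 1) (derM (dpar_sqn i y) (derC y (ebasis i) (r ^+ 2)^-1)))) => //.
  by rewrite mulr0 addr0 sub0r.
have H1 := @is_derive_line _ _ _ x (ebasis i) 0 _ (H0 _).
apply: (der_eq (der1_comp H1 (is_derive_qpos K _))) => //.
by rewrite scale0r addr0 /cutoff; ring.
Qed.

Lemma cut_supp K r x : 0 < r -> r <= enorm x -> cutoff K.+1 r x = 0.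
Proof.
move=> r0 xr; rewrite /cutoff /qpos max_r ?expr0n// subr_le0 ler_pdivlMr ?exprn_gt0// mul1r.
by rewrite /sqn -sqr_enorm ler_pXn2r ?nnegrE ?(ltW r0)// enorm_ge0.
Qed.

Lemma cut_ge0 K r x : 0 <= cutoff K r x. Proof. exact: qpos_ge0. Qed.
Lemma sqn_ge0 x : 0 <= sqn x. Proof. by apply: sumr_ge0 => i _; exact: sqr_ge0. Qed.
Lemma cut_le1 K r x : cutoff K r x <= 1.
Proof. by apply: qpos_le1; rewrite lerBlDr lerDl mulr_ge0 ?sqn_ge0// invr_ge0 exprn_even_ge0. Qed.

Lemma cut_continuous K r : continuous (cutoff K r).
Proof.
move=> x; apply: (@continuous_comp _ _ _ (fun x : V => 1 - sqn x / r ^+ 2) (qpos K)).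
  have : continuous (fun x : V => 1 - sqn x / r ^+ 2).
    apply: (@continuous_of_dpar _ _ _ (fun i x => - (2 * x ord0 i / r ^+ 2))) => [i y|y].
      apply: (der_eq (derB (derC y (ebasis i) 1) (derM (dpar_sqn i y) (derC y (ebasis i) (r ^+ 2)^-1)))) => //.
      by rewrite mulr0 addr0 sub0r.
    exists (2 * (enorm y + 1) / r ^+ 2) => i z zy.
    rewrite normrN normrM normfV [X in _ / X]ger0_norm ?sqr_ge0// ler_wpM2r ?invr_ge0 ?sqr_ge0//.
    rewrite normrM ger0_norm// ler_wpM2l//; apply: le_trans (coord_le_enorm _ _) _.
    by rewrite -lerBlDl (le_trans (enormB_ge _ _)).
  exact.
exact: qpos_continuous.
Qed.

Definition ge1 (r : R) : Prop := 1 <= r.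
Local Notation SyW := (@Sy R n R ge1 (fun _ => W)).
Let W0 (t : R) (x : V) : ge1 t -> 0 < W x. Proof. by move=> _; exact: W_gt0. Qed.

Lemma Sy_coordW N i : SyW N 1 (fun _ x => x ord0 i).
Proof. by apply: Sy_coordinate => t x _; rewrite (le_trans (coord_le_enorm x i))// lerDr. Qed.

(** On the support |x| < r, so that 1/r <= 2/(1 + |x|): negative powers of r count as decay,
    uniformly in r >= 1. Each derivative brings out x_i / r^2 and one less power in the cutoff,
    whence N < K. *)
Lemma Sy_cutB N K a : (N < K)%N -> SyW N (- a%:Z) (fun r x => r ^- a * cutoff K.+1 r x).
Proof.
have Hb K' a' : exists C : R, forall r x, ge1 r -> `|r ^- a' * cutoff K'.+1 r x| <= C * W x ^ (- a'%:Z).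
  exists (2 ^+ a') => r x r1; have r0 : 0 < r by exact: lt_le_trans r1.
  rewrite ger0_norm ?mulr_ge0 ?cut_ge0 ?invr_ge0 ?exprn_ge0 ?(ltW r0)//.
  have [xr|xr] := leP r (enorm x).
    by rewrite cut_supp// mulr0 mulr_ge0// exprz_ge0// ltW// W_gt0.
  apply: (@le_trans _ _ (r ^- a')); first by rewrite ler_piMr ?cut_le1// invr_ge0 exprn_ge0 ?(ltW r0).
  rewrite -exprnN ler_pdivlMr ?exprn_gt0 ?W_gt0// -[r ^- a']exprVn -exprMn.
  apply: lerXn2r; rewrite ?nnegrE ?mulr_ge0 ?invr_ge0 ?(ltW r0) ?(ltW (W_gt0 _))//.
  by rewrite mulrC ler_pdivrMr// /W; move: r1; rewrite /ge1; lra.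
have Hc K' a' (r : R) : ge1 r -> continuous (fun x => r ^- a' * cutoff K'.+1 r x).
  by move=> _ x; apply: (@continuousM _ _ (fun _ => r ^- a') (cutoff K'.+1 r)); [exact: cst_continuous|exact: cut_continuous].
elim: N K a => [|N IH] K a NK; (split; [exact: Hb|exact: Hc|]) => // i.
case: K NK => // K NK.
exists (fun (r : R) (x : V) => (- 2 * K.+2%:R) * x ord0 i * (r ^- a.+2 * cutoff K.+1 r x)).
  move=> r r1 x; have r0 : r != 0 by rewrite gt_eqF// (lt_le_trans _ r1).
  apply: (der_eq (derZ (r ^- a) (dpar_cut K r i x))) => //.
  rewrite !exprS; have : r ^+ a != 0 by rewrite expf_neq0.
  by move: (r ^+ a) => q q0; field; rewrite r0 q0.
have Sc := Sy_coordW N i.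
have := Sy_M W0 (Sy_Z W0 (- 2 * K.+2%:R) Sc) (IH K a.+2 NK).
by rewrite (_ : 1 + - a.+2%:Z = - a%:Z - 1)//; lia.
Qed.

(** For r >= 1 this cutoff equals 1 only at the origin, so removing it costs something everywhere.
    What makes it usable is that the defect is O(|x| / r) together with its derivatives: one order
    of decay is exchanged for a factor 1/r. *)
Lemma Sy_1cut N K : (N < K)%N -> SyW N 1 (fun r x => r * (1 - cutoff K.+2 r x)).
Proof.
move=> NK.
have Hb : exists C : R, forall r x, ge1 r -> `|r * (1 - cutoff K.+2 r x)| <= C * W x ^ (1 : int).
  exists K.+2%:R => r x r1; have r0 : 0 < r by exact: lt_le_trans r1.
  have c1 := cut_le1 K.+2 r x; have c0 := cut_ge0 K.+2 r x.
  rewrite expr1z ger0_norm ?mulr_ge0 ?(ltW r0) ?subr_ge0//.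
  have [xr|xr] := leP r (enorm x).
    apply: (@le_trans _ _ (1 * (enorm x + 1))).
      rewrite mul1r -[leRHS]mulr1 ler_pM ?(ltW r0) ?subr_ge0//; first by rewrite ler_wpDr.
      by rewrite lerBlDr lerDl.
    by rewrite addrC ler_wpM2r ?(ltW (W_gt0 _))// ler1n.
  have z0 : 0 <= enorm x / r by rewrite divr_ge0 ?enorm_ge0// ltW.
  have z1 : enorm x / r <= 1 by rewrite ler_pdivrMr// mul1r ltW.
  have zE : sqn x / r ^+ 2 = (enorm x / r) ^+ 2.
    by rewrite /sqn -sqr_enorm exprMn exprVn.
  (* Bernoulli's inequality (1 - y)^m >= 1 - m y at y = (|x|/r)^2, and y <= |x|/r since |x| < r
     here. *)
  have B : 1 - K.+2%:R * (enorm x / r) <= cutoff K.+2 r x.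
    rewrite /cutoff /qpos zE max_l; last by rewrite subr_ge0 exprn_ile1.
    have z2 : (enorm x / r) ^+ 2 <= enorm x / r by rewrite expr2 ler_piMl.
    have y0 : 0 <= (enorm x / r) ^+ 2 <= 1 by rewrite sqr_ge0 (le_trans z2).
    apply: (@le_trans _ _ (1 - K.+2%:R * (enorm x / r) ^+ 2)).
      by rewrite lerB// ler_wpM2l.
    move: y0; move: ((enorm x / r) ^+ 2) => y /andP[y0 y1].
    elim: K.+2 => [|m IHm]; first by rewrite mul0r subr0 expr0.
    rewrite exprS; apply: (@le_trans _ _ ((1 - y) * (1 - m%:R * y))).
      have m0 : 0 <= m%:R :> R by []; rewrite -natr1; nra.
    by rewrite ler_wpM2l// subr_ge0.
  apply: (@le_trans _ _ (r * (K.+2%:R * (enorm x / r)))).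
    by rewrite ler_wpM2l ?(ltW r0)//; move: B; lra.
  rewrite mulrCA [enorm x / r]mulrC mulVKf ?gt_eqF// ler_wpM2l// /W lerDr//.
have Hc (r : R) : ge1 r -> continuous (fun x => r * (1 - cutoff K.+2 r x)).
  move=> _ x; apply: (@continuousM _ _ (fun _ => r) (fun x => 1 - cutoff K.+2 r x)); first exact: cst_continuous.
  by apply: continuousB; [exact: cst_continuous|exact: cut_continuous].
case: N NK => [|N] NK; (split; [exact: Hb|exact: Hc|]) => // i.
exists (fun (r : R) (x : V) => (2 * K.+2%:R) * x ord0 i * (r ^- 1 * cutoff K.+1 r x)).
  move=> r r1 x; have r0 : r != 0 by rewrite gt_eqF// (lt_le_trans _ r1).
  apply: (der_eq (derZ r (derB (derC x (ebasis i) 1) (dpar_cut K r i x)))) => //.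
  by rewrite expr1; field.
have Sc := Sy_coordW N i.
exact: (Sy_M W0 (Sy_Z W0 (2 * K.+2%:R) Sc) (Sy_cutB 1 (ltnW NK))).
Qed.

Lemma cut_CN N K r : 1 <= r -> (N < K)%N -> CN N (cutoff K.+1 r).
Proof.
move=> r1 NK; have := Sy_CN (Sy_cutB 0 NK) r1.
by congr (CN _ _); apply/funext => x; rewrite expr0 invr1 mul1r.
Qed.

End cutoffs.

(** * Integration by parts and polynomial growth *)

Section integration_by_parts.
Context {R : realType} {n : nat}.
Notation V := 'rV[R]_n.
Notation mu := (@vmeas R n).
Notation I := (Ig mu).

Lemma Ig_derive d (T : measurableType d) (m : {measure set T -> \bar R})
    (f f' : R -> T -> R) (G : T -> R) (a u v : R) : u < a < v ->
  (forall t, u < t < v -> ibl m (f t)) ->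
  (forall t y, u < t < v -> is_derive t 1 (f ^~ y) (f' t y)) ->
  (forall t y, u < t < v -> `|f' t y| <= G y) -> ibl m G ->
  is_derive a 1 (fun t => Ig m (f t)) (Ig m (f' a)).
Proof.
move=> auv fi df fG Gi.
have E t y : u < t < v -> partial1of2 f t y = f' t y.
  by move=> tuv; rewrite partial1of2E; exact: (@derive_val _ _ _ _ _ _ _ (df t y tuv)).
have G0 y : 0 <= G y by apply: le_trans (fG a y auv).
have [H1 H2] : derivable (fun t => Ig m (f t)) a 1 /\
   derive1 (fun t => Ig m (f t)) a = Ig m (fun y => partial1of2 f a y).
  have P1 x : `]u, v[%classic x -> m.-integrable setT (EFin \o f x).
    by rewrite /= in_itv /= => H; have := fi x H.
  have P2 x y : `]u, v[%classic x -> setT y -> derivable (f ^~ y) x 1.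
    by rewrite /= in_itv /= => H _; case: (df x y H).
  have P3 x y : `]u, v[%classic x -> setT y -> `|partial1of2 f x y| <= G y.
    by rewrite /= in_itv /= => H _; rewrite E//; exact: fG.
  have Pa : `]u, v[%classic a by rewrite /= in_itv.
  split; first exact: (derivable_under_integral measurableT Pa P1 P2 G0 Gi P3).
  exact: (differentiation_under_integral measurableT Pa P1 P2 G0 Gi P3).
apply: DeriveDef => //; rewrite -derive1E H2.
by apply: eq_Ig => y; rewrite E.
Qed.

(** Difference quotients of an integrable function have integral zero by translation invariance, and
    they converge to the derivative. The bound along segments of length one is the majorant; no
    compact support is involved. *)
Lemma Ig_partial0 i (f f' g : V -> R) : dpar i f f' -> ibl mu f -> ibl mu g ->
  (forall x (h : R), `|h| <= 1 -> `|f' (x + h *: ebasis i)| <= g x) -> I f' = 0.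
Proof.
move=> H fi gi Hg.
pose h j : R := j.+1%:R^-1.
have h0 j : 0 < h j by rewrite invr_gt0.
have h1 j : h j <= 1 by rewrite invf_le1// ler1n.
pose q j x := (h j)^-1 * (f (x + h j *: ebasis i) - f x).
have qi j : ibl mu (q j) by apply/iblZ/iblB => //; exact: ibl_shift.
have q0 j : I (q j) = 0.
  by rewrite IgZ ?IgB ?Ig_shift ?subrr ?mulr0//; [exact: ibl_shift|apply: iblB => //; exact: ibl_shift].
have [||||_] := @Ig_dct _ _ _ mu q f' g.
- by move=> j; exact: ibl_meas (qi j).
- exact: gi.
- move=> j x; have [c /andP[c0 c1] E] := mvt_dpar x (h j) H.
  rewrite /q E mulKf ?gt_eqF//; apply: Hg.
  by rewrite ger0_norm ?mulr_ge0 ?(ltW (h0 j))// mulr_ile1// ltW.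
- move=> x; have [D <-] := H x.
  have : h @ \oo --> (0:R)^'.
    move=> A hA; have B : \forall j \near \oo, h j != 0 -> A (h j) := @cvg_harmonic R _ hA.
    by apply: filterS B => j; apply; rewrite gt_eqF.
  move=> hc; have := cvg_comp _ _ hc D.
  apply: cvg_trans; apply: near_eq_cvg; apply: nearW => j.
  by rewrite /q /= [x + _]addrC.
move=> L; apply: (cvg_unique _ L) => //.
rewrite (_ : (fun _ => _) = fun _ => 0); first exact: cvg_cst.
by apply/funext => j; rewrite q0.
Qed.

Definition cpt (f : V -> R) := exists r : R, forall x, r <= enorm x -> f x = 0.

Lemma cpt_partial i f : cpt f -> cpt (partial i f).
Proof.
move=> [r H]; exists (r + 1) => x xr.
have N : \near x, (fun _ => 0) x = f x.
  apply/nbhs_ballP; exists (n%:R + 1)^-1 => /=; first by rewrite invr_gt0 ltr_wpDl.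
  move=> y; rewrite -ball_normE /= => xy; rewrite H//.
  have h1 : enorm (x - y) < 1.
    apply: le_lt_trans (enorm_le_norm _) _.
    apply: (@le_lt_trans _ _ ((n%:R + 1) * `|x - y|)); first by rewrite ler_wpM2r// lerDl.
    by rewrite mulrC -ltr_pdivlMr ?ltr_wpDl// div1r.
  by have := enormB_ge x y; move: h1 xr; lra.
have D := near_eq_is_derive N (derC x (ebasis i) 0).
exact: (@derive_val _ _ _ _ _ _ _ D).
Qed.

Lemma cpt_ibl f : continuous f -> cpt f -> ibl mu f.
Proof.
move=> cf [r H]; have [C C0 HC] := continuous_bounded cf r.
apply: (@ibl_bounded_ball R n f 0 r C); first exact: continuous_measurable.
- by move=> x; rewrite subr0 => /ltW; exact: HC.
- by move=> x; rewrite subr0; exact: H.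
Qed.

Lemma cptM f g : cpt g -> cpt (fun x => f x * g x).
Proof. by move=> [r H]; exists r => x xr; rewrite H// mulr0. Qed.

Lemma Ig_partial_cpt i f : CN 1 f -> cpt f -> I (partial i f) = 0.
Proof.
move=> Hf cf; have cf' := cpt_partial i cf.
have [r Hr] := cf'.
have [C C0 HC] := continuous_bounded (CN_continuous (CN_partial i Hf)) r.
apply: (@Ig_partial0 i f _ (fun x => C * ball_ind 0 (r + 1) x) (CN_dpar i Hf)).
- exact: cpt_ibl (CN_continuous Hf) cf.
- exact/iblZ/ibl_ball_ind.
- move=> x h h1; rewrite /ball_ind subr0; case: ltP => xr /=; rewrite ?mulr1 ?mulr0.
    have [yr|yr] := leP r (enorm (x + h *: ebasis i)); last exact/HC/ltW.
    by rewrite Hr// normr0 ltW.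
  rewrite Hr ?normr0//.
  have := enorm_triangleB x (x + h *: ebasis i) 0; rewrite !subr0 opprD addNKr enormN enormZ enorm_ebasis mulr1.
  by move: xr h1; lra.
Qed.

Lemma ibp_cpt i w f : CN 1 w -> CN 1 f -> cpt f ->
  I (fun x => partial i w x * f x) = - I (fun x => w x * partial i f x).
Proof.
move=> Hw Hf cf; have H := dparM (CN_dpar i Hw) (CN_dpar i Hf).
have := @Ig_partial_cpt i (fun x => w x * f x) (CN_M Hw Hf) (cptM w cf).
rewrite (partial_dpar H) IgD; first by move/eqP; rewrite addr_eq0 => /eqP.
- apply: cpt_ibl; last exact: cptM.
  by move=> x; apply: (@continuousM _ _ (partial i w) f); [exact: CN_continuous (CN_partial i Hw) x|exact: CN_continuous Hf x].
- apply: cpt_ibl; last exact/cptM/cpt_partial.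
  by move=> x; apply: (@continuousM _ _ w (partial i f)); [exact: CN_continuous Hw x|exact: CN_continuous (CN_partial i Hf) x].
Qed.

Lemma cpt_ibl_mul (w f : V -> R) : continuous w -> continuous f -> cpt f -> ibl mu (fun x => w x * f x).
Proof.
move=> cw cf kf; apply: cpt_ibl; last exact: cptM.
by move=> x; apply: (@continuousM _ _ w f); [exact: cw|exact: cf].
Qed.

Lemma cpt_Lap f : cpt f -> cpt (Lap f).
Proof.
move=> cf; have /choice[r Hr] : forall i : 'I_n, cpt (partial i (partial i f)).
  by move=> i; exact/cpt_partial/cpt_partial.
exists (\sum_i `|r i|) => x xr; rewrite /Lap big1// => i _; apply: Hr.
apply: le_trans xr; apply: le_trans (ler_norm _) _.
by rewrite (bigD1 i)//= lerDl sumr_ge0.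
Qed.

Lemma green w f : CN 2 w -> CN 2 f -> cpt f ->
  I (fun x => Lap w x * f x) = I (fun x => w x * Lap f x).
Proof.
move=> Hw Hf cf.
have -> : I (fun x => Lap w x * f x) = I (fun x => \sum_i (partial i (partial i w) x * f x)).
  by apply: eq_Ig => x; rewrite mulr_suml.
have -> : I (fun x => w x * Lap f x) = I (fun x => \sum_i (w x * partial i (partial i f) x)).
  by apply: eq_Ig => x; rewrite mulr_sumr.
rewrite !Ig_sum.
- apply: eq_bigr => i _.
  rewrite ibp_cpt//; [|exact: CN_partial|exact: CNS].
  rewrite (@ibp_cpt i w (partial i f)); [by rewrite opprK|exact: CNS|exact: CN_partial|exact: cpt_partial].
- move=> i; apply: cpt_ibl_mul; [exact: CN_continuous Hw| |exact/cpt_partial/cpt_partial].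
  exact: CN_continuous (CN_partial i (CN_partial i Hf)).
- move=> i; apply: cpt_ibl_mul => //; last exact: CN_continuous Hf.
  exact: CN_continuous (CN_partial i (CN_partial i Hw)).
Qed.

Lemma green_iter m w f : CN m.*2 w -> CN m.*2 f -> cpt f ->
  I (fun x => iter m Lap w x * f x) = I (fun x => w x * iter m Lap f x).
Proof.
elim: m f => [//|m IH] f Hw Hf cf.
have H2 (g : V -> R) : CN m.+1.*2 g -> CN 2 (iter m Lap g) by move=> Hg; apply: CN_iter_Lap; rewrite add2n -doubleS.
have Hf2 : CN 2 f by apply: CN_le Hf; rewrite doubleS.
have HL : CN m.*2 (Lap f) by apply: CN_Lap; rewrite -doubleS.
have Hw' : CN m.*2 w by apply: CN_le Hw; rewrite doubleS -addn2 leq_addr.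
transitivity (I (fun x => iter m Lap w x * Lap f x)); first exact: (green (H2 _ Hw) Hf2 cf).
transitivity (I (fun x => w x * iter m Lap (Lap f) x)); first exact: (IH (Lap f) Hw' HL (cpt_Lap cf)).
by apply: eq_Ig => x; rewrite -iterSr.
Qed.

End integration_by_parts.

Section growth.
Context {R : realType} {n : nat}.
Notation V := 'rV[R]_n.
Notation mu := (@vmeas R n).
Notation I := (Ig mu).

(** This is (r^2 - |x|^2)_+^k, left without normalisation: both d/dr and the Laplacian then stay in
    the family, with coefficients polynomial in r and x. *)
Definition En (k : nat) (r : R) (x : V) : R := qpos k (r ^+ 2 - sqn x).

Lemma En_supp k r x : 0 < r -> r <= enorm x -> En k.+1 r x = 0.
Proof.
move=> r0 xr; rewrite /En /qpos max_r ?expr0n// subr_le0.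
by rewrite /sqn -sqr_enorm ler_pXn2r ?nnegrE ?(ltW r0)// enorm_ge0.
Qed.

Lemma En_ge0 k r x : 0 <= En k r x. Proof. exact: qpos_ge0. Qed.

Lemma En_le k r x : 0 <= r -> En k r x <= r ^+ (2 * k).
Proof.
move=> r0; rewrite exprM; apply: lerXn2r; rewrite ?nnegrE ?le_max ?lexx ?orbT// ?sqr_ge0//.
by rewrite ge_max sqr_ge0 andbT lerBlDr lerDl sqn_ge0.
Qed.

Lemma dpar_En k r i : dpar i (En k.+2 r) (fun x => (- 2 * k.+2%:R) * x ord0 i * En k.+1 r x).
Proof.
move=> x; apply: is_derive_of_line.
have H0 : dpar i (fun x => r ^+ 2 - sqn x) (fun x => - (2 * x ord0 i)).
  by move=> y; apply: (der_eq (derB (derC y (ebasis i) (r ^+ 2)) (dpar_sqn i y))) => //; rewrite sub0r.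
have H1 := @is_derive_line _ _ _ x (ebasis i) 0 _ (H0 _).
apply: (der_eq (der1_comp H1 (is_derive_qpos k _))) => //.
by rewrite scale0r addr0 /En; ring.
Qed.

Lemma En_continuous k r : continuous (En k r).
Proof.
move=> x; apply: (@continuous_comp _ _ _ (fun x : V => r ^+ 2 - sqn x) (qpos k)).
  have : continuous (fun x : V => r ^+ 2 - sqn x).
    apply: (@continuous_of_dpar _ _ _ (fun i x => - (2 * x ord0 i))) => [i y|y].
      by apply: (der_eq (derB (derC y (ebasis i) (r ^+ 2)) (dpar_sqn i y))) => //; rewrite sub0r.
    exists (2 * (enorm y + 1)) => i z zy.
    rewrite normrN normrM ger0_norm// ler_wpM2l//; apply: le_trans (coord_le_enorm _ _) _.
    by rewrite -lerBlDl (le_trans (enormB_ge _ _)).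
  exact.
exact: qpos_continuous.
Qed.

Lemma En_CN N k r : (N < k)%N -> CN N (En k r).
Proof.
elim: N k => [|N IH] k Nk; (split; first exact: En_continuous) => // i.
case: k Nk => [//|[//|k]] Nk; have H := dpar_En k r i.
split; first exact: dpar_derivable H.
rewrite (partial_dpar H); apply: CN_M; last exact: IH.
apply: CN_M; first exact: CN_C.
elim: N {IH Nk} => [|N IH]; (split; first exact: coord_continuous) => // j.
have H' := @dpar_coord R n j i; split; first exact: dpar_derivable H'.
by rewrite (partial_dpar H'); exact: CN_C.
Qed.

Lemma Lap_En r x : Lap (En 4 r) x = 48 * r ^+ 2 * En 2 r x - (8 * n%:R + 48) * En 3 r x.
Proof.
have E i : partial i (partial i (En 4 r)) x = - 8 * En 3 r x + 48 * (x ord0 i ^+ 2 * En 2 r x).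
  rewrite (partial_dpar (dpar_En 2 r i)).
  have H := dparM (dparZ (- 2 * 4%:R) (dpar_coord i i)) (dpar_En 1 r i).
  by rewrite (partial_dpar H) eqxx /=; ring.
rewrite /Lap; under eq_bigr do rewrite E.
rewrite big_split /= sumr_const card_ord -mulr_sumr -mulr_suml -/(sqn x).
have -> : sqn x * En 2 r x = r ^+ 2 * En 2 r x - En 3 r x.
  rewrite /En /qpos; set t := r ^+ 2 - sqn x.
  have -> : sqn x = r ^+ 2 - t by rewrite /t; ring.
  by have [t0|t0] := lerP 0 t; [|rewrite !expr0n /=]; ring.
by rewrite -mulr_natr; ring.
Qed.

Lemma is_derive_En k (r : R) (x : V) : is_derive r 1 (fun r => En k.+2 r x) (2 * k.+2%:R * (r * En k.+1 r x)).
Proof.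
have H0 : is_derive r 1 (fun r => r ^+ 2 - sqn x) (2 * r).
  apply: (der_eq (derB (derX 2 (is_derive_id r (1:R))) (derC r 1 (sqn x)))) => //.
  by rewrite expr1; ring.
apply: (der_eq (der1_comp H0 (is_derive_qpos k _))) => //.
by rewrite /En; ring.
Qed.

Lemma cpt_En k r : 0 < r -> cpt (En k.+1 r).
Proof. by move=> r0; exists r => x; exact: En_supp. Qed.

Lemma ibl_mul_En (w : V -> R) k (r : R) : continuous w -> 0 < r -> ibl mu (fun x => w x * En k.+1 r x).
Proof. by move=> cw r0; apply: cpt_ibl_mul => //; [exact: En_continuous|exact: cpt_En]. Qed.

Lemma is_derive_Mn (w : V -> R) k (r : R) : continuous w -> 0 < r ->
  is_derive r 1 (fun r => I (fun x => w x * En k.+2 r x))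
    (2 * k.+2%:R * (r * I (fun x => w x * En k.+1 r x))).
Proof.
move=> cw r0; have [C C0 HC] := continuous_bounded cw (r + 1).
have -> : 2 * k.+2%:R * (r * I (fun x => w x * En k.+1 r x)) =
   I (fun x => (2 * k.+2%:R * r) * (w x * En k.+1 r x)).
  by rewrite IgZ ?mulrA//; exact: ibl_mul_En.
apply: (@Ig_derive R _ _ mu (fun r x => w x * En k.+2 r x)
   (fun r x => (2 * k.+2%:R * r) * (w x * En k.+1 r x))
   (fun x => (C * (2 * k.+2%:R * (r + 1) * (r + 1) ^+ (2 * k.+1))) * ball_ind 0 (r + 1) x) r 0 (r + 1)).
- by rewrite r0 /= ltrDl.
- by move=> t /andP[t0 _]; exact: ibl_mul_En.
- move=> t y _; apply: (der_eq (derZ (w y) (is_derive_En k t y))) => //; ring.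
- move=> t y /andP[t0 tr]; rewrite /ball_ind subr0; case: ltP => yr /=; last first.
    by rewrite En_supp ?mulr0 ?normr0// (le_trans (ltW tr)).
  rewrite mulr1 mulrCA !normrM; apply: ler_pM; rewrite ?mulr_ge0//; first exact/HC/ltW.
  rewrite [in leLHS](ger0_norm (En_ge0 _ _ _)); apply: ler_pM; rewrite ?mulr_ge0 ?En_ge0//.
    rewrite (gtr0_norm t0) !ger0_norm// ler_wpM2l ?(ltW tr)//.
  apply: le_trans (En_le _ _ (ltW t0)) _.
  by apply: lerXn2r; rewrite ?nnegrE ?(ltW tr)// ltW// (lt_trans t0).
- exact/iblZ/ibl_ball_ind.
Qed.

Definition pgrow (f : R -> R) := exists (K : R) (p : nat), forall r, 1 <= r -> `|f r| <= K * r ^+ p.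

(* By [Lap_En] and [is_derive_En] the moments of w solve an ODE in r whose source is the moment of Lap w. *)
Lemma pgrow_Lap w : CN 2 w -> pgrow (fun r => I (fun x => Lap w x * En 4 r x)) ->
  pgrow (fun r => I (fun x => w x * En 4 r x)).
Proof.
move=> Hw [K [p HK]]; have cw := CN_continuous Hw.
have K0 : 0 <= K by have := HK 1 (lexx _); rewrite expr1n mulr1; exact: le_trans.
pose M3 r := I (fun x => w x * En 3 r x).
pose M2 r := I (fun x => w x * En 2 r x).
pose M4 r := I (fun x => w x * En 4 r x).
have D4 (r : R) : 0 < r -> is_derive r 1 M4 (8 * (r * M3 r)).
  by move=> r0; apply: (der_eq (is_derive_Mn 2 cw r0)) => //; rewrite -natrM.
have D3 (r : R) : 0 < r -> is_derive r 1 M3 (6 * (r * M2 r)).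
  by move=> r0; apply: (der_eq (is_derive_Mn 1 cw r0)) => //; rewrite -natrM.
have L (r : R) : 0 < r -> I (fun x => Lap w x * En 4 r x) = 48 * r ^+ 2 * M2 r - (8 * n%:R + 48) * M3 r.
  move=> r0; rewrite (green Hw (@En_CN 2 4 r isT) (cpt_En 3 r0)).
  rewrite /M2 /M3 -!IgZ -?IgB; first by apply: eq_Ig => x; rewrite Lap_En; ring.
  - exact/iblZ/ibl_mul_En.
  - exact/iblZ/ibl_mul_En.
  - exact: ibl_mul_En.
  - exact: ibl_mul_En.
(* Integrating factor: by [D3] and [L], the moment of Lap w equals 8 r M3' - 8 (n + 6) M3, which is
   r^(n+7) Z'. A polynomial bound on the source thus bounds Z, then M3, and finally M4 through M4' =
   8 r M3. *)
pose Z r := 8 * M3 r / r ^+ (n + 6).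
have DZ (r : R) : 0 < r -> is_derive r 1 Z ((48 * r ^+ 2 * M2 r - (8 * n%:R + 48) * M3 r) / r ^+ (n + 7)).
  move=> r0; have rn : r != 0 by rewrite gt_eqF.
  have H1 := der1V (derX (n + 6) (is_derive_id r (1:R))) (expf_neq0 _ rn).
  apply: (der_eq (derM (derZ 8 (D3 r r0)) H1)) => //.
  rewrite !addnS addn0 /= !exprS -!natr1.
  have : r ^+ n != 0 by rewrite expf_neq0.
  by move: (r ^+ n) => q q0; field; rewrite rn q0.
have BZ (r : R) : 1 <= r -> `|Z r - Z 1| <= K * r ^+ p.+1.
  move=> r1; have r0 : 0 < r by exact: lt_le_trans r1.
  move: r1; rewrite le_eqVlt => /predU1P[<-|r1].
    by rewrite subrr normr0 mulr_ge0// exprn_ge0.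
  have [||c] := @MVT R Z (fun r => (48 * r ^+ 2 * M2 r - (8 * n%:R + 48) * M3 r) / r ^+ (n + 7)) 1 r r1.
  - by move=> c; rewrite in_itv /= => /andP[c1 _]; apply: DZ; exact: lt_trans c1.
  - apply: derivable_within_continuous => c; rewrite in_itv /= => /andP[c1 _].
    by have [] := DZ c (lt_le_trans ltr01 c1).
  rewrite in_itv /= => /andP[c1 cr] ->.
  have c0 : 0 < c by exact: lt_trans c1.
  rewrite [r ^+ p.+1]exprSr mulrA normrM; apply: ler_pM => //; last first.
    by rewrite ger0_norm ?subr_ge0 ?(ltW r1)// lerBlDr lerDl.
  rewrite -L// normrM normfV; apply: (@le_trans _ _ (K * c ^+ p)).
    rewrite [X in _ / X]ger0_norm ?exprn_ge0 ?(ltW c0)// ler_pdivrMr ?exprn_gt0//.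
    apply: le_trans (HK _ (ltW c1)) _; rewrite ler_peMr ?mulr_ge0 ?exprn_ge0 ?(ltW c0)//.
    by rewrite exprn_ege1// ltW.
  by rewrite ler_wpM2l//; apply: lerXn2r; rewrite ?nnegrE ?(ltW c0) ?(ltW r0)// ltW.
pose K3 := `|Z 1| + K.
have B3 (r : R) : 1 <= r -> `|8 * (r * M3 r)| <= K3 * r ^+ (n + 7 + p.+1).
  move=> r1; have r0 : 0 < r by exact: lt_le_trans r1.
  have -> : 8 * (r * M3 r) = r ^+ (n + 7) * Z r.
    rewrite /Z addnS exprS; have q0 : r ^+ (n + 6) != 0 by rewrite expf_neq0// gt_eqF.
    by move: (r ^+ (n + 6)) q0 => q q0; field.
  rewrite normrM ger0_norm ?exprn_ge0 ?(ltW r0)// [r ^+ (n + 7 + _)]exprD [leRHS]mulrCA ler_wpM2l ?exprn_ge0 ?(ltW r0)//.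
  have -> : Z r = (Z r - Z 1) + Z 1 by rewrite subrK.
  apply: le_trans (ler_normD _ _) _; rewrite /K3 mulrDl addrC lerD ?BZ//.
  by rewrite ler_peMr// exprn_ege1.
have K30 : 0 <= K3 by rewrite addr_ge0.
exists (`|M4 1| + K3), (n + 7 + p.+1).+1 => r r1.
have r0 : 0 < r by exact: lt_le_trans r1.
rewrite -/(M4 r) -[M4 r](subrK (M4 1)).
apply: le_trans (ler_normD _ _) _; rewrite mulrDl addrC; apply: lerD.
  by rewrite ler_peMr// exprn_ege1.
move: r1; rewrite le_eqVlt => /predU1P[<-|r1].
  by rewrite subrr normr0 mulr_ge0// exprn_ge0.
have [||c] := @MVT R M4 (fun r => 8 * (r * M3 r)) 1 r r1.
- by move=> c; rewrite in_itv /= => /andP[c1 _]; apply: D4; exact: lt_trans c1.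
- apply: derivable_within_continuous => c; rewrite in_itv /= => /andP[c1 _].
  by have [] := D4 c (lt_le_trans ltr01 c1).
rewrite in_itv /= => /andP[c1 cr] ->.
rewrite [r ^+ _.+1]exprSr [leRHS]mulrA normrM; apply: ler_pM => //; last first.
  by rewrite ger0_norm ?subr_ge0 ?(ltW r1)// lerBlDr lerDl.
apply: le_trans (B3 c (ltW c1)) _; rewrite ler_wpM2l//.
by apply: lerXn2r; rewrite ?nnegrE ?(ltW r0) ?(ltW cr)// ltW// (lt_trans _ c1).
Qed.

Lemma pgrow_iter_Lap m w : CN m.*2 w -> pgrow (fun r => I (fun x => iter m Lap w x * En 4 r x)) ->
  pgrow (fun r => I (fun x => w x * En 4 r x)).
Proof.
elim: m => [//|m IH] Hw H.
apply: IH; first by apply: CN_le Hw; rewrite doubleS -addn2 leq_addr.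
by apply: pgrow_Lap => //; apply: CN_iter_Lap; rewrite add2n -doubleS.
Qed.

End growth.

Section fatou.
Context d (T : measurableType d) {R : realType} (m : {measure set T -> \bar R}).

Lemma ibl_fatou (g : nat -> T -> R) (f : T -> R) (C : R) : (forall j, ibl m (g j)) ->
  (forall j x, 0 <= g j x) -> (forall x, g ^~ x @ \oo --> f x) ->
  (forall j, Ig m (g j) <= C) -> ibl m f /\ Ig m f <= C.
Proof.
move=> gi g0 gf gC.
have mg j := ibl_meas (gi j).
have mf : measurable_fun [set: T] f by apply: (measurable_fun_cvg mg) => x _; exact: gf.
have f0 x : 0 <= f x.
  rewrite -(cvg_lim _ (gf x))//; apply: limr_ge; first by apply/cvg_ex; exists (f x); exact: gf.
  exact: nearW.
have H : (\int[m]_x (f x)%:E <= C%:E)%E.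
  have mg' j : measurable_fun [set: T] (fun x => (g j x)%:E) by exact/measurable_EFinP.
  have g0' j x : [set: T] x -> (0 <= (g j x)%:E)%E by rewrite lee_fin.
  have := fatou m measurableT mg' g0'.
  rewrite (_ : (fun x => limn_einf _) = fun x => (f x)%:E); last first.
    apply/funext => x; have /cvg_limn_einf_sup[-> _]// : (g j x)%:E @[j --> \oo] --> (f x)%:E.
    by apply: cvg_EFin; [exact: nearW|exact: gf].
  move/le_trans; apply.
  rewrite limn_einf_lim; apply: lime_le; first exact: is_cvg_einfs.
  apply: nearW => j; apply: le_trans (_ : ((Ig m (g j))%:E <= _)%E); last by rewrite lee_fin.
  by rewrite -ibl_EFin//; apply: ereal_inf_lbound; exists j => //=.
have fi : ibl m f by apply: ibl_ge0 => //; apply: le_lt_trans H _; exact: ltry.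
by split => //; rewrite -lee_fin -ibl_EFin.
Qed.

End fatou.

(** * Integrability against powers of 1 + |x| *)

Section weights.
Context {R : realType} {n : nat}.
Notation V := 'rV[R]_n.
Notation mu := (@vmeas R n).
Notation I := (Ig mu).

Lemma ball_ind_ge0 (a x : V) r : 0 <= ball_ind a r x.
Proof. by rewrite /ball_ind ler0n. Qed.

Lemma ball_ind_le1 (a x : V) r : ball_ind a r x <= 1.
Proof. by rewrite /ball_ind; case: ltP. Qed.

Lemma ibl_ball (f : V -> R) (a : V) r C : measurable_fun [set: V] f ->
  (forall x, enorm (x - a) < r -> `|f x| <= C) -> ibl mu (fun x => f x * ball_ind a r x).
Proof.
move=> mf fC; apply: (@ibl_bounded_ball R n _ a r C).
- by apply: measurable_funM => //; exact: measurable_ball_ind.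
- by move=> x H; rewrite /ball_ind H mulr1 fC.
- by move=> x H; rewrite /ball_ind ltNge H mulr0.
Qed.

Lemma cont_ibl_ball (f : V -> R) (a : V) r : continuous f -> ibl mu (fun x => f x * ball_ind a r x).
Proof.
move=> cf; have [C _ HC] := continuous_bounded cf (r + enorm a).
apply: (@ibl_ball _ _ _ C); first exact: continuous_measurable.
by move=> x xr; apply: HC; have := enormB_ge x a; move: xr; lra.
Qed.

Lemma ball_ind_cvg (x : V) : (fun j : nat => ball_ind 0 j%:R x) @ \oo --> (1 : R).
Proof.
apply: cvg_near_cst; near=> j.
rewrite /ball_ind subr0 (_ : _ < _)//.
by near: j; apply: nbhs_infty_gtr.
Unshelve. all: by end_near. Qed.

Lemma W_continuous : continuous (@W R n).
Proof.
move=> x; apply/continuousVP => e e0; have [d d0 H] := (continuousVP (@enorm R n) x).1 (@enorm_continuous R n x) e e0.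
by exists d => // y /H; rewrite /W opprD addrACA subrr add0r.
Qed.

Lemma WX_continuous q : continuous (fun x : V => W x ^- q).
Proof.
move=> x; apply: (@continuous_comp _ _ _ (fun x : V => W x ^+ q) (@GRing.inv R)).
  by apply: (@continuous_comp _ _ _ (@W R n) (fun s => s ^+ q)); [exact: W_continuous|exact: exprn_continuous].
by apply: inv_continuous; rewrite expf_neq0// gt_eqF// W_gt0.
Qed.

Lemma WX_ge0 q (x : V) : 0 <= W x ^- q.
Proof. by rewrite invr_ge0 exprn_ge0// ltW// W_gt0. Qed.

Lemma WX_gt0 q (x : V) : 0 < W x ^- q.
Proof. by rewrite invr_gt0 exprn_gt0// W_gt0. Qed.

Lemma WX_le1 q (x : V) : W x ^- q <= 1.
Proof. by rewrite invf_le1 ?exprn_gt0 ?W_gt0// exprn_ege1// W_ge1. Qed.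

Lemma WD (x y : V) : W (x + y) <= W x * W y.
Proof.
rewrite /W mulrDl mul1r mulrDr mulr1; have := enorm_triangle x y.
by have := mulr_ge0 (enorm_ge0 x) (enorm_ge0 y); lra.
Qed.

Lemma WN (x : V) : W (- x) = W x. Proof. by rewrite /W enormN. Qed.

Lemma ibl_W : ibl mu (fun x => W x ^- n.+1).
Proof.
apply: (ibl_le _ _ (ibl_poisson (oner_neq0 R))); first by apply: continuous_measurable; exact: WX_continuous.
move=> x; rewrite ger0_norm ?WX_ge0// lef_pV2 ?posrE ?exprn_gt0 ?W_gt0 ?rho_pos_gt0 /pos//.
apply: lerXn2r; rewrite ?nnegrE ?(ltW (W_gt0 _))// ?(ltW (rho_pos_gt0 _ _)) /pos//.
by apply: le_trans (rho_le _ _) _; rewrite normr1.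
Qed.

(** Summation over unit shells: on the shell ending at radius j + 2 the weight is at most
    (j+2)^(-p-2), so it contributes at most K (j+2)^(-2). The bound K (2 - 1/(j+1)) dominates these
    partial sums, since 1/(j+1) - 1/(j+2) >= (j+2)^(-2). *)
Lemma ibl_weight (f : V -> R) p (K : R) : measurable_fun [set: V] f -> (forall x, 0 <= f x) ->
  (forall r, ibl mu (fun x => f x * ball_ind 0 r x)) ->
  (forall r, 1 <= r -> I (fun x => f x * ball_ind 0 r x) <= K * r ^+ p) ->
  ibl mu (fun x => f x * W x ^- p.+2).
Proof.
move=> mf f0 fi fK.
have K0 : 0 <= K.
  have := fK 1 (lexx _); rewrite expr1n mulr1; apply: le_trans; apply: Ig_ge0 => x.
  by rewrite mulr_ge0// ball_ind_ge0.
pose g (j : nat) (x : V) := f x * W x ^- p.+2 * ball_ind 0 j%:R x.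
have gi j : ibl mu (g j).
  apply: (eq_ibl (f := fun x => W x ^- p.+2 * (f x * ball_ind 0 j%:R x))); first by move=> x; rewrite /g; ring.
  apply: (@iblM _ _ _ _ _ _ 1) => //; first by apply: continuous_measurable; exact: WX_continuous.
  by move=> x; rewrite ger0_norm ?WX_ge0// WX_le1.
have gB j : I (g j.+1) <= K * (2 - j.+1%:R^-1).
  elim: j => [|j IH].
    rewrite invr1 (_ : 2 - 1 = 1) ?mulr1; last by ring.
    have := fK 1 (lexx _); rewrite expr1n mulr1; apply: le_trans.
    apply: Ig_le => // x; rewrite /g ler_wpM2r ?ball_ind_ge0// ler_piMr//; exact: WX_le1.
  have E : I (g j.+2) <= I (fun x => g j.+1 x + j.+2%:R ^- p.+2 * (f x * ball_ind 0 j.+2%:R x)).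
    apply: Ig_le => //; first by apply: iblD => //; exact: iblZ.
    move=> x; rewrite /g /ball_ind subr0.
    have fb : 0 <= j.+2%:R ^- p.+2 * (f x * (enorm x < j.+2%:R)%R%:R).
      by rewrite !mulr_ge0 ?invr_ge0 ?exprn_ge0 ?ler0n.
    have [h1|h1] := ltP (enorm x) j.+1%:R.
      by rewrite (lt_trans h1) ?ltr_nat//= lerDl !mulr_ge0 ?invr_ge0 ?exprn_ge0.
    rewrite mulr0 add0r; case: (ltP _ j.+2%:R) => h2; rewrite ?mulr0// !mulr1 mulrC ler_wpM2r//.
    rewrite lef_pV2 ?posrE ?exprn_gt0 ?W_gt0//; apply: lerXn2r; rewrite ?nnegrE ?(ltW (W_gt0 _))//.
    by rewrite /W -natr1 addrC lerD2l.
  apply: le_trans E _; rewrite IgD ?IgZ//; last exact: iblZ.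
  have := fK j.+2%:R (_ : 1 <= j.+2%:R); rewrite ler1n => /(_ isT) H.
  have J0 : (0 : R) < j.+2%:R by [].
  have {H}H : j.+2%:R ^- p.+2 * I (fun x => f x * ball_ind 0 j.+2%:R x) <= K * j.+2%:R ^- 2.
    apply: le_trans (ler_wpM2l _ H) _; first by rewrite invr_ge0 exprn_ge0.
    rewrite mulrCA ler_wpM2l// -[p.+2]addn2 exprD invfM mulrAC mulVf ?mul1r//.
  apply: le_trans (lerD IH H) _; rewrite -mulrDr ler_wpM2l//.
  have a0 : (0 : R) < j.+1%:R by [].
  have -> : (j.+2%:R : R) = j.+1%:R + 1 by rewrite natr1.
  move: (j.+1%:R : R) a0 => a a0.
  have E : a^-1 - (a + 1) ^- 2 = (a + 1)^-1 + (a * (a + 1) ^+ 2)^-1.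
    by field; apply/andP; split; apply: lt0r_neq0; lra.
  have : 0 <= (a * (a + 1) ^+ 2)^-1 by rewrite invr_ge0 mulr_ge0 ?sqr_ge0// ltW.
  by move: E; lra.
apply: (proj1 (@ibl_fatou _ _ _ mu (fun j => g j.+1) (fun x => f x * W x ^- p.+2) (K * 2) (fun j => gi j.+1) _ _ _)).
- by move=> j x; rewrite /g !mulr_ge0// ?ball_ind_ge0 ?WX_ge0.
- move=> x; have : g ^~ x @ \oo --> f x * W x ^- p.+2.
    by rewrite -[X in _ --> X]mulr1; apply: cvgMr; exact: ball_ind_cvg.
  by rewrite -(cvg_shiftS (g ^~ x)).
- move=> j; apply: le_trans (gB j) _; rewrite ler_wpM2l// gerDl oppr_le0 invr_ge0//.
Qed.

(** From |w| = 2 max(w, 0) - w: the positive part is bounded by assumption and the moment of w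
    itself by the differential equation, so the negative part is bounded as well. The weight
    [En 4 (2 * r)] is at least 1 on the ball of radius r >= 1. *)
Lemma ibl_growth m (w : V -> R) : CN m.*2 w ->
  pgrow (fun r => I (fun x => iter m Lap w x * En 4 r x)) ->
  (exists K p, forall r, 1 <= r -> I (fun x => Num.max (w x) 0 * ball_ind 0 r x) <= K * r ^+ p) ->
  exists q, ibl mu (fun x => `|w x| * W x ^- q).
Proof.
move=> Hw /(pgrow_iter_Lap Hw)[K [p HK]] [L [q HL]].
have cw := CN_continuous Hw.
have cp : continuous (fun x => Num.max (w x) 0).
  by move=> x; apply: (@continuous_max _ _ w (fun _ => 0)); [exact: cw|exact: cst_continuous].
have ca : continuous (fun x => `|w x|).
  by move=> x; apply: (@continuous_comp _ _ _ w (fun t : R => `|t|)); [exact: cw|exact: norm_continuous].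
have L0 : 0 <= L.
  have := HL 1 (lexx _); rewrite expr1n mulr1; apply: le_trans; apply: Ig_ge0 => x.
  by rewrite mulr_ge0 ?ball_ind_ge0// le_max lexx orbT.
have K0 : 0 <= K by have := HK 1 (lexx _); rewrite expr1n mulr1; exact: le_trans.
exists (p + q + 8).+2; apply: (@ibl_weight _ _ (2 * (2 ^+ 8 * (L * 2 ^+ q)) + K * 2 ^+ p)) => //.
- exact: continuous_measurable.
- by move=> r; exact: cont_ibl_ball.
move=> r r1; have r0 : 0 < r by exact: lt_le_trans r1.
have r2 : 1 <= 2 * r by lra.
have r20 : 0 < 2 * r by lra.
have i1 : ibl mu (fun x => 2 * ((2 * r) ^+ 8 * (Num.max (w x) 0 * ball_ind 0 (2 * r) x))).
  exact/iblZ/iblZ/cont_ibl_ball.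
have i2 : ibl mu (fun x => w x * En 4 (2 * r) x) by exact: ibl_mul_En.
apply: (@le_trans _ _ (I (fun x => 2 * ((2 * r) ^+ 8 * (Num.max (w x) 0 * ball_ind 0 (2 * r) x)) - w x * En 4 (2 * r) x))).
  apply: Ig_le; [exact: cont_ibl_ball|exact: iblB|move=> x].
  apply: (@le_trans _ _ (`|w x| * En 4 (2 * r) x)).
    rewrite ler_wpM2l// /ball_ind subr0; case: ltP => xr; last exact: En_ge0.
    rewrite /En /qpos; apply: exprn_ege1; rewrite le_max; apply/orP; left.
    rewrite /sqn -sqr_enorm; have := enorm_ge0 x; nra.
  have -> : `|w x| = 2 * Num.max (w x) 0 - w x.
    by have [h|h] := leP 0 (w x); [rewrite ger0_norm//|rewrite ltr0_norm//]; ring.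
  rewrite mulrBl lerD2r -mulrA ler_wpM2l// [leRHS]mulrCA ler_wpM2l ?le_max ?lexx ?orbT//.
  rewrite /ball_ind subr0; case: ltP => xr; last by rewrite En_supp ?mulr0.
  by rewrite mulr1; exact: En_le (ltW r20).
rewrite IgB// !IgZ; [|exact: cont_ibl_ball|exact/iblZ/cont_ibl_ball].
have h1 := HL _ r2; have h2 := HK _ r2.
rewrite [leRHS]mulrDl; apply: lerD.
  apply: (@le_trans _ _ (2 * ((2 * r) ^+ 8 * (L * (2 * r) ^+ q)))).
    by rewrite ler_wpM2l// ler_wpM2l// exprn_ge0// ltW.
  have -> : 2 * ((2 * r) ^+ 8 * (L * (2 * r) ^+ q)) = 2 * (2 ^+ 8 * (L * 2 ^+ q)) * (r ^+ 8 * r ^+ q).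
    by rewrite !exprMn; move: (2 ^+ q) (r ^+ q) (2 ^+ 8) (r ^+ 8) => a b c d; ring.
  rewrite ler_wpM2l//; first by rewrite !mulr_ge0 ?exprn_ge0.
  by rewrite -exprD; apply: ler_weXn2l => //; lia.
apply: le_trans (ler_norm _) _; rewrite normrN; apply: le_trans h2 _.
rewrite exprMn mulrA ler_wpM2l ?mulr_ge0 ?exprn_ge0//.
by apply: ler_weXn2l => //; lia.
Qed.

End weights.

(** * Local singularities *)

Section singular.
Context {R : realType} {n : nat}.
Notation V := 'rV[R]_n.
Notation mu := (@vmeas R n).
Notation I := (Ig mu).

Lemma measurable_lnorm : measurable_fun [set: V] (fun x => ln (enorm x)).
Proof. by apply: measurableT_comp; [exact: measurable_ln|exact: measurable_enorm]. Qed.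

(** The function |x|^(-g) on the unit ball; as ln 0 = 0, its value at the origin is 1. *)
Definition sing (g : R) (x : V) : R := expR (- g * ln (enorm x)) * ball_ind 0 1 x.

Lemma sing_ge0 g x : 0 <= sing g x.
Proof. by rewrite mulr_ge0 ?expR_ge0 ?ball_ind_ge0. Qed.

Lemma measurable_expln g : measurable_fun [set: V] (fun x => expR (g * ln (enorm x))).
Proof.
apply: measurableT_comp; first exact: measurable_expR.
by apply: measurable_funM => //; exact: measurable_lnorm.
Qed.

Lemma measurable_sing g : measurable_fun [set: V] (sing g).
Proof. by apply: measurable_funM; [exact: measurable_expln|exact: measurable_ball_ind]. Qed.

(** Self-similarity under doubling: with [G j] the part outside the ball of radius 2^(-j), the
    integrals satisfy I(G (j+1)) = I(G 1) + q I(G j) with q = 2^(g-n) < 1, hence stay below a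
    geometric sum. Fatou's lemma concludes. *)
Lemma ibl_sing g : g < n%:R -> ibl mu (sing g).
Proof.
move=> gn.
pose G j x : R := sing g x * ((2 : R) ^- j <= enorm x)%R%:R.
have p2 j : (0 : R) < 2 ^- j by rewrite invr_gt0 exprn_gt0.
have G0 j x : 0 <= G j x by rewrite mulr_ge0 ?sing_ge0 ?ler0n.
have mG j : measurable_fun [set: V] (G j).
  apply: measurable_funM; first exact: measurable_sing.
  rewrite (_ : (fun x => _) = fun x => 1 - ball_ind 0 (2 ^- j) x).
    by apply: measurable_funB => //; exact: measurable_ball_ind.
  by apply/funext => x; rewrite /ball_ind subr0; case: ltP; rewrite ?subrr ?subr0.
have Gi j : ibl mu (G j).
  apply: (@ibl_bounded_ball R n _ 0 1 (expR (`|g| * (j%:R * ln 2)))) => // x; rewrite subr0 => x1.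
    rewrite ger0_norm// /G /sing /ball_ind subr0 x1 mulr1.
    have [xj|_] := leP _ (enorm x); last by rewrite mulr0 expR_ge0.
    rewrite mulr1 ler_expR; apply: le_trans (ler_norm _) _; rewrite normrM normrN ler_wpM2l//.
    have x0 : 0 < enorm x by exact: lt_le_trans xj.
    rewrite ler0_norm ?ln_le0 ?(ltW x1)//.
    have : ln (2 ^- j) <= ln (enorm x) by rewrite ler_ln ?posrE.
    by rewrite lnV ?posrE ?exprn_gt0// lnXn// mulr_natl; lra.
  by rewrite /G /sing /ball_ind subr0 ltNge x1 mulr0 mul0r.
pose q := expR (g * ln 2) / 2 ^+ n.
have q0 : 0 <= q by rewrite divr_ge0 ?expR_ge0 ?exprn_ge0.
have q1 : q < 1.
  rewrite ltr_pdivrMr ?exprn_gt0// mul1r -[2 ^+ n]lnK ?posrE ?exprn_gt0// ltr_expR lnXn//.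
  by rewrite -[ltRHS]mulr_natl ltr_pM2r// ln_gt0// ltr1n.
have GS j x : G j.+1 x = G 1%N x + expR (g * ln 2) * G j (2 *: x + 0).
  rewrite /G /sing /ball_ind !subr0 addr0 enormZ normr_nat.
  have [x2|x2] := leP (2 ^-1) (enorm x).
    rewrite (_ : 2 ^- j.+1 <= enorm x) ?mulr1; last first.
      apply: le_trans x2.
      rewrite exprS invfM ler_piMr// invf_le1 ?exprn_gt0// exprn_ege1// ler1n//.
    have -> : (2 * enorm x < 1) = false by apply/negbTE; rewrite -leNgt; move: x2; lra.
    by rewrite mulr0 mul0r mulr0 addr0.
  rewrite mulr0 add0r (_ : 2 * enorm x < 1); last by move: x2; lra.
  rewrite (_ : enorm x < 1); last by move: x2; lra.
  rewrite (_ : (2 ^- j <= 2 * enorm x) = (2 ^- j.+1 <= enorm x)); last first.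
    by rewrite exprS invfM ler_pdivrMl.
  case: (leP _ (enorm x)) => xj; rewrite ?mulr0// !mulr1 -expRD; congr expR.
  rewrite lnM ?posrE//; last exact: lt_le_trans xj.
  by ring.
have aB j : I (G j) <= I (G 1%N) / (1 - q).
  have a1 : 0 <= I (G 1%N) by exact: Ig_ge0.
  elim: j => [|j IH].
    rewrite (_ : I (G 0%N) = 0) ?divr_ge0 ?subr_ge0 ?(ltW q1)//.
    rewrite -[RHS](@Ig0 _ _ _ mu); apply: eq_Ig => x.
    rewrite /G /sing /ball_ind subr0 expr0 invr1.
    by case: ltP => _; rewrite ?mulr0 ?mul0r.
  have t0 : (2 : R) != 0 by [].
  have i2 := ibl_affine 0 t0 (Gi j).
  rewrite (eq_Ig mu (GS j)) IgD ?IgZ ?Ig_affine//; last exact: iblZ.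
  rewrite normr_nat mulrA -/q; apply: (@le_trans _ _ (I (G 1%N) + q * (I (G 1%N) / (1 - q)))).
    by rewrite lerD2l ler_wpM2l.
  have q2 : 1 - q != 0 by rewrite gt_eqF// subr_gt0.
  by move: (I _) => a; rewrite le_eqVlt; apply/orP; left; apply/eqP; field.
have Gc x : G ^~ x @ \oo --> sing g x * (x != 0)%:R.
  apply: cvg_near_cst; have [->|x0] := eqVneq x 0.
    by apply: nearW => j; rewrite /G enorm0 leNgt p2.
  rewrite -enorm_gt0 in x0; near=> j; rewrite /G (_ : _ <= _)//; apply/ltW.
  rewrite -[ltRHS]invrK ltf_pV2 ?posrE ?exprn_gt0 ?invr_gt0//.
  apply: (@lt_trans _ _ j%:R); first by near: j; exact: nbhs_infty_gtr.
  by rewrite -natrX ltr_nat ltn_expl.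
have [H _] := ibl_fatou Gi G0 Gc aB.
(* The limit of the [G j] vanishes at the origin, where [sing g] is 1; the added indicator of the
   ball covers that point. *)
apply: (ibl_le (measurable_sing g) _ (iblD H (ibl_ball_ind 0 1))) => x.
rewrite ger0_norm ?sing_ge0//; have [->|x0] := eqVneq x 0.
  by rewrite mulr0 add0r /sing enorm0 ln0// mulr0 expR0 mul1r.
by rewrite mulr1 lerDl ball_ind_ge0.
Unshelve. all: by end_near. Qed.

(* Since ln 0 = 0, Lam 0 = 0. *)
Definition Lam (x : V) : R := - ln (enorm x) * ball_ind 0 1 x.

Lemma Lam_ge0 x : 0 <= Lam x.
Proof.
rewrite /Lam /ball_ind subr0; case: ltP => x1; rewrite ?mulr0// mulr1 oppr_ge0.
by rewrite ln_le0// ltW.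
Qed.

Lemma measurable_Lam : measurable_fun [set: V] Lam.
Proof.
apply: measurable_funM; last exact: measurable_ball_ind.
by apply: measurableT_comp => //; exact: measurable_lnorm.
Qed.

Lemma Lam_sing x : Lam x <= sing 1 x.
Proof.
rewrite /Lam /sing ler_wpM2r ?ball_ind_ge0// mulN1r.
by apply: le_trans (expR_ge1Dx _); rewrite lerDr.
Qed.

Lemma ibl_Lam : (1 < n)%N -> ibl mu Lam.
Proof.
move=> n1; apply: (ibl_le measurable_Lam _ (@ibl_sing 1 _)); last by rewrite ltr1n.
by move=> x; rewrite ger0_norm ?Lam_ge0// Lam_sing.
Qed.

Lemma LamN x : Lam (- x) = Lam x.
Proof. by rewrite /Lam /ball_ind !subr0 enormN. Qed.

(** Separates growth at infinity from the local singularity; thanks to ln 0 = 0 it is also true at x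
    = 0. *)
Lemma lnE x : ln (enorm x) = ln (Num.max 1 (enorm x)) - Lam x.
Proof.
rewrite /Lam /ball_ind subr0; case: ltP => x1; first by rewrite ln1 mulr1 opprK add0r.
by rewrite mulr0 subr0.
Qed.

End singular.

Section calculus.
Context {R : realType}.

Lemma der0_const (f : R -> R) (a b : R) : a <= b -> (forall t, a <= t <= b -> is_derive t 1 f 0) -> f a = f b.
Proof.
rewrite le_eqVlt => /predU1P[-> //|ab] H.
have [||c _] := @MVT R f (fun _ => 0) a b ab.
- by move=> c; rewrite in_itv /= => /andP[c1 c2]; apply: H; rewrite !ltW.
- apply: derivable_within_continuous => c; rewrite in_itv /= => cab.
  by have [] := H c cab.
by rewrite mul0r => /eqP; rewrite subr_eq0 => /eqP.
Qed.

(** The room needed to differentiate under an integral: on a whole interval around t0 both times a +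
    s t and b + t stay above a common positive [m], so one kernel at time [m] dominates. *)
Lemma near_gt0 (a b t0 s : R) : `|s| <= 1 -> 0 < a + s * t0 -> 0 < b + t0 ->
  exists d m, [/\ 0 < d, 0 < m & forall t, t0 - d < t < t0 + d ->
   [/\ m <= a + s * t, m <= b + t & b + t <= 2 * (b + t0)]].
Proof.
move=> s1 a0 b0; pose m := Num.min (a + s * t0) (b + t0) / 2.
have m0 : 0 < m by rewrite divr_gt0// lt_min a0 b0.
have ma : 2 * m <= a + s * t0 by rewrite /m mulrCA divff// mulr1 ge_min lexx.
have mb : 2 * m <= b + t0 by rewrite /m mulrCA divff// mulr1 ge_min lexx orbT.
exists m, m; split=> // t /andP[t1 t2].
have h : `|s * (t - t0)| <= m.
  rewrite normrM; apply: le_trans (ler_piMl _ s1) _ => //.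
  by rewrite ler_norml; apply/andP; split; lra.
move: h; rewrite ler_norml => /andP[h1 h2].
by split; [move: h1; rewrite mulrBr; lra|lra|lra].
Qed.

End calculus.

(** * The Poisson semigroup *)

Section semigroup.
Context {R : realType} {n : nat}.
Notation V := 'rV[R]_n.
Notation mu := (@vmeas R n).
Notation I := (Ig mu).
Implicit Types (s r q : R) (x y z : V).

Local Notation cPn := (@cP R n).
Let c_gt0 : 0 < cPn := @cP_gt0 R n.
Let c_ge0 : 0 <= cPn := ltW c_gt0.

Lemma pk0_ge0 s x : 0 < s -> 0 <= pk 0 s x.
Proof. by move=> s0; rewrite pk0E; exact: (mulr_ge0 (mulr_ge0 c_ge0 (ltW s0)) (rp_ge0 _ _ _)). Qed.

Lemma rho_gt0' s x : 0 < s -> 0 < rho s x.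
Proof. exact: rho_pos_gt0. Qed.

Lemma rp_le k s t x : 0 < s -> s <= t -> rp k t x <= rp k s x.
Proof.
move=> s0 st; have t0 : 0 < t by exact: lt_le_trans st.
rewrite lef_pV2 ?posrE ?exprn_gt0 ?rho_gt0'//; apply: lerXn2r; rewrite ?nnegrE ?(ltW (rho_gt0' _ _))//.
rewrite !rhoE; apply: ler_wsqrtr; rewrite lerD2r; apply: lerXn2r; rewrite ?nnegrE// ltW//.
Qed.

Lemma rp_sup k s x : 0 < s -> rp k s x <= s ^- k.
Proof.
move=> s0; rewrite lef_pV2 ?posrE ?exprn_gt0 ?rho_gt0'//; apply: lerXn2r; rewrite ?nnegrE ?(ltW s0)//.
  exact: ltW (rho_gt0' _ _).
by have := abs_le_rho s x; rewrite gtr0_norm.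
Qed.

Lemma pk0_sup s x : 0 < s -> pk 0 s x <= cPn * s ^- n.
Proof.
move=> s0; rewrite pk0E -mulrA ler_wpM2l ?c_ge0//.
apply: le_trans (ler_wpM2l (ltW s0) (rp_sup n.+1 x s0)) _.
by rewrite exprS invfM mulVKf// gt_eqF.
Qed.

(** As rho >= s, each derivative in s costs at most a factor 1/s, and what is left is the positive
    kernel of mass one. *)
Lemma pk_dom b : exists2 C : R, 0 <= C & forall s x, 0 < s ->
  `|pk b s x| <= C * s ^- b * pk 0 s x.
Proof.
case: b => [|b].
  exists 1 => // s x s0; rewrite expr0 invr1 !mul1r ger0_norm//; exact: pk0_ge0.
have [C C0 HC] := @pk_bound R n b.+1; exists (C / cPn); first by rewrite divr_ge0// ltW// c_gt0.
move=> s x s0; apply: le_trans (HC s x s0) _.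
have c0 : (cPn : R) != 0 by rewrite gt_eqF.
have -> : C / cPn * s ^- b.+1 * pk 0 s x = C * (s ^- b * rp n.+1 s x).
  rewrite pk0E exprS; have : s ^+ b != 0 by rewrite expf_neq0// gt_eqF.
  have : s != 0 by rewrite gt_eqF.
  by move: (s ^+ b) (rp _ _ _) => p w s1 p0; field; rewrite c0 s1 p0.
rewrite ler_wpM2l// addnS -addSn exprD invfM mulrC ler_wpM2r ?rp_ge0//.
exact: rp_sup.
Qed.

Lemma pk_sup b : exists2 C : R, 0 <= C & forall s x m, 0 < m -> m <= s ->
  `|pk b s x| <= C * m ^- (n + b).
Proof.
have [C C0 HC] := @pk_bound R n b; exists C => // s x m m0 ms.
have s0 : 0 < s by exact: lt_le_trans ms.
apply: le_trans (HC s x s0) _; rewrite ler_wpM2l//.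
by apply: le_trans (rp_le (n + b) x m0 ms) _; exact: rp_sup.
Qed.

Lemma pk_dom2 b : exists2 C : R, 0 <= C & forall s x m M, 0 < m -> m <= s -> s <= M ->
  `|pk b s x| <= C * m ^- b * M * rp n.+1 m x.
Proof.
have [C C0 HC] := @pk_dom b; exists (C * cPn); first by rewrite mulr_ge0// ltW// c_gt0.
move=> s x m M m0 ms sM; have s0 : 0 < s by exact: lt_le_trans ms.
apply: le_trans (HC s x s0) _; rewrite pk0E.
have -> : C * cPn * m ^- b * M * rp n.+1 m x = C * m ^- b * (cPn * M * rp n.+1 m x) by ring.
apply: ler_pM.
- by rewrite mulr_ge0 ?invr_ge0 ?exprn_ge0// ltW.
- by rewrite -pk0E pk0_ge0.
- rewrite ler_wpM2l// lef_pV2 ?posrE ?exprn_gt0//; apply: lerXn2r; rewrite ?nnegrE// ltW//.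
- apply: ler_pM; [exact: (mulr_ge0 c_ge0 (ltW s0))|exact: rp_ge0| |exact: rp_le].
  by rewrite ler_wpM2l.
Qed.

Lemma pk_continuous b s : 0 < s -> continuous (pk b s : V -> R).
Proof. by move=> s0; apply: (@CN_continuous _ _ 0); apply: pk_CN; rewrite gt_eqF. Qed.

Lemma ibl_pk b s : 0 < s -> ibl mu (pk b s).
Proof.
move=> s0; have [C C0 HC] := @pk_dom b.
apply: (ibl_le _ (fun x => HC s x s0)); first by apply: continuous_measurable; exact: pk_continuous.
by apply: iblZ; case: (@int_pk0 R n s s0).
Qed.

(** The mass of the Poisson kernel does not depend on s; differentiate under the integral. *)
Lemma Ig_pkS b s : 0 < s -> I (pk b.+1 s) = 0.
Proof.
move=> s0.
have H c r : 0 < r -> is_derive r 1 (fun r => I (pk c r)) (I (pk c.+1 r)).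
  move=> r0; have [C C0 HC] := @pk_dom2 c.+1.
  have [|||d [m [d0 m0 Hm]]] := @near_gt0 R 0 0 r 1 _ _ _; rewrite ?normr1 ?mul1r ?add0r//.
  apply: (@Ig_derive R _ _ mu (pk c) (pk c.+1) (fun x => C * m ^- c.+1 * (2 * r) * rp n.+1 m x) r (r - d) (r + d)).
  - by apply/andP; split; lra.
  - by move=> t /Hm[]; rewrite !add0r => h _ _; apply: ibl_pk; lra.
  - by move=> t y /Hm[]; rewrite !add0r => _ h _; apply: pk_ds; rewrite gt_eqF//; lra.
  - by move=> t y /Hm[]; rewrite !add0r => _ h1 h2; apply: HC.
  - apply: iblZ; apply: (eq_ibl _ (ibl_poisson (_ : m != 0))); first by [].
    by rewrite gt_eqF.
have Z c r : (forall r, 0 < r -> is_derive r 1 (fun r => I (pk c r)) (0:R)) -> 0 < r -> I (pk c.+1 r) = 0.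
  by move=> H0 r0; rewrite -(@derive_val _ _ _ _ _ _ _ (H c r r0)); exact: (@derive_val _ _ _ _ _ _ _ (H0 r r0)).
have cst c k : (forall r, 0 < r -> I (pk c r) = k) -> forall r, 0 < r -> is_derive r 1 (fun r => I (pk c r)) (0:R).
  move=> E r r0; have N : \near r, (fun _ => k) r = I (pk c r).
    by near=> t; rewrite E//; near: t; exact: lt_nbhsr.
  exact: (near_eq_is_derive N (derC r 1 k)).
elim: b s s0 => [|b IH] s s0.
  by apply: Z => //; apply: (cst _ 1) => r r0; case: (@int_pk0 R n r r0).
by apply: Z => //; apply: (cst _ 0).
Unshelve. all: by end_near. Qed.

Lemma rho_scale s x : 0 < s -> rho s (s *: x) = s * rho 1 x.
Proof.
move=> s0; rewrite !rhoE enormZ exprMn real_normK ?num_real// expr1n -[in RHS](gtr0_norm s0) -sqrtr_sqr -sqrtrM ?sqr_ge0//.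
by rewrite mulrDr mulr1.
Qed.

Lemma pk0_scale s x : 0 < s -> s ^+ n * pk 0 s (s *: x) = pk 0 1 x.
Proof.
move=> s0; rewrite !pk0E /rp rho_scale// exprMn [s ^+ n.+1]exprS.
have : rho 1 x ^+ n.+1 != 0 by rewrite expf_neq0// gt_eqF// rho_gt0'.
have : s ^+ n != 0 by rewrite expf_neq0// gt_eqF.
have : s != 0 by rewrite gt_eqF.
by move: (s ^+ n) (rho 1 x ^+ _) => p w s1 p0 w0; field; rewrite w0 s1 p0.
Qed.

(** The substitution y = x - t z freezes the kernel at time 1 and moves t into [g], where continuity
    at [x] and dominated convergence apply. The absolute value sits inside the integral because the
    limit is later used with kernels of variable sign, merely dominated by [pk 0]. *)
Lemma pk_approx (g : V -> R) x M (t : nat -> R) : measurable_fun [set: V] g -> (forall y, `|g y| <= M) ->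
  {for x, continuous g} -> (forall j, 0 < t j) -> t @ \oo --> (0:R) ->
  (forall j, ibl mu (fun y => `|g y - g x| * pk 0 (t j) (x - y))) /\
  (fun j => I (fun y => `|g y - g x| * pk 0 (t j) (x - y))) @ \oo --> (0:R).
Proof.
move=> mg gM cg t0 tc.
have gb y : `|g y - g x| <= M + M by apply: le_trans (ler_normB _ _) _; exact: lerD.
have mgx : measurable_fun [set: V] (fun y => `|g y - g x|).
  by apply: measurableT_comp => //; apply: measurable_funB.
have mp s : 0 < s -> measurable_fun [set: V] (pk 0 s : V -> R).
  by move=> s0; apply: continuous_measurable; exact: pk_continuous.
have mrefl f : measurable_fun [set: V] f -> measurable_fun [set: V] (fun y => f (x - y) : R).
  by move=> mf; apply: vcomp mf _; apply: measurable_rVB.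
have i1 j : ibl mu (fun z => `|g (x - z) - g x| * pk 0 (t j) z).
  apply: (@iblM _ _ _ _ _ _ (M + M)); [exact: (mrefl (fun y => `|g y - g x|))|by move=> z; rewrite normr_id|exact: ibl_pk].
have i2 j : ibl mu (fun y => `|g y - g x| * pk 0 (t j) (x - y)).
  by apply: eq_ibl (ibl_refl x (i1 j)) => y; rewrite subKr.
have E j : I (fun y => `|g y - g x| * pk 0 (t j) (x - y)) = I (fun z => `|g (x - t j *: z) - g x| * pk 0 1 z).
  transitivity (I (fun z => `|g (x - z) - g x| * pk 0 (t j) z)).
    by rewrite -(Ig_refl x (i1 j)); apply: eq_Ig => y; rewrite subKr.
  have tn : t j != 0 by rewrite gt_eqF.
  transitivity (t j ^+ n * I (fun z => `|g (x - (t j *: z + 0)) - g x| * pk 0 (t j) (t j *: z + 0))).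
    rewrite (Ig_affine 0 tn (i1 j)) gtr0_norm// mulVKf//.
    by rewrite expf_neq0.
  rewrite -IgZ; last exact: (ibl_affine 0 tn (i1 j)).
  by apply: eq_Ig => z; rewrite addr0 mulrCA pk0_scale.
split => //; rewrite (_ : (fun j => _) = fun j => I (fun z => `|g (x - t j *: z) - g x| * pk 0 1 z)); last first.
  by apply/funext => j; exact: E.
have [||||_ H] := @Ig_dct _ _ _ mu (fun j z => `|g (x - t j *: z) - g x| * pk 0 1 z) (fun _ => 0) (fun z => (M + M) * pk 0 1 z).
- move=> j; apply: measurable_funM; last exact: mp.
  apply: (vcomp mgx); apply: measurable_rVB => //.
  exact: measurable_rVZ.
- by apply: iblZ; exact: ibl_pk.
- by move=> j z; rewrite normrM normr_id (ger0_norm (pk0_ge0 _ ltr01)) ler_wpM2r ?pk0_ge0.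
- move=> z; rewrite -[X in _ --> X](mul0r (pk 0 1 z)); apply: cvgMl.
  apply/cvgrPdist_lt => e e0; have [d d0 Hd] := (continuousVP g x).1 cg e e0.
  have d1 : 0 < d / (enorm z + 1) by rewrite divr_gt0// ltr_wpDl// enorm_ge0.
  near=> j; rewrite sub0r normrN normr_id; apply: Hd.
  rewrite addrAC subrr add0r enormN enormZ (gtr0_norm (t0 j)).
  apply: (@le_lt_trans _ _ (t j * (enorm z + 1))); first by rewrite ler_wpM2l ?lerDl// ltW.
  rewrite -ltr_pdivlMr ?ltr_wpDl ?enorm_ge0//.
  by near: j; apply: (cvgr_lt 0 tc).
by move: H; rewrite Ig0.
Unshelve. all: by end_near. Qed.

Definition pconv (a b : nat) (x : V) (r q : R) : R := I (fun y => pk a r (x - y) * pk b q y).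

Lemma mpk a s x : 0 < s -> measurable_fun [set: V] (fun y : V => pk a s (x - y) : R).
Proof.
move=> s0; apply: (@vcomp R n _ V (pk a s) (fun y => x - y)); last exact: measurable_rVB.
by apply: continuous_measurable; exact: pk_continuous.
Qed.

Lemma ibl_conv a b x r q : 0 < r -> 0 < q -> ibl mu (fun y => pk a r (x - y) * pk b q y).
Proof.
move=> r0 q0; have [C C0 HC] := @pk_sup a.
apply: (@iblM _ _ _ mu _ _ (C * r ^- (n + a))); [exact: mpk|by move=> y; exact: HC|exact: ibl_pk].
Qed.

Lemma is_derive_conv (sg : R) a b x r q t0 : `|sg| <= 1 -> 0 < r + sg * t0 -> 0 < q + t0 ->
  is_derive t0 1 (fun t : R => pconv a b x (r + sg * t) (q + t))
   (sg * pconv a.+1 b x (r + sg * t0) (q + t0) + pconv a b.+1 x (r + sg * t0) (q + t0)).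
Proof.
move=> s1 r0 q0.
have [d [m [d0 m0 Hm]]] := near_gt0 s1 r0 q0.
have [A A0 HA] := @pk_sup a; have [A' A'0 HA'] := @pk_sup a.+1.
have [B B0 HB] := @pk_dom2 b; have [B' B'0 HB'] := @pk_dom2 b.+1.
pose M := 2 * (q + t0).
have -> : sg * pconv a.+1 b x (r + sg * t0) (q + t0) + pconv a b.+1 x (r + sg * t0) (q + t0) =
  I (fun y => sg * (pk a.+1 (r + sg * t0) (x - y) * pk b (q + t0) y) + pk a (r + sg * t0) (x - y) * pk b.+1 (q + t0) y).
  by rewrite IgD ?IgZ//; [exact: ibl_conv|apply: iblZ; exact: ibl_conv|exact: ibl_conv].
apply: (@Ig_derive R _ _ mu (fun t y => pk a (r + sg * t) (x - y) * pk b (q + t) y)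
  (fun t y => sg * (pk a.+1 (r + sg * t) (x - y) * pk b (q + t) y) + pk a (r + sg * t) (x - y) * pk b.+1 (q + t) y)
  (fun y => (A' * m ^- (n + a.+1) * (B * m ^- b * M) + A * m ^- (n + a) * (B' * m ^- b.+1 * M)) * rp n.+1 m y)
  t0 (t0 - d) (t0 + d)).
- by apply/andP; split; lra.
- by move=> t /Hm[h1 h2 _]; apply: ibl_conv; [exact: lt_le_trans h1|exact: lt_le_trans h2].
- move=> t y /Hm[h1 h2 _].
  have l1 : is_derive t 1 (fun t : R => r + sg * t) sg.
    by apply: (der_eq (derD (derC t 1 r) (derZ sg (is_derive_id t (1:R))))) => //; rewrite add0r mulr1.
  have l2 : is_derive t 1 (fun t : R => q + t) 1.
    by apply: (der_eq (derD (derC t 1 q) (is_derive_id t (1:R)))) => //; rewrite add0r.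
  have p1 : r + sg * t != 0 by rewrite gt_eqF// (lt_le_trans m0).
  have p2 : q + t != 0 by rewrite gt_eqF// (lt_le_trans m0).
  apply: (der_eq (derM (der1_comp l1 (pk_ds a (x - y) p1)) (der1_comp l2 (pk_ds b y p2)))) => //.
  by ring.
- move=> t y /Hm[h1 h2 h3]; apply: le_trans (ler_normD _ _) _; rewrite mulrDl; apply: lerD.
    rewrite normrM; apply: le_trans (ler_piMl _ s1) _ => //; rewrite normrM -mulrA.
    by apply: ler_pM => //; [exact: HA'|exact: HB].
  by rewrite normrM -mulrA; apply: ler_pM => //; [exact: HA|exact: HB'].
- apply: iblZ; apply: (eq_ibl _ (ibl_poisson (_ : m != 0))); first by [].
  by rewrite gt_eqF.
Qed.

Lemma rho_shift s x y : 0 < s -> rho s y <= rho s (y + x) + enorm x.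
Proof.
move=> s0; have h0 : 0 <= rho s (y + x) + enorm x by rewrite addr_ge0 ?enorm_ge0// ltW// rho_gt0'.
rewrite -[leRHS]ger0_norm// -sqrtr_sqr rhoE; apply: ler_wsqrtr.
rewrite sqrrD sqr_rho -sqr_enorm.
have e1 : enorm y <= enorm (y + x) + enorm x by have := enormB_ge y (- x); rewrite enormN opprK; lra.
have e2 := enorm_le_rho s (y + x).
have := enorm_ge0 x; have := enorm_ge0 y; have := enorm_ge0 (y + x); nra.
Qed.

Lemma rp_shift k s x y : 0 < s -> enorm x <= 1 -> rp k s (y + x) <= (1 + s^-1) ^+ k * rp k s y.
Proof.
move=> s0 x1; rewrite /rp -ler_pdivrMl; last by rewrite exprn_gt0// ltr_wpDr// invr_ge0 ltW.
rewrite -invfM -exprMn lef_pV2 ?posrE ?exprn_gt0 ?mulr_gt0 ?rho_gt0'//; last by rewrite ltr_wpDr// invr_ge0 ltW.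
apply: lerXn2r; rewrite ?nnegrE ?mulr_ge0 ?(ltW (rho_gt0' _ _))//; first by rewrite addr_ge0// invr_ge0 ltW.
apply: le_trans (rho_shift x y s0) _; rewrite mulrDl mul1r lerD2l; apply: le_trans x1 _.
rewrite ler_pdivlMl// mulr1.
by have := abs_le_rho s (y + x); rewrite gtr0_norm.
Qed.

Lemma continuous_reflV (f : V -> R) x : continuous f -> continuous (fun y => f (x - y)).
Proof.
move=> cf z; apply/continuousVP => e e0; have [d d0 H] := (continuousVP f (x - z)).1 (cf _) e e0.
exists d => // y yz; apply: H; have -> : x - y - (x - z) = z - y by rewrite opprB addrC addrA subrK.
by rewrite enormBC.
Qed.

(** Green's identity without boundary: the integrand is the sum over i of the i-th partial
    derivatives of g_i h - g h_i, where g_i and h_i are partial derivatives of the two factors. One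
    factor is bounded and the other decays like rho^(-n-1), so [Ig_partial0] applies to each
    term. *)
Lemma Ig_green_pk s r x : 0 < s -> 0 < r ->
  I (fun y => Lap (pk 0 r) (x - y) * pk 0 s y) = I (fun y => pk 0 r (x - y) * Lap (pk 0 s) y).
Proof.
move=> s0 r0.
have s0' : s != 0 by rewrite gt_eqF.
have r0' : r != 0 by rewrite gt_eqF.
have Bd (t : R) i : 0 < t -> exists2 C : R, 0 <= C & forall y, [/\ `|pk 0 t y| <= C * rp n.+1 t y,
    `|partial i (pk 0 t) y| <= C * rp n.+1 t y & `|partial i (partial i (pk 0 t)) y| <= C * rp n.+1 t y].
  move=> t0; have := @sp_Sy R n 2 _ _ (@pk_sp R n 0); rewrite addn0 => S2.
  have S1 := Sy_partial i S2; have S0 := Sy_partial i S1.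
  have [C1 C10 H1] := Sy_bound rho_pos_gt0 S1; have [C2 C20 H2] := Sy_bound rho_pos_gt0 S0.
  have C3 : 0 <= cPn * t by rewrite mulr_ge0// ltW.
  have C4 : 0 <= C2 * t^-1 by rewrite mulr_ge0// invr_ge0 ltW.
  exists (cPn * t + C1 + C2 * t^-1) => [|y]; first by rewrite !addr_ge0.
  have rp0 := rp_ge0 n.+1 t y.
  have h1 : `|pk 0 t y| <= cPn * t * rp n.+1 t y by rewrite ger0_norm ?pk0_ge0// pk0E.
  have h2 : `|partial i (pk 0 t) y| <= C1 * rp n.+1 t y.
    by apply: le_trans (H1 t y t0) _; rewrite -opprD -PoszD addn1 -exprnN.
  have h3 : `|partial i (partial i (pk 0 t)) y| <= C2 * t^-1 * rp n.+1 t y.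
    apply: le_trans (H2 t y t0) _; rewrite -!opprD -!PoszD !addn1 -exprnN exprS invfM -mulrA ler_wpM2l//.
    rewrite ler_wpM2r ?rp_ge0//; have := rp_sup 1 y t0; rewrite /rp !expr1; exact.
  have m1 := mulr_ge0 C3 rp0; have m2 := mulr_ge0 C10 rp0; have m3 := mulr_ge0 C4 rp0.
  by split; rewrite !mulrDl; lra.
pose g y := pk 0 r (x - y) : R; pose h := pk 0 s : V -> R.
have Cr N : CN N (pk 0 r : V -> R) by apply: pk_CN; rewrite gt_eqF.
have Cs N : CN N (pk 0 s : V -> R) by apply: pk_CN; rewrite gt_eqF.
pose g1 i y := - partial i (pk 0 r) (x - y) : R.
pose g2 i y := partial i (partial i (pk 0 r)) (x - y) : R.
have dg i : dpar i g (g1 i) by apply: dpar_refl; exact: CN_dpar (Cr 1%N).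
have dg1 i : dpar i (g1 i) (g2 i).
  move=> y; have H := dpar_refl x (CN_dpar i (CN_partial i (Cr 2%N))).
  have E1 : g1 i = fun y => - 1 * partial i (pk 0 r) (x - y) by apply: funext => z; rewrite mulN1r.
  by rewrite E1; apply: (der_eq (dparZ (-1) H y)) => //; rewrite mulN1r opprK.
have dh i : dpar i h (partial i h) by exact: CN_dpar (Cs 1%N).
have dh1 i : dpar i (partial i h) (partial i (partial i h)) by exact: CN_dpar (CN_partial i (Cs 2%N)).
pose f' i y := g2 i y * h y - g y * partial i (partial i h) y.
have rps y : rp n.+1 r y <= r ^- n.+1 by exact: rp_sup.
have ibr : ibl mu (rp n.+1 s) by apply: (ibl_poisson s0').
have mC (f : V -> R) : continuous f -> measurable_fun [set: V] f by exact: continuous_measurable.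
have mR (f : V -> R) : continuous f -> measurable_fun [set: V] (fun y => f (x - y)).
  by move=> cf; apply: (@vcomp R n _ V f (fun y => x - y)); [exact: mC|exact: measurable_rVB].
have key i : ibl mu (f' i) /\ I (f' i) = 0.
  have [A A0 HA] := Bd r i r0; have [B B0 HB] := Bd s i s0.
  have Ar y : A * rp n.+1 r y <= A * r ^- n.+1 by rewrite ler_wpM2l.
  have a1 y : `|g y| <= A * r ^- n.+1 by have [h1 _ _] := HA (x - y); exact: le_trans h1 (Ar _).
  have a2 y : `|g1 i y| <= A * r ^- n.+1 by have [_ h1 _] := HA (x - y); rewrite normrN; exact: le_trans h1 (Ar _).
  have a3 y : `|g2 i y| <= A * r ^- n.+1 by have [_ _ h1] := HA (x - y); exact: le_trans h1 (Ar _).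
  have D y : `|f' i y| <= (A * r ^- n.+1 * B + A * r ^- n.+1 * B) * rp n.+1 s y.
    have [h1 h2 h3] := HB y.
    apply: le_trans (ler_normB _ _) _; rewrite mulrDl !normrM -!mulrA.
    by apply: lerD; rewrite mulrA; apply: ler_pM.
  have if' : ibl mu (f' i).
    apply: (ibl_le _ D); last exact: iblZ.
    apply: measurable_funB; apply: measurable_funM.
    - by apply: mR; exact: CN_continuous (CN_partial i (CN_partial i (Cr 2%N))).
    - by apply: mC; exact: CN_continuous (Cs 0%N).
    - by apply: mR; exact: CN_continuous (Cr 0%N).
    - by apply: mC; exact: CN_continuous (CN_partial i (CN_partial i (Cs 2%N))).
  split => //.
  apply: (@Ig_partial0 R n i (fun y => g1 i y * h y - g y * partial i h y) (f' i)
    (fun y => (A * r ^- n.+1 * B + A * r ^- n.+1 * B) * ((1 + s^-1) ^+ n.+1 * rp n.+1 s y))).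
  - move=> y; apply: (der_eq (dparB (dparM (dg1 i) (dh i)) (dparM (dg i) (dh1 i)) y)) => //.
    by rewrite /f'; ring.
  - apply: iblB.
      apply: (@iblM _ _ _ mu _ _ (A * r ^- n.+1)) => //; last exact: ibl_pk.
      apply: measurable_funN; apply: mR; exact: CN_continuous (CN_partial i (Cr 1%N)).
    apply: (@iblM _ _ _ mu _ _ (A * r ^- n.+1)) => //; first by apply: mR; exact: CN_continuous (Cr 0%N).
    apply: (@ibl_le _ _ _ mu _ (fun y => B * rp n.+1 s y)); last exact: iblZ.
      by apply: mC; exact: CN_continuous (CN_partial i (Cs 1%N)).
    by move=> y; have [] := HB y.
  - exact/iblZ/iblZ.
  - move=> y t t1; apply: le_trans (D _) _; rewrite ler_wpM2l//.
      by rewrite addr_ge0// !mulr_ge0// invr_ge0 exprn_ge0// ltW.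
    by apply: rp_shift => //; rewrite enormZ enorm_ebasis mulr1.
have : I (fun y => \sum_i f' i y) = 0 by rewrite Ig_sum ?big1// => i; case: (key i).
have -> : (fun y => \sum_i f' i y) = fun y => Lap (pk 0 r) (x - y) * pk 0 s y - pk 0 r (x - y) * Lap (pk 0 s) y.
  apply/funext => y; rewrite /f' sumrB -mulr_suml -mulr_sumr; congr (_ * _ - _).
have L1 : (fun y => Lap (pk 0 r) (x - y) * pk 0 s y) = fun y => - (pk 2 r (x - y) * pk 0 s y).
  by apply/funext => y; rewrite pk_lap// mulNr.
have L2 : (fun y => pk 0 r (x - y) * Lap (pk 0 s) y) = fun y => - (pk 0 r (x - y) * pk 2 s y).
  by apply/funext => y; rewrite pk_lap// mulrN.
have i1 : ibl mu (fun y => Lap (pk 0 r) (x - y) * pk 0 s y) by rewrite L1; apply: iblN; exact: (ibl_conv 2 0).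
have i2 : ibl mu (fun y => pk 0 r (x - y) * Lap (pk 0 s) y) by rewrite L2; apply: iblN; exact: (ibl_conv 0 2).
by rewrite IgB// => /eqP; rewrite subr_eq0 => /eqP.
Qed.

(** Two derivatives in time are minus a Laplacian, which Green's identity carries from one factor to
    the other. *)
Lemma conv20 x r q : 0 < r -> 0 < q -> pconv 2 0 x r q = pconv 0 2 x r q.
Proof.
move=> r0 q0; have := Ig_green_pk x q0 r0.
have r0' : r != 0 by rewrite gt_eqF.
have q0' : q != 0 by rewrite gt_eqF.
have -> : I (fun y => Lap (pk 0 r) (x - y) * pk 0 q y) = - pconv 2 0 x r q.
  by rewrite -IgN; [apply: eq_Ig => y; rewrite pk_lap// mulNr|exact: ibl_conv].
have -> : I (fun y => pk 0 r (x - y) * Lap (pk 0 q) y) = - pconv 0 2 x r q.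
  by rewrite -IgN; [apply: eq_Ig => y; rewrite pk_lap// mulrN|exact: ibl_conv].
exact: oppr_inj.
Qed.

Lemma conv00_le x r q : 0 < r -> 0 < q -> 0 <= pconv 0 0 x r q <= cPn * r ^- n.
Proof.
move=> r0 q0; apply/andP; split; first by apply: Ig_ge0 => y; rewrite mulr_ge0 ?pk0_ge0.
have [iq eq] := @int_pk0 R n q q0.
rewrite -[leRHS]mulr1 -eq -IgZ//; apply: Ig_le; [exact: ibl_conv|exact: iblZ|].
by move=> y; rewrite ler_wpM2r ?pk0_ge0// pk0_sup.
Qed.

Lemma conv10_le : exists2 C : R, 0 <= C & forall x r q, 1 <= r -> 1 <= q ->
  `|pconv 1 0 x r q - pconv 0 1 x r q| <= C * (r^-1 + q^-1).
Proof.
have [C C0 HC] := pk_dom 1; exists (C * cPn); first by rewrite mulr_ge0.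
move=> x r q r1 q1; have r0 : 0 < r by exact: lt_le_trans r1.
have q0 : 0 < q by exact: lt_le_trans q1.
have /andP[c0 c1] := conv00_le x r0 q0.
have c2 : pconv 0 0 x r q <= cPn.
  by apply: le_trans c1 _; rewrite ler_piMr// invf_le1 ?exprn_gt0// exprn_ege1.
have i0 := ibl_conv 0 0 x r0 q0.
apply: le_trans (ler_normB _ _) _; rewrite mulrDr; apply: lerD.
  apply: (@le_trans _ _ (I (fun y => C * r^-1 * (pk 0 r (x - y) * pk 0 q y)))).
    apply: Ig_norm_le; [exact: ibl_conv|exact: iblZ|move=> y].
    by rewrite normrM [X in _ * X](ger0_norm (pk0_ge0 _ q0)) mulrA ler_wpM2r ?pk0_ge0//; exact: HC.
  rewrite IgZ// mulrAC ler_wpM2r ?invr_ge0 ?(ltW r0)// ler_wpM2l//.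
apply: (@le_trans _ _ (I (fun y => C * q^-1 * (pk 0 r (x - y) * pk 0 q y)))).
  apply: Ig_norm_le; [exact: ibl_conv|exact: iblZ|move=> y].
  by rewrite normrM (ger0_norm (pk0_ge0 _ r0)) mulrCA ler_wpM2l ?pk0_ge0//; exact: HC.
by rewrite IgZ// mulrAC ler_wpM2r ?invr_ge0 ?(ltW q0)// ler_wpM2l.
Qed.

(** Let E(t) be the difference of the two sides at times (r + t, q + t). Its derivative is pconv 2 0
    - pconv 0 2, because the mixed terms cancel, and this is zero by [conv20]. Since E(t) -> 0 as t
    -> oo by [conv10_le], E vanishes identically. *)
Lemma conv10 x r q : 0 < r -> 0 < q -> pconv 1 0 x r q = pconv 0 1 x r q.
Proof.
move=> r0 q0; have [C C0 HC] := conv10_le.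
pose E t := pconv 1 0 x (r + 1 * t) (q + t) - pconv 0 1 x (r + 1 * t) (q + t).
have n1 : `|1 : R| <= 1 by rewrite normr1.
have dE (t : R) : 0 <= t -> is_derive t 1 E 0.
  move=> t0; have r1 : 0 < r + 1 * t by rewrite mul1r ltr_wpDr.
  have q1 : 0 < q + t by rewrite ltr_wpDr.
  apply: (der_eq (derB (is_derive_conv 1 0 x n1 r1 q1) (is_derive_conv 0 1 x n1 r1 q1))) => //.
  by rewrite conv20//; ring.
suff E0 : E 0 = 0 by move: E0; rewrite /E mulr0 !addr0 => /eqP; rewrite subr_eq0 => /eqP.
apply/eqP; rewrite -normr_le0; apply/ler_addgt0Pl => e e0; rewrite addr0.
pose t := Num.max 1 (2 * C / e).
have t1 : 1 <= t by rewrite le_max lexx.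
have t0 : 0 < t by exact: lt_le_trans t1.
have -> : E 0 = E t by apply: (der0_const (ltW t0)) => c /andP[c0 _]; exact: dE.
have r1 : t <= r + 1 * t by rewrite mul1r lerDr ltW.
have q1 : t <= q + t by rewrite lerDr ltW.
apply: le_trans (HC _ _ _ (le_trans t1 r1) (le_trans t1 q1)) _.
apply: (@le_trans _ _ (C * (t^-1 + t^-1))).
  by rewrite ler_wpM2l// lerD// lef_pV2 ?posrE//; [exact: lt_le_trans r1|exact: lt_le_trans q1].
have : 2 * C / e <= t by rewrite le_max lexx orbT.
rewrite ler_pdivrMr// => h; have -> : C * (t^-1 + t^-1) = 2 * C / t by ring.
by rewrite ler_pdivrMr// mulrC [e * _]mulrC mulrC; exact: h.
Qed.

(** The semigroup law. By [conv10] the convolution depends on r + q only, so the second time may be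
    sent to 0, where the kernel is an approximate identity. *)
Lemma conv00 x r q : 0 < r -> 0 < q -> pconv 0 0 x r q = pk 0 (r + q) x.
Proof.
move=> r0 q0; pose s := r + q; have s0 : 0 < s by rewrite addr_gt0.
have n1 : `|-1 : R| <= 1 by rewrite normrN normr1.
have E e : 0 < e -> e < q -> pconv 0 0 x r q = pconv 0 0 x (s - e) e.
  move=> e0 eq.
  have -> : pconv 0 0 x r q = pconv 0 0 x (s + (-1) * q) (0 + q) by rewrite mulN1r /s addrK add0r.
  have -> : pconv 0 0 x (s - e) e = pconv 0 0 x (s + (-1) * e) (0 + e) by rewrite mulN1r add0r.
  apply/esym; apply: (@der0_const _ (fun t => pconv 0 0 x (s + (-1) * t) (0 + t)) e q (ltW eq)).
  move=> t /andP[t1 t2]; have p1 : 0 < s + (-1) * t by rewrite mulN1r subr_gt0 /s ltr_pwDl.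
  have p2 : 0 < 0 + t by rewrite add0r (lt_le_trans e0).
  apply: (der_eq (is_derive_conv 0 0 x n1 p1 p2)) => //.
  by rewrite conv10//; ring.
have [C C0 HC] := pk_sup 1.
pose m := r.
pose t (j : nat) : R := q / j.+2%:R.
have t0 j : 0 < t j by rewrite divr_gt0.
have tq j : t j < q by rewrite /t ltr_pdivrMr// ltr_pMr// ltr1n.
have tc : t @ \oo --> (0 : R).
  rewrite -[X in _ --> X](mulr0 q); apply: cvgMr.
  by have := @cvg_harmonic R; rewrite -(cvg_shiftS (@harmonic R)).
pose g y := pk 0 s (x - y) : R.
have gM y : `|g y| <= cPn * s ^- n by rewrite ger0_norm ?pk0_ge0// pk0_sup.
have cg : {for 0, continuous g} by apply: continuous_reflV; exact: pk_continuous.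
have mg : measurable_fun [set: V] g by exact: mpk.
have [iZ Zc] := pk_approx mg gM cg t0 tc.
pose Z j := I (fun y => `|g y - g 0| * pk 0 (t j) (0 - y)).
have [d0 d1] : (forall j, 0 < s - t j) /\ forall j, r <= s - t j.
  by split=> j; have := tq j; rewrite /s; lra.
have B j : `|pconv 0 0 x r q - pk 0 s x| <= C * r ^- (n + 1) * t j + Z j.
  rewrite (E (t j))//.
  have [ip ep] := @int_pk0 R n (t j) (t0 j).
  have i1 := ibl_conv 0 0 x (d0 j) (t0 j).
  have -> : pconv 0 0 x (s - t j) (t j) - pk 0 s x = I (fun y => pk 0 (s - t j) (x - y) * pk 0 (t j) y - pk 0 s x * pk 0 (t j) y).
    by rewrite IgB//; [rewrite IgZ// ep mulr1|exact: iblZ].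
  have -> : C * r ^- (n + 1) * t j + Z j = I (fun y => C * r ^- (n + 1) * t j * pk 0 (t j) y + `|g y - g 0| * pk 0 (t j) (0 - y)).
    by rewrite IgD//; [rewrite IgZ// ep mulr1|exact: iblZ].
  apply: Ig_norm_le; [by apply: iblB => //; exact: iblZ|by apply: iblD => //; exact: iblZ|move=> y].
  have tn : t j != 0 by rewrite gt_eqF.
  rewrite -mulrBl normrM (ger0_norm (pk0_ge0 _ (t0 j))) sub0r (pk_even _ _ tn) -mulrDl ler_wpM2r ?pk0_ge0//.
  have -> : pk 0 (s - t j) (x - y) - pk 0 s x = (pk 0 (s - t j) (x - y) - pk 0 s (x - y)) + (g y - g 0).
    by rewrite /g subr0; ring.
  apply: le_trans (ler_normD _ _) _; rewrite lerD2r distrC.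
  have st : s - t j < s by rewrite ltrBlDr ltrDl.
  have [||c] := @MVT R (fun s => pk 0 s (x - y)) (fun s => pk 1 s (x - y)) (s - t j) s st.
  - by move=> c; rewrite in_itv /= => /andP[c1 _]; apply: pk_ds; rewrite gt_eqF// (lt_trans _ c1).
  - apply: derivable_within_continuous => c; rewrite in_itv /= => /andP[c1 _].
    by have [] := @pk_ds R n 0 c (x - y) (lt0r_neq0 (lt_le_trans (d0 j) c1)).
  rewrite in_itv /= => /andP[c1 c2] ->; rewrite subKr normrM (gtr0_norm (t0 j)).
  rewrite ler_wpM2r ?(ltW (t0 j))//; apply: HC => //.
  by apply: le_trans (d1 j) _; exact: ltW.
apply/eqP; rewrite -subr_eq0 -normr_le0.
have L : (fun j => C * r ^- (n + 1) * t j + Z j) @ \oo --> (0 : R).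
  by rewrite -[X in _ --> X]addr0 -[X in _ --> X + _](mulr0 (C * r ^- (n + 1))); apply: cvgD => //; exact: cvgMr.
rewrite -(cvg_lim _ L)//; apply: limr_ge; first by apply/cvg_ex; exists 0.
exact: nearW.
Qed.

End semigroup.

(** * The half Laplacian *)

Section half_laplacian.
Context {R : realType} {n : nat}.
Notation V := 'rV[R]_n.
Notation mu := (@vmeas R n).
Notation I := (Ig mu).
Implicit Types (x y z : V) (g f w : V -> R).

(** Both sides gain the same factor when n grows by two. The agreement of these constants is what
    makes the principal value integral the generator of the Poisson semigroup. *)
Lemma ChalfE : odd n -> @Chalf R n = @cP R n.
Proof.
rewrite /Chalf /cP => on; rewrite -[in RHS](odd_double_half n) on add1n.
elim: n./2 => [|m IH]; first by rewrite fact0 expr1 /=; have := pi_gt0 R; move: pi => p p0; field; exact: lt0r_neq0.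
rewrite doubleS sphere_volSS factS exprS natrM.
have p0 : (pi : R) != 0 by rewrite gt_eqF// pi_gt0.
have -> : (m.*2.+2%:R : R) = 2 * m.+1%:R by rewrite -natrM mul2n.
have m0 : (m.+1%:R : R) != 0 by [].
have s0 : sphere_vol m.*2.+1 != 0 :> R by rewrite gt_eqF// sphere_vol_gt0.
have q0 : (pi : R) ^+ m.+1 != 0 by rewrite expf_neq0.
transitivity (m.+1%:R / pi * (m`!%:R / pi ^+ m.+1) : R); last first.
  by rewrite IH; move: (sphere_vol _) (m.+1%:R : R) (pi : R) s0 m0 p0 => a b c a0 b0 c0; field; rewrite a0 b0 c0.
by move: q0 p0; move: (_ ^+ m.+1) => a; move: (pi) => c a0 c0; field; rewrite a0 c0.
Qed.

Definition k0 z : R := (enorm z ^+ n.+1)^-1.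
Definition sd g x z : R := 2 * g x - g (x + z) - g (x - z).
Definition ops w g x : R := I (fun y => (g x - g y) * w (x - y)).

Lemma k0_ge0 z : 0 <= k0 z.
Proof. by rewrite invr_ge0 exprn_ge0// enorm_ge0. Qed.

Lemma measurable_k0 : measurable_fun [set: V] k0.
Proof.
apply: measurable_funV; apply: measurable_funX; exact: measurable_enorm.
Qed.

Lemma sd0 g x : sd g x 0 = 0.
Proof. by rewrite /sd addr0 subr0; ring. Qed.

Lemma mshift f x : measurable_fun [set: V] f -> measurable_fun [set: V] (fun z => f (x + z)).
Proof. by move=> mf; apply: (vcomp mf); apply: measurable_rVD. Qed.

Lemma mreflB f x : measurable_fun [set: V] f -> measurable_fun [set: V] (fun z => f (x - z)).
Proof. by move=> mf; apply: (vcomp mf); apply: measurable_rVB. Qed.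

Lemma measurable_sd g x : measurable_fun [set: V] g -> measurable_fun [set: V] (sd g x).
Proof.
move=> mg; apply: measurable_funB; last exact: mreflB.
by apply: measurable_funB => //; exact: mshift.
Qed.

(** Peetre's inequality: moving the centre of a weight costs a power of the displacement. *)
Lemma WB q x y : W (x - y) ^- q <= W x ^+ q * W y ^- q.
Proof.
rewrite -ler_pdivrMl ?exprn_gt0 ?W_gt0// -invfM -exprMn lef_pV2 ?posrE ?exprn_gt0 ?mulr_gt0 ?W_gt0//.
apply: lerXn2r; rewrite ?nnegrE ?mulr_ge0 ?(ltW (W_gt0 _))//.
by have := WD x (- (x - y)); rewrite WN opprB addrC subrK.
Qed.

(** Averaging the substitutions y = x - z and y = x + z turns the first difference into a second
    one. This cancels the linear term of [g] and makes the integrals converge absolutely as w tends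
    to |z|^(-n-1). *)
Lemma ops_sym w g x : (forall z, w (- z) = w z) -> ibl mu (fun y => (g x - g y) * w (x - y)) ->
  ops w g x = 2^-1 * I (fun z => sd g x z * w z).
Proof.
move=> we i0.
have i1 : ibl mu (fun z => (g x - g (x - z)) * w z).
  by apply: eq_ibl (ibl_refl x i0) => z; rewrite subKr.
have i2 : ibl mu (fun z => (g x - g (x + z)) * w z).
  by apply: eq_ibl (ibl_refl 0 i1) => z; rewrite sub0r opprK we.
have e1 : ops w g x = I (fun z => (g x - g (x - z)) * w z).
  by rewrite /ops -(Ig_refl x i0); apply: eq_Ig => z; rewrite subKr.
have e2 : ops w g x = I (fun z => (g x - g (x + z)) * w z).
  by rewrite e1 -(Ig_refl 0 i1); apply: eq_Ig => z; rewrite sub0r opprK we.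
have -> : I (fun z => sd g x z * w z) = ops w g x + ops w g x.
  by rewrite {1}e1 e2 -IgD//; apply: eq_Ig => z; rewrite /sd; ring.
by field.
Qed.

Lemma ibl_ops w g x (C : R) : measurable_fun [set: V] w -> (forall z, 0 <= w z <= C * W z ^- n.+1) ->
  measurable_fun [set: V] g -> ibl mu (fun y => `|g y| * W y ^- n.+1) ->
  ibl mu (fun y => (g x - g y) * w (x - y)).
Proof.
move=> mw wC mg gi.
have C0 : 0 <= C.
  by have /andP[h1 h2] := wC 0; rewrite -(pmulr_lge0 _ (WX_gt0 n.+1 (0 : V))) (le_trans h1).
have i1 : ibl mu (fun y => W (x - y) ^- n.+1) by apply: (@ibl_refl R n (fun z => W z ^- n.+1)); exact: ibl_W.
apply: (@ibl_le _ _ _ mu _ (fun y => (C * `|g x|) * W (x - y) ^- n.+1 + (C * W x ^+ n.+1) * (`|g y| * W y ^- n.+1))).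
- by apply: measurable_funM; [exact: measurable_funB|exact: mreflB].
- move=> y; have /andP[h1 h2] := wC (x - y); rewrite normrM (ger0_norm h1).
  apply: le_trans (ler_wpM2r h1 (ler_normB _ _)) _; rewrite mulrDl; apply: lerD.
    by apply: le_trans (ler_wpM2l _ h2) _ => //; rewrite mulrCA mulrA.
  apply: le_trans (ler_wpM2l _ h2) _ => //.
  have -> : C * W x ^+ n.+1 * (`|g y| * W y ^- n.+1) = `|g y| * (C * (W x ^+ n.+1 * W y ^- n.+1)) by ring.
  by rewrite ler_wpM2l// ler_wpM2l// WB.
- by apply: iblD; exact: iblZ.
Qed.

Lemma k0_le_W z : 1 <= enorm z -> k0 z <= 2 ^+ n.+1 * W z ^- n.+1.
Proof.
move=> z1; have z0 : 0 < enorm z by exact: lt_le_trans z1.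
rewrite -ler_pdivrMl ?exprn_gt0// -invfM -exprMn lef_pV2 ?posrE ?exprn_gt0 ?mulr_gt0 ?W_gt0//.
by apply: lerXn2r; rewrite ?nnegrE ?(ltW (W_gt0 _)) ?mulr_ge0 ?enorm_ge0//; rewrite /W; lra.
Qed.

Lemma sqr_k0_sing z : (0 < n)%N -> enorm z < 1 -> z != 0 -> enorm z ^+ 2 * k0 z = sing n.-1%:R z.
Proof.
move=> n0 z1 z0; have ez : 0 < enorm z by rewrite enorm_gt0.
rewrite /sing /ball_ind subr0 z1 mulr1 mulNr expRN mulr_natl -lnXn// lnK ?posrE ?exprn_gt0// /k0.
have -> : n.+1 = n.-1.+2 by rewrite prednK.
rewrite !exprS; have : enorm z ^+ n.-1 != 0 by rewrite expf_neq0// gt_eqF.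
by move: (enorm z ^+ n.-1) => q q0; field; rewrite q0 gt_eqF.
Qed.

(** Inside the unit ball Taylor's formula gives |z|^2, and |z|^2 |z|^(-n-1) = |z|^(-(n-1)) is
    integrable; outside, the kernel is comparable to (1 + |z|)^(-n-1) and no cancellation is
    used. *)
Lemma sd_dom g x A (f' : 'I_n -> V -> R) (f'' : 'I_n -> 'I_n -> V -> R) z : (0 < n)%N -> 0 <= A ->
  (forall i, dpar i g (f' i)) -> (forall i j, dpar j (f' i) (f'' i j)) ->
  (forall i j y, enorm (y - x) <= 2 -> `|f'' i j y| <= A) ->
  `|sd g x z| * k0 z <= A * n%:R ^+ 2 * sing n.-1%:R z +
    2 ^+ n.+1 * (W z ^- n.+1 * (2 * `|g x| + `|g (x + z)| + `|g (x - z)|)).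
Proof.
move=> n0 A0 d1 d2 HA.
have t1 : 0 <= A * n%:R ^+ 2 * sing n.-1%:R z by rewrite !mulr_ge0// sing_ge0.
have t2 : 0 <= 2 ^+ n.+1 * (W z ^- n.+1 * (2 * `|g x| + `|g (x + z)| + `|g (x - z)|)).
  by rewrite !mulr_ge0 ?exprn_ge0 ?WX_ge0// !addr_ge0// mulr_ge0.
have [z0|z0] := eqVneq z 0.
  have -> : sd g x z = 0 by rewrite z0 sd0.
  by rewrite normr0 mul0r; exact: addr_ge0.
have [z1|z1] := ltP (enorm z) 1.
  apply: le_trans (_ : _ <= A * n%:R ^+ 2 * sing n.-1%:R z) _; last by rewrite lerDl.
  rewrite -sqr_k0_sing// mulrA ler_wpM2r ?k0_ge0//.
  apply: le_trans (second_diff A0 d1 d2 _) _; last by rewrite exprMn mulrA.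
  by move=> i j y yz; apply: HA; apply: le_trans yz _; lra.
apply: le_trans (_ : _ <= 2 ^+ n.+1 * (W z ^- n.+1 * (2 * `|g x| + `|g (x + z)| + `|g (x - z)|))) _; last by rewrite lerDr.
rewrite mulrA [leRHS]mulrC; apply: ler_pM => //; [exact: k0_ge0| |exact: k0_le_W].
apply: le_trans (ler_normB _ _) _; rewrite lerD2r; apply: le_trans (ler_normB _ _) _.
by rewrite lerD2r normrM normr_nat.
Qed.

Lemma sd_int g r : (0 < n)%N -> CN 2 g -> ibl mu (fun y => `|g y| * W y ^- n.+1) ->
  exists2 B : R, 0 <= B & forall x, enorm x <= r -> exists D : V -> R,
    [/\ ibl mu D, forall z, `|sd g x z| * k0 z <= D z & I D <= B].
Proof.
move=> n0 Hg gi.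
have cg := CN_continuous Hg.
have [G G0 HG] := continuous_bounded cg r.
have /choice[A0 HA0] : forall p : 'I_n * 'I_n, exists A : R, forall y, enorm y <= r + 2 -> `|partial p.2 (partial p.1 g) y| <= A.
  by move=> [i j]; have [C _ HC] := continuous_bounded (CN_continuous (CN_partial j (CN_partial i Hg))) (r + 2); exists C.
pose A := \sum_p `|A0 p|.
have A_ge0 : 0 <= A by exact: sumr_ge0.
have HA x : enorm x <= r -> forall i j y, enorm (y - x) <= 2 -> `|partial j (partial i g) y| <= A.
  move=> xr i j y yx; apply: le_trans (HA0 (i, j) y _) _; first by have := enormB_ge y x; lra.
  by apply: le_trans (ler_norm _) _; rewrite /A (bigD1 (i, j))//= lerDl sumr_ge0.
pose M := I (fun y => `|g y| * W y ^- n.+1).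
have M0 : 0 <= M by apply: Ig_ge0 => y; rewrite mulr_ge0 ?WX_ge0.
have isg : ibl mu (sing n.-1%:R) by apply: ibl_sing; rewrite ltr_nat prednK.
have S0 : 0 <= I (sing n.-1%:R) by apply: Ig_ge0 => y; exact: sing_ge0.
have W0 : 0 <= I (fun z => W z ^- n.+1) by apply: Ig_ge0 => y; exact: WX_ge0.
have iW := @ibl_W R n.
have R0 : 0 <= (1 + `|r|) ^+ n.+1 by rewrite exprn_ge0// addr_ge0.
exists (A * n%:R ^+ 2 * I (sing n.-1%:R) + 2 ^+ n.+1 * (2 * G * I (fun z => W z ^- n.+1) + 2 * ((1 + `|r|) ^+ n.+1 * M))).
  by rewrite addr_ge0 ?mulr_ge0 ?exprn_ge0// addr_ge0// !mulr_ge0// ltW.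
move=> x xr.
have Wxr : W x ^+ n.+1 <= (1 + `|r|) ^+ n.+1.
  apply: lerXn2r; rewrite ?nnegrE ?(ltW (W_gt0 _)) ?addr_ge0//.
  by rewrite /W lerD2l (le_trans xr)// ler_norm.
have ish : ibl mu (fun z => `|g (x + z)| * W (x + z) ^- n.+1).
  by apply: eq_ibl (ibl_shift x gi) => z; rewrite addrC.
have Ish : I (fun z => `|g (x + z)| * W (x + z) ^- n.+1) = M.
  by rewrite /M -(Ig_shift x gi); apply: eq_Ig => z; rewrite addrC.
have irf := ibl_refl x gi; have Irf := Ig_refl x gi.
exists (fun z => A * n%:R ^+ 2 * sing n.-1%:R z + 2 ^+ n.+1 * (2 * G * W z ^- n.+1 +
   ((1 + `|r|) ^+ n.+1 * (`|g (x + z)| * W (x + z) ^- n.+1) + (1 + `|r|) ^+ n.+1 * (`|g (x - z)| * W (x - z) ^- n.+1)))).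
have i1 := iblZ (2 * G) iW.
have i2 := iblD (iblZ ((1 + `|r|) ^+ n.+1) ish) (iblZ ((1 + `|r|) ^+ n.+1) irf).
split.
- by apply: iblD; [exact: iblZ|apply: iblZ; exact: iblD].
- move=> z; apply: le_trans (sd_dom z n0 A_ge0 (fun i => CN_dpar i Hg) (fun i j => CN_dpar j (CN_partial i Hg)) (HA x xr)) _.
  rewrite lerD2l ler_wpM2l ?exprn_ge0// -addrA mulrDr; apply: lerD.
    by rewrite [leLHS]mulrC; apply: ler_wpM2r; [exact: WX_ge0|apply: ler_wpM2l => //; exact: HG].
  have h1 : W z ^- n.+1 <= (1 + `|r|) ^+ n.+1 * W (x + z) ^- n.+1.
    apply: (@le_trans _ _ (W x ^+ n.+1 * W (x + z) ^- n.+1)); last by rewrite ler_wpM2r ?WX_ge0.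
    by have := WB n.+1 x (x + z); rewrite opprD addrA subrr add0r WN.
  have h2 : W z ^- n.+1 <= (1 + `|r|) ^+ n.+1 * W (x - z) ^- n.+1.
    apply: (@le_trans _ _ (W x ^+ n.+1 * W (x - z) ^- n.+1)); last by rewrite ler_wpM2r ?WX_ge0.
    by have := WB n.+1 x (x - z); rewrite subKr.
  rewrite mulrDr; apply: lerD.
    by rewrite mulrCA [leLHS]mulrC ler_wpM2l.
  by rewrite mulrCA [leLHS]mulrC ler_wpM2l.
- have a1 := iblZ ((1 + `|r|) ^+ n.+1) ish; have a2 := iblZ ((1 + `|r|) ^+ n.+1) irf.
  have j1 := iblZ (A * n%:R ^+ 2) isg; have j2 := iblD i1 i2; have j3 := iblZ (2 ^+ n.+1) j2.
  rewrite (IgD j1 j3) (IgZ _ isg) (IgZ _ j2) (IgD i1 i2) (IgZ _ iW) (IgD a1 a2) (IgZ _ ish) (IgZ _ irf) Ish Irf -/M.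
  rewrite lerD2l ler_wpM2l ?exprn_ge0// lerD2l.
  by move: (_ * M) => c; lra.
Qed.

(** One statement for two regularisations of |z|^(-n-1): the truncation [wt] of the principal value
    and the smooth kernel [gk] coming from the semigroup. Both limits are the same absolutely
    convergent integral. *)
Lemma sd_cvg (w : nat -> V -> R) g x : (0 < n)%N -> CN 2 g -> ibl mu (fun y => `|g y| * W y ^- n.+1) ->
  (forall j, measurable_fun [set: V] (w j)) -> (forall j z, z != 0 -> 0 <= w j z <= k0 z) ->
  (forall z, z != 0 -> w ^~ z @ \oo --> k0 z) ->
  ibl mu (fun z => sd g x z * k0 z) /\
  (fun j => I (fun z => sd g x z * w j z)) @ \oo --> I (fun z => sd g x z * k0 z).
Proof.
move=> n0 Hg gi mw w0 wc; have [B B0 /(_ x (lexx _))[D [Di HD _]]] := sd_int (enorm x) n0 Hg gi.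
have msd : measurable_fun [set: V] (sd g x) by apply: measurable_sd; exact: continuous_measurable (CN_continuous Hg).
apply: (@Ig_dct _ _ _ mu (fun j z => sd g x z * w j z) _ D) => //.
- by move=> j; exact: measurable_funM.
- move=> j z; have [->|z0] := eqVneq z 0.
    by rewrite sd0 mul0r normr0; apply: le_trans (HD 0); rewrite mulr_ge0// k0_ge0.
  have /andP[h1 h2] := w0 j z z0.
  by rewrite normrM (ger0_norm h1); apply: le_trans (HD z); rewrite ler_wpM2l.
- move=> z; have [->|z0] := eqVneq z 0.
    by rewrite sd0 mul0r; apply: cvg_near_cst; apply: nearW => j; rewrite mul0r.
  by apply: cvgMr; exact: wc.
Qed.

End half_laplacian.

Section half_laplacian_limits.
Context {R : realType} {n : nat}.
Notation V := 'rV[R]_n.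
Notation mu := (@vmeas R n).
Notation I := (Ig mu).
Implicit Types (x y z : V) (g f w : V -> R).
Local Notation cPn := (@cP R n).
Let c_gt0 : 0 < cPn := @cP_gt0 R n.
Let c_ge0 : 0 <= cPn := ltW c_gt0.
Let c2_ge0 : 0 <= cPn / 2 := divr_ge0 c_ge0 (ler0n _ 2).

Definition gk (e : R) z : R := cPn * rp n.+1 e z.

Lemma gk_ge0 e z : 0 <= gk e z.
Proof. by apply: mulr_ge0 => //; exact: rp_ge0. Qed.

Lemma rp_W k e z : 0 < e -> rp k e z <= (1 + e^-1) ^+ k * W z ^- k.
Proof.
move=> e0; have e1 : 0 < 1 + e^-1 by rewrite ltr_wpDr// invr_ge0 ltW.
rewrite -ler_pdivrMl ?exprn_gt0// -invfM -exprMn lef_pV2 ?posrE ?exprn_gt0 ?mulr_gt0 ?W_gt0 ?rho_gt0'//.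
apply: lerXn2r; rewrite ?nnegrE ?(ltW (W_gt0 _)) ?mulr_ge0 ?(ltW e1) ?(ltW (rho_gt0' _ e0))//.
rewrite mulrDl mul1r /W addrC lerD ?enorm_le_rho// mulrC ler_pdivlMr// mul1r.
by have := abs_le_rho e z; rewrite gtr0_norm.
Qed.

Lemma gk_W e z : 0 < e -> 0 <= gk e z <= cPn * (1 + e^-1) ^+ n.+1 * W z ^- n.+1.
Proof. by move=> e0; rewrite gk_ge0 /= -mulrA ler_wpM2l// rp_W. Qed.

Lemma gk_k0 e z : z != 0 -> gk e z <= cPn * k0 z.
Proof.
move=> z0; rewrite ler_wpM2l//; have ez : 0 < enorm z by rewrite enorm_gt0.
have rz : 0 < rho e z by apply: lt_le_trans (enorm_le_rho e z).
rewrite lef_pV2 ?posrE ?exprn_gt0//; apply: lerXn2r; rewrite ?nnegrE ?(ltW ez) ?(ltW rz)//.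
exact: enorm_le_rho.
Qed.

Lemma measurable_gk e : 0 < e -> measurable_fun [set: V] (gk e).
Proof.
move=> e0; apply: measurable_funM => //; apply: continuous_measurable; apply: rp_continuous.
by rewrite gt_eqF.
Qed.

Lemma gkN e z : gk e (- z) = gk e z.
Proof. by rewrite /gk /rp !rhoE enormN. Qed.

Lemma gk_pk e z : 0 < e -> gk e z = e^-1 * pk 0 e z.
Proof. by move=> e0; rewrite pk0E /gk; field; rewrite gt_eqF. Qed.

Lemma gk_cvg (t : nat -> R) z : z != 0 -> t @ \oo --> (0 : R) -> (fun j => gk (t j) z) @ \oo --> cPn * k0 z.
Proof.
move=> z0 tc; have ez : 0 < enorm z by rewrite enorm_gt0.
apply: cvgMr; apply: cvgV; first by rewrite expf_neq0// gt_eqF.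
have H : (fun j => rho (t j) z) @ \oo --> enorm z.
  apply: (@squeeze_cvgr _ _ _ _ (fun _ => enorm z) (fun j => `|t j| + enorm z)).
  - by apply: nearW => j; rewrite enorm_le_rho rho_le.
  - exact: cvg_cst.
  - rewrite -[X in _ --> X]add0r; apply: cvgD; last exact: cvg_cst.
    by rewrite -[X in _ --> X](normr0 R); apply: cvg_norm.
exact: (cvg_comp _ _ H (@exprn_continuous R n.+1 (enorm z))).
Qed.

(** Since [gk e] is [pk 0 e] divided by [e] and the Poisson kernel has mass one, this is (g - P_e
    g)/e: minus the difference quotient of the Poisson semigroup at time 0. *)
Definition J (e : R) g x : R := ops (gk e) g x.

Section weighted.
Variable f : V -> R.
Hypothesis n0 : (0 < n)%N.
Hypothesis Hf : CN 2 f.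
Hypothesis fi : ibl mu (fun y => `|f y| * W y ^- n.+1).
Let mf : measurable_fun [set: V] f := continuous_measurable (CN_continuous Hf).

Lemma ibl_J e x : 0 < e -> ibl mu (fun y => (f x - f y) * gk e (x - y)).
Proof. by move=> e0; apply: (ibl_ops x (measurable_gk e0) (fun z => gk_W z e0) mf fi). Qed.

Lemma J_sym e x : 0 < e -> J e f x = 2^-1 * I (fun z => sd f x z * gk e z).
Proof. by move=> e0; apply: ops_sym; [exact: gkN|exact: ibl_J]. Qed.

Lemma J_cvg (t : nat -> R) x : (forall j, 0 < t j) -> t @ \oo --> (0 : R) ->
  (fun j => J (t j) f x) @ \oo --> cPn / 2 * I (fun z => sd f x z * k0 z).
Proof.
move=> t0 tc.
rewrite (_ : (fun j => _) = fun j => cPn / 2 * I (fun z => sd f x z * (cPn^-1 * gk (t j) z))); last first.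
  apply/funext => j; rewrite J_sym//.
  have E : I (fun z => sd f x z * gk (t j) z) = I (fun z => cPn * (sd f x z * (cPn^-1 * gk (t j) z))).
    by apply: eq_Ig => z; field; rewrite gt_eqF.
  rewrite E IgZ; first by field.
  have [B B0 /(_ x (lexx _))[D [Di HD _]]] := sd_int (enorm x) n0 Hf fi.
  apply: (ibl_le _ _ Di) => [|z].
    by apply: measurable_funM; [exact: measurable_sd|apply: measurable_funM => //; exact: measurable_gk].
  apply: le_trans (HD z); have [->|z0] := eqVneq z 0.
    by rewrite sd0 mul0r normr0 mulr_ge0// k0_ge0.
  rewrite normrM ler_wpM2l// ger0_norm; last by rewrite mulr_ge0 ?invr_ge0 ?gk_ge0.
  by rewrite ler_pdivrMl//; exact: gk_k0.
apply: cvgMr.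
have [] := @sd_cvg R n (fun j z => cPn^-1 * gk (t j) z) f x n0 Hf fi; last by [].
- by move=> j; apply: measurable_funM => //; exact: measurable_gk.
- by move=> j z z0; rewrite mulr_ge0 ?invr_ge0 ?gk_ge0//= ler_pdivrMl//; exact: gk_k0.
- move=> z z0; rewrite -[X in _ --> X](mulKf (lt0r_neq0 c_gt0)); apply: cvgMr.
  exact: gk_cvg.
Qed.

Definition wt (e : R) z : R := if e < enorm z then k0 z else 0.

Lemma measurable_wt e : measurable_fun [set: V] (wt e).
Proof.
rewrite (_ : wt e = fun z => (e < enorm z)%R%:R * k0 z); last first.
  by apply/funext => z; rewrite /wt; case: ifP => _; rewrite ?mul1r ?mul0r.
apply: measurable_funM; last exact: measurable_k0.
rewrite (_ : (fun z => _) = \1_(enorm @^-1` `]e, +oo[%classic)); last first.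
  apply/funext => z; rewrite indicE; congr (_%:R); congr nat_of_bool.
  by apply/idP/idP; rewrite inE /= in_itv /= andbT.
apply: measurable_indic; rewrite -[X in measurable X]setTI; apply: measurable_enorm => //.
Qed.

Lemma trunc_ops e x : trunc_pv f x e = Rn_integral (fun y => (f x - f y) * wt e (x - y)).
Proof.
rewrite /trunc_pv; congr Rn_integral; apply/funext => y; rewrite /wt.
by case: ifP => _; rewrite ?mulr0.
Qed.

Lemma wt_W e z : 0 < e -> 0 <= wt e z <= (1 + e^-1) ^+ n.+1 * W z ^- n.+1.
Proof.
move=> e0; rewrite /wt; have e1 : 0 < 1 + e^-1 by rewrite ltr_wpDr// invr_ge0 ltW.
case: ltP => ez; last by rewrite lexx mulr_ge0 ?WX_ge0// exprn_ge0// ltW.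
rewrite k0_ge0 /=; have z0 : 0 < enorm z by exact: lt_trans ez.
rewrite -ler_pdivrMl ?exprn_gt0// -invfM -exprMn lef_pV2 ?posrE ?exprn_gt0 ?mulr_gt0 ?W_gt0//.
apply: lerXn2r; rewrite ?nnegrE ?(ltW (W_gt0 _)) ?mulr_ge0 ?(ltW e1) ?enorm_ge0//.
by rewrite mulrDl mul1r /W addrC lerD2l mulrC ler_pdivlMr// mul1r ltW.
Qed.

Lemma wtN e z : wt e (- z) = wt e z.
Proof. by rewrite /wt /k0 enormN. Qed.

Lemma trunc_cvg (t : nat -> R) x : (forall j, 0 < t j) -> t @ \oo --> (0 : R) ->
  (fun j => trunc_pv f x (t j)) @ \oo --> 2^-1 * I (fun z => sd f x z * k0 z).
Proof.
move=> t0 tc.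
rewrite (_ : (fun j => _) = fun j => 2^-1 * I (fun z => sd f x z * wt (t j) z)); last first.
  apply/funext => j.
  have i1 := ibl_ops x (measurable_wt (t j)) (fun z => wt_W z (t0 j)) mf fi.
  by rewrite trunc_ops Rn_integralE//; exact: (ops_sym (wtN (t j)) i1).
apply: cvgMr.
have [] := @sd_cvg R n (fun j => wt (t j)) f x n0 Hf fi; last by [].
- by move=> j; exact: measurable_wt.
- by move=> j z z0; rewrite /wt; case: ifP => _; rewrite ?k0_ge0 ?lexx.
- move=> z z0; apply: cvg_near_cst; near=> j; rewrite /wt ifT//.
  by near: j; apply: (cvgr_lt 0 tc); rewrite enorm_gt0.
Unshelve. all: by end_near. Qed.

(** The limit at 0+ is read off along the sequence 1/(j+1), which brings the principal value into
    the form that [J_cvg] also produces. *)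
Lemma half_lap_eq (P : R) x : odd n -> (fun e => Chalf (n := n) * trunc_pv f x e) @ 0^'+ --> P ->
  P = cPn / 2 * I (fun z => sd f x z * k0 z).
Proof.
move=> on Hc.
have h0 j : 0 < @harmonic R j by rewrite /harmonic invr_gt0.
have hr : @harmonic R @ \oo --> (0 : R)^'+.
  move=> A hA; have B : \forall j \near \oo, 0 < @harmonic R j -> A (harmonic j) := @cvg_harmonic R _ hA.
  by apply: filterS B => j; apply.
have L1 := cvg_comp _ _ hr Hc.
have L2 := @trunc_cvg _ x h0 (@cvg_harmonic R).
apply: (cvg_unique _ L1) => //; rewrite -mulrA -ChalfE//.
exact: cvgMr.
Qed.

Lemma J_bound r : exists2 B : R, 0 <= B & forall x, enorm x <= r ->
  (forall e, 0 < e -> `|J e f x| <= B) /\ `|cPn / 2 * I (fun z => sd f x z * k0 z)| <= B.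
Proof.
have [B B0 HB] := sd_int r n0 Hf fi; exists (cPn / 2 * B); first exact: mulr_ge0.
move=> x xr; have [D [Di HD IB]] := HB x xr.
have msd := measurable_sd x mf.
have D0 z : 0 <= D z by apply: le_trans (HD z); rewrite mulr_ge0// k0_ge0.
split.
- move=> e e0; rewrite J_sym// normrM ger0_norm//.
  have sg z : `|sd f x z * gk e z| <= cPn * D z.
    have [->|z0] := eqVneq z 0; first by rewrite sd0 mul0r normr0 mulr_ge0.
    rewrite normrM (ger0_norm (gk_ge0 _ _)); apply: le_trans (ler_wpM2l _ (gk_k0 e z0)) _ => //.
    by rewrite mulrCA ler_wpM2l.
  have i1 : ibl mu (fun z => sd f x z * gk e z).
    apply: (ibl_le _ sg); last exact: iblZ.
    by apply: measurable_funM => //; exact: measurable_gk.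
  rewrite mulrC -mulrA [_^-1 * _]mulrC mulrA ler_wpM2r//.
  by apply: le_trans (Ig_norm_le i1 (iblZ cPn Di) sg) _; rewrite IgZ// ler_wpM2l.
- rewrite normrM (@ger0_norm _ (cPn / 2)) // ler_wpM2l //.
  have sg z : `|sd f x z * k0 z| <= D z by rewrite normrM (ger0_norm (k0_ge0 _)).
  have i1 : ibl mu (fun z => sd f x z * k0 z).
    apply: (ibl_le _ sg); last exact: Di.
    by apply: measurable_funM => //; exact: measurable_k0.
  by apply: le_trans (Ig_norm_le i1 Di sg) _.
Qed.

Lemma mB2 g : measurable_fun [set: V] g -> measurable_fun [set: V * V] (fun p => g (p.1 - p.2)).
Proof. by move=> mg; apply: (vcomp mg); apply: measurable_rVB. Qed.

(** Because [gk e] has total mass 1/e, each side splits into the integral of f phi / e minus a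
    double integral, and the double integrals agree since the kernel is even. The splitting is
    legitimate for e > 0 only. *)
Lemma J_fubini (e r M : R) (phi : V -> R) : 0 < e -> measurable_fun [set: V] phi -> (forall x, `|phi x| <= M * ball_ind 0 r x) ->
  [/\ ibl mu (fun x => J e f x * phi x), ibl mu (fun x => f x * J e phi x) &
  I (fun x => J e f x * phi x) = I (fun x => f x * J e phi x)].
Proof.
move=> e0 mphi HM.
have iphi : ibl mu phi by apply: (ibl_le mphi HM); apply: iblZ; exact: ibl_ball_ind.
have mg := measurable_gk e0.
have [ip ep] := @int_pk0 R n e e0.
have ig : ibl mu (gk e) by apply: (@eq_ibl _ _ _ mu (fun z => e^-1 * pk 0 e z)); [move=> z; rewrite gk_pk|exact: iblZ].
have igx x : ibl mu (fun y => gk e (x - y)) by exact: ibl_refl.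
have Igx x : I (fun y => gk e (x - y)) = e^-1.
  rewrite Ig_refl// -[RHS]mulr1 -ep -IgZ//; apply: eq_Ig => z; exact: gk_pk.
pose K := cPn * (1 + e^-1) ^+ n.+1.
have K0 : 0 <= K by rewrite mulr_ge0// exprn_ge0// addr_ge0// invr_ge0 ltW.
have fg x y : `|f y * gk e (x - y)| <= K * W x ^+ n.+1 * (`|f y| * W y ^- n.+1).
  have /andP[h1 h2] := gk_W (x - y) e0; rewrite normrM (ger0_norm h1).
  apply: le_trans (ler_wpM2l _ h2) _ => //.
  have -> : K * W x ^+ n.+1 * (`|f y| * W y ^- n.+1) = `|f y| * (K * (W x ^+ n.+1 * W y ^- n.+1)) by ring.
  by rewrite ler_wpM2l// ler_wpM2l// WB.
have ifg x : ibl mu (fun y => f y * gk e (x - y)).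
  by apply: (ibl_le _ (fg x)); [apply: measurable_funM => //; exact: mreflB|exact: iblZ].
have gM z : `|gk e z| <= K.
  have /andP[h1 h2] := gk_W z e0; rewrite ger0_norm//; apply: le_trans h2 _.
  by rewrite ler_piMr//; exact: WX_le1.
have igp y : ibl mu (fun x => gk e (x - y) * phi x).
  apply: (@iblM _ _ _ mu _ _ K) => //.
  by apply: (vcomp mg); apply: measurable_rVB.
have ig2 y : ibl mu (fun x => phi x * gk e (y - x)).
  by apply: eq_ibl (igp y) => x; rewrite mulrC -opprB gkN.
have Jf x : J e f x = f x / e - I (fun y => f y * gk e (x - y)).
  rewrite -(Igx x) -IgZ// -IgB//; last exact: iblZ.
  by apply: eq_Ig => y; rewrite mulrBl.
have Jp y : J e phi y = phi y / e - I (fun x => gk e (x - y) * phi x).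
  rewrite -(Igx y) -IgZ//.
  have -> : I (fun x => gk e (x - y) * phi x) = I (fun x => phi x * gk e (y - x)).
    by apply: eq_Ig => x; rewrite mulrC -opprB gkN.
  by rewrite -IgB//; [apply: eq_Ig => x; rewrite mulrBl|exact: iblZ].
have ifp : ibl mu (fun x => f x * phi x).
  have [C C0 HC] := continuous_bounded (CN_continuous Hf) r.
  apply: (ibl_le _ _ (iblZ (C * M) (ibl_ball_ind 0 r))); first exact: measurable_funM.
  move=> x; rewrite normrM; have := HM x; rewrite /ball_ind subr0; case: ltP => xr h.
    by rewrite -mulrA; apply: ler_pM => //; apply: HC; exact: ltW.
  by rewrite mulr0 in h; rewrite mulr0 mulr_ge0_le0.
have [||||F1 F2 F3] := @Ig_fubini _ _ _ _ R mu mu (fun x y => phi x * (f y * gk e (x - y))).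
- apply: measurable_funM; first exact: (measurableT_comp mphi).
  by apply: measurable_funM; [exact: (measurableT_comp mf)|exact: mB2].
- by move=> x; exact: iblZ.
- by move=> y; apply: eq_ibl (iblZ (f y) (igp y)) => x; ring.
- pose Q := I (fun y => `|f y| * W y ^- n.+1).
  have Q0 : 0 <= Q by apply: Ig_ge0 => y; rewrite mulr_ge0 ?WX_ge0.
  exists (fun x => (M * (K * (1 + `|r|) ^+ n.+1 * Q)) * ball_ind 0 r x); first by apply: iblZ; exact: ibl_ball_ind.
  move=> x; have -> : I (fun y => `|phi x * (f y * gk e (x - y))|) = `|phi x| * I (fun y => `|f y * gk e (x - y)|).
    by rewrite -IgZ; [apply: eq_Ig => y; rewrite normrM|exact: ibl_norm].
  have := HM x; rewrite /ball_ind subr0; case: ltP => xr h; last first.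
    rewrite mulr0 in h; have -> : `|phi x| = 0 by apply/eqP; rewrite eq_le h normr_ge0.
    by rewrite mul0r mulr0.
  rewrite mulr1 in h; rewrite mulr1; apply: ler_pM => //; first exact: Ig_ge0.
  apply: (@le_trans _ _ (I (fun y => K * W x ^+ n.+1 * (`|f y| * W y ^- n.+1)))).
    by apply: Ig_le; [exact: ibl_norm|exact: iblZ|exact: fg].
  rewrite IgZ// ler_wpM2r// ler_wpM2l//; apply: lerXn2r; rewrite ?nnegrE ?(ltW (W_gt0 _)) ?addr_ge0//.
  by rewrite /W lerD2l (le_trans (ltW xr))// ler_norm.
have E1 x : J e f x * phi x = e^-1 * (f x * phi x) - I (fun y => phi x * (f y * gk e (x - y))).
  by rewrite Jf mulrBl (IgZ (phi x) (ifg x)) [X in _ - X]mulrC -mulrA [e^-1 * _]mulrC mulrAC mulrA.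
have E2 y : f y * J e phi y = e^-1 * (f y * phi y) - I (fun x => phi x * (f y * gk e (x - y))).
  have -> : I (fun x => phi x * (f y * gk e (x - y))) = f y * I (fun x => gk e (x - y) * phi x).
    by rewrite -(IgZ (f y) (igp y)); apply: eq_Ig => x; ring.
  by rewrite Jp mulrBr mulrA mulrC [e^-1 * _]mulrC.
have A1 : ibl mu (fun x => J e f x * phi x) by apply: eq_ibl (iblB (iblZ e^-1 ifp) F1) => x; rewrite E1.
have A2 : ibl mu (fun x => f x * J e phi x) by apply: eq_ibl (iblB (iblZ e^-1 ifp) F2) => x; rewrite E2.
split; [exact: A1|exact: A2|].
apply: (etrans (eq_Ig mu E1)).
apply: (etrans (IgB (iblZ e^-1 ifp) F1)).
apply: (etrans (congr1 (fun t => _ - t) F3)).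
apply: esym; apply: (etrans (eq_Ig mu E2)).
exact: (IgB (iblZ e^-1 ifp) F2).
Qed.

End weighted.

Lemma L_half_ibl f : L_half f -> ibl mu (fun y => `|f y| * W y ^- n.+1).
Proof.
move=> [mf fi].
have mf' : measurable_fun [set: V] f by move=> _ B mB; rewrite setTI; exact: mf.
have me : measurable_fun [set: V] (fun y => (1 + enorm y ^+ n.+1)^-1 : R).
  apply: measurable_funV; apply: measurable_funD => //; apply: measurable_funX; exact: measurable_enorm.
have e1 y : 0 < 1 + enorm y ^+ n.+1 :> R by rewrite ltr_pwDl// exprn_ge0// enorm_ge0.
have i1 : ibl mu (fun y => `|f y| / (1 + enorm y ^+ n.+1)).
  apply: ibl_ge0; first by apply: measurable_funM => //; exact: measurableT_comp.
  - by move=> y; rewrite divr_ge0// ltW.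
  - have mF : measurable_fun [set: V] (fun y => (`|f y| / (1 + enorm y ^+ n.+1))%:E).
      by apply/measurable_EFinP; apply: measurable_funM => //; exact: measurableT_comp.
    have F0 y : (0 <= (`|f y| / (1 + enorm y ^+ n.+1))%:E)%E by rewrite lee_fin divr_ge0// ltW.
    by rewrite int_vmeas.
apply: (ibl_le _ _ i1).
  apply: measurable_funM; first exact: measurableT_comp.
  by apply: continuous_measurable; exact: WX_continuous.
move=> y; rewrite ger0_norm ?mulr_ge0 ?WX_ge0// ler_wpM2l// lef_pV2 ?posrE ?exprn_gt0 ?W_gt0//.
rewrite /W [(1 + enorm y) ^+ n.+1]exprS mulrDl mul1r; apply: lerD.
  by rewrite exprn_ege1// lerDl enorm_ge0.
rewrite exprS ler_wpM2l ?enorm_ge0//; apply: lerXn2r; rewrite ?nnegrE ?enorm_ge0 ?addr_ge0 ?enorm_ge0//.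
by rewrite lerDr.
Qed.

End half_laplacian_limits.

(** * Testing the half Laplacian against differences of kernels *)

Section half_laplacian_test.
Context {R : realType} {n : nat}.
Notation V := 'rV[R]_n.
Notation mu := (@vmeas R n).
Notation I := (Ig mu).
Implicit Types (x y z : V).
Local Notation cPn := (@cP R n).
Let c_gt0 : 0 < cPn := @cP_gt0 R n.
Let c_ge0 : 0 <= cPn := ltW c_gt0.

(** The weight is at most a multiple of the Poisson kernel at time 1, and P_1 * P_1 = P_2 is again
    bounded by a multiple of the weight: the semigroup law replaces a splitting of the convolution
    into regions. *)
Lemma W_conv : exists2 K : R, 0 <= K & forall x,
  ibl mu (fun z => W z ^- n.+1 * W (x - z) ^- n.+1) /\
  I (fun z => W z ^- n.+1 * W (x - z) ^- n.+1) <= K * W x ^- n.+1.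
Proof.
exists (2 * cPn^-1 * 2 ^+ n.+1); first by rewrite !mulr_ge0 ?invr_ge0 ?exprn_ge0.
move=> x; have l1 : (0 : R) < 1 by [].
have Wr z : W z ^- n.+1 <= cPn^-1 * pk 0 1 z.
  rewrite pk0E mulr1 mulKf; last exact: lt0r_neq0.
  rewrite lef_pV2 ?posrE ?exprn_gt0 ?W_gt0 ?rho_gt0'//; apply: lerXn2r; rewrite ?nnegrE ?(ltW (W_gt0 _))//.
    exact: ltW (rho_gt0' _ l1).
  by have := rho_le 1 z; rewrite normr1.
have i0 := ibl_conv 0 0 x l1 l1.
have B z : `|W z ^- n.+1 * W (x - z) ^- n.+1| <= cPn^-1 ^+ 2 * (pk 0 1 (x - z) * pk 0 1 z).
  rewrite ger0_norm ?mulr_ge0 ?WX_ge0//.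
  have -> : cPn^-1 ^+ 2 * (pk 0 1 (x - z) * pk 0 1 z) = (cPn^-1 * pk 0 1 z) * (cPn^-1 * pk 0 1 (x - z)) by ring.
  by apply: ler_pM; rewrite ?WX_ge0.
have i1 : ibl mu (fun z => W z ^- n.+1 * W (x - z) ^- n.+1).
  apply: (ibl_le _ B); last exact: iblZ.
  have mW : measurable_fun [set: V] (fun z => W z ^- n.+1 : R) by apply: continuous_measurable; exact: WX_continuous.
  by apply: measurable_funM => //; exact: (mreflB x mW).
split => //; apply: le_trans (ler_norm _) _.
apply: le_trans (Ig_norm_le i1 (iblZ _ i0) B) _; rewrite IgZ// -/(pconv 0 0 x 1 1) conv00// pk0E.
have -> : cPn^-1 ^+ 2 * (cPn * (1 + 1) * rp n.+1 (1 + 1) x) = 2 * cPn^-1 * rp n.+1 (1 + 1) x.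
  by field; exact: lt0r_neq0.
rewrite -[leRHS]mulrA ler_wpM2l ?mulr_ge0 ?invr_ge0//.
apply: le_trans (rp_le n.+1 x l1 _) _; first by rewrite lerDl.
by have := rp_W n.+1 x l1; rewrite invr1.
Qed.

Lemma W_near q x y (c : R) : enorm (y - x) <= c -> W y ^- q <= (1 + c) ^+ q * W x ^- q.
Proof.
move=> yx; have := WB q (y - x) (- x); rewrite opprK subrK WN => /le_trans; apply.
rewrite ler_wpM2r ?WX_ge0//; apply: lerXn2r; rewrite ?nnegrE ?(ltW (W_gt0 _)) ?lerD2l//.
by rewrite addr_ge0// (le_trans (enorm_ge0 _) yx).
Qed.

(** The decay |x|^(-n-1) survives the half Laplacian, with a constant independent of [e]. This
    uniformity is what allows e -> 0 before the cutoff is removed in [half_lap_test]. *)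
Lemma J_decay : (0 < n)%N -> exists2 K : R, 0 <= K & forall (g : V -> R) C e x, 0 <= C -> 0 < e -> CN 2 g ->
  (forall y, `|g y| <= C * W y ^- n.+1) ->
  (forall i j y, `|partial j (partial i g) y| <= C * W y ^- n.+1) ->
  `|J e g x| <= K * C * W x ^- n.+1.
Proof.
move=> n0; have [Kw Kw0 HK] := W_conv.
have isg : ibl mu (sing n.-1%:R) by apply: ibl_sing; rewrite ltr_nat prednK.
have S0 : 0 <= I (sing n.-1%:R) by apply: Ig_ge0 => y; exact: sing_ge0.
have W0 : 0 <= I (fun z => W z ^- n.+1) by apply: Ig_ge0 => y; exact: WX_ge0.
have iW := @ibl_W R n.
pose K := cPn * (3 ^+ n.+1 * n%:R ^+ 2 * I (sing n.-1%:R) + 2 ^+ n.+1 * (2 * I (fun z => W z ^- n.+1) + (Kw + Kw))).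
have K0 : 0 <= K.
  by apply: mulr_ge0 => //; rewrite addr_ge0 ?mulr_ge0 ?exprn_ge0// addr_ge0 ?mulr_ge0// addr_ge0.
exists K => // g C e x C0 e0 Hg gB g2B.
have mg := continuous_measurable (CN_continuous Hg).
have gi : ibl mu (fun y => `|g y| * W y ^- n.+1).
  apply: (@ibl_le _ _ _ mu _ (fun y => C * W y ^- n.+1)); last exact: iblZ.
    apply: measurable_funM; first exact: measurableT_comp.
    by apply: continuous_measurable; exact: WX_continuous.
  move=> y; rewrite ger0_norm ?mulr_ge0 ?WX_ge0//; apply: le_trans (gB y).
  by rewrite ler_piMr//; exact: WX_le1.
have [i1 I1] := HK x.
have E2 z : W (0 - z) ^- n.+1 * W (x - (0 - z)) ^- n.+1 = W z ^- n.+1 * W (x + z) ^- n.+1 :> R.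
  by rewrite sub0r opprK WN.
have i2 : ibl mu (fun z => W z ^- n.+1 * W (x + z) ^- n.+1) := eq_ibl E2 (ibl_refl 0 i1).
have I2 : I (fun z => W z ^- n.+1 * W (x + z) ^- n.+1) <= Kw * W x ^- n.+1.
  by rewrite -(eq_Ig mu E2) (Ig_refl 0 i1).
pose A := C * (3 ^+ n.+1 * W x ^- n.+1).
have A0 : 0 <= A by rewrite !mulr_ge0 ?exprn_ge0 ?WX_ge0.
pose D z := A * n%:R ^+ 2 * sing n.-1%:R z + (2 ^+ n.+1 * C) *
   (2 * W x ^- n.+1 * W z ^- n.+1 + (W z ^- n.+1 * W (x + z) ^- n.+1 + W z ^- n.+1 * W (x - z) ^- n.+1)).
have j1 := iblZ (A * n%:R ^+ 2) isg.
have j2 := iblZ (2 * W x ^- n.+1) iW.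
have j3 := iblD i2 i1.
have j4 := iblZ (2 ^+ n.+1 * C) (iblD j2 j3).
have Di : ibl mu D := iblD j1 j4.
have D0 z : 0 <= D z.
  have w1 := WX_ge0 n.+1 x; have w2 := WX_ge0 n.+1 z; have w3 := WX_ge0 n.+1 (x + z).
  have w4 := WX_ge0 n.+1 (x - z); have s1 := sing_ge0 n.-1%:R z.
  apply: addr_ge0; first by apply: mulr_ge0 => //; apply: mulr_ge0 => //; exact: sqr_ge0.
  apply: mulr_ge0; first by apply: mulr_ge0 => //; exact: exprn_ge0.
  apply: addr_ge0; first by apply: mulr_ge0 => //; apply: mulr_ge0.
  by apply: addr_ge0; apply: mulr_ge0.
have SD z : `|sd g x z * gk e z| <= cPn * D z.
  have [->|z0] := eqVneq z 0.
    rewrite sd0 mul0r normr0; exact: mulr_ge0.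
  rewrite normrM (ger0_norm (gk_ge0 _ _)); apply: le_trans (ler_wpM2l _ (gk_k0 e z0)) _ => //.
  rewrite mulrCA ler_wpM2l//.
  apply: le_trans (sd_dom z n0 A0 (fun i => CN_dpar i Hg) (fun i j => CN_dpar j (CN_partial i Hg)) _) _.
    move=> i j y yx; apply: le_trans (g2B i j y) _; rewrite ler_wpM2l//.
    by have := W_near n.+1 yx; rewrite (_ : 1 + 2 = 3)//; ring.
  rewrite lerD2l -[leRHS]mulrA ler_wpM2l ?exprn_ge0//.
  have -> : C * (2 * W x ^- n.+1 * W z ^- n.+1 + (W z ^- n.+1 * W (x + z) ^- n.+1 + W z ^- n.+1 * W (x - z) ^- n.+1)) =
     W z ^- n.+1 * (2 * (C * W x ^- n.+1) + C * W (x + z) ^- n.+1 + C * W (x - z) ^- n.+1) by ring.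
  rewrite ler_wpM2l ?WX_ge0//; apply: lerD => //; apply: lerD => //.
  by rewrite ler_wpM2l.
have i0 : ibl mu (fun z => sd g x z * gk e z).
  by apply: (ibl_le _ SD); [apply: measurable_funM; [exact: measurable_sd|exact: measurable_gk]|exact: iblZ].
rewrite (J_sym Hg gi x e0) normrM ger0_norm//.
apply: (@le_trans _ _ `|I (fun z => sd g x z * gk e z)|); first by rewrite ler_piMl// invf_le1// ler1n.
apply: le_trans (Ig_norm_le i0 (iblZ cPn Di) SD) _; rewrite (IgZ _ Di).
have -> : K * C * W x ^- n.+1 = cPn * (A * n%:R ^+ 2 * I (sing n.-1%:R) +
   2 ^+ n.+1 * C * (2 * W x ^- n.+1 * I (fun z => W z ^- n.+1) + (Kw * W x ^- n.+1 + Kw * W x ^- n.+1))).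
  rewrite /K /A; move: (I (sing n.-1%:R)) (I (fun z => W z ^- n.+1)) => a b.
  by move: cPn (3 ^+ _) (2 ^+ _) (W x ^- _) => c d f w; ring.
rewrite ler_wpM2l// (IgD j1 j4) (IgZ _ isg) (IgZ _ (iblD j2 j3)) (IgD j2 j3) (IgZ _ iW) (IgD i2 i1).
by rewrite lerD2l ler_wpM2l ?mulr_ge0 ?exprn_ge0// lerD2l lerD.
Qed.

Section differences.
Variables (i : 'I_n) (h : R) (k : nat).
Local Notation Dk := (iter k (fdiff (h *: ebasis i : V))).

Lemma rhoX_W (d : int) s0 x0 : 0 < s0 -> d <= 0 -> exists2 K : R, 0 <= K & forall s y (t : R), s0 <= s ->
  `|t| <= k%:R * `|h| -> rho s (x0 - y + t *: ebasis i) ^ d <= K * W y ^ d.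
Proof.
move=> s00; case: d => [[|//]|m] _; first by exists 1 => // s y t _ _; rewrite !expr0z mulr1.
rewrite NegzE; pose K := (1 + s0^-1) * (W x0 + k%:R * `|h|).
have e1 : 0 < 1 + s0^-1 by rewrite ltr_wpDr// invr_ge0 ltW.
have e2 : 0 < W x0 + k%:R * `|h| by rewrite ltr_wpDr ?mulr_ge0// W_gt0.
have K0 : 0 < K by rewrite mulr_gt0.
exists (K ^+ m.+1); first by rewrite exprn_ge0// ltW.
move=> s y t ss tk; have s1 : 0 < s by exact: lt_le_trans ss.
rewrite -!exprnN; apply: le_trans (rp_le m.+1 _ s00 ss) _.
apply: le_trans (rp_W m.+1 _ s00) _; rewrite exprMn -mulrA ler_wpM2l ?exprn_ge0 ?(ltW e1)//.
have -> : x0 - y + t *: ebasis i = (x0 + t *: ebasis i) - y by rewrite addrAC.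
apply: le_trans (WB _ _ _) _; rewrite ler_wpM2r ?WX_ge0//; apply: lerXn2r; rewrite ?nnegrE ?(ltW (W_gt0 _)) ?(ltW e2)//.
rewrite /W -addrA lerD2l; apply: le_trans (enorm_triangle _ _) _; rewrite lerD2l enormZ enorm_ebasis mulr1//.
Qed.

Lemma fdiff_W d g s0 x0 : @Sy R n R pos rho k d g -> 0 < s0 -> d - k%:Z <= 0 -> exists2 C : R, 0 <= C &
  forall s y, s0 <= s -> `|Dk (g s) (x0 - y)| <= C * W y ^ (d - k%:Z).
Proof.
move=> Hg s00 d0; have [C C0 HC] := fdiff_Sy_bound Hg; have [K K0 HK] := rhoX_W x0 s00 d0.
exists (C * `|h| ^+ k * K); first by rewrite !mulr_ge0 ?exprn_ge0.
move=> s y ss; rewrite -mulrA; apply: HC; first exact: lt_le_trans ss.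
by move=> t tk; exact: HK.
Qed.

Lemma continuous_shiftV (g : V -> R) a : continuous g -> continuous (fun x => g (x + a)).
Proof.
move=> cg x; apply/continuousVP => e e0; have [d d0 H] := (continuousVP g (x + a)).1 (cg _) e e0.
by exists d => // y yx; apply: H; rewrite opprD addrACA subrr addr0.
Qed.

Lemma Dk_continuous (g : V -> R) : continuous g -> continuous (Dk g).
Proof.
move=> cg; have [c _ Hc] := @iter_fdiffE R n k.
have -> : Dk g = fun x => \sum_(j < k.+1) c j * g (x + j%:R *: (h *: ebasis i)).
  by apply/funext => x; exact: Hc.
apply: (@CN_continuous _ _ 0); apply: CN_sum => j; apply: CN_M; first exact: CN_C.
by split => //; exact: continuous_shiftV.
Qed.

(** At a fixed time [rho] is comparable to 1 + |y|, even along the segments swept by the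
    differences, so the kernel becomes a symbol for the same weight as the cutoffs and can be
    multiplied by them. *)
Lemma Sy_fdiff N d g s x0 : 0 < s -> @Sy R n R pos rho (N + k) d g -> d - k%:Z <= 0 ->
  @Sy R n R ge1 (fun _ => W) N (d - k%:Z) (fun _ y => Dk (g s) (x0 - y)).
Proof.
move=> s0; elim: N d g => [|N IH] d g Hg d0.
  have [C C0 HC] := fdiff_W x0 Hg s0 d0.
  split => //; first by exists C => _ y _; exact: HC.
  by move=> _ _; apply: continuous_reflV; apply: Dk_continuous; exact: Sy_cont Hg s s0.
have [C C0 HC] := fdiff_W x0 (Sy_le (leq_addl _ _) Hg) s0 d0.
split; first by exists C => _ y _; exact: HC.
  by move=> _ _; apply: continuous_reflV; apply: Dk_continuous; exact: Sy_cont Hg s s0.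
move=> i'; have [_ _ /(_ i')[g' Dg Sg]] := Hg.
exists (fun _ y => -1 * Dk (g' s) (x0 - y)).
  move=> _ _ y; apply: (der_eq (dpar_refl x0 (dpar_iter_fdiff (h *: ebasis i) k (Dg s s0)) y)) => //.
  by rewrite mulN1r.
have W0 (t : R) (z : V) : ge1 t -> 0 < W z :> R by move=> _; exact: W_gt0.
apply: (Sy_Z W0); rewrite (_ : d - k%:Z - 1 = d - 1 - k%:Z); last by ring.
by apply: IH => //; rewrite (le_trans _ d0)// lerD2r lerBlDr lerDl.
Qed.

Lemma is_derive_Dk (g g' : R -> V -> R) (s : R) x : dsg g g' -> s != 0 ->
  is_derive s 1 (fun s => Dk (g s) x) (Dk (g' s) x).
Proof.
move=> H s0; elim: k x => [|m IH] x; first exact: H.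
by rewrite iterS; apply: (der_eq (derB (IH (x + h *: ebasis i)) (IH x))).
Qed.

Lemma cut_cvg K x : (fun j : nat => cutoff K.+3 j.+1%:R x) @ \oo --> (1 : R).
Proof.
have W0 (t : R) (z : V) : ge1 t -> 0 < W z :> R by move=> _; exact: W_gt0.
have [C C0 HC] := Sy_bound W0 (@Sy_1cut R n 0 K.+1 isT).
have B j : `|1 - cutoff K.+3 j.+1%:R x| <= C * W x * (@harmonic R j).
  have j1 : ge1 (j.+1%:R : R) by rewrite /ge1 ler1n.
  have := HC j.+1%:R x j1; rewrite expr1z normrM ger0_norm// => h1.
  by rewrite /harmonic ler_pdivlMr// mulrC.
have L : (fun j => C * W x * @harmonic R j) @ \oo --> (0 : R).
  by rewrite -[X in _ --> X](mulr0 (C * W x)); apply: cvgMr; exact: cvg_harmonic.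
apply/cvgrPdist_le => e e0; near=> j; apply: le_trans (B j) _; apply: ltW.
by near: j; apply: (cvgr_lt 0 L).
Unshelve. all: by end_near. Qed.

Lemma conv_pk0 (s e : R) a y : 0 < s -> 0 < e ->
  ibl mu (fun z => pk 0 s (a - z) * pk 0 e (y - z)) /\
  I (fun z => pk 0 s (a - z) * pk 0 e (y - z)) = pk 0 (s + e) (a - y).
Proof.
move=> s0 e0; have i0 := ibl_conv 0 0 (a - y) s0 e0.
have en : e != 0 by rewrite gt_eqF.
have E z : pk 0 s (a - y - (z + - y)) * pk 0 e (z + - y) = pk 0 s (a - z) * pk 0 e (y - z) :> R.
  have -> : a - y - (z + - y) = a - z by rewrite opprB addrA subrK.
  by rewrite -[y - z]opprB pk_even.
have i1 := ibl_shift (- y) i0.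
split; first exact: eq_ibl E i1.
by rewrite -(eq_Ig mu E) (Ig_shift (- y) i0) -/(pconv 0 0 (a - y) s e) conv00.
Qed.

(** P_e P_s = P_(s+e), so on kernels [J] is exactly a difference quotient in time; its limit as e ->
    0 is minus the differences of [pk 1]. *)
Lemma J_Dk (s e : R) x0 y : 0 < s -> 0 < e ->
  J e (fun z => Dk (pk 0 s) (x0 - z)) y = - (e^-1 * (Dk (pk 0 (s + e)) (x0 - y) - Dk (pk 0 s) (x0 - y))).
Proof.
move=> s0 e0; have [c _ Hc] := @iter_fdiffE R n k.
pose a (j : nat) := x0 + j%:R *: (h *: ebasis i : V).
have Da t z : Dk (pk 0 t) (x0 - z) = \sum_(j < k.+1) c j * pk 0 t (a j - z) :> R.
  by rewrite Hc; apply: eq_bigr => j _; rewrite /a addrAC.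
have ic j := proj1 (conv_pk0 (a j) y s0 e0).
have iP : ibl mu (fun z => Dk (pk 0 s) (x0 - z) * pk 0 e (y - z)).
  apply: (@eq_ibl _ _ _ mu (fun z => \sum_(j < k.+1) c j * (pk 0 s (a j - z) * pk 0 e (y - z)))).
    by move=> z; rewrite Da mulr_suml; apply: eq_bigr => j _; rewrite mulrA.
  by apply: ibl_sum => j; exact: iblZ.
have IP : I (fun z => Dk (pk 0 s) (x0 - z) * pk 0 e (y - z)) = Dk (pk 0 (s + e)) (x0 - y).
  rewrite Da; transitivity (I (fun z => \sum_(j < k.+1) c j * (pk 0 s (a j - z) * pk 0 e (y - z)))).
    by apply: eq_Ig => z; rewrite Da mulr_suml; apply: eq_bigr => j _; rewrite mulrA.
  rewrite Ig_sum; last by move=> j; exact: iblZ.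
  by apply: eq_bigr => j _; rewrite (IgZ _ (ic j)) (proj2 (conv_pk0 (a j) y s0 e0)).
have [ip ep] := @int_pk0 R n e e0.
have ipy := ibl_refl y ip.
rewrite /J /ops; transitivity (I (fun z => e^-1 * (Dk (pk 0 s) (x0 - y) * pk 0 e (y - z) - Dk (pk 0 s) (x0 - z) * pk 0 e (y - z)))).
  by apply: eq_Ig => z; rewrite gk_pk//; ring.
rewrite (IgZ _ (iblB (iblZ _ ipy) iP)) (IgB (iblZ _ ipy) iP) (IgZ _ ipy) (Ig_refl y ip) ep mulr1 IP.
by ring.
Qed.

(** The test function has no compact support, so it is cut off at scale r and the error is carried
    by [psi]. Its order 1 - n - k must be at most -(n+1) for [J_decay], which is where 1 < k
    enters. *)
Lemma half_lap_test (f P : V -> R) (s : R) x0 : (0 < n)%N -> (1 < k)%N -> 0 < s -> CN 2 f ->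
  ibl mu (fun y => `|f y| * W y ^- n.+1) -> ibl mu P ->
  (forall x, P x = cPn / 2 * I (fun z => sd f x z * k0 z)) ->
  I (fun y => P y * Dk (pk 0 s) (x0 - y)) = - I (fun y => f y * Dk (pk 1 s) (x0 - y)).
Proof.
move=> n0 k1 s0 Hf fi Pi PE.
have d1 : - (n + 1)%:Z - k%:Z <= 0 by clear; lia.
have d2 : - (n + 1)%:Z - k%:Z <= - n.+1%:Z by clear; lia.
have mf := continuous_measurable (CN_continuous Hf).
have W0 (t : R) (z : V) : ge1 t -> 0 < W z :> R by move=> _; exact: W_gt0.
have Wd (d : int) y : d <= - n.+1%:Z -> W y ^ d <= W y ^- n.+1 :> R.
  by move=> hd; rewrite exprnN; apply: ler_weXz2l => //; exact: W_ge1.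
pose phi y := Dk (pk 0 s) (x0 - y) : R.
pose q y := Dk (pk 1 s) (x0 - y) : R.
have Sp N := sp_Sy N (@pk_sp R n 0).
have Sphi : @Sy R n R ge1 (fun _ => W) 2 (- (n + 0)%:Z - k%:Z) (fun _ => phi).
  by apply: Sy_fdiff => //; lia.
have SG := Sy_M W0 (@Sy_1cut R n 2 3 isT) Sphi.
have [Kp Kp0 HKp] := Sy_bound W0 Sphi.
have [G0 G00 HG0] := Sy_bound W0 SG.
have cphi : continuous phi := Sy_cont Sphi (lexx (1 : R)).
have mphi := continuous_measurable cphi.
have cq : continuous q.
  by apply: continuous_reflV; apply: Dk_continuous; exact: pk_continuous.
have phiB y : `|phi y| <= Kp * W y ^- n.+1.
  by apply: le_trans (HKp 1 y (lexx _)) _; rewrite ler_wpM2l// Wd//; lia.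
(* psi r is r times the part of phi removed by the cutoff at scale r *)
pose psi (r : R) y := r * (1 - cutoff 5 r y) * phi y.
have psiB r y : 1 <= r -> `|psi r y| <= G0 * W y ^- n.+1.
  by move=> r1; apply: le_trans (HG0 r y r1) _; rewrite ler_wpM2l// Wd//; lia.
have [G2 G20 HG2] : exists2 C : R, 0 <= C & forall i j r y, 1 <= r -> `|partial j (partial i (psi r)) y| <= C * W y ^- n.+1.
  have H (p : 'I_n * 'I_n) : exists C : R, 0 <= C /\ forall r y, 1 <= r -> `|partial p.2 (partial p.1 (psi r)) y| <= C * W y ^- n.+1.
    have [C C0 HC] := Sy_bound W0 (Sy_partial p.2 (Sy_partial p.1 SG)).
    exists C; split => // r y r1; apply: le_trans (HC r y r1) _; rewrite ler_wpM2l// Wd//; lia.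
  have [C HC] := choice H; exists (\sum_p C p); first by apply: sumr_ge0 => p _; case: (HC p).
  move=> i1 i2 r y r1; have [_ /(_ r y r1)/le_trans] := HC (i1, i2); apply.
  rewrite ler_wpM2r ?WX_ge0// (bigD1 (i1, i2))//= lerDl sumr_ge0// => p _; by case: (HC p).
have [KJ KJ0 HJ] := J_decay n0.
pose Cp := G0 + G2.
have Cp0 : 0 <= Cp by rewrite addr_ge0.
have psiC r : 1 <= r -> CN 2 (psi r) by move=> r1; exact: Sy_CN SG r r1.
have Jpsi e r y : 0 < e -> 1 <= r -> `|J e (psi r) y| <= KJ * Cp * W y ^- n.+1.
  move=> e0 r1.
  have a1 z : `|psi r z| <= Cp * W z ^- n.+1.
    by apply: le_trans (psiB r z r1) _; rewrite ler_wpM2r ?WX_ge0// lerDl.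
  have a2 a b z : `|partial b (partial a (psi r)) z| <= Cp * W z ^- n.+1.
    by apply: le_trans (HG2 a b r z r1) _; rewrite ler_wpM2r ?WX_ge0// lerDr.
  exact: (HJ (psi r) Cp e y Cp0 e0 (psiC r r1) a1 a2).
have wI (g : V -> R) (C : R) : measurable_fun [set: V] g -> (forall y, `|g y| <= C * W y ^- n.+1) -> ibl mu (fun y => `|g y| * W y ^- n.+1).
  move=> mg gB; apply: (@ibl_le _ _ _ mu _ (fun y => C * W y ^- n.+1)); last by apply: iblZ; exact: ibl_W.
    apply: measurable_funM; first exact: measurableT_comp.
    by apply: continuous_measurable; exact: WX_continuous.
  move=> y; rewrite ger0_norm ?mulr_ge0 ?WX_ge0//; apply: le_trans (gB y).
  by rewrite ler_piMr//; exact: WX_le1.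
pose phir r y := cutoff 5 r y * phi y.
have phirE r y : 1 <= r -> phir r y = phi y - r^-1 * psi r y.
  by move=> r1; rewrite /phir /psi; field; rewrite gt_eqF// (lt_le_trans ltr01).
have Jlin e r y : 0 < e -> 1 <= r -> J e (phir r) y = J e phi y - r^-1 * J e (psi r) y.
  move=> e0 r1.
  have mpsi := continuous_measurable (CN_continuous (psiC r r1)).
  have i1 := ibl_ops y (measurable_gk e0) (fun z => gk_W z e0) mphi (wI _ _ mphi phiB).
  have i2 := ibl_ops y (measurable_gk e0) (fun z => gk_W z e0) mpsi (wI _ _ mpsi (fun y => psiB r y r1)).
  rewrite /J /ops -(IgZ _ i2) -(IgB i1 (iblZ _ i2)); apply: eq_Ig => z.
  by rewrite !phirE//; ring.
pose M := I (fun y => `|f y| * W y ^- n.+1).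
have M0 : 0 <= M by apply: Ig_ge0 => y; rewrite mulr_ge0 ?WX_ge0.
have [Cd Cd0 HCd] := fdiff_W x0 (sp_Sy k (@pk_sp R n 1)) s0 d1.
have JB e y : 0 < e -> `|J e phi y| <= Cd * W y ^- n.+1.
  move=> e0; rewrite J_Dk// normrN normrM [X in X * _]gtr0_norm ?invr_gt0//.
  have se : s < s + e by rewrite ltrDl.
  have Hd (c : R) : s <= c -> is_derive c 1 (fun s => Dk (pk 0 s) (x0 - y)) (Dk (pk 1 c) (x0 - y)).
    by move=> sc; apply: is_derive_Dk; [exact: pk_ds|rewrite gt_eqF// (lt_le_trans s0)].
  have [||c] := @MVT R (fun s => Dk (pk 0 s) (x0 - y)) (fun s => Dk (pk 1 s) (x0 - y)) s (s + e) se.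
  - by move=> c; rewrite in_itv /= => /andP[c1 _]; apply: Hd; exact: ltW.
  - apply: derivable_within_continuous => c; rewrite in_itv /= => /andP[c1 _].
    by have [] := Hd c c1.
  rewrite in_itv /= => /andP[c1 c2] ->; rewrite addrAC subrr add0r normrM (gtr0_norm e0) mulrCA mulVf ?gt_eqF// mulr1.
  by apply: le_trans (HCd c y (ltW c1)) _; rewrite ler_wpM2l// Wd.
pose t (j : nat) : R := @harmonic R j.
have t0 j : 0 < t j by rewrite /t /harmonic invr_gt0.
have tc : t @ \oo --> (0 : R) by exact: cvg_harmonic.
have mJphi e : 0 < e -> measurable_fun [set: V] (fun y => J e phi y).
  move=> e0; rewrite (_ : (fun y => _) = fun y => - (e^-1 * (Dk (pk 0 (s + e)) (x0 - y) - Dk (pk 0 s) (x0 - y)))); last first.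
    by apply/funext => y; exact: J_Dk.
  apply: measurable_funN; apply: measurable_funM => //; apply: measurable_funB.
    by apply: continuous_measurable; apply: continuous_reflV; apply: Dk_continuous; apply: pk_continuous; rewrite addr_gt0.
  exact: mphi.
have fJ e y : 0 < e -> `|f y * J e phi y| <= Cd * (`|f y| * W y ^- n.+1).
  by move=> e0; rewrite normrM mulrCA ler_wpM2l// JB.
have [Fq FqL] : ibl mu (fun y => f y * - q y) /\ (fun j => I (fun y => f y * J (t j) phi y)) @ \oo --> I (fun y => f y * - q y).
  apply: (@Ig_dct _ _ _ mu _ _ (fun y => Cd * (`|f y| * W y ^- n.+1))).
  - by move=> j; apply: measurable_funM => //; exact: mJphi.
  - exact: iblZ.
  - by move=> j y; exact: fJ.
  - move=> y; apply: cvgMr.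
    rewrite (_ : (fun j => _) = fun j => - ((t j)^-1 * (Dk (pk 0 (s + t j)) (x0 - y) - Dk (pk 0 s) (x0 - y)))); last first.
      by apply/funext => j; exact: J_Dk.
    apply: cvgN.
    have [D DE] := @is_derive_Dk _ _ s (x0 - y) (@pk_ds R n 0) (lt0r_neq0 s0).
    have hc : t @ \oo --> (0 : R)^'.
      move=> A hA; have B : \forall j \near \oo, t j != 0 -> A (t j) := tc _ hA.
      by apply: filterS B => j; apply; rewrite gt_eqF.
    rewrite /q -DE; have := cvg_comp _ _ hc D.
    apply: cvg_trans; apply: near_eq_cvg; apply: nearW => j.
    by rewrite /= [s + _]addrC /GRing.scale /= mulr1.
have KEY r : 1 <= r -> `|I (fun y => P y * phir r y) - I (fun y => f y * - q y)| <= r^-1 * (KJ * Cp * M).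
  move=> r1; have r0 : 0 < r by exact: lt_le_trans r1.
  have [B B0 HB] := J_bound n0 Hf fi r.
  have cphir : continuous (phir r).
    by move=> x; apply: (@continuousM _ _ (cutoff 5 r) phi); [exact: cut_continuous|exact: cphi].
  have mphir := continuous_measurable cphir.
  have phirB y : `|phir r y| <= Kp * ball_ind 0 r y.
    rewrite /phir /ball_ind subr0; case: ltP => yr; last by rewrite cut_supp// mul0r normr0 mulr0.
    rewrite mulr1 normrM; apply: le_trans (_ : 1 * `|phi y| <= _).
      by rewrite ler_wpM2r// ger0_norm ?cut_ge0// cut_le1.
    rewrite mul1r; apply: le_trans (phiB y) _; rewrite ler_piMr//; exact: WX_le1.
  have FB j := J_fubini Hf fi (t0 j) mphir phirB.
  have [_ L1] : ibl mu (fun y => P y * phir r y) /\ (fun j => I (fun y => J (t j) f y * phir r y)) @ \oo --> I (fun y => P y * phir r y).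
    apply: (@Ig_dct _ _ _ mu _ _ (fun y => (B * Kp) * ball_ind 0 r y)).
    - by move=> j; have [/ibl_meas] := FB j.
    - by apply: iblZ; exact: ibl_ball_ind.
    - move=> j y; rewrite normrM; move: (phirB y); rewrite /ball_ind subr0; case: ltP => yr h1.
        rewrite -[leRHS]mulrA; apply: ler_pM => //.
        by have [/(_ (t j) (t0 j))] := HB y (ltW yr).
      rewrite mulr0 in h1; rewrite mulr0; apply: mulr_ge0_le0 => //.
    - by move=> y; apply: cvgMl; rewrite PE; exact: J_cvg.
  have L4 : (fun j => `|I (fun y => J (t j) f y * phir r y) - I (fun y => f y * J (t j) phi y)|) @ \oo -->
     `|I (fun y => P y * phir r y) - I (fun y => f y * - q y)| by apply: cvg_norm; exact: cvgB.
  rewrite -(cvg_lim _ L4)//; apply: limr_le; first by apply/cvg_ex; eexists; exact: L4.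
  apply: nearW => j; have [F1 F2 F3] := FB j.
  have iJ : ibl mu (fun y => f y * J (t j) phi y).
    by apply: (ibl_le _ (fun y => fJ (t j) y (t0 j))); [apply: measurable_funM => //; exact: mJphi|exact: iblZ].
  have E : I (fun y => J (t j) f y * phir r y) - I (fun y => f y * J (t j) phi y) = I (fun y => f y * J (t j) (phir r) y - f y * J (t j) phi y).
    by apply: (etrans (congr1 (fun a => a - _) F3)); rewrite (IgB F2 iJ).
  rewrite [X in `|X| <= _]E.
  have iD := iblB F2 iJ.
  have iM := iblZ (r^-1 * (KJ * Cp)) fi.
  apply: le_trans (Ig_norm_le iD iM _) _.
    move=> y; rewrite Jlin//.
    have -> : f y * (J (t j) phi y - r^-1 * J (t j) (psi r) y) - f y * J (t j) phi y = - (r^-1 * (f y * J (t j) (psi r) y)) by ring.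
    rewrite normrN !normrM gtr0_norm ?invr_gt0// -mulrA ler_wpM2l ?invr_ge0 ?(ltW r0)// mulrCA ler_wpM2l//.
    exact: Jpsi.
  by rewrite (IgZ _ fi) [leRHS]mulrA.
have [_ LP] : ibl mu (fun y => P y * phi y) /\ (fun j : nat => I (fun y => P y * phir j.+1%:R y)) @ \oo --> I (fun y => P y * phi y).
  apply: (@Ig_dct _ _ _ mu _ _ (fun y => Kp * `|P y|)).
  - move=> j; apply: measurable_funM; first exact: ibl_meas Pi.
    by apply: measurable_funM => //; apply: continuous_measurable; exact: cut_continuous.
  - by apply: iblZ; exact: ibl_norm.
  - move=> j y; rewrite normrM mulrC ler_wpM2r// /phir normrM (ger0_norm (cut_ge0 _ _ _)).
    apply: le_trans (_ : 1 * `|phi y| <= _); first by rewrite ler_wpM2r// cut_le1.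
    rewrite mul1r; apply: le_trans (phiB y) _; rewrite ler_piMr//; exact: WX_le1.
  - move=> y; apply: cvgMr; rewrite -[X in _ --> X]mul1r; apply: cvgMl.
    exact: cut_cvg 2 y.
have E : I (fun y => P y * phi y) = I (fun y => f y * - q y).
  apply/eqP; rewrite -subr_eq0 -normr_le0.
  have L1 : (fun j : nat => `|I (fun y => P y * phir j.+1%:R y) - I (fun y => f y * - q y)|) @ \oo --> `|I (fun y => P y * phi y) - I (fun y => f y * - q y)|.
    by apply: cvg_norm; apply: cvgB => //; exact: cvg_cst.
  have L2 : (fun j : nat => @harmonic R j * (KJ * Cp * M)) @ \oo --> (0 : R).
    by rewrite -[X in _ --> X](mul0r (KJ * Cp * M)); apply: cvgMl; exact: cvg_harmonic.
  apply: (ler_cvg_to L1 L2); apply: nearW => j.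
  by apply: KEY; rewrite ler1n.
rewrite E; have -> : (fun y => f y * - q y) = fun y => - (f y * q y) by apply/funext => y; rewrite mulrN.
by rewrite IgN//; apply: eq_ibl (iblN Fq) => y; rewrite mulrN opprK.
Qed.

End differences.
End half_laplacian_test.

(** * Testing the full operator against differences of kernels *)

Section laplacian_test.
Context {R : realType} {n : nat}.
Notation V := 'rV[R]_n.
Notation mu := (@vmeas R n).
Notation I := (Ig mu).
Implicit Types (x y z : V).

Lemma iter_Lap_D m (f g : V -> R) : CN m.*2 f -> CN m.*2 g ->
  iter m Lap (fun x => f x + g x) = fun x => iter m Lap f x + iter m Lap g x.
Proof.
elim: m => [//|m IH] Hf Hg.
have Hf' : CN m.*2 f by apply: CN_le Hf; rewrite doubleS -addn2 leq_addr.
have Hg' : CN m.*2 g by apply: CN_le Hg; rewrite doubleS -addn2 leq_addr.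
rewrite !iterS (IH Hf' Hg') Lap_D//; by apply: CN_iter_Lap; rewrite add2n -doubleS.
Qed.

Lemma Lap_refl x0 (g : V -> R) : CN 2 g -> Lap (fun y => g (x0 - y)) = fun y => Lap g (x0 - y).
Proof.
move=> Hg; apply/funext => y; rewrite /Lap; apply: eq_bigr => i _.
have H1 := dpar_refl x0 (CN_dpar i Hg).
have H2 := dparZ (-1) (dpar_refl x0 (CN_dpar i (CN_partial i Hg))).
rewrite (partial_dpar H1) (_ : (fun x => - partial i g (x0 - x)) = fun x => -1 * partial i g (x0 - x)); last first.
  by apply/funext => z; rewrite mulN1r.
by rewrite (partial_dpar H2) mulN1r opprK.
Qed.

Lemma Lap_fdiff a (g : V -> R) : CN 2 g -> Lap (fdiff a g) = fdiff a (Lap g).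
Proof.
move=> Hg; apply/funext => y; rewrite /fdiff /Lap -sumrB; apply: eq_bigr => i _.
have H1 := dpar_fdiff a (CN_dpar i Hg).
have H2 := dpar_fdiff a (CN_dpar i (CN_partial i Hg)).
by rewrite (partial_dpar H1) (partial_dpar H2).
Qed.

Lemma CN_shift N a (g : V -> R) : CN N g -> CN N (fun x => g (x + a)).
Proof.
elim: N g => [|N IH] g Hg; (split; first exact: continuous_shiftV (CN_continuous Hg)) => // i.
have H := dpar_shift a (CN_dpar i Hg).
split; first exact: dpar_derivable H.
by rewrite (partial_dpar H); apply: (IH (partial i g)); exact: CN_partial.
Qed.

Lemma CN_fdiff N a k (g : V -> R) : CN N g -> CN N (iter k (fdiff a) g).
Proof.
move=> Hg; elim: k => [//|k IH]; rewrite iterS.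
have -> : fdiff a (iter k (fdiff a) g) = fun x => iter k (fdiff a) g (x + a) + -1 * iter k (fdiff a) g x.
  by apply/funext => x; rewrite mulN1r.
apply: CN_D; first exact: CN_shift.
by apply: CN_M => //; exact: CN_C.
Qed.

Lemma Lap_Dk a k (g : V -> R) : CN 2 g -> Lap (iter k (fdiff a) g) = iter k (fdiff a) (Lap g).
Proof.
move=> Hg; elim: k => [//|k IHk].
by rewrite !iterS (Lap_fdiff a (CN_fdiff a k Hg)) IHk.
Qed.

Lemma iter_Lap_Dk m a k x0 (g : V -> R) : CN m.*2 g ->
  iter m Lap (fun y => iter k (fdiff a) g (x0 - y)) = fun y => iter k (fdiff a) (iter m Lap g) (x0 - y).
Proof.
elim: m => [//|m IH] Hg.
have Hg' : CN m.*2 g by apply: CN_le Hg; rewrite doubleS -addn2 leq_addr.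
have H2 : CN 2 (iter m Lap g) by apply: CN_iter_Lap; rewrite add2n -doubleS.
rewrite !iterS (IH Hg') Lap_refl; last exact: CN_fdiff.
congr (fun f y => f (x0 - y)).
exact: Lap_Dk.
Qed.

Lemma Dk_Z a k (c : R) (g : V -> R) x : iter k (fdiff a) (fun x => c * g x) x = c * iter k (fdiff a) g x.
Proof. by elim: k x => [//|k IH] x; rewrite !iterS /fdiff !IH mulrBr. Qed.

(** Green's formula holds for the cut-off kernel; the error is r^(-1) times Delta^m of a symbol of
    order 1 - n - j - k. That order drops by 2m, which leaves at least the q powers needed to
    integrate against |u| because n >= 1 and q <= k. *)
Lemma lap_test (f : V -> R) m j q k (i : 'I_n) (h s : R) x0 : (0 < n)%N -> (q <= k)%N -> 0 < s ->
  CN m.*2 f -> ibl mu (fun y => `|f y| * W y ^- q) ->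
  ibl mu (fun y => iter m Lap f y * iter k (fdiff (h *: ebasis i)) (pk j s) (x0 - y)) ->
  ibl mu (fun y => f y * iter k (fdiff (h *: ebasis i)) (pk (j + m.*2) s) (x0 - y)) /\
  I (fun y => iter m Lap f y * iter k (fdiff (h *: ebasis i)) (pk j s) (x0 - y)) =
  (-1) ^+ m * I (fun y => f y * iter k (fdiff (h *: ebasis i)) (pk (j + m.*2) s) (x0 - y)).
Proof.
set Dk := iter k (fdiff (h *: ebasis i)).
move=> n0 qk s0 Hf fi Li.
have d1 : - (n + j)%:Z - k%:Z <= 0 by clear; lia.
have d2 : - (n + (j + m.*2))%:Z - k%:Z <= 0 by clear; lia.
have d3 : - (n + (j + m.*2))%:Z - k%:Z <= - q%:Z by move: n0 qk; clear; lia.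
have d4 : 1 + (- (n + j)%:Z - k%:Z) - m.*2%:Z <= - q%:Z by move: n0 qk; clear; lia.
have W0 (t : R) (z : V) : ge1 t -> 0 < W z :> R by move=> _; exact: W_gt0.
have Wd (d : int) y : d <= - q%:Z -> W y ^ d <= W y ^- q :> R.
  by move=> hd; rewrite exprnN; apply: ler_weXz2l => //; exact: W_ge1.
have sN : s != 0 by rewrite gt_eqF.
pose phi y := Dk (pk j s) (x0 - y) : R.
have Sphi : @Sy R n R ge1 (fun _ => W) m.*2 (- (n + j)%:Z - k%:Z) (fun _ => phi).
  exact: (Sy_fdiff i h x0 s0 (sp_Sy (m.*2 + k) (@pk_sp R n j)) d1).
have SG := Sy_M W0 (@Sy_1cut R n m.*2 m.*2.+1 (leqnn _)) Sphi.
pose psi (r : R) y := r * (1 - cutoff m.*2.+3 r y) * phi y.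
have [C C0 HC] : exists2 C : R, 0 <= C & forall r y, 1 <= r -> `|iter m Lap (psi r) y| <= C * W y ^- q.
  have SL : @Sy R n R ge1 (fun _ => W) 0 (1 + (- (n + j)%:Z - k%:Z) - m.*2%:Z) (fun r => iter m Lap (psi r)).
    exact: (@Sy_iter_Lap R n R ge1 (fun _ => W) m 0 _ psi SG).
  have [C C0 HC] := Sy_bound W0 SL; exists C => // r y r1.
  by apply: le_trans (HC r y r1) _; rewrite ler_wpM2l// Wd.
have Cphi : CN m.*2 phi := Sy_CN Sphi (lexx (1 : R)).
have Cpsi r : 1 <= r -> CN m.*2 (psi r) by move=> r1; exact: Sy_CN SG r r1.
pose g y := f y * Dk (pk (j + m.*2) s) (x0 - y).
have mf := continuous_measurable (CN_continuous Hf).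
have gi : ibl mu g.
  have [K K0 HK] := fdiff_W i h x0 (sp_Sy k (@pk_sp R n (j + m.*2))) s0 d2.
  apply: (@ibl_le _ _ _ mu _ (fun y => K * (`|f y| * W y ^- q))); last exact: iblZ.
    apply: measurable_funM => //; apply: continuous_measurable; apply: continuous_reflV.
    by apply: Dk_continuous; exact: pk_continuous.
  move=> y; rewrite normrM mulrCA ler_wpM2l//; apply: le_trans (HK s y (lexx _)) _.
  by rewrite ler_wpM2l// Wd.
split => //.
have Lphi : iter m Lap phi = fun y => (-1) ^+ m * Dk (pk (j + m.*2) s) (x0 - y).
  rewrite /phi iter_Lap_Dk; last exact: pk_CN.
  by rewrite pk_iter_Lap//; apply/funext => y; rewrite /Dk Dk_Z.
pose phir r y := cutoff m.*2.+3 r y * phi y.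
have KEY r : 1 <= r -> `|I (fun y => iter m Lap f y * phir r y) - (-1) ^+ m * I g| <= r^-1 * (C * I (fun y => `|f y| * W y ^- q)).
  move=> r1; have r0 : 0 < r by exact: lt_le_trans r1.
  have Cphir : CN m.*2 (phir r).
    by apply: CN_M => //; apply: cut_CN => //.
  have kphir : cpt (phir r) by exists r => x xr; rewrite /phir cut_supp// mul0r.
  rewrite (green_iter Hf Cphir kphir).
  have E y : iter m Lap (phir r) y = (-1) ^+ m * Dk (pk (j + m.*2) s) (x0 - y) - r^-1 * iter m Lap (psi r) y.
    have -> : phir r = fun y => phi y + - r^-1 * psi r y.
      by apply/funext => z; rewrite /phir /psi; field; rewrite gt_eqF.
    rewrite iter_Lap_D//; last by apply: CN_M; [exact: CN_C|exact: Cpsi].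
    by rewrite (iter_Lap_Z _ (Cpsi r r1)) Lphi mulNr.
  have i1 := iblZ ((-1) ^+ m) gi.
  have i2 : ibl mu (fun y => r^-1 * (f y * iter m Lap (psi r) y)).
    apply: iblZ; apply: (@ibl_le _ _ _ mu _ (fun y => C * (`|f y| * W y ^- q))); last exact: iblZ.
      apply: measurable_funM => //; apply: continuous_measurable.
      by apply: (@CN_continuous _ _ 0); apply: CN_iter_Lap; rewrite add0n; exact: Cpsi.
    by move=> y; rewrite normrM mulrCA ler_wpM2l//; exact: HC.
  have E2 y : f y * iter m Lap (phir r) y = (-1) ^+ m * g y - r^-1 * (f y * iter m Lap (psi r) y).
    by rewrite E /g; ring.
  rewrite (eq_Ig mu E2) (IgB i1 i2) (IgZ _ gi) addrAC subrr add0r normrN.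
  apply: le_trans (Ig_norm_le i2 (iblZ (r^-1 * C) fi) _) _.
    move=> y; rewrite normrM gtr0_norm ?invr_gt0// -mulrA ler_wpM2l ?invr_ge0 ?(ltW r0)//.
    by rewrite normrM mulrCA ler_wpM2l//; exact: HC.
  by rewrite (IgZ _ fi) mulrA.
have [_ LP] : ibl mu (fun y => iter m Lap f y * phi y) /\
    (fun l : nat => I (fun y => iter m Lap f y * phir l.+1%:R y)) @ \oo --> I (fun y => iter m Lap f y * phi y).
  have mL : measurable_fun [set: V] (iter m Lap f).
    apply: continuous_measurable; apply: (@CN_continuous _ _ 0); apply: CN_iter_Lap.
    by rewrite add0n.
  apply: (@Ig_dct _ _ _ mu _ _ (fun y => `|iter m Lap f y * phi y|)).
  - move=> l; apply: measurable_funM => //.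
    apply: measurable_funM; first by apply: continuous_measurable; exact: cut_continuous.
    exact: continuous_measurable (CN_continuous Cphi).
  - exact: ibl_norm.
  - move=> l y; rewrite /phir mulrCA normrM (ger0_norm (cut_ge0 _ _ _)).
    by rewrite ler_piMl// cut_le1.
  - move=> y; apply: cvgMr; rewrite -[X in _ --> X]mul1r; apply: cvgMl.
    exact: cut_cvg m.*2 y.
apply/eqP; rewrite -subr_eq0 -normr_le0.
have L1 : (fun l : nat => `|I (fun y => iter m Lap f y * phir l.+1%:R y) - (-1) ^+ m * I g|) @ \oo -->
    `|I (fun y => iter m Lap f y * phi y) - (-1) ^+ m * I g|.
  by apply: cvg_norm; apply: cvgB => //; exact: cvg_cst.
have L2 : (fun l : nat => @harmonic R l * (C * I (fun y => `|f y| * W y ^- q))) @ \oo --> (0 : R).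
  by rewrite -[X in _ --> X](mul0r (C * I (fun y => `|f y| * W y ^- q))); apply: cvgMl; exact: cvg_harmonic.
apply: (ler_cvg_to L1 L2); apply: nearW => l.
by apply: KEY; rewrite ler1n.
Qed.

(** For n = 2m the sign (-1)^m of the operator meets the (-1)^m of [pk_iter_Lap]. For n = 2m + 1 the
    half Laplacian first gives - d/ds, and the m Laplacians then act on [pk 1]. Either way the
    outcome is (-1)^n times the n-th derivative in time. *)
Lemma frac_lap_test (u F : V -> R) q k (i : 'I_n) (h s : R) x0 : (0 < n)%N -> (q <= k)%N -> (1 < k)%N -> 0 < s ->
  smooth u -> frac_lap_eq u F -> ibl mu F -> ibl mu (fun y => `|u y| * W y ^- q) ->
  I (fun y => F y * iter k (fdiff (h *: ebasis i)) (pk 0 s) (x0 - y)) =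
  (-1) ^+ n * I (fun y => u y * iter k (fdiff (h *: ebasis i)) (pk n s) (x0 - y)).
Proof.
move=> n0 qk k1 s0 su uF Fi ui.
pose m := n./2; have Hu N : CN N u by exact: smooth_CN.
have Dc j : continuous (fun y => iter k (fdiff (h *: ebasis i)) (pk j s) (x0 - y) : R).
  by apply: continuous_reflV; apply: Dk_continuous; exact: pk_continuous.
move: uF; rewrite /frac_lap_eq -/m; case: ifP => [en FE|/negbFE on [Lh FE]].
- have nE : m.*2 = n by rewrite /m halfK (negbTE en) subn0.
  have Fi' : ibl mu (fun y => iter m Lap u y * iter k (fdiff (h *: ebasis i)) (pk 0 s) (x0 - y)).
    have d1 : - (n + 0)%:Z - k%:Z <= 0 by clear; lia.
    have [K K0 HK] := fdiff_W i h x0 (sp_Sy k (@pk_sp R n 0)) s0 d1.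
    apply: (@ibl_le _ _ _ mu _ (fun y => K * `|F y|)).
    + apply: measurable_funM; last by apply: continuous_measurable; exact: Dc.
      by apply: continuous_measurable; apply: (@CN_continuous _ _ 0); apply: CN_iter_Lap; exact: Hu.
    + move=> y; rewrite normrM mulrC; apply: ler_pM => //.
        apply: le_trans (HK s y (lexx _)) _; rewrite ler_piMr//.
        by rewrite -(expr0z (W y)); apply: ler_weXz2l => //; exact: W_ge1.
      by rewrite FE normrM normrX normrN1 expr1n mul1r.
    + by apply: iblZ; exact: ibl_norm.
  have [_ E] := @lap_test u m 0 q k i h s x0 n0 qk s0 (Hu _) ui Fi'.
  rewrite add0n nE in E.
  have -> : (-1) ^+ n * I (fun y => u y * iter k (fdiff (h *: ebasis i)) (pk n s) (x0 - y)) =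
     (-1) ^+ m * I (fun y => iter m Lap u y * iter k (fdiff (h *: ebasis i)) (pk 0 s) (x0 - y)).
    by rewrite E mulrA -exprD addnn nE.
  by rewrite -(IgZ _ Fi'); apply: eq_Ig => y; rewrite FE mulrA.
- have nE : m.*2.+1 = n by rewrite /m -[RHS]odd_double_half on.
  pose f x := (-1) ^+ m * iter m Lap u x.
  have fi := L_half_ibl Lh; rewrite -/f in fi.
  have Hf : CN 2 f by apply: CN_M; [exact: CN_C|apply: CN_iter_Lap; exact: Hu].
  have E1 : I (fun y => F y * iter k (fdiff (h *: ebasis i)) (pk 0 s) (x0 - y)) =
     - I (fun y => f y * iter k (fdiff (h *: ebasis i)) (pk 1 s) (x0 - y)).
    apply: half_lap_test => // x; apply: half_lap_eq => //; exact: FE.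
  have Fi' : ibl mu (fun y => iter m Lap u y * iter k (fdiff (h *: ebasis i)) (pk 1 s) (x0 - y)).
    have d1 : - (n + 1)%:Z - k%:Z <= 0 by clear; lia.
    have d2 : - (n + 1)%:Z - k%:Z <= - n.+1%:Z by clear; lia.
    have [K K0 HK] := fdiff_W i h x0 (sp_Sy k (@pk_sp R n 1)) s0 d1.
    apply: (@ibl_le _ _ _ mu _ (fun y => K * (`|f y| * W y ^- n.+1))).
    + apply: measurable_funM; last by apply: continuous_measurable; exact: Dc.
      by apply: continuous_measurable; apply: (@CN_continuous _ _ 0); apply: CN_iter_Lap; exact: Hu.
    + move=> y; rewrite normrM mulrCA; apply: ler_pM => //.
        by rewrite /f normrM normrX normrN1 expr1n mul1r.
      apply: le_trans (HK s y (lexx _)) _; rewrite ler_wpM2l// exprnN.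
      by apply: ler_weXz2l => //; exact: W_ge1.
    + exact: iblZ.
  have [_ E] := @lap_test u m 1 q k i h s x0 n0 qk s0 (Hu _) ui Fi'.
  rewrite add1n nE in E.
  have E2 : I (fun y => f y * iter k (fdiff (h *: ebasis i)) (pk 1 s) (x0 - y)) =
     (-1) ^+ m * I (fun y => iter m Lap u y * iter k (fdiff (h *: ebasis i)) (pk 1 s) (x0 - y)).
    by rewrite -(IgZ _ Fi'); apply: eq_Ig => y; rewrite /f mulrA.
  rewrite E1 E2 E mulrA -exprD addnn -(signr_odd _ m.*2) odd_double mul1r.
  by rewrite -(signr_odd _ n) on expr1 mulN1r.
Qed.

End laplacian_test.

(** * Finite differences of a solution *)

Section logarithmic_kernel.
Context {R : realType} {n : nat}.
Notation V := 'rV[R]_n.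
Notation mu := (@vmeas R n).
Notation I := (Ig mu).
Implicit Types (x y z : V) (s t : R).
Local Notation cPn := (@cP R n).

(* The t-derivative of this sum telescopes to a single term, see [qk_ds]. *)
Definition qk (N : nat) t z : R := \sum_(j < N) ((-1) ^+ j * t ^+ j / j`!%:R) * pk j t z.

Lemma qk_ds N : dsg (qk N.+1) (fun t z => ((-1) ^+ N * t ^+ N / N`!%:R) * pk N.+1 t z).
Proof.
elim: N => [|N IH] t z t0.
  have -> : qk 1 ^~ z = pk 0 ^~ z by apply/funext => r; rewrite /qk big_ord1 !expr0 fact0 divr1 !mul1r.
  by apply: (der_eq (pk_ds 0 z t0)) => //; rewrite !expr0 fact0 divr1 !mul1r.
have -> : qk N.+2 ^~ z = fun r => qk N.+1 r z + ((-1) ^+ N.+1 / N.+1`!%:R) * (r ^+ N.+1 * pk N.+1 r z).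
  by apply/funext => r; rewrite /qk big_ord_recr /=; congr (_ + _); ring.
have D1 : is_derive t 1 (fun r : R => r ^+ N.+1) (N.+1%:R * t ^+ N).
  by apply: (der_eq (derX N.+1 (is_derive_id t (1:R)))) => //; rewrite mulr1.
apply: (der_eq (derD (IH t z t0) (derZ _ (derM D1 (pk_ds N.+1 z t0))))) => //.
rewrite factS natrM exprS; have f0 : (N`!%:R : R) != 0 by rewrite pnatr_eq0 -lt0n fact_gt0.
have m0 : (N.+1%:R : R) != 0 by [].
by move: (N`!%:R : R) (N.+1%:R : R) f0 m0 => a b a0 b0; field; rewrite a0 b0.
Qed.

Lemma qk_dom N : exists2 C : R, 0 <= C & forall t z, 0 < t -> `|qk N t z| <= C * pk 0 t z.
Proof.
have /choice[C HC] : forall j, exists C : R, 0 <= C /\ forall t z, 0 < t -> `|pk j t z| <= C * t ^- j * pk 0 t z.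
  by move=> j; have [C C0 HC] := @pk_dom R n j; exists C.
exists (\sum_(j < N) C j); first by apply: sumr_ge0 => j _; case: (HC j).
move=> t z t0; apply: le_trans (ler_norm_sum _ _ _) _; rewrite mulr_suml; apply: ler_sum => j _.
have [C0 /(_ t z t0) H] := HC j; have p0 := pk0_ge0 z t0.
rewrite !normrM normrX normrN1 expr1n mul1r normrX (gtr0_norm t0) normfV normr_nat.
apply: (@le_trans _ _ (t ^+ j * `|pk j t z|)).
  rewrite ler_wpM2r// ler_piMr ?exprn_ge0 ?(ltW t0)// invf_le1 ?ler1n ?ltr0n ?fact_gt0//.
apply: le_trans (ler_wpM2l _ H) _; first by rewrite exprn_ge0// ltW.
by rewrite !mulrA [t ^+ j * C j]mulrC mulfK// expf_neq0// gt_eqF.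
Qed.

Lemma int_qk N t : 0 < t -> ibl mu (qk N.+1 t) /\ I (qk N.+1 t) = 1.
Proof.
move=> t0; have i0 j : ibl mu (fun z => ((-1) ^+ j * t ^+ j / j`!%:R) * pk j t z) by apply: iblZ; exact: ibl_pk.
split; first exact: ibl_sum.
rewrite /qk Ig_sum// big_ord_recl /= big1 ?addr0 => [|j _].
  rewrite (IgZ _ (ibl_pk 0 t0)) !expr0 fact0 divr1 !mul1r.
  by case: (@int_pk0 R n t t0).
by rewrite (IgZ _ (ibl_pk _ t0)) Ig_pkS// mulr0.
Qed.

(* The primitive in t of t^N / rho^(N+1) that tends to ln |z| as t -> 0. *)
Fixpoint lk (N : nat) t z : R :=
  match N with
  | 0%N => ln (t + rho t z)
  | 1%N => ln (rho t z)
  | (N'.+1 as N1).+1 => lk N' t z - N1%:R^-1 * (t / rho t z) ^+ N1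
  end.

Lemma is_derive_lk N t z : 0 < t -> is_derive t 1 (fun t => lk N t z) (t ^+ N * rp N.+1 t z).
Proof.
move=> t0; have tN : t != 0 by rewrite gt_eqF.
have r0 := rho_gt0' z t0; have rN : rho t z != 0 by rewrite gt_eqF.
have Dr := is_derive_rho_s z tN.
suff H : is_derive t 1 (fun t => lk N t z) (t ^+ N * rp N.+1 t z) /\ is_derive t 1 (fun t => lk N.+1 t z) (t ^+ N.+1 * rp N.+2 t z).
  by case: H.
elim: N => [|N [IH1 IH2]].
  split.
  - have p0 : 0 < t + rho t z by rewrite addr_gt0.
    apply: (der_eq (der1_comp (derD (is_derive_id t (1:R)) Dr) (is_derive1_ln p0))) => //.
    by rewrite /rp expr0 expr1; field; rewrite rN gt_eqF.
  - apply: (der_eq (der1_comp Dr (is_derive1_ln r0))) => //.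
    by rewrite /rp; field.
split => //.
have D1 := derX N.+1 (derM (is_derive_id t (1:R)) (der1V Dr rN)).
apply: (der_eq (derB IH1 (derZ N.+1%:R^-1 D1))) => //.
have m0 : (N.+1%:R : R) != 0 by [].
have z2 : rho t z ^+ 2 = t ^+ 2 + enorm z ^+ 2 by rewrite sqr_rho sqr_enorm.
rewrite /= /rp exprMn exprVn !exprS.
have q0 : rho t z ^+ N != 0 by rewrite expf_neq0.
move: (rho t z ^+ N) (t ^+ N) (rho t z) (N.+1%:R : R) q0 rN m0 {IH1 IH2 D1 Dr r0 z2} => a b r m a0 rn m0.
by field; rewrite a0 rn m0.
Qed.

Lemma ln_le_mul (a b c : R) : 0 < a -> 0 < b -> 0 < c -> a <= c * b -> ln a <= ln c + ln b.
Proof. by move=> a0 b0 c0 h; rewrite -lnM ?posrE// ler_ln ?posrE// mulr_gt0. Qed.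

(** t <= rho puts every subtracted term in [0, 1], and in the two base cases the argument of the
    logarithm is within a factor 2 of t + |z|. Independence of t is the point: it leads to one
    majorant for both t -> 0 and t -> oo. *)
Lemma lk_near N t z : 0 < t -> `|lk N t z - ln (t + enorm z)| <= ln 2 + N%:R.
Proof.
move=> t0; have r0 := rho_gt0' z t0.
have e0 := enorm_ge0 z.
have te : 0 < t + enorm z by rewrite ltr_pwDl.
have h1 : rho t z <= t + enorm z by have := rho_le t z; rewrite gtr0_norm.
have h2 : t <= rho t z by have := abs_le_rho t z; rewrite gtr0_norm.
have h3 := enorm_le_rho t z.
have l2 : 0 <= ln (2 : R) by rewrite ln_ge0// ler1n.
suff H : `|lk N t z - ln (t + enorm z)| <= ln 2 + N%:R /\ `|lk N.+1 t z - ln (t + enorm z)| <= ln 2 + N.+1%:R.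
  by case: H.
elim: N => [|N [IH1 IH2]].
  split.
  - have b0 : 0 < t + rho t z by rewrite addr_gt0.
    have a1 : ln (t + enorm z) <= ln (t + rho t z) by rewrite ler_ln ?posrE//; lra.
    have a2 : ln (t + rho t z) <= ln 2 + ln (t + enorm z).
      by apply: ln_le_mul => //; lra.
    by rewrite ler_norml addr0; apply/andP; split => /=; lra.
  - have a1 : ln (rho t z) <= ln (t + enorm z) by rewrite ler_ln ?posrE.
    have a2 : ln (t + enorm z) <= ln 2 + ln (rho t z) by apply: ln_le_mul => //; lra.
    by rewrite ler_norml; apply/andP; split => /=; lra.
split => //.
have q0 : 0 <= t / rho t z by rewrite divr_ge0// ltW.
have q1 : t / rho t z <= 1 by rewrite ler_pdivrMr// mul1r.
have p0 : 0 <= N.+1%:R^-1 * (t / rho t z) ^+ N.+1 by rewrite mulr_ge0 ?invr_ge0 ?exprn_ge0.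
have p1 : N.+1%:R^-1 * (t / rho t z) ^+ N.+1 <= 1.
  by rewrite mulr_ile1 ?invr_ge0 ?exprn_ge0 ?exprn_ile1// invf_le1 ?ler1n.
have -> : lk N.+2 t z - ln (t + enorm z) = (lk N t z - ln (t + enorm z)) - N.+1%:R^-1 * (t / rho t z) ^+ N.+1.
  by rewrite /=; ring.
apply: le_trans (ler_normB _ _) _; rewrite (ger0_norm p0); apply: le_trans (lerD IH1 p1) _.
by rewrite -[N.+2]addn2 natrD; lra.
Qed.

(** For large t the kernel is nearly constant in z, and finite differences remove the constant
    [lk N t 0]; this is how the boundary term at t = oo disappears. *)
Lemma lk_far N t z : 0 < t -> `|lk N t z - lk N t 0| <= N.+1%:R * (enorm z / t).
Proof.
move=> t0; have r0 := rho_gt0' z t0.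
have e0 := enorm_ge0 z.
have rE : rho t (0 : V) = t by rewrite rhoE enorm0 expr0n addr0 sqrtr_sqr gtr0_norm.
have h1 : rho t z <= t + enorm z by have := rho_le t z; rewrite gtr0_norm.
have h2 : t <= rho t z by have := abs_le_rho t z; rewrite gtr0_norm.
have et : 0 <= enorm z / t by rewrite divr_ge0// ltW.
suff H : `|lk N t z - lk N t 0| <= N.+1%:R * (enorm z / t) /\ `|lk N.+1 t z - lk N.+1 t 0| <= N.+2%:R * (enorm z / t).
  by case: H.
have lnb (a b c : R) : 0 < b -> b <= a -> a <= b * (1 + c) -> 0 <= c -> `|ln a - ln b| <= c.
  move=> b0 ba ac c0; have a0 : 0 < a by exact: lt_le_trans ba.
  rewrite ger0_norm ?subr_ge0 ?ler_ln ?posrE// lerBlDr; have c1 : 0 < 1 + c by rewrite ltr_pwDl.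
  apply: le_trans (ln_le_mul a0 b0 c1 _) _; first by rewrite mulrC.
  by rewrite lerD2r le_ln1Dx// (lt_le_trans _ c0).
have te : t * (1 + enorm z / t) = t + enorm z by rewrite mulrDr mulr1 mulrCA divff ?mulr1// gt_eqF.
elim: N => [|N [IH1 IH2]].
  split.
  - rewrite mul1r /= rE; apply: lnb => //; [lra|lra|].
    by rewrite -mulr2n -mulr_natl -mulrA te; lra.
  - apply: (@le_trans _ _ (enorm z / t)); last by rewrite ler_peMl// ler1n.
    by rewrite /= rE; apply: lnb => //; rewrite te.
split => //.
have q0 : 0 <= t / rho t z by rewrite divr_ge0// ltW.
have q1 : t / rho t z <= 1 by rewrite ler_pdivrMr// mul1r.
have B : 1 - (t / rho t z) ^+ N.+1 <= N.+1%:R * (enorm z / t).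
  apply: (@le_trans _ _ (N.+1%:R * (1 - t / rho t z))).
    elim: N.+1 => [|m IHm]; first by rewrite expr0 subrr mul0r.
    have := exprn_ge0 m q0; rewrite exprS -natr1; move: IHm (exprn_ile1 m q0 q1); move: (_ ^+ m) q0 q1 => a q0 q1; nra.
  rewrite ler_wpM2l//; apply: (@le_trans _ _ (enorm z / rho t z)).
    by rewrite -[X in X - _](divff (lt0r_neq0 r0)) -mulrBl ler_wpM2r ?invr_ge0 ?(ltW r0)//; lra.
  by rewrite ler_wpM2l// lef_pV2 ?posrE.
have -> : lk N.+2 t z - lk N.+2 t 0 = (lk N t z - lk N t 0) + N.+1%:R^-1 * (1 - (t / rho t z) ^+ N.+1).
  by rewrite /= rE divff ?gt_eqF// expr1n; ring.
apply: le_trans (ler_normD _ _) _.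
have -> : N.+3%:R * (enorm z / t) = N.+1%:R * (enorm z / t) + (enorm z / t) + (enorm z / t) by rewrite -!natr1; ring.
have m0 : 0 < N.+1%:R^-1 :> R by rewrite invr_gt0.
have p0 : 0 <= 1 - (t / rho t z) ^+ N.+1 by rewrite subr_ge0 exprn_ile1.
have h : N.+1%:R^-1 * (1 - (t / rho t z) ^+ N.+1) <= enorm z / t by rewrite ler_pdivrMl.
rewrite (ger0_norm (mulr_ge0 (ltW m0) p0)); apply: le_trans (lerD IH1 h) _.
by rewrite lerDl.
Qed.

Lemma lk_cvg N (t : nat -> R) z : z != 0 -> (forall j, 0 < t j) -> t @ \oo --> (0 : R) ->
  (fun j => lk N (t j) z) @ \oo --> ln (enorm z).
Proof.
move=> z0 t0 tc; have ez : 0 < enorm z by rewrite enorm_gt0.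
have H : (fun j => rho (t j) z) @ \oo --> enorm z.
  apply: (@squeeze_cvgr _ _ _ _ (fun _ => enorm z) (fun j => `|t j| + enorm z)).
  - by apply: nearW => j; rewrite enorm_le_rho rho_le.
  - exact: cvg_cst.
  - rewrite -[X in _ --> X]add0r; apply: cvgD; last exact: cvg_cst.
    by rewrite -[X in _ --> X](normr0 R); apply: cvg_norm.
have cl : {for enorm z, continuous (@ln R)} by exact: continuous_ln.
suff HH : (fun j => lk N (t j) z) @ \oo --> ln (enorm z) /\ (fun j => lk N.+1 (t j) z) @ \oo --> ln (enorm z).
  by case: HH.
elim: N => [|N [IH1 IH2]].
  split; last exact: (cvg_comp _ _ H cl).
  have H2 : (fun j => t j + rho (t j) z) @ \oo --> enorm z.
    by rewrite -[X in _ --> X]add0r; exact: cvgD.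
  exact: (cvg_comp _ _ H2 cl).
split => //.
rewrite -[X in _ --> X]subr0; apply: cvgB => //.
rewrite -[X in _ --> X](mulr0 N.+1%:R^-1); apply: cvgMr.
have H3 : (fun j => t j / rho (t j) z) @ \oo --> (0 : R).
  rewrite -[X in _ --> X](mul0r (enorm z)^-1); apply: cvgM => //.
  by apply: cvgV => //; rewrite gt_eqF.
by have := cvg_comp _ _ H3 (@exprn_continuous R N.+1 0); rewrite expr0n.
Qed.

Lemma measurable_lk N t : 0 < t -> measurable_fun [set: V] (lk N t).
Proof.
move=> t0; have mr : measurable_fun [set: V] (rho t) by exact: measurable_rho.
have ml (f : V -> R) : measurable_fun [set: V] f -> measurable_fun [set: V] (fun z => ln (f z)).
  by move=> mf; apply: measurableT_comp => //; exact: measurable_ln.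
suff H : measurable_fun [set: V] (lk N t) /\ measurable_fun [set: V] (lk N.+1 t) by case: H.
elim: N => [|N [IH1 IH2]].
  by split; apply: ml => //; exact: measurable_funD.
split => //; apply: measurable_funB => //; apply: measurable_funM => //.
by apply: measurable_funX; apply: measurable_funM => //; exact: measurable_funV.
Qed.

Lemma ln1D_near t z : 0 < t -> z != 0 -> `|ln (t + enorm z) - ln (1 + t + enorm z)| <= ln 2 + Lam z.
Proof.
move=> t0; rewrite -enorm_gt0 => e0.
have a0 : 0 < t + enorm z by rewrite addr_gt0.
have b0 : 0 < 1 + t + enorm z by rewrite addr_gt0// addr_gt0.
rewrite distrC ger0_norm; last by rewrite subr_ge0 ler_ln ?posrE//; lra.
rewrite lerBlDr /Lam /ball_ind subr0; case: ltP => z1 /=.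
  rewrite mulr1 -lnV ?posrE// -lnM ?posrE ?invr_gt0//.
  apply: ln_le_mul => //; first by rewrite divr_gt0.
  rewrite mulrAC ler_pdivlMr//; nra.
rewrite mulr0 addr0; apply: ln_le_mul => //; lra.
Qed.

Lemma lk_ln1D N t z : 0 < t -> z != 0 -> `|lk N t z - ln (1 + t + enorm z)| <= (ln 2 + N%:R + ln 2) + Lam z.
Proof.
move=> t0 z0; apply: le_trans (ler_distD (ln (t + enorm z)) _ _) _.
by rewrite -[leRHS]addrA; apply: lerD; [exact: lk_near|exact: ln1D_near].
Qed.

Lemma ln1D_shift t z a : 0 <= t -> `|ln (1 + t + enorm (z + a)) - ln (1 + t + enorm z)| <= ln (1 + enorm a).
Proof.
move=> t0; have ea := enorm_ge0 a; have ez := enorm_ge0 z; have eza := enorm_ge0 (z + a).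
have h1 := enorm_triangle z a.
have h2 : enorm z <= enorm (z + a) + enorm a.
  by have := enorm_triangle (z + a) (- a); rewrite addrK enormN.
have p1 : 0 < 1 + t + enorm (z + a) by lra.
have p2 : 0 < 1 + t + enorm z by lra.
have p3 : 0 < 1 + enorm a by lra.
have l1 : ln (1 + t + enorm (z + a)) <= ln (1 + enorm a) + ln (1 + t + enorm z) by apply: ln_le_mul => //; nra.
have l2 : ln (1 + t + enorm z) <= ln (1 + enorm a) + ln (1 + t + enorm (z + a)) by apply: ln_le_mul => //; nra.
by rewrite ler_norml; apply/andP; split; lra.
Qed.

Section finite_support.
Hypothesis n0 : (0 < n)%N.

(** Finite sets are null: cover the points by balls of radius r <= 1, whose volume is at most a
    multiple of r. Serves to discard the points where the convention ln 0 = 0 breaks an identity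
    between logarithms. *)
Lemma Ig_finite_support (s : seq V) (f : V -> R) : measurable_fun [set: V] f ->
  (forall y, y \notin s -> f y = 0) -> ibl mu f /\ I f = 0.
Proof.
move=> mf f0.
have B (r : R) y : 0 < r -> `|f y| <= \sum_(p <- s) `|f p| * ball_ind p r y.
  move=> r0; have S0 : 0 <= \sum_(p <- s) `|f p| * ball_ind p r y.
    by apply: sumr_ge0 => p _; rewrite mulr_ge0// ball_ind_ge0.
  have [ys|ys] := boolP (y \in s); last by rewrite f0// normr0.
  rewrite (big_rem y)//= {1}/ball_ind subrr enorm0 r0 mulr1 lerDl.
  by apply: sumr_ge0 => p _; rewrite mulr_ge0// ball_ind_ge0.
have ib (r : R) : ibl mu (fun y => \sum_(p <- s) `|f p| * ball_ind p r y).
  by apply: ibl_sum => p; apply: iblZ; exact: ibl_ball_ind.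
have fi : ibl mu f := ibl_le mf (fun y => B 1 y ltr01) (ib 1).
split => //; apply/eqP; rewrite -normr_le0; apply/ler_addgt0Pl => e e0; rewrite addr0.
pose A := \sum_(p <- s) `|f p| * @ballvol R n.
have A0 : 0 <= A by apply: sumr_ge0 => p _; rewrite mulr_ge0// ltW// ballvol_gt0.
have A1 : 0 < A + 1 by rewrite ltr_wpDl.
pose r := Num.min 1 (e / (A + 1)).
have r0 : 0 < r by rewrite lt_min ltr01 /= divr_gt0.
apply: le_trans (Ig_norm_le fi (ib r) (fun y => B r y r0)) _.
rewrite Ig_sum; last by move=> p; apply: iblZ; exact: ibl_ball_ind.
under eq_bigr do rewrite (IgZ _ (ibl_ball_ind _ _)) Ig_ball_ind// mulrA.
rewrite -mulr_suml -/A; apply: (@le_trans _ _ ((A + 1) * r)); last first.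
  by rewrite mulrC -ler_pdivlMr// ge_min lexx orbT.
apply: ler_pM; rewrite ?exprn_ge0 ?(ltW r0) ?lerDl//.
rewrite -(prednK n0) exprS ler_piMr ?(ltW r0)// exprn_ile1 ?(ltW r0)// ge_min lexx//.
Qed.

End finite_support.
End logarithmic_kernel.

Lemma cvg_ord_sum {R : realType} m (f : 'I_m -> nat -> R) (l : 'I_m -> R) :
  (forall i, f i @ \oo --> l i) -> (fun j => \sum_(i < m) f i j) @ \oo --> \sum_(i < m) l i.
Proof.
elim: m f l => [|m IH] f l H.
  rewrite big_ord0 (_ : (fun _ => _) = fun _ => 0); first exact: cvg_cst.
  by apply/funext => j; rewrite big_ord0.
rewrite big_ord_recr /= (_ : (fun _ => _) = fun j => \sum_(i < m) f (widen_ord (leqnSn m) i) j + f ord_max j).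
  by apply: cvgD => //; apply: IH.
by apply/funext => j; rewrite big_ord_recr.
Qed.

Section representation.
Context {R : realType} {n : nat}.
Notation V := 'rV[R]_n.
Notation mu := (@vmeas R n).
Notation I := (Ig mu).
Implicit Types (x y z : V).
Local Notation cPn := (@cP R n).
Let c_gt0 : 0 < cPn := @cP_gt0 R n.

Variables (i : 'I_n) (h : R) (k : nat).
Hypothesis k1 : (1 < k)%N.
Local Notation a := (h *: ebasis i : V).
Local Notation Dk := (iter k (fdiff a)).

Let n0 : (0 < n)%N. Proof. by case: (n) i => [[]|]. Qed.

Lemma Dk_sumE (N : nat) (c : nat -> R) (g : nat -> V -> R) x :
  Dk (fun z => \sum_(j < N) c j * g j z) x = \sum_(j < N) c j * Dk (g j) x.
Proof.
have [w _ Hw] := @iter_fdiffE R n k.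
rewrite Hw; under eq_bigr do rewrite mulr_sumr; rewrite exchange_big /=; apply: eq_bigr => j _.
by rewrite Hw mulr_sumr; apply: eq_bigr => l _; ring.
Qed.

Lemma Dk_const (c : R) x : Dk (fun _ => c) x = 0.
Proof.
case: k k1 => // m _; rewrite iterS /fdiff.
have H y y' : iter m (fdiff a) (fun _ => c) y = iter m (fdiff a) (fun _ => c) y'.
  by elim: m y y' => [//|m IH] y y'; rewrite !iterS /fdiff; congr (_ - _).
by rewrite (H _ x) subrr.
Qed.

(** Differences kill constants, so ln(1 + t + |x|) may be subtracted from every term first; each
    remainder is then bounded by a constant plus the local singularity [Lam], with no trace of t. *)
Lemma lk_Dk_bound N : exists2 w : nat -> R, (forall j, 0 <= w j) & exists2 C : R, 0 <= C & forall t x, 0 < t ->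
  (forall j : 'I_k.+1, x + j%:R *: a != 0) ->
  `|Dk (lk N t) x| <= \sum_(j < k.+1) w j * (C + Lam (x + j%:R *: a)).
Proof.
have [w _ Hw] := @iter_fdiffE R n k.
have l2 : 0 <= ln (2 : R) by rewrite ln_ge0// ler1n.
have l3 : 0 <= ln (1 + k%:R * `|h|) by rewrite ln_ge0// lerDl mulr_ge0.
exists (fun j => `|w j|) => //; exists (ln 2 + N%:R + ln 2 + ln (1 + k%:R * `|h|)); first by rewrite !addr_ge0.
move=> t x t0 xN; pose c := ln (1 + t + enorm x).
have -> : Dk (lk N t) x = \sum_(j < k.+1) w j * (lk N t (x + j%:R *: a) - c).
  have E0 := Dk_const c x; rewrite Hw in E0.
  rewrite [RHS](_ : _ = \sum_(j < k.+1) w j * lk N t (x + j%:R *: a) - \sum_(j < k.+1) w j * c).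
    by rewrite E0 subr0 Hw.
  by rewrite -sumrB; apply: eq_bigr => j _; rewrite mulrBr.
apply: le_trans (ler_norm_sum _ _ _) _; apply: ler_sum => j _.
rewrite normrM ler_wpM2l//; apply: le_trans (ler_distD (ln (1 + t + enorm (x + j%:R *: a))) _ _) _.
rewrite [leRHS]addrAC; apply: lerD; first exact: lk_ln1D.
apply: le_trans (ln1D_shift _ _ (ltW t0)) _; rewrite ler_ln ?posrE ?ltr_pwDl ?enorm_ge0 ?mulr_ge0//.
rewrite lerD2l !enormZ enorm_ebasis mulr1 normr_nat ler_wpM2r// ler_nat.
by case: j {xN}.
Qed.

Lemma rho_far (d : int) x0 : d <= 0 -> exists2 K : R, 0 <= K & forall s y (t : R),
  enorm x0 + k%:R * `|h| + 1 <= enorm y -> `|t| <= k%:R * `|h| -> rho s (x0 - y + t *: ebasis i) ^ d <= K * W y ^ d.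
Proof.
case: d => [[|//]|m] _; first by exists 1 => // s y t _ _; rewrite !expr0z mulr1.
rewrite NegzE; pose K := 2 * (W x0 + k%:R * `|h|).
have e2 : 0 < W x0 + k%:R * `|h| by rewrite ltr_wpDr ?mulr_ge0// W_gt0.
have K0 : 0 < K by rewrite mulr_gt0.
exists (K ^+ m.+1); first by rewrite exprn_ge0// ltW.
move=> s y t My tk; pose z := x0 - y + t *: ebasis i.
have tz : enorm (t *: ebasis i : V) <= k%:R * `|h| by rewrite enormZ enorm_ebasis mulr1.
have z1 : 1 <= enorm z.
  have := enorm_triangle (x0 + t *: ebasis i) (- z); rewrite enormN.
  have -> : x0 + t *: ebasis i - z = y by rewrite /z opprD opprB addrACA subrr addr0 addrC subrK.
  have := enorm_triangle x0 (t *: ebasis i); move: My tz; lra.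
have Wy : W y <= K * enorm z.
  have := enorm_triangle (x0 + t *: ebasis i) (- z); rewrite enormN.
  have -> : x0 + t *: ebasis i - z = y by rewrite /z opprD opprB addrACA subrr addr0 addrC subrK.
  have := enorm_triangle x0 (t *: ebasis i); rewrite /K /W; have := enorm_ge0 x0.
  have kh : 0 <= k%:R * `|h| by rewrite mulr_ge0.
  move: tz z1 kh; nra.
have r0 : 0 < rho s z by apply: lt_le_trans (enorm_le_rho s z); exact: lt_le_trans z1.
rewrite -!exprnN -/z -ler_pdivrMl ?exprn_gt0// -invfM -exprMn lef_pV2 ?posrE ?exprn_gt0 ?mulr_gt0 ?W_gt0//.
apply: lerXn2r; [rewrite nnegrE ltW// W_gt0//|rewrite nnegrE; exact: mulr_ge0 (ltW K0) (ltW r0)|].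
by apply: le_trans Wy _; rewrite ler_wpM2l ?(ltW K0)// enorm_le_rho.
Qed.

Lemma Dk_qk N t x : Dk (qk N t) x = \sum_(j < N) ((-1) ^+ j * t ^+ j / j`!%:R) * Dk (pk j t) x.
Proof. exact: (@Dk_sumE N (fun j => (-1) ^+ j * t ^+ j / j`!%:R) (fun j => pk j t)). Qed.

Lemma coef_le (t : R) j : 0 < t -> `|(-1) ^+ j * t ^+ j / j`!%:R| <= t ^+ j.
Proof.
move=> t0; rewrite !normrM normrX normrN1 expr1n mul1r normrX (gtr0_norm t0) normfV normr_nat.
by rewrite ler_piMr ?exprn_ge0 ?(ltW t0)// invf_le1 ?ler1n ?ltr0n ?fact_gt0.
Qed.

(** Of the n + j + k powers of rho in the denominator, j + 1 are spent on t^(-j-1), which beats the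
    coefficient t^j by one factor, and the other n + k - 1 >= q become the weight. *)
Lemma qk_large N q x0 : (q <= k)%N -> exists2 C : R, 0 <= C & forall t y, 1 <= t ->
  `|Dk (qk N t) (x0 - y)| <= C * t^-1 * W y ^- q.
Proof.
move=> qk'.
have H (j : nat) : exists C : R, 0 <= C /\ forall t y, 1 <= t -> t ^+ j * `|Dk (pk j t) (x0 - y)| <= C * t^-1 * W y ^- q.
  have [C C0 HC] := @fdiff_pk_bound R n j k.
  have d1 : - (n + k).-1%:Z <= 0 by clear; lia.
  have [K K0 HK] := rhoX_W i h k x0 ltr01 d1.
  exists (C * `|h| ^+ k * K); split; first by rewrite !mulr_ge0 ?exprn_ge0.
  move=> t y t1; have t0 : 0 < t by exact: lt_le_trans t1.
  have tN : t ^+ j != 0 by rewrite expf_neq0// gt_eqF.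
  have B : `|Dk (pk j t) (x0 - y)| <= C * `|h| ^+ k * (t ^- j.+1 * (K * W y ^- q)).
    apply: HC => // s sk; have r0 := rho_gt0' (x0 - y + s *: ebasis i) t0.
    have -> : (n + j + k = j.+1 + (n + k).-1)%N by move: n0; clear; lia.
    rewrite exprD invfM; apply: ler_pM; rewrite ?invr_ge0 ?exprn_ge0 ?(ltW r0)//.
      exact: rp_sup.
    rewrite exprnN; apply: le_trans (HK t y s t1 sk) _; rewrite ler_wpM2l// exprnN.
    by apply: ler_weXz2l; [exact: W_ge1|move: n0 qk'; clear; lia].
  apply: le_trans (ler_wpM2l _ B) _; first by rewrite exprn_ge0// ltW.
  rewrite exprSr invfM; move: (t ^+ j) tN (C * _) (W y ^- q) => b b0 A w.
  by rewrite le_eqVlt; apply/orP; left; apply/eqP; field; rewrite b0 gt_eqF.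
have [C HC] := choice H; exists (\sum_(j < N) C j); first by apply: sumr_ge0 => j _; case: (HC j).
move=> t y t1; rewrite Dk_qk; apply: le_trans (ler_norm_sum _ _ _) _; rewrite !mulr_suml; apply: ler_sum => j _.
rewrite normrM; apply: le_trans (ler_wpM2r _ (coef_le j (lt_le_trans ltr01 t1))) _ => //.
by case: (HC j) => _; apply.
Qed.

(** Away from the singularity a factor t is gained: for j = 0 it is the explicit factor s of the
    Poisson kernel, for j > 0 it comes from the coefficient t^j. *)
Lemma qk_small N q x0 : (q <= k)%N -> exists2 C : R, 0 <= C & forall t y, 0 < t -> t <= 1 ->
  enorm x0 + k%:R * `|h| + 1 <= enorm y -> `|Dk (qk N t) (x0 - y)| <= C * t * W y ^- q.
Proof.
move=> qk'.
have H (j : nat) : exists C : R, 0 <= C /\ forall t y, 0 < t -> t <= 1 -> enorm x0 + k%:R * `|h| + 1 <= enorm y ->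
     t ^+ j * `|Dk (pk j t) (x0 - y)| <= C * t * W y ^- q.
  case: j => [|j].
    have [C C0 HC] := fdiff_Sy_bound (@Sy_rp R n k n.+1).
    have d1 : - n.+1%:Z - k%:Z <= 0 by clear; lia.
    have [K K0 HK] := rho_far x0 d1.
    exists (cPn * (C * `|h| ^+ k * K)); split.
      by apply: mulr_ge0; [exact: ltW|rewrite !mulr_ge0 ?exprn_ge0].
    move=> t y t0 t1 My; rewrite expr0 mul1r.
    have -> : Dk (pk 0 t) (x0 - y) = cPn * t * Dk (rp n.+1 t) (x0 - y).
      rewrite -Dk_Z; congr (iter k (fdiff a) _ _); apply/funext => z; exact: pk0E.
    have B : `|Dk (rp n.+1 t) (x0 - y)| <= C * `|h| ^+ k * (K * W y ^- q).
      apply: HC => // s sk; apply: le_trans (HK t y s My sk) _; rewrite ler_wpM2l// exprnN.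
      by apply: ler_weXz2l; [exact: W_ge1|move: qk'; clear; lia].
    rewrite normrM (gtr0_norm (mulr_gt0 c_gt0 t0)).
    have -> : cPn * (C * `|h| ^+ k * K) * t * W y ^- q = cPn * t * (C * `|h| ^+ k * (K * W y ^- q)) by ring.
    by rewrite ler_wpM2l//; exact: mulr_ge0 (ltW c_gt0) (ltW t0).
  have [C C0 HC] := fdiff_Sy_bound (sp_Sy k (@pk_sp R n j.+1)).
  have d1 : - (n + j.+1)%:Z - k%:Z <= 0 by clear; lia.
  have [K K0 HK] := rho_far x0 d1.
  exists (C * `|h| ^+ k * K); split; first by rewrite !mulr_ge0 ?exprn_ge0.
  move=> t y t0 t1 My.
  have B : `|Dk (pk j.+1 t) (x0 - y)| <= C * `|h| ^+ k * (K * W y ^- q).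
    apply: HC => // s sk; apply: le_trans (HK t y s My sk) _; rewrite ler_wpM2l// exprnN.
    by apply: ler_weXz2l; [exact: W_ge1|move: qk'; clear; lia].
  have -> : C * `|h| ^+ k * K * t * W y ^- q = t * (C * `|h| ^+ k * (K * W y ^- q)) by ring.
  apply: ler_pM => //; first by rewrite exprn_ge0// ltW.
  by rewrite exprS ler_piMr ?(ltW t0)// exprn_ile1// ltW.
have [C HC] := choice H; exists (\sum_(j < N) C j); first by apply: sumr_ge0 => j _; case: (HC j).
move=> t y t0 t1 My; rewrite Dk_qk; apply: le_trans (ler_norm_sum _ _ _) _; rewrite !mulr_suml; apply: ler_sum => j _.
rewrite normrM; apply: le_trans (ler_wpM2r _ (coef_le j t0)) _ => //.
by case: (HC j) => _; apply.
Qed.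

(** [u] is cut at a radius M exceeding by 1 every norm |x0 + l a| for l <= k. The inner part is
    bounded, and [qk] acts on it as an approximate identity, having mass one and being dominated by
    [pk 0]; the outer part is O(t) by [qk_small]. *)
Lemma qk_approx N (u : V -> R) q x0 : (q <= k)%N -> continuous u -> ibl mu (fun y => `|u y| * W y ^- q) ->
  (forall t, 0 < t -> ibl mu (fun y => u y * Dk (qk N.+1 t) (x0 - y))) ->
  (fun j => I (fun y => u y * Dk (qk N.+1 (@harmonic R j)) (x0 - y))) @ \oo --> Dk u x0.
Proof.
move=> qk' cu ui ia.
pose M := enorm x0 + k%:R * `|h| + 1.
pose t j : R := @harmonic R j.
have t0 j : 0 < t j by rewrite /t /harmonic invr_gt0.
have tle j : t j <= 1 by rewrite /t /harmonic invf_le1// ler1n.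
have tc : t @ \oo --> (0 : R) by exact: cvg_harmonic.
pose u1 y := u y * ball_ind 0 M y.
have mu' := continuous_measurable cu.
have mu1 : measurable_fun [set: V] u1 by apply: measurable_funM => //; exact: measurable_ball_ind.
have [B B0 HB] := continuous_bounded cu M.
have u1B y : `|u1 y| <= B.
  rewrite /u1 /ball_ind subr0; case: ltP => yM; rewrite ?mulr1 ?mulr0 ?normr0 ?(ltW B0)//.
  by apply: HB; exact: ltW.
have [w _ Hw] := @iter_fdiffE R n k.
have [C C0 HC] := @qk_dom R n N.+1.
have ip p j : ibl mu (fun y => u1 y * qk N.+1 (t j) (p - y)).
  apply: (@iblM _ _ _ mu _ _ B) => //; apply: (@ibl_refl R n (qk N.+1 (t j))).
  by case: (@int_qk R n N (t j) (t0 j)).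
have near1 (l : 'I_k.+1) : (fun j => I (fun y => u1 y * qk N.+1 (t j) (x0 + l%:R *: a - y))) @ \oo --> u (x0 + l%:R *: a).
  set p := x0 + _.
  have pM : enorm p < M.
    apply: (@le_lt_trans _ _ (enorm x0 + k%:R * `|h|)); last by rewrite /M ltrDl.
    apply: le_trans (enorm_triangle _ _) _; rewrite lerD2l !enormZ enorm_ebasis mulr1 normr_nat ler_wpM2r// ler_nat.
    by case: (l).
  have u1p : u1 p = u p by rewrite /u1 /ball_ind subr0 pM mulr1.
  have cp : {for p, continuous u1}.
    apply/continuousVP => e e0; have [d d0 Hd] := (continuousVP u p).1 (cu p) e e0.
    exists (Num.min d (M - enorm p)); first by rewrite lt_min d0 subr_gt0.
    move=> y; rewrite lt_min => /andP[yd yM]; rewrite u1p.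
    have -> : u1 y = u y by rewrite /u1 /ball_ind subr0 (_ : enorm y < M) ?mulr1//; have := enormB_ge y p; move: yM; lra.
    exact: Hd.
  have [iZ Zc] := pk_approx mu1 u1B cp t0 tc.
  apply/cvgrPdist_le => e e0.
  have L : (fun j => C * I (fun y => `|u1 y - u1 p| * pk 0 (t j) (p - y))) @ \oo --> (0 : R).
    by rewrite -[X in _ --> X](mulr0 C); exact: cvgMr.
  near=> j.
  have [iq eq] := @int_qk R n N (t j) (t0 j).
  have iqp := ibl_refl p iq.
  have -> : u p - I (fun y => u1 y * qk N.+1 (t j) (p - y)) = - I (fun y => u1 y * qk N.+1 (t j) (p - y) - u1 p * qk N.+1 (t j) (p - y)).
    by rewrite (IgB (ip p j) (iblZ _ iqp)) (IgZ _ iqp) (Ig_refl p iq) eq mulr1 u1p opprB.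
  rewrite normrN; apply: le_trans (_ : C * I (fun y => `|u1 y - u1 p| * pk 0 (t j) (p - y)) <= e).
    rewrite -(IgZ _ (iZ j)); apply: Ig_norm_le.
    - exact: (iblB (ip p j) (iblZ _ iqp)).
    - exact: (iblZ _ (iZ j)).
    - move=> y; rewrite -mulrBl normrM mulrCA ler_wpM2l//; exact: HC.
  by apply: ltW; near: j; apply: (cvgr_lt 0 L).
have S1 : (fun j => I (fun y => u1 y * Dk (qk N.+1 (t j)) (x0 - y))) @ \oo --> Dk u x0.
  rewrite (_ : (fun j => _) = fun j => \sum_(l < k.+1) w l * I (fun y => u1 y * qk N.+1 (t j) (x0 + l%:R *: a - y))); last first.
    apply/funext => j.
    transitivity (I (fun y => \sum_(l < k.+1) w l * (u1 y * qk N.+1 (t j) (x0 + l%:R *: a - y)))).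
      apply: eq_Ig => y; rewrite Hw mulr_sumr; apply: eq_bigr => l _.
      by rewrite mulrCA [x0 - y + _]addrAC.
    rewrite Ig_sum; last by move=> l; apply: iblZ; exact: ip.
    by apply: eq_bigr => l _; rewrite (IgZ _ (ip _ _)).
  rewrite Hw; apply: cvg_ord_sum => l; apply: cvgMr; exact: near1.
have [K K0 HK] := @qk_small N.+1 q x0 qk'.
have i1 j : ibl mu (fun y => u1 y * Dk (qk N.+1 (t j)) (x0 - y)).
  apply: (@eq_ibl _ _ _ mu (fun y => \sum_(l < k.+1) w l * (u1 y * qk N.+1 (t j) (x0 + l%:R *: a - y)))).
    move=> y; rewrite Hw mulr_sumr; apply: eq_bigr => l _.
    by rewrite mulrCA [x0 - y + _]addrAC.
  by apply: ibl_sum => l; apply: iblZ; exact: ip.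
have S2 j : `|I (fun y => u y * Dk (qk N.+1 (t j)) (x0 - y)) - I (fun y => u1 y * Dk (qk N.+1 (t j)) (x0 - y))| <=
   t j * (K * I (fun y => `|u y| * W y ^- q)).
  have iD := iblB (ia (t j) (t0 j)) (i1 j).
  have iM := iblZ (t j * K) ui.
  rewrite -(IgB (ia (t j) (t0 j)) (i1 j)) mulrA -(IgZ _ ui); apply: Ig_norm_le => // y.
  rewrite -mulrBl /u1 /ball_ind subr0; case: ltP => yM.
    by rewrite mulr1 subrr mul0r normr0 !mulr_ge0 ?WX_ge0 ?(ltW (t0 j)).
  rewrite mulr0 subr0 normrM mulrCA ler_wpM2l//; apply: le_trans (HK (t j) y (t0 j) (tle j) yM) _.
  by rewrite [K * _]mulrC.
apply/cvgrPdist_lt => e e0.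
have L2 : (fun j => t j * (K * I (fun y => `|u y| * W y ^- q))) @ \oo --> (0 : R).
  by rewrite -[X in _ --> X](mul0r (K * I (fun y => `|u y| * W y ^- q))); exact: cvgMl.
have e2 : 0 < e / 2 by rewrite divr_gt0.
move/cvgrPdist_lt: S1 => /(_ _ e2) S1.
near=> j.
have h1 : `|Dk u x0 - I (fun y => u1 y * Dk (qk N.+1 (t j)) (x0 - y))| < e / 2.
  by near: j; exact: S1.
have h2 : t j * (K * I (fun y => `|u y| * W y ^- q)) < e / 2 by near: j; apply: (cvgr_lt 0 L2).
apply: le_lt_trans (ler_distD (I (fun y => u1 y * Dk (qk N.+1 (t j)) (x0 - y))) _ _) _.
have h3 : `|I (fun y => u1 y * Dk (qk N.+1 (t j)) (x0 - y)) - I (fun y => u y * Dk (qk N.+1 (t j)) (x0 - y))| < e / 2.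
  by apply: le_lt_trans h2; rewrite distrC; exact: S2.
by apply: lt_le_trans (ltrD h1 h3) _; rewrite -splitr.
Unshelve. all: by end_near. Qed.

End representation.

(** * The logarithmic potential *)

Section log_potential.
Context {R : realType} {n : nat}.
Notation V := 'rV[R]_n.
Notation mu := (@vmeas R n).
Notation I := (Ig mu).
Implicit Types (x y z : V).
Local Notation cPn := (@cP R n).
Let c_gt0 : 0 < cPn := @cP_gt0 R n.

Definition lbounded (F : V -> R) := forall r, exists B : R, forall y, enorm y <= r -> `|F y| <= B.

(** The factor (n-1)! comes from undoing n derivatives in t. [cnE] identifies this with the constant
    in the definition of a normal metric. *)
Definition cn : R := cPn / (n.-1)`!%:R.

Lemma cn_gt0 : 0 < cn.
Proof. by apply: divr_gt0 => //; rewrite ltr0n fact_gt0. Qed.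

Variable F : V -> R.
Hypothesis n1 : (1 < n)%N.
Hypothesis Fi : ibl mu F.
Hypothesis Fb : lbounded F.
Let n0 : (0 < n)%N := ltnW n1.
Let mF := ibl_meas Fi.

(** A difference of logarithms instead of the logarithm of a quotient: with ln 0 = 0 the two can
    disagree at y = 0 and y = x, and the difference obeys the clean bound [ln_diff_bound]
    everywhere. [normalP] reconciles them. *)
Definition vp x : R := cn * I (fun y => (ln (enorm y) - ln (enorm (x - y))) * F y).

Lemma measurable_Lam_refl x : measurable_fun [set: V] (fun y => Lam (x - y)).
Proof. by apply: (mreflB x); exact: measurable_Lam. Qed.

(** [Lam] is unbounded but integrable and lives on the unit ball, where [F] is bounded: local
    boundedness compensates for what integrability of [F] cannot give. *)
Lemma ibl_LamF x : ibl mu (fun y => Lam (x - y) * `|F y|).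
Proof.
have [B HB] := Fb (enorm x + 1).
have iL : ibl mu (fun y => Lam (x - y)) by apply: ibl_refl; exact: ibl_Lam.
apply: (ibl_le _ _ (iblZ B iL)).
  by apply: measurable_funM; [exact: measurable_Lam_refl|exact: measurableT_comp].
move=> y; rewrite normrM normr_id (ger0_norm (Lam_ge0 _)).
have [xy|xy] := ltP (enorm (x - y)) 1.
  rewrite mulrC ler_wpM2r ?Lam_ge0//; apply: HB.
  by have := enormB_ge y x; rewrite enormBC; move: xy; lra.
by rewrite /Lam /ball_ind subr0 ltNge xy /= mulr0 mul0r mulr0.
Qed.

Lemma ln_diff_bound x y : `|ln (enorm y) - ln (enorm (x - y))| <= ln (1 + enorm x) + Lam y + Lam (x - y).
Proof.
have ex := enorm_ge0 x.
have m1 (z : V) : 0 < Num.max 1 (enorm z) by rewrite lt_max ltr01.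
have le (z w : V) : enorm z <= enorm w + enorm x -> ln (Num.max 1 (enorm z)) <= ln (1 + enorm x) + ln (Num.max 1 (enorm w)).
  move=> h; apply: ln_le_mul => //; first by lra.
  have h1 : 1 <= Num.max 1 (enorm w) by rewrite le_max lexx.
  have h2 : enorm w <= Num.max 1 (enorm w) by rewrite le_max lexx orbT.
  by rewrite ge_max; apply/andP; split; nra.
have a1 : enorm y <= enorm (x - y) + enorm x.
  by have := enorm_triangle (- (x - y)) x; rewrite opprB subrK enormBC.
have a2 : enorm (x - y) <= enorm y + enorm x.
  by apply: le_trans (enorm_triangle _ _) _; rewrite enormN addrC.
have := le _ _ a1; have := le _ _ a2; rewrite (lnE y) (lnE (x - y)).
have := Lam_ge0 y; have := Lam_ge0 (x - y).
move: (ln (Num.max 1 (enorm y))) (ln (Num.max 1 (enorm (x - y)))) (Lam y) (Lam (x - y)) => A B C D *.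
by rewrite ler_norml; apply/andP; split; lra.
Qed.

Lemma measurable_ln_diff x : measurable_fun [set: V] (fun y => ln (enorm y) - ln (enorm (x - y))).
Proof. by apply: measurable_funB; [exact: measurable_lnorm|exact: (mreflB x (@measurable_lnorm R n))]. Qed.

Lemma ibl_LamF0 : ibl mu (fun y => Lam y * `|F y|).
Proof. by apply: eq_ibl (ibl_LamF 0) => y; rewrite sub0r LamN. Qed.

Lemma ibl_v x : ibl mu (fun y => (ln (enorm y) - ln (enorm (x - y))) * F y).
Proof.
apply: (@ibl_le _ _ _ mu _ (fun y => ln (1 + enorm x) * `|F y| + Lam y * `|F y| + Lam (x - y) * `|F y|)).
- by apply: measurable_funM => //; exact: measurable_ln_diff.
- by move=> y; rewrite normrM -!mulrDl ler_wpM2r// ln_diff_bound.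
- by apply: iblD; [apply: iblD; [apply: iblZ; exact: ibl_norm|exact: ibl_LamF0]|exact: ibl_LamF].
Qed.

Section differences.
Variables (i : 'I_n) (h : R) (k : nat) (x0 : V).
Hypothesis k1 : (1 < k)%N.
Local Notation a := (h *: ebasis i : V).
Local Notation Dk := (iter k (fdiff a)).

Lemma Dk_vp : ibl mu (fun y => F y * Dk (fun z => ln (enorm z)) (x0 - y)) /\
  Dk vp x0 = - (cn * I (fun y => F y * Dk (fun z => ln (enorm z)) (x0 - y))).
Proof.
have [w _ Hw] := @iter_fdiffE R n k.
have E0 c : \sum_(j < k.+1) w j * c = 0 by have := Dk_const i h k1 c 0; rewrite Hw.
have E y : F y * Dk (fun z => ln (enorm z)) (x0 - y) =
    - \sum_(j < k.+1) w j * ((ln (enorm y) - ln (enorm (x0 + j%:R *: a - y))) * F y).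
  rewrite Hw mulr_sumr -sumrN.
  transitivity (\sum_(j < k.+1) (- (w j * ((ln (enorm y) - ln (enorm (x0 + j%:R *: a - y))) * F y)) + w j * (ln (enorm y) * F y))).
    by apply: eq_bigr => j _; rewrite [x0 - y + _]addrAC; ring.
  by rewrite big_split /= E0 addr0.
have iS : ibl mu (fun y => \sum_(j < k.+1) w j * ((ln (enorm y) - ln (enorm (x0 + j%:R *: a - y))) * F y)).
  by apply: ibl_sum => j; apply: iblZ; exact: ibl_v.
have Ei := eq_ibl (fun y => esym (E y)) (iblN iS).
split => //; rewrite (eq_Ig mu E) (IgN iS) mulrN opprK Ig_sum; last by move=> j; apply: iblZ; exact: ibl_v.
rewrite Hw mulr_sumr; apply: eq_bigr => j _.
by rewrite (IgZ _ (ibl_v _)) /vp mulrCA.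
Qed.

Definition nz y : R := \prod_(j < k.+1) (x0 - y + j%:R *: a != 0)%R%:R.
(* F0 drops the finitely many y at which the differences of ln |x0 - y| meet the junk value ln 0 = 0. *)
Definition F0 y : R := F y * nz y.

Lemma nzP y : (nz y = 1 /\ forall j : 'I_k.+1, x0 - y + j%:R *: a != 0) \/
  (nz y = 0 /\ y \in [seq x0 + (nat_of_ord j)%:R *: a | j <- enum 'I_k.+1]).
Proof.
have [/forallP H|/forallPn[j /negPn /eqP H]] := boolP [forall j : 'I_k.+1, x0 - y + j%:R *: a != 0].
  by left; split => //; rewrite /nz big1// => j _; rewrite H.
right; split; first by rewrite /nz (bigD1 j)//= H eqxx mul0r.
apply/mapP; exists j; first by rewrite mem_enum.
by apply/eqP; rewrite eq_sym -subr_eq0 -H addrAC.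
Qed.

Lemma measurable_nz : measurable_fun [set: V] nz.
Proof.
have mj (j : nat) : measurable_fun [set: V] (fun y => (x0 - y + j%:R *: a != 0)%R%:R : R).
  have -> : (fun y => (x0 - y + j%:R *: a != 0)%R%:R : R) = \1_((fun y : V => enorm (x0 + j%:R *: a - y)) @^-1` `]0, +oo[%classic).
    apply/funext => y; rewrite indicE -enorm_gt0 addrAC; congr (_%:R); congr nat_of_bool.
    by apply/idP/idP; rewrite inE /= in_itv /= andbT.
  apply: measurable_indic; rewrite -[X in measurable X]setTI.
  by apply: (mreflB (x0 + j%:R *: a) (@measurable_enorm R n)).
rewrite /nz; elim: (index_enum _) => [|j s IH].
  by rewrite (_ : (fun y => _) = fun _ => 1)//; apply/funext => y; rewrite big_nil.
rewrite (_ : (fun y => _) = fun y => (x0 - y + j%:R *: a != 0)%R%:R * \prod_(j <- s) (x0 - y + j%:R *: a != 0)%R%:R); last first.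
  by apply/funext => y; rewrite big_cons.
exact: measurable_funM.
Qed.

Lemma F0_norm y : `|F0 y| <= `|F y|.
Proof.
rewrite normrM; case: (nzP y) => -[-> _]; first by rewrite normr1 mulr1.
by rewrite normr0 mulr0.
Qed.

Lemma measurable_F0 : measurable_fun [set: V] F0.
Proof. by apply: measurable_funM => //; exact: measurable_nz. Qed.

Lemma Ig_F0 g : measurable_fun [set: V] g -> ibl mu (fun y => F0 y * g y) ->
  ibl mu (fun y => F y * g y) /\ I (fun y => F y * g y) = I (fun y => F0 y * g y).
Proof.
move=> mg ig.
have H y : y \notin [seq x0 + (nat_of_ord j)%:R *: a | j <- enum 'I_k.+1] -> F y * g y - F0 y * g y = 0.
  by case: (nzP y) => -[h1 h2]; rewrite ?h2// => _; rewrite /F0 h1 mulr1 subrr.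
have [i1 E1] := @Ig_finite_support R n n0 _ _
  (measurable_funB (measurable_funM mF mg) (measurable_funM measurable_F0 mg)) H.
have E y : F0 y * g y + (F y * g y - F0 y * g y) = F y * g y by rewrite addrC subrK.
split; first exact: (eq_ibl E (iblD ig i1)).
by rewrite -(eq_Ig mu E) (IgD ig i1) E1 addr0.
Qed.

Definition Gd (w : nat -> R) (C : R) y : R := `|F y| * \sum_(j < k.+1) w j * (C + Lam (x0 - y + j%:R *: a)).

Lemma ibl_Gd w C : ibl mu (Gd w C).
Proof.
apply: (@eq_ibl _ _ _ mu (fun y => \sum_(j < k.+1) w j * (C * `|F y| + Lam (x0 + j%:R *: a - y) * `|F y|))).
  move=> y; rewrite /Gd mulr_sumr; apply: eq_bigr => j _.
  by rewrite [x0 - y + _]addrAC; ring.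
by apply: ibl_sum => j; apply: iblZ; apply: iblD; [apply: iblZ; exact: ibl_norm|exact: ibl_LamF].
Qed.

Lemma lk_dom N : exists2 G : V -> R, ibl mu G & forall t y, 0 < t ->
  `|F0 y * Dk (lk N t) (x0 - y)| <= G y.
Proof.
have [w w0 [C C0 H]] := @lk_Dk_bound R n i h k k1 N.
exists (Gd w C); first exact: ibl_Gd.
move=> t y t0; rewrite /F0; case: (nzP y) => -[-> Hy].
  by rewrite mulr1 normrM ler_wpM2l// H.
rewrite mulr0 mul0r normr0 mulr_ge0// sumr_ge0// => j _.
by rewrite mulr_ge0// addr_ge0// Lam_ge0.
Qed.

Lemma measurable_Dk (g : V -> R) : measurable_fun [set: V] g -> measurable_fun [set: V] (fun y => Dk g (x0 - y)).
Proof.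
move=> mg; apply: (mreflB x0 (f := Dk g)).
elim: k => [//|m IH]; rewrite iterS; apply: measurable_funB => //.
by apply: (vcomp (f := iter m (fdiff a) g)) => //; apply: measurable_rVD => //; exact: measurable_cst.
Qed.

Lemma ibl_lk N t : 0 < t -> ibl mu (fun y => F0 y * Dk (lk N t) (x0 - y)).
Proof.
move=> t0; have [G iG HG] := lk_dom N.
apply: (ibl_le _ (fun y => HG t y t0) iG).
by apply: measurable_funM; [exact: measurable_F0|apply: measurable_Dk; exact: measurable_lk].
Qed.

Lemma lk_to0 N : (fun j : nat => I (fun y => F0 y * Dk (lk N j.+1%:R) (x0 - y))) @ \oo --> (0 : R).
Proof.
have [G iG HG] := lk_dom N; have t0 (j : nat) : 0 < j.+1%:R :> R by [].
have [w _ Hw] := @iter_fdiffE R n k.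
have [||||_] := @Ig_dct _ _ _ mu (fun (j : nat) y => F0 y * Dk (lk N j.+1%:R) (x0 - y)) (fun _ => 0) G.
- by move=> j; exact: ibl_meas (ibl_lk N (t0 j)).
- exact: iG.
- by move=> j y; exact: HG.
- move=> y; rewrite -[X in _ --> X](mulr0 (F0 y)); apply: cvgMr.
  have E (j : nat) : \sum_(l < k.+1) w l * (lk N j.+1%:R (x0 - y + l%:R *: a) - lk N j.+1%:R (0 : V)) = Dk (lk N j.+1%:R) (x0 - y).
    under eq_bigr do rewrite mulrBr.
    have E0 := Dk_const i h k1 (lk N j.+1%:R (0 : V)) 0; rewrite Hw in E0.
    by rewrite sumrB E0 subr0 Hw.
  have L : (fun j : nat => \sum_(l < k.+1) w l * (lk N j.+1%:R (x0 - y + l%:R *: a) - lk N j.+1%:R (0 : V))) @ \oo --> \sum_(l < k.+1) w l * 0.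
    apply: cvg_ord_sum => l; apply: cvgMr; apply/norm_cvg0P.
    apply: (@squeeze_cvgr _ _ _ _ (fun _ : nat => 0) (fun j : nat => (N.+1%:R * enorm (x0 - y + l%:R *: a)) * @harmonic R j)).
    + apply: nearW => j; rewrite normr_ge0 /=; apply: le_trans (lk_far _ _ (t0 j)) _.
      by rewrite /harmonic mulrA.
    + exact: cvg_cst.
    + by rewrite -[X in _ --> X](mulr0 (N.+1%:R * enorm (x0 - y + l%:R *: a))); apply: cvgMr; exact: cvg_harmonic.
  rewrite big1 in L; last by move=> l _; rewrite mulr0.
  by apply: cvg_trans L; apply: near_eq_cvg; apply: nearW => j; exact: E.
- by rewrite Ig0.
Qed.

Lemma lk_toln N : ibl mu (fun y => F0 y * Dk (fun z => ln (enorm z)) (x0 - y)) /\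
  (fun j : nat => I (fun y => F0 y * Dk (lk N (@harmonic R j)) (x0 - y))) @ \oo -->
  I (fun y => F0 y * Dk (fun z => ln (enorm z)) (x0 - y)).
Proof.
have [G iG HG] := lk_dom N; have t0 (j : nat) : 0 < @harmonic R j by rewrite /harmonic invr_gt0.
have [w _ Hw] := @iter_fdiffE R n k.
apply: (@Ig_dct _ _ _ mu _ _ G).
- by move=> j; exact: ibl_meas (ibl_lk N (t0 j)).
- exact: iG.
- by move=> j y; exact: HG.
move=> y; case: (nzP y) => -[E Hy]; last first.
  rewrite /F0 E mulr0 mul0r (_ : (fun _ => _) = fun _ : nat => 0); first exact: cvg_cst.
  by apply/funext => j; rewrite mul0r.
apply: cvgMr; rewrite Hw (_ : (fun j : nat => Dk (lk N (@harmonic R j)) (x0 - y)) = fun j : nat => \sum_(l < k.+1) w l * lk N (@harmonic R j) (x0 - y + l%:R *: a)); last first.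
  by apply/funext => j; rewrite Hw.
by apply: cvg_ord_sum => l; apply: cvgMr; apply: lk_cvg => //; exact: cvg_harmonic.
Qed.

Lemma kernel_derive (f w : V -> R) (g p : R -> V -> R) (c : R -> R) (t M : R) : 0 < t ->
  (forall (s : R) z, 0 < s -> is_derive s 1 (g ^~ z) (c s * p s z)) ->
  (forall s, t / 2 < s < 2 * t -> `|c s| <= M) ->
  (forall s y, t / 2 <= s -> `|Dk (p s) (x0 - y)| <= w y) ->
  ibl mu (fun y => `|f y| * w y) ->
  (forall s, 0 < s -> ibl mu (fun y => f y * Dk (g s) (x0 - y))) ->
  measurable_fun [set: V] f -> continuous (p t) ->
  is_derive t 1 (fun s => I (fun y => f y * Dk (g s) (x0 - y))) (c t * I (fun y => f y * Dk (p t) (x0 - y))).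
Proof.
move=> t0 Hd Hc Hw iw ig mf cp.
have tt : t / 2 < t < 2 * t by apply/andP; split; lra.
have ip : ibl mu (fun y => f y * Dk (p t) (x0 - y)).
  apply: (ibl_le _ _ iw); first by apply: measurable_funM => //; apply: measurable_Dk; exact: continuous_measurable.
  by move=> y; rewrite normrM ler_wpM2l// Hw//; case/andP: tt => /ltW.
rewrite -(IgZ _ ip).
apply: (@Ig_derive _ _ _ mu (fun s y => f y * Dk (g s) (x0 - y)) (fun s y => c s * (f y * Dk (p s) (x0 - y)))
  (fun y => M * (`|f y| * w y)) t (t / 2) (2 * t) tt).
- by move=> s /andP[s1 _]; apply: ig; apply: lt_trans s1; rewrite divr_gt0.
- move=> s y /andP[s1 _]; have s0 : 0 < s by apply: lt_trans s1; rewrite divr_gt0.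
  have D x : is_derive s 1 (fun s => Dk (g s) x) (c s * Dk (p s) x).
    elim: k x => [|m IH] x; first exact: Hd.
    by rewrite !iterS; apply: (der_eq (derB (IH (x + a)) (IH x))) => //; rewrite /fdiff mulrBr.
  by apply: (der_eq (derZ (f y) (D (x0 - y)))) => //; rewrite mulrCA.
- move=> s y st; rewrite !normrM; apply: ler_pM => //; first exact: Hc.
  by rewrite ler_wpM2l// Hw//; case/andP: st => /ltW.
- exact: iblZ.
Qed.

Section representation.
Variables (u : V -> R) (q : nat).
Hypothesis qk' : (q <= k)%N.
Hypothesis su : smooth u.
Hypothesis uF : frac_lap_eq u F.
Hypothesis ui : ibl mu (fun y => `|u y| * W y ^- q).

Let cu : continuous u. Proof. by case: (su [::]). Qed.

Lemma Dk_pk_W j s0 : 0 < s0 -> exists2 C : R, 0 <= C & forall s y, s0 <= s ->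
  `|Dk (pk j s) (x0 - y)| <= C * W y ^- q.
Proof.
move=> s00; have d1 : - (n + j)%:Z - k%:Z <= 0 by clear; lia.
have [C C0 HC] := fdiff_W i h x0 (sp_Sy k (@pk_sp R n j)) s00 d1; exists C => // s y sy.
apply: le_trans (HC s y sy) _; rewrite ler_wpM2l// exprnN; apply: ler_weXz2l; first exact: W_ge1.
by move: qk'; clear; lia.
Qed.

Lemma ibl_uqk N t : 0 < t -> ibl mu (fun y => u y * Dk (qk N t) (x0 - y)).
Proof.
move=> t0; apply: (@eq_ibl _ _ _ mu (fun y => \sum_(j < N) ((-1) ^+ j * t ^+ j / j`!%:R) * (u y * Dk (pk j t) (x0 - y)))).
  by move=> y; rewrite Dk_qk mulr_sumr; apply: eq_bigr => j _; rewrite mulrCA.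
apply: ibl_sum => j; apply: iblZ; have [C C0 HC] := Dk_pk_W j t0.
apply: (@ibl_le _ _ _ mu _ (fun y => C * (`|u y| * W y ^- q))).
- apply: measurable_funM; first exact: continuous_measurable.
  by apply: measurable_Dk; apply: continuous_measurable; exact: pk_continuous.
- by move=> y; rewrite normrM mulrCA ler_wpM2l// HC.
- exact: iblZ.
Qed.

(* A(t) + cn B(t), with A and B the integrals of u and F against differences of qk and lk,
   is constant in t; compare t -> 0 with t -> oo. *)
Lemma Dk_represent : Dk u x0 = Dk vp x0.
Proof.
have [iv ->] := Dk_vp.
pose N := n.-1; have nE : N.+1 = n by rewrite /N prednK.
have mu' : measurable_fun [set: V] u by exact: continuous_measurable.
have mln : measurable_fun [set: V] (fun y => Dk (fun z => ln (enorm z)) (x0 - y)).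
  by apply: measurable_Dk; exact: measurable_lnorm.
have [i0 L2] := lk_toln N.+1.
have [_ ->] := Ig_F0 mln i0.
pose ca t : R := (-1) ^+ N * t ^+ N / N`!%:R.
pose cb t : R := t ^+ N / cPn.
pose A t := I (fun y => u y * Dk (qk N.+1 t) (x0 - y)).
pose B t := I (fun y => F0 y * Dk (lk N.+1 t) (x0 - y)).
have coefb (t s : R) : 0 < t -> t / 2 < s < 2 * t -> `|s ^+ N| <= (2 * t) ^+ N.
  move=> t0 /andP[s1 s2]; have s0 : 0 < s by apply: lt_trans s1; rewrite divr_gt0.
  by rewrite ger0_norm ?exprn_ge0 ?(ltW s0)//; apply: lerXn2r; rewrite ?nnegrE ?(ltW s0) ?(ltW s2)// mulr_ge0 ?(ltW t0).
have dA (t : R) : 0 < t -> is_derive t 1 A (ca t * I (fun y => u y * Dk (pk N.+1 t) (x0 - y))).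
  move=> t0; have t2 : 0 < t / 2 by rewrite divr_gt0.
  have [C C0 HC] := Dk_pk_W N.+1 t2.
  apply: (@kernel_derive u (fun y => C * W y ^- q) (qk N.+1) (pk N.+1) ca t ((2 * t) ^+ N) t0).
  - by move=> s z s0; apply: qk_ds; rewrite gt_eqF.
  - move=> s st; have /andP[s1 _] := st; have s0 : 0 < s by apply: lt_trans s1.
    by apply: le_trans (coef_le _ s0) _; apply: le_trans (coefb _ _ t0 st); exact: ler_norm.
  - exact: HC.
  - by apply: (eq_ibl _ (iblZ C ui)) => y; rewrite mulrCA.
  - by move=> s s0; exact: ibl_uqk.
  - exact: mu'.
  - exact: pk_continuous.
have dB (t : R) : 0 < t -> is_derive t 1 B (cb t * I (fun y => F0 y * Dk (pk 0 t) (x0 - y))).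
  move=> t0; have t2 : 0 < t / 2 by rewrite divr_gt0.
  have [C C0 HC] := Dk_pk_W 0 t2.
  apply: (@kernel_derive F0 (fun _ => C) (lk N.+1) (pk 0) cb t ((2 * t) ^+ N / cPn) t0).
  - move=> s z s0; apply: (der_eq (is_derive_lk N.+1 z s0)) => //.
    have rE : rp n.+1 s z = rp N.+2 s z by rewrite nE.
    rewrite pk0E /cb rE exprS; have cN : cPn != 0 by rewrite gt_eqF.
    by move: cPn cN (s ^+ N) (rp N.+2 s z) => c cN e r; field.
  - by move=> s st; rewrite normrM normfV (gtr0_norm c_gt0) ler_wpM2r ?invr_ge0 ?(ltW c_gt0)// coefb.
  - by move=> s y sy; apply: le_trans (HC s y sy) _; rewrite ler_piMr// WX_le1.
  - apply: (@ibl_le _ _ _ mu _ (fun y => C * `|F y|)).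
    + by apply: measurable_funM => //; apply: measurableT_comp => //; exact: measurable_F0.
    + by move=> y; rewrite normrM normr_id (ger0_norm C0) mulrC ler_wpM2l// F0_norm.
    + by apply: iblZ; exact: ibl_norm.
  - by move=> s s0; exact: ibl_lk.
  - exact: measurable_F0.
  - exact: pk_continuous.
(* The equation enters here. [frac_lap_test] turns the n-th time derivative against [u] into [F]
   against the kernel, and the signs (-1)^(n-1) and (-1)^n multiply to the -1 that cancels the two
   derivatives. *)
have E t : 0 < t -> ca t * I (fun y => u y * Dk (pk N.+1 t) (x0 - y)) = - (cn * (cb t * I (fun y => F0 y * Dk (pk 0 t) (x0 - y)))).
  move=> t0.
  have mp : measurable_fun [set: V] (fun y => Dk (pk 0 t) (x0 - y)).
    by apply: measurable_Dk; apply: continuous_measurable; exact: pk_continuous.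
  have ip : ibl mu (fun y => F0 y * Dk (pk 0 t) (x0 - y)).
    have [C C0 HC] := Dk_pk_W 0 t0.
    apply: (@ibl_le _ _ _ mu _ (fun y => C * `|F y|)); last by apply: iblZ; exact: ibl_norm.
      by apply: measurable_funM => //; exact: measurable_F0.
    move=> y; rewrite normrM mulrC; apply: ler_pM => //; last exact: F0_norm.
    by apply: le_trans (HC t y (lexx _)) _; rewrite ler_piMr// WX_le1.
  have [_ <-] := Ig_F0 mp ip.
  have G m : m = n -> I (fun y => F y * Dk (pk 0 t) (x0 - y)) = (-1) ^+ m * I (fun y => u y * Dk (pk m t) (x0 - y)).
    by move=> ->; exact: (frac_lap_test i h x0 n0 qk' k1 t0 su uF Fi ui).
  rewrite (G _ nE) /ca /cb /cn -/N exprS.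
  have cN : cPn != 0 by rewrite gt_eqF.
  have fN : N`!%:R != 0 :> R by rewrite pnatr_eq0 -lt0n fact_gt0.
  have s1 : (-1) ^+ N * (-1) ^+ N = 1 :> R by rewrite -exprMn mulrNN mulr1 expr1n.
  move: cPn cN (I _) (N`!%:R) fN ((-1) ^+ N) s1 (t ^+ N) => c cN X f fN s s1 T; field.
  by rewrite cN fN.
pose D t := A t + cn * B t.
have dD (t : R) : 0 < t -> is_derive t 1 D 0.
  by move=> t0; apply: (der_eq (derD (dA t t0) (derZ cn (dB t t0)))) => //; rewrite E// addNr.
have Dc (j : nat) : D (@harmonic R j) = D j.+1%:R.
  have h0 : 0 < @harmonic R j by rewrite /harmonic invr_gt0.
  apply: der0_const => [|t /andP[t1 _]]; last by apply: dD; exact: lt_le_trans t1.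
  by apply: (@le_trans _ _ 1); [rewrite /harmonic invf_le1// ler1n|rewrite ler1n].
have LA : (fun j => A (@harmonic R j)) @ \oo --> Dk u x0.
  by exact: (@qk_approx R n i h k N u q x0 qk' cu ui (fun t t0 => ibl_uqk N.+1 t0)).
have LA0 : (fun j : nat => A j.+1%:R) @ \oo --> (0 : R).
  have [C C0 HC] := @qk_large R n i h k N.+1 q x0 qk'.
  apply/norm_cvg0P; apply: (@squeeze_cvgr _ _ _ _ (fun _ : nat => 0) (fun j : nat => (C * I (fun y => `|u y| * W y ^- q)) * @harmonic R j)).
  + apply: nearW => j; rewrite normr_ge0 /=.
    have -> : C * I (fun y => `|u y| * W y ^- q) * @harmonic R j = I (fun y => (C * @harmonic R j) * (`|u y| * W y ^- q)).
      by rewrite (IgZ _ ui) mulrAC.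
    apply: Ig_norm_le; [exact: ibl_uqk|exact: iblZ|].
    move=> y; rewrite normrM mulrCA ler_wpM2l//; apply: HC; by rewrite ler1n.
  + exact: cvg_cst.
  + by rewrite -[X in _ --> X](mulr0 (C * I (fun y => `|u y| * W y ^- q))); apply: cvgMr; exact: cvg_harmonic.
have X1 : (fun j => D (@harmonic R j)) @ \oo --> Dk u x0 + cn * I (fun y => F0 y * Dk (fun z => ln (enorm z)) (x0 - y)).
  by apply: cvgD => //; apply: cvgMr; exact: L2.
have X2 : (fun j : nat => D j.+1%:R) @ \oo --> 0 + cn * 0.
  by apply: cvgD => //; apply: cvgMr; exact: lk_to0.
have e : (fun j => D (@harmonic R j)) = (fun j : nat => D j.+1%:R) by apply/funext.
rewrite e in X1; have H0 := cvg_unique (@Rhausdorff R) X1 X2.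
have H : _ + _ = 0 :> R := etrans (H0 _) (etrans (add0r _) (mulr0 cn)).
have G (b c : R) : b + c = 0 -> b = - c by move=> bc; apply/eqP; rewrite -addr_eq0 bc.
exact: G (H _).
Qed.

End representation.
End differences.
End log_potential.

(** * A priori growth of a solution *)

Section growth.
Context {R : realType} {n : nat}.
Notation V := 'rV[R]_n.
Notation mu := (@vmeas R n).
Notation I := (Ig mu).
Implicit Types (x y z : V).

Variables (u F : V -> R).
Hypothesis n0 : (0 < n)%N.
Hypothesis su : smooth u.
Hypothesis uF : frac_lap_eq u F.
Hypothesis Fi : ibl mu F.

Let Hu N : CN N u. Proof. exact: smooth_CN. Qed.
Let m := n./2.
Let f x := (-1) ^+ m * iter m Lap u x.

Let cL : continuous (iter m Lap u).
Proof. by apply: (@CN_continuous _ _ 0); apply: CN_iter_Lap; exact: Hu. Qed.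

(** For even n, [F] is a derivative of [u] up to sign. For odd n it is given by the integral of
    second differences of a C^2 function, and [J_bound] is uniform for x in a ball. *)
Lemma F_lbounded : lbounded F.
Proof.
move: uF; rewrite /frac_lap_eq -/m; case: ifP => [en FE|/negbFE on [Lh FE]] r.
  have [C _ HC] := continuous_bounded cL r; exists C => y yr.
  by rewrite FE normrM normrX normrN1 expr1n mul1r HC.
have fi := L_half_ibl Lh; rewrite -/f in fi.
have Hf : CN 2 f by apply: CN_M; [exact: CN_C|apply: CN_iter_Lap; exact: Hu].
have [B _ HB] := J_bound n0 Hf fi r; exists B => y yr.
have -> := half_lap_eq n0 Hf fi on (FE y).
by case: (HB y yr).
Qed.

(** Start of the descent through the powers of the Laplacian: for even n the top power is [F] up to
    sign, hence integrable; for odd n the membership in [L_half] bounds its integral over a ball of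
    radius r by a multiple of r^(n+1). *)
Lemma pgrow_top : pgrow (fun r => I (fun x => iter m Lap u x * En 4 r x)).
Proof.
have iE r : 1 <= r -> ibl mu (fun x => iter m Lap u x * En 4 r x).
  by move=> r1; apply: ibl_mul_En => //; exact: lt_le_trans r1.
have fE x : `|iter m Lap u x| = `|f x| by rewrite /f normrM normrX normrN1 expr1n mul1r.
move: uF; rewrite /frac_lap_eq -/m; case: ifP => [en FE|/negbFE on [Lh FE]].
  exists (I (fun x => `|F x|)), 8%N => r r1; have r0 : 0 <= r by exact: le_trans r1.
  rewrite mulrC -(IgZ _ (ibl_norm Fi)); apply: Ig_norm_le; [exact: iE|exact: iblZ (ibl_norm Fi)|].
  move=> x; have E : `|F x| = `|iter m Lap u x| by rewrite FE -/(f x) fE.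
  rewrite normrM E mulrC (ger0_norm (En_ge0 _ _ _)); apply: ler_wpM2r => //; exact: En_le.
have fi := L_half_ibl Lh; rewrite -/f in fi.
exists (2 ^+ n.+1 * I (fun y => `|f y| * W y ^- n.+1)), (8 + n.+1)%N => r r1.
have r0 : 0 < r by exact: lt_le_trans r1.
rewrite [leRHS](_ : _ = r ^+ (8 + n.+1) * (2 ^+ n.+1 * I (fun y => `|f y| * W y ^- n.+1))); last by rewrite mulrC.
rewrite -(IgZ (2 ^+ n.+1) fi) -(IgZ _ (iblZ (2 ^+ n.+1) fi)).
apply: Ig_norm_le; [exact: iE|exact/iblZ/iblZ|move=> x].
rewrite normrM fE (ger0_norm (En_ge0 _ _ _)).
have [xr|xr] := leP r (enorm x).
  rewrite (En_supp _ r0 xr) mulr0; apply: mulr_ge0; first by rewrite exprn_ge0 ?(ltW r0).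
  by apply: mulr_ge0; [rewrite exprn_ge0|exact: mulr_ge0 (normr_ge0 _) (WX_ge0 _ _)].
have h1 : En 4 r x <= r ^+ 8 by exact: En_le (ltW r0).
have h2 : W x ^+ n.+1 <= (2 * r) ^+ n.+1.
  by apply: lerXn2r; rewrite ?nnegrE ?(ltW (W_gt0 _))//; rewrite ?mulr_ge0 ?(ltW r0)// /W; lra.
have w0 : 0 < W x ^+ n.+1 by rewrite exprn_gt0// W_gt0.
rewrite -/(f x) [leRHS](_ : _ = `|f x| * (r ^+ 8 * ((2 * r) ^+ n.+1 * W x ^- n.+1))); last first.
  by rewrite exprD exprMn; move: (2 ^+ n.+1) (r ^+ n.+1) (r ^+ 8) (W x ^- _) `|f x| => A B C D E; ring.
rewrite ler_wpM2l//; apply: le_trans h1 _; rewrite ler_peMr ?exprn_ge0 ?(ltW r0)//.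
by rewrite ler_pdivlMr// mul1r.
Qed.

Lemma ball_ind_le (r s : R) x : r <= s -> ball_ind 0 r x <= ball_ind 0 s x.
Proof.
move=> rs; rewrite /ball_ind; case: ltP => h1; last by case: ltP.
by rewrite (lt_le_trans h1 rs).
Qed.

Let cexp : continuous (fun x => expR (n%:R * u x)).
Proof.
move=> x; apply: (@continuous_comp _ _ _ (fun x => n%:R * u x) expR); last exact: continuous_expR.
by apply: continuousM; [exact: cst_continuous|case: (su [::]) => c _; exact: c].
Qed.

Definition gv r : R := I (fun x => expR (n%:R * u x) * ball_ind 0 r x).

Lemma ibl_gv r : ibl mu (fun x => expR (n%:R * u x) * ball_ind 0 r x).
Proof. exact: cont_ibl_ball. Qed.

Lemma gv_mono r s : r <= s -> gv r <= gv s.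
Proof.
move=> rs; apply: Ig_le; [exact: ibl_gv|exact: ibl_gv|].
by move=> x; rewrite ler_wpM2l ?expR_ge0 ?ball_ind_le.
Qed.

Lemma gvolE r : gvol u r = gv r.
Proof.
rewrite /gvol -int_vmeas.
- rewrite -[fine _]/(Ig _ _); apply: eq_Ig => x; rewrite /ball_ind subr0 indicE mulrC.
  by congr (_ * _); congr (_%:R); rewrite mem_setE.
- by move=> x; rewrite lee_fin mulr_ge0 ?expR_ge0// indicE.
- apply/measurable_EFinP; apply: measurable_funM.
    exact: measurable_indic (measurable_eball r).
  exact: continuous_measurable.
Qed.

Lemma Rn_vol_eball r : 0 < r -> Rn_vol (eball r : set V) = @ballvol R n * r ^+ n.
Proof.
move=> r0; rewrite /Rn_vol -int_vmeas.
- rewrite -(Ig_ball_ind 0 r0) -[fine _]/(Ig _ _); apply: eq_Ig => x; rewrite /ball_ind subr0 indicE.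
  by congr (_%:R); rewrite mem_setE.
- by move=> x; rewrite lee_fin indicE.
- by apply/measurable_EFinP; exact: measurable_indic (measurable_eball r).
Qed.

(** max(u, 0) <= exp(n u), so the volume of balls controls the positive part of [u], which is the
    one-sided input of [ibl_growth]. *)
Lemma weight_exists : (exists K p, forall r, 1 <= r -> gv r <= K * r ^+ p) ->
  exists q, ibl mu (fun x => `|u x| * W x ^- q).
Proof.
move=> [K [p H]]; apply: (ibl_growth (Hu _) pgrow_top); exists K, p => r r1.
apply: le_trans (H r r1); apply: Ig_le; last 1 first.
- move=> x; apply: ler_wpM2r; first exact: ball_ind_ge0.
  rewrite ge_max expR_ge0 andbT.
  have [u0|u0] := leP 0 (u x); last by apply: le_trans (ltW u0) _; exact: expR_ge0.
  apply: le_trans (_ : n%:R * u x <= _); first by rewrite ler_peMl// ler1n.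
  by apply: le_trans (expR_ge1Dx _); rewrite lerDr.
- apply: cont_ibl_ball => x.
  by apply: (@continuous_max _ _ u (fun _ => 0)); [case: (su [::]) => c _; exact: c|exact: cst_continuous].
- exact: ibl_gv.
Qed.

End growth.

(** * Growth of the logarithmic potential *)

Section potential_growth.
Context {R : realType} {n : nat}.
Notation V := 'rV[R]_n.
Notation mu := (@vmeas R n).
Notation I := (Ig mu).
Implicit Types (x y z : V).

Lemma conv_ibl (K g : V -> R) : ibl mu K -> (forall z, 0 <= K z) -> (forall z, 1 <= enorm z -> K z = 0) ->
  ibl mu g -> lbounded g -> (forall y, 0 <= g y) ->
  [/\ forall x, ibl mu (fun y => K (x - y) * g y), ibl mu (fun x => I (fun y => K (x - y) * g y)) &
      I (fun x => I (fun y => K (x - y) * g y)) = I K * I g].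
Proof.
move=> iK K0 K1 ig gb g0; have mK := ibl_meas iK; have mg := ibl_meas ig.
have i2 x : ibl mu (fun y => K (x - y) * g y).
  have [B HB] := gb (enorm x + 1).
  apply: (ibl_le _ _ (iblZ B (ibl_refl x iK))).
    by apply: measurable_funM => //; exact: (mreflB x mK).
  move=> y; rewrite ger0_norm ?mulr_ge0//.
  have [xy|xy] := ltP (enorm (x - y)) 1; last by rewrite K1// mul0r mulr0.
  rewrite mulrC ler_wpM2r//; apply: le_trans (ler_norm _) _; apply: HB.
  by have := enormB_ge y x; rewrite enormBC; move: xy; lra.
have i1 y : ibl mu (fun x => K (x - y) * g y).
  by apply: (eq_ibl _ (iblZ (g y) (ibl_shift (- y) iK))) => x; rewrite mulrC.
have E1 y : I (fun x => K (x - y) * g y) = I K * g y.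
  rewrite -(Ig_shift (- y) iK) mulrC -(IgZ _ (ibl_shift (- y) iK)).
  by apply: eq_Ig => x; rewrite mulrC.
have [||_ H2 H3] := @Ig_fubini _ _ _ _ R mu mu (fun y x => K (x - y) * g y) _ i1 i2.
- apply: measurable_funM; last by apply: measurableT_comp.
  by apply: (vcomp (f := K) mK); apply: measurable_rVB.
- exists (fun y => I K * g y); first exact: iblZ.
  move=> y; rewrite -E1 le_eqVlt; apply/orP; left; apply/eqP; apply: eq_Ig => x.
  by rewrite ger0_norm// mulr_ge0.
split => //; rewrite -H3 -(IgZ _ ig); exact: eq_Ig.
Qed.

Variable F : V -> R.
Hypothesis n1 : (1 < n)%N.
Hypothesis Fi : ibl mu F.
Hypothesis Fb : lbounded F.
Let n0 : (0 < n)%N := ltnW n1.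
Let mF := ibl_meas Fi.

Local Notation c := (@cn R n).
Let c0 : 0 < c := @cn_gt0 R n.

Definition lmx x : R := ln (Num.max 1 (enorm x)).
Definition LF x : R := I (fun y => Lam (x - y) * `|F y|).
(** The potential with the logarithm truncated at distance 1. It carries the behaviour - alpha
    ln|x|, and [vp_near] bounds the rest by [LF], where the absolute value of [F] gives an estimate
    in both directions. *)
Definition Sv x : R := c * I (fun y => (ln (enorm y) - lmx (x - y)) * F y).
Definition alpha : R := c * I F.
Definition LM : R := I Lam * I (fun y => `|F y|).

Let absb : lbounded (fun y => `|F y|).
Proof. by move=> r; have [B HB] := Fb r; exists B => y yr; rewrite normr_id HB. Qed.

Let LamS z : 1 <= enorm z -> Lam z = 0.
Proof. by move=> h; rewrite /Lam /ball_ind subr0 ltNge h mulr0. Qed.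

Lemma LF_ibl : [/\ forall x, ibl mu (fun y => Lam (x - y) * `|F y|), ibl mu LF & I LF = LM].
Proof. exact: (conv_ibl (ibl_Lam n1) (@Lam_ge0 R n) LamS (ibl_norm Fi) absb (fun y => normr_ge0 _)). Qed.

Lemma LF_ge0 x : 0 <= LF x.
Proof. by apply: Ig_ge0 => y; rewrite mulr_ge0// Lam_ge0. Qed.

Lemma LM_ge0 : 0 <= LM.
Proof. by rewrite mulr_ge0// Ig_ge0// => y; rewrite Lam_ge0. Qed.

Let lmx_ge0 x : 0 <= lmx x.
Proof. by rewrite ln_ge0// le_max lexx. Qed.

Let m1 x : 0 < Num.max 1 (enorm x). Proof. by rewrite lt_max ltr01. Qed.

Let lmx_le x y (b : R) : 0 < b -> 1 <= b * Num.max 1 (enorm y) -> enorm x <= b * Num.max 1 (enorm y) -> lmx x <= ln b + lmx y.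
Proof. by move=> b0 h1 h2; apply: ln_le_mul => //; rewrite ge_max h1. Qed.

Lemma lmx_diff x y : `|ln (enorm y) - lmx (x - y)| <= ln (1 + enorm x) + Lam y.
Proof.
have ex := enorm_ge0 x; have x1 : 0 < 1 + enorm x by lra.
have le (z w : V) : enorm z <= enorm w + enorm x -> lmx z <= ln (1 + enorm x) + lmx w.
  move=> h; have h1 : 1 <= Num.max 1 (enorm w) by rewrite le_max lexx.
  have h2 : enorm w <= Num.max 1 (enorm w) by rewrite le_max lexx orbT.
  by apply: lmx_le => //; nra.
have a1 : enorm y <= enorm (x - y) + enorm x.
  by have := enorm_triangle (- (x - y)) x; rewrite opprB subrK enormBC.
have a2 : enorm (x - y) <= enorm y + enorm x.
  by apply: le_trans (enorm_triangle _ _) _; rewrite enormN addrC.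
have := le _ _ a1; have := le _ _ a2; rewrite (lnE y) -/(lmx y).
have := Lam_ge0 y; move: (lmx y) (lmx (x - y)) (Lam y) => A B C *.
by rewrite ler_norml; apply/andP; split; lra.
Qed.

Lemma lmx_far x y : 1 <= enorm x -> `|lmx (x - y) - ln (enorm x)| <= ln (1 + enorm y).
Proof.
move=> x1; have ey := enorm_ge0 y; have y1 : 0 < 1 + enorm y by lra.
have Ex : ln (enorm x) = lmx x by rewrite /lmx max_r.
have Mx : Num.max 1 (enorm x) = enorm x by rewrite max_r.
have a1 : enorm x <= enorm (x - y) + enorm y by have := enorm_triangle (x - y) y; rewrite subrK.
have a2 : enorm (x - y) <= enorm x + enorm y by apply: le_trans (enorm_triangle _ _) _; rewrite enormN.
have h1 : 1 <= Num.max 1 (enorm (x - y)) by rewrite le_max lexx.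
have h2 : enorm (x - y) <= Num.max 1 (enorm (x - y)) by rewrite le_max lexx orbT.
have l1 : lmx x <= ln (1 + enorm y) + lmx (x - y) by apply: lmx_le => //; nra.
have l2 : lmx (x - y) <= ln (1 + enorm y) + lmx x by apply: lmx_le => //; rewrite Mx; nra.
by rewrite Ex ler_norml; apply/andP; split; lra.
Qed.

Lemma measurable_lmx : measurable_fun [set: V] lmx.
Proof.
apply: measurableT_comp; first exact: measurable_ln.
by apply: measurable_maxr => //; exact: measurable_enorm.
Qed.

Let mdiff x : measurable_fun [set: V] (fun y => ln (enorm y) - lmx (x - y)).
Proof. by apply: measurable_funB; [exact: measurable_lnorm|exact: (mreflB x measurable_lmx)]. Qed.

Let iLF0 : ibl mu (fun y => Lam y * `|F y|).
Proof. by have [H _ _] := LF_ibl; apply: eq_ibl (H 0) => y; rewrite sub0r LamN. Qed.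

Lemma ibl_S x : ibl mu (fun y => (ln (enorm y) - lmx (x - y)) * F y).
Proof.
apply: (@ibl_le _ _ _ mu _ (fun y => ln (1 + enorm x) * `|F y| + Lam y * `|F y|)).
- exact: measurable_funM.
- by move=> y; rewrite normrM -!mulrDl ler_wpM2r// lmx_diff.
- by apply: iblD => //; apply: iblZ; exact: ibl_norm.
Qed.

Lemma vp_near x : `|vp F x - Sv x| <= c * LF x.
Proof.
rewrite /vp /Sv -mulrBr normrM (gtr0_norm c0) ler_wpM2l ?(ltW c0)//.
have [iL _ _] := LF_ibl; rewrite -(IgB (ibl_v n1 Fi Fb x) (ibl_S x)).
apply: Ig_norm_le; [exact: iblB (ibl_v n1 Fi Fb x) (ibl_S x)|exact: iL|].
move=> y; rewrite -mulrBl normrM ler_wpM2r// (lnE (x - y)) -/(lmx (x - y)).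
rewrite -[leRHS]ger0_norm ?Lam_ge0// le_eqVlt; apply/orP; left; apply/eqP; congr `|_|; ring.
Qed.

Lemma Sv_le : exists2 A : R, 0 <= A & forall x, `|Sv x| <= A * (1 + ln (1 + enorm x)).
Proof.
have p1 : 0 <= I (fun y => `|F y|) by exact: Ig_ge0.
have p2 : 0 <= I (fun y => Lam y * `|F y|) by apply: Ig_ge0 => y; rewrite mulr_ge0// Lam_ge0.
exists (c * (I (fun y => `|F y|) + I (fun y => Lam y * `|F y|))).
  by apply: mulr_ge0 (ltW c0) _; exact: addr_ge0.
move=> x; rewrite normrM (gtr0_norm c0) -mulrA ler_wpM2l ?(ltW c0)//.
have l0 : 0 <= ln (1 + enorm x) by rewrite ln_ge0// lerDl enorm_ge0.
apply: le_trans (_ : ln (1 + enorm x) * I (fun y => `|F y|) + I (fun y => Lam y * `|F y|) <= _).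
  rewrite -(IgZ _ (ibl_norm Fi)) -(IgD (iblZ _ (ibl_norm Fi)) iLF0).
  apply: Ig_norm_le; [exact: ibl_S|exact: iblD (iblZ _ (ibl_norm Fi)) iLF0|].
  by move=> y; rewrite normrM -!mulrDl ler_wpM2r// lmx_diff.
move: (I _) (I _) (ln _) p1 p2 l0 => a b l *; nra.
Qed.

(** By contradiction, along points going to infinity: divided by ln|X|, the kernel plus ln|X| tends
    to 0 for each fixed y, and it is dominated by 3 + Lam y. The threshold exp(j+1) makes the
    logarithm at least j + 1, in particular at least 1, so division by it is harmless. *)
Lemma Sv_asym (d : R) : 0 < d -> exists j : nat, forall x, expR j.+1%:R <= enorm x ->
  `|Sv x + alpha * ln (enorm x)| <= d * ln (enorm x).
Proof.
move=> d0; apply/not_existsP => H.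
have H' j : exists x, expR j.+1%:R <= enorm x /\ d * ln (enorm x) < `|Sv x + alpha * ln (enorm x)|.
  apply: contrapT => /forallNP N; apply: (H j) => x xj; rewrite leNgt; apply/negP => h.
  by apply: (N x).
have [X HX] := choice H'.
have Xe j : expR j.+1%:R <= enorm (X j) by case: (HX j).
have X1 j : 1 <= enorm (X j) by apply: le_trans (Xe j); rewrite -expR0 ler_expR.
have Xp j : 0 < enorm (X j) by exact: lt_le_trans (X1 j).
have Xl j : j.+1%:R <= ln (enorm (X j)) by rewrite -[leLHS]expRK ler_ln ?posrE ?expR_gt0.
have Xl1 j : 1 <= ln (enorm (X j)) by apply: le_trans (Xl j); rewrite ler1n.
have Xl0 j : 0 < ln (enorm (X j)) by exact: lt_le_trans (Xl1 j).
pose f j y := (ln (enorm y) - lmx (X j - y) + ln (enorm (X j))) * F y / ln (enorm (X j)).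
have iF j : ibl mu (fun y => (ln (enorm y) - lmx (X j - y)) * F y + ln (enorm (X j)) * F y).
  by apply: iblD; [exact: ibl_S|exact: iblZ].
have iff j : ibl mu (f j).
  by apply: (eq_ibl _ (iblZ (ln (enorm (X j)))^-1 (iF j))) => y; rewrite /f -mulrDl mulrC.
have If j : c * I (f j) = (Sv (X j) + alpha * ln (enorm (X j))) / ln (enorm (X j)).
  have -> : I (f j) = (ln (enorm (X j)))^-1 * (I (fun y => (ln (enorm y) - lmx (X j - y)) * F y) + ln (enorm (X j)) * I F).
    rewrite -(IgZ _ Fi) -(IgD (ibl_S _) (iblZ _ Fi)) -(IgZ _ (iF j)).
    by apply: eq_Ig => y; rewrite /f -mulrDl mulrC.
  rewrite /Sv /alpha; move: (ln _) (I _) (I _) => l a b; ring.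
have [||||_ L] := @Ig_dct _ _ _ mu f (fun _ => 0) (fun y => 3 * `|F y| + Lam y * `|F y|).
- by move=> j; exact: ibl_meas (iff j).
- by apply: iblD => //; apply: iblZ; exact: ibl_norm.
- move=> j y; rewrite /f !normrM normfV (gtr0_norm (Xl0 j)) ler_pdivrMr// -mulrDl mulrAC ler_wpM2r//.
  have h := lmx_diff (X j) y.
  have h2 : ln (1 + enorm (X j)) <= ln (2 : R) + ln (enorm (X j)).
    by apply: ln_le_mul => //; [have := Xp j; lra|have := X1 j; lra].
  have h3 : ln (2 : R) <= 1 by have := @le_ln1Dx R 1 _; rewrite -natr1 addrC; apply; lra.
  apply: le_trans (ler_normD _ _) _; rewrite (gtr0_norm (Xl0 j)).
  have L0 := Lam_ge0 y; have x1 := Xl1 j.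
  move: h h2 h3 L0 x1; move: (ln (enorm (X j))) (ln (1 + _)) (Lam y) (ln 2) `|_| => a b l2 e q *; nra.
- move=> y; apply/norm_cvg0P.
  apply: (@squeeze_cvgr _ _ _ _ (fun _ : nat => 0) (fun j : nat => ((`|ln (enorm y)| + ln (1 + enorm y)) * `|F y|) * @harmonic R j)).
  + apply: nearW => j; rewrite normr_ge0 /= /f normrM normrM normfV (gtr0_norm (Xl0 j)).
    have h := lmx_far y (X1 j).
    have Ey : ln (enorm y) - lmx (X j - y) + ln (enorm (X j)) = ln (enorm y) - (lmx (X j - y) - ln (enorm (X j))) by ring.
    apply: ler_pM; [exact: mulr_ge0|by rewrite invr_ge0 ltW| |].
      rewrite ler_wpM2r// Ey; apply: le_trans (ler_normB _ _) _; rewrite lerD2l; exact: h.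
    by rewrite /harmonic lef_pV2 ?posrE.
  + exact: cvg_cst.
  + by rewrite -[X in _ --> X](mulr0 ((`|ln (enorm y)| + ln (1 + enorm y)) * `|F y|)); apply: cvgMr; exact: cvg_harmonic.
rewrite Ig0 in L; have L1 : (fun j => c * I (f j)) @ \oo --> (0 : R).
  by rewrite -[X in _ --> X](mulr0 c); exact: cvgMr.
have /cvgrPdist_lt/(_ _ d0)[j _ /(_ j (leqnn j))] := L1.
rewrite /= sub0r normrN If normrM normfV (gtr0_norm (Xl0 j)) ltr_pdivrMr//.
by case: (HX j) => _ h1 h2; have := lt_trans h1 h2; rewrite ltxx.
Qed.

(* Outside a large ball F has mass so small that Jensen bounds the exponential of its part of LF by a
   convolution with the integrable |z|^(-1/2). *)
Lemma exp_LF (p : R) : 0 < p -> exists C : R, exists2 Psi : V -> R, 0 < C & [/\ ibl mu Psi, (forall x, 0 <= Psi x) &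
  forall x, expR (p * LF x) <= C * (1 + Psi x)].
Proof.
move=> p0; have p20 : 0 < 2 * p by rewrite mulr_gt0.
have [||||_ L] := @Ig_dct _ _ _ mu (fun (j : nat) y => `|F y| * ball_ind 0 j%:R y) (fun y => `|F y|) (fun y => `|F y|).
- by move=> j; apply: measurable_funM; [exact: measurableT_comp|exact: measurable_ball_ind].
- exact: ibl_norm.
- by move=> j y; rewrite normrM normr_id (ger0_norm (ball_ind_ge0 _ _ _)) ler_piMr// ball_ind_le1.
- by move=> y; rewrite -[X in _ --> X]mulr1; apply: cvgMr; exact: ball_ind_cvg.
have e0 : 0 < (2 * p)^-1 by rewrite invr_gt0.
have /cvgrPdist_lt/(_ _ e0)[N _ /(_ N (leqnn N))/= HN] := L.
pose F1 y := `|F y| * ball_ind 0 N%:R y.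
pose F2 y := `|F y| - F1 y.
have iF1 : ibl mu F1.
  apply: (ibl_le _ _ (ibl_norm Fi)).
    by apply: measurable_funM; [exact: measurableT_comp|exact: measurable_ball_ind].
  by move=> y; rewrite normrM normr_id (ger0_norm (ball_ind_ge0 _ _ _)) ler_piMr// ball_ind_le1.
have iF2 : ibl mu F2 by exact: iblB (ibl_norm Fi) iF1.
have F10 y : 0 <= F1 y by rewrite mulr_ge0// ball_ind_ge0.
have F20 y : 0 <= F2 y by rewrite subr_ge0 ler_piMr// ball_ind_le1.
have F12 y : F2 y <= `|F y| by rewrite gerBl.
(* [N] was chosen so that [w] has mass at most one. The exponent then becomes half of Lam * w, and
   exp(Lam / 2) is |z|^(-1/2) on the unit ball, integrable in every dimension considered. *)
pose w y := 2 * p * F2 y.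
have iw : ibl mu w by exact: iblZ.
have w0 y : 0 <= w y by exact: mulr_ge0 (ltW p20) (F20 y).
have wb : lbounded w.
  move=> r; have [B HB] := Fb r; exists (2 * p * B) => y yr.
  rewrite ger0_norm//; apply: (ler_wpM2l (ltW p20)); exact: le_trans (F12 y) (HB y yr).
have w1 : I w <= 1.
  rewrite (IgZ _ iF2) (IgB (ibl_norm Fi) iF1) -ler_pdivlMl// mulr1.
  by apply: le_trans (ler_norm _) _; exact: ltW.
have n12 : (2^-1 : R) < n%:R.
  by apply: lt_le_trans (_ : 1 <= _); rewrite ?ler1n//; lra.
have sS z : 1 <= enorm z -> sing (2^-1 : R) z = 0.
  by move=> h; rewrite /sing /ball_ind subr0 ltNge h mulr0.
have [i1 iPsi _] := conv_ibl (ibl_sing n12) (@sing_ge0 R n _) sS iw wb w0.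
have [B HB] := Fb N%:R.
have B0 : 0 <= B.
  by have := HB 0; rewrite enorm0 => /(_ (ler0n _ _)); apply: le_trans.
have [iL _ _] := LF_ibl.
have iL2 x : ibl mu (fun y => Lam (x - y) * w y).
  apply: (ibl_le _ _ (iblZ (2 * p) (iL x))).
    by apply: measurable_funM; [exact: measurable_Lam_refl|exact: ibl_meas iw].
  move=> y; rewrite ger0_norm; last by rewrite mulr_ge0// Lam_ge0.
  by rewrite mulrCA; apply: (ler_wpM2l (ltW p20)); rewrite ler_wpM2l// Lam_ge0.
have iLr x : ibl mu (fun y => Lam (x - y)) := ibl_refl x (ibl_Lam n1).
exists (expR (p * (B * I Lam))), (fun x => I (fun y => sing 2^-1 (x - y) * w y)); first exact: expR_gt0.
split => [//|x|x]; first by apply: Ig_ge0 => y; rewrite mulr_ge0// sing_ge0.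
pose A := 2^-1 * I (fun y => Lam (x - y) * w y).
have LE : p * LF x <= p * (B * I Lam) + A.
  rewrite -(Ig_refl x (ibl_Lam n1)) -(IgZ B (iLr x)) -(IgZ p (iblZ B (iLr x))) -(IgZ p (iL x)) /A -(IgZ _ (iL2 x)).
  rewrite -(IgD (iblZ p (iblZ B (iLr x))) (iblZ _ (iL2 x))); apply: Ig_le; [exact: iblZ|exact: iblD (iblZ p (iblZ B (iLr x))) (iblZ _ (iL2 x))|].
  move=> y; have -> : 2^-1 * (Lam (x - y) * w y) = p * (Lam (x - y) * F2 y).
    by rewrite /w; have : (2 : R) != 0 by []; move=> ?; field.
  rewrite -mulrDr (ler_pM2l p0) [B * _]mulrC -mulrDr ler_wpM2l ?Lam_ge0//.
  have -> : `|F y| = F1 y + F2 y by rewrite /F2 addrC subrK.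
  rewrite lerD2r /F1 /ball_ind subr0; case: ltP => yN; last by rewrite mulr0.
  by rewrite mulr1; apply: HB; exact: ltW.
apply: le_trans (_ : expR (p * (B * I Lam)) * expR A <= _).
  by rewrite -expRD ler_expR.
rewrite ler_pM2l ?expR_gt0//.
have iR : ibl mu (fun y => (expR A * (1 - A) - 1) * w y + (expR A * 2^-1) * (Lam (x - y) * w y)).
  by apply: iblD; exact: iblZ.
(* Jensen through the tangent line of exp at [A], integrated against [w]. Because [w] may have mass
   below one, the inequality e^A (1 - A) <= 1 ([h3]) is needed to account for the missing mass. *)
have H : (expR A * (1 - A) - 1) * I w + expR A * A <= I (fun y => sing 2^-1 (x - y) * w y).
  rewrite /A mulrA -/A -(IgZ _ iw) -(IgZ _ (iL2 x)) -(IgD (iblZ _ iw) (iblZ _ (iL2 x))).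
  apply: Ig_le; [exact: iR|exact: i1|move=> y].
  rewrite mulrA -mulrDl ler_wpM2r//.
  have h : expR (2^-1 * Lam (x - y)) - 1 <= sing 2^-1 (x - y).
    rewrite /Lam /sing /ball_ind subr0; case: ltP => _.
      by rewrite !mulr1 mulrN -mulNr gerBl.
    by rewrite !mulr0 expR0 subrr.
  have h2 : expR A * (1 + (2^-1 * Lam (x - y) - A)) <= expR (2^-1 * Lam (x - y)).
    have := expR_ge1Dx (2^-1 * Lam (x - y) - A).
    rewrite -(ler_pM2l (expR_gt0 A)) -expRD [A + _]addrC subrK; exact.
  move: h h2; move: (expR A) (expR _) (sing _ _) (Lam _) => a b s l; lra.
have h3 : expR A * (1 - A) <= 1.
  have := expR_ge1Dx (- A); rewrite -(ler_pM2l (expR_gt0 A)) -expRD subrr expR0; exact.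
have iw0 : 0 <= I w by exact: Ig_ge0.
move: H h3 w1 iw0; move: (I (fun y => sing _ _ * _)) (I w) (expR A) => a m e H h3 w1 iw0.
have : (e * (1 - A) - 1) * (1 - m) <= 0 by rewrite mulr_le0_ge0//; lra.
clearbody A; lra.
Qed.

(** Tangent line of exp at the mean lower bound A = L - D LM / |ball|. The function [LF] may be
    large at points of the ball, but its mean there is at most LM / |ball|. *)
Lemma jensen_ball (f : V -> R) z (r L D : R) : continuous f -> 0 < r -> 0 <= D ->
  (forall x, enorm (x - z) < r -> L - D * LF x <= f x) ->
  @ballvol R n * r ^+ n * expR (L - D * LM / (@ballvol R n * r ^+ n)) <= I (fun x => expR (f x) * ball_ind z r x).
Proof.
move=> cf r0 D0 Hf; have [_ iL IL] := LF_ibl.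
pose b := @ballvol R n * r ^+ n.
have b0 : 0 < b by rewrite mulr_gt0 ?ballvol_gt0 ?exprn_gt0.
have iB : ibl mu (ball_ind z r) := ibl_ball_ind z r.
have Ib : I (ball_ind z r) = b := Ig_ball_ind z r0.
pose A := L - D * LM / b; rewrite -/b -/A.
have ce : continuous (fun x => expR (f x)).
  by move=> x; apply: (@continuous_comp _ _ _ f expR); [exact: cf|exact: continuous_expR].
have iLb : ibl mu (fun x => LF x * ball_ind z r x).
  apply: (ibl_le _ _ iL); first by apply: measurable_funM; [exact: ibl_meas iL|exact: measurable_ball_ind].
  by move=> x; rewrite normrM (ger0_norm (LF_ge0 x)) (ger0_norm (ball_ind_ge0 _ _ _)) ler_piMr ?LF_ge0// ball_ind_le1.
have ILb : I (fun x => LF x * ball_ind z r x) <= LM.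
  by rewrite -IL; apply: Ig_le => // x; rewrite ler_piMr ?LF_ge0 ?ball_ind_le1.
have iG : ibl mu (fun x => (expR A * (1 + L - A)) * ball_ind z r x - (expR A * D) * (LF x * ball_ind z r x)).
  by apply: iblB; exact: iblZ.
apply: le_trans (Ig_le iG (cont_ibl_ball z r ce) _); last first.
  move=> x; rewrite mulrA -mulrBl; have [xr|xr] := ltP (enorm (x - z)) r; last first.
    by rewrite /ball_ind ltNge xr !mulr0.
  rewrite ler_wpM2r ?ball_ind_ge0//.
  have h := Hf x xr; have h2 := expR_ge1Dx (f x - A).
  rewrite -(ler_pM2l (expR_gt0 A)) -expRD [A + _]addrC subrK in h2.
  apply: le_trans h2; rewrite -mulrA -mulrBr (ler_pM2l (expR_gt0 A)).
  by move: h; move: (D * _) => dl; lra.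
rewrite (IgB (iblZ _ iB) (iblZ _ iLb)) (IgZ _ iB) (IgZ _ iLb) Ib.
have h : D * I (fun x => LF x * ball_ind z r x) <= D * LM by rewrite ler_wpM2l.
have E : b * A = b * L - D * LM by rewrite /A mulrBr mulrCA divff ?mulr1// gt_eqF.
have E2 : expR A * (b * A) = expR A * (b * L - D * LM) by rewrite E.
have h2 : 0 <= expR A * (D * LM - D * I (fun x => LF x * ball_ind z r x)) by rewrite mulr_ge0 ?expR_ge0// subr_ge0.
move: E2 h2; move: (I _) (expR A) => t e; lra.
Qed.

End potential_growth.

(** * Continuity of the potential *)

Section potential_continuous.
Context {R : realType} {n : nat}.
Notation V := 'rV[R]_n.
Notation mu := (@vmeas R n).
Notation I := (Ig mu).
Implicit Types (x y z : V).

Lemma Ig_norm_le_off (s : seq V) (f g : V -> R) : (0 < n)%N -> ibl mu f -> ibl mu g ->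
  (forall y, y \notin s -> `|f y| <= g y) -> `|I f| <= I g.
Proof.
move=> n0 fi gi fg; pose d y := Num.max 0 (`|f y| - g y).
have md : measurable_fun [set: V] d.
  apply: measurable_maxr => //; apply: measurable_funB; last exact: ibl_meas gi.
  by apply: measurableT_comp => //; exact: ibl_meas fi.
have d0 y : y \notin s -> d y = 0 by move=> /fg h; rewrite /d max_l// subr_le0.
have [di Id] := @Ig_finite_support R n n0 s d md d0.
rewrite -[leRHS]addr0 -Id -(IgD gi di); apply: Ig_norm_le; [exact: fi|exact: iblD|].
by move=> y; rewrite -lerBlDl le_max lexx orbT.
Qed.

Lemma Lam_small : (1 < n)%N -> (fun j => I (fun z => Lam z * ball_ind 0 (@harmonic R j) z)) @ \oo --> (0 : R).
Proof.
move=> n1; have iL := @ibl_Lam R n n1.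
have [||||_] := @Ig_dct _ _ _ mu (fun (j : nat) (z : V) => Lam z * ball_ind 0 (@harmonic R j) z) (fun _ => 0) Lam.
- by move=> j; apply: measurable_funM; [exact: measurable_Lam|exact: measurable_ball_ind].
- exact: iL.
- by move=> j z; rewrite normrM (ger0_norm (Lam_ge0 _)) (ger0_norm (ball_ind_ge0 _ _ _)) ler_piMr ?Lam_ge0// ball_ind_le1.
- move=> z; have [->|z0] := eqVneq z 0.
    by apply: cvg_near_cst; apply: nearW => j; rewrite /Lam enorm0 ln0// oppr0 !mul0r.
  have ez : 0 < enorm z by rewrite enorm_gt0.
  have /(cvgr_lt (0 : R))/(_ _ ez) H := @cvg_harmonic R.
  apply: cvg_near_cst; near=> j; rewrite /ball_ind subr0 ltNge ltW ?mulr0//.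
  by near: j; exact: H.
- by rewrite Ig0.
Unshelve. all: by end_near. Qed.

Variable F : V -> R.
Hypothesis n1 : (1 < n)%N.
Hypothesis Fi : ibl mu F.
Hypothesis Fb : lbounded F.
Let n0 : (0 < n)%N := ltnW n1.
Local Notation c := (@cn R n).
Let c0 : 0 < c := @cn_gt0 R n.

(** The logarithm truncated from below at scale [e]; it is Lipschitz with constant 1/e. *)
Let Le (e : R) z : R := ln (Num.max e (enorm z)).

Let mLe e : measurable_fun [set: V] (Le e).
Proof.
apply: measurableT_comp; first exact: measurable_ln.
by apply: measurable_maxr => //; exact: measurable_enorm.
Qed.

Let Le_lip (e : R) z w : 0 < e -> Le e z <= Le e w + enorm (z - w) / e.
Proof.
move=> e0; have d0 : 0 <= enorm (z - w) / e by rewrite divr_ge0 ?enorm_ge0// ltW.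
have m0 v : 0 < Num.max e (enorm v) by rewrite lt_max e0.
have h : ln (1 + enorm (z - w) / e) <= enorm (z - w) / e by apply: le_ln1Dx; lra.
have p1 : 0 < 1 + enorm (z - w) / e by lra.
have : Le e z <= ln (1 + enorm (z - w) / e) + Le e w.
  apply: ln_le_mul => //.
  have h1 : e <= Num.max e (enorm w) by rewrite le_max lexx.
  have h2 : enorm w <= Num.max e (enorm w) by rewrite le_max lexx orbT.
  have h3 : enorm (z - w) <= enorm (z - w) / e * Num.max e (enorm w).
    by rewrite mulrAC -mulrA ler_peMr ?enorm_ge0// ler_pdivlMr// mul1r.
  have h4 : enorm z <= enorm (z - w) + enorm w by have := enorm_triangle (z - w) w; rewrite subrK.
  have h5 : 0 <= enorm (z - w) / e * Num.max e (enorm w) by rewrite mulr_ge0// ltW.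
  by rewrite mulrDl mul1r ge_max; apply/andP; split; lra.
by move=> h1; lra.
Qed.

Let ve e x : R := c * I (fun y => (ln (enorm y) - Le e (x - y)) * F y).

Let ibl_ve (e : R) x : 0 < e <= 1 -> ibl mu (fun y => (ln (enorm y) - Le e (x - y)) * F y).
Proof.
move=> /andP[e0 e1].
have iG : ibl mu (fun y => `|(ln (enorm y) - lmx (x - y)) * F y| + `|ln e| * `|F y|).
  by apply: iblD; [exact: ibl_norm (ibl_S n1 Fi Fb x)|apply: iblZ; exact: ibl_norm].
apply: (ibl_le _ _ iG).
  apply: measurable_funM; last exact: ibl_meas Fi.
  by apply: measurable_funB; [exact: measurable_lnorm|exact: (mreflB x (mLe e))].
move=> y; rewrite !normrM -mulrDl ler_wpM2r//.
have -> : ln (enorm y) - Le e (x - y) = (ln (enorm y) - lmx (x - y)) - (Le e (x - y) - lmx (x - y)) by ring.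
apply: le_trans (ler_normB _ _) _; rewrite lerD2l /Le /lmx.
have l1 : ln e <= 0 by rewrite ln_le0.
have [h|h] := leP 1 (enorm (x - y)); first by rewrite max_r ?(le_trans e1)// subrr normr0.
rewrite ln1 subr0 !ler0_norm//.
  by rewrite lerN2 ler_ln ?posrE ?lt_max ?e0// le_max lexx.
by rewrite ln_le0// ge_max e1 ltW.
Qed.

Let ve_near (e B r : R) x : 0 < e <= 1 -> 0 <= B -> (forall y, enorm y <= r + 1 -> `|F y| <= B) -> enorm x <= r ->
  `|ve e x - vp F x| <= c * (B * I (fun z => Lam z * ball_ind 0 e z)).
Proof.
move=> e01 B0 HB xr; have /andP[e0 e1] := e01.
have iL : ibl mu (fun z => Lam z * ball_ind 0 e z).
  apply: (ibl_le _ _ (ibl_Lam n1)); first by apply: measurable_funM; [exact: measurable_Lam|exact: measurable_ball_ind].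
  by move=> z; rewrite normrM (ger0_norm (Lam_ge0 _)) (ger0_norm (ball_ind_ge0 _ _ _)) ler_piMr ?Lam_ge0// ball_ind_le1.
rewrite /ve /vp -mulrBr normrM (gtr0_norm c0) ler_wpM2l ?(ltW c0)//.
have i1 := ibl_ve x e01; have i2 := ibl_v n1 Fi Fb x.
rewrite -(Ig_refl x iL) -(IgZ B (ibl_refl x iL)) -(IgB i1 i2).
apply: (@Ig_norm_le_off [:: x]) => //; [exact: iblB|exact: iblZ (ibl_refl x iL)|].
move=> y; rewrite inE => yx; have xy : 0 < enorm (x - y) by rewrite enorm_gt0 subr_eq0 eq_sym.
rewrite -mulrBl normrM [leRHS]mulrC.
have -> : ln (enorm y) - Le e (x - y) - (ln (enorm y) - ln (enorm (x - y))) = ln (enorm (x - y)) - Le e (x - y) by ring.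
rewrite /Le /Lam /ball_ind subr0; have [h|h] := ltP (enorm (x - y)) e; last first.
  by rewrite subrr normr0 mul0r mulr0 mul0r.
have h1 : enorm (x - y) < 1 by exact: lt_le_trans e1.
rewrite h1 !mulr1; apply: ler_pM => //.
  have l1 : ln e <= 0 by rewrite ln_le0.
  have l2 : ln (enorm (x - y)) <= ln e by rewrite ler_ln ?posrE// ltW.
  by rewrite ler0_norm; lra.
apply: HB; have := enormB_ge y x; rewrite enormBC; move: h1; lra.
Qed.

Let aux (A B C D : R) : A <= B + D -> B <= A + D -> `|C - B - (C - A)| <= D.
Proof. by move=> h1 h2; rewrite ler_norml; apply/andP; split; lra. Qed.

Let aux2 (P Q A B ep : R) : `|P - A| < ep / 4 -> `|Q - B| < ep / 4 -> `|Q - P| <= ep / 4 -> `|B - A| < ep.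
Proof.
rewrite !ltr_norml !ler_norml => /andP[a1 a2] /andP[a3 a4] /andP[a5 a6].
by apply/andP; split; lra.
Qed.

(** A locally uniform limit of Lipschitz functions: replacing the logarithm by its truncation [Le e]
    changes the potential by at most the mass of [Lam] on the ball of radius [e], times a local
    bound of [F]. *)
Lemma vp_continuous : continuous (vp F).
Proof.
move=> x; apply/continuousVP => ep ep0.
have [B' HB'] := Fb (enorm x + 1 + 1).
have B'0 : 0 <= B'.
  by have := HB' 0; rewrite enorm0 => /(_ _)/(le_trans (normr_ge0 _)); apply; have := enorm_ge0 x; lra.
have L : (fun j => c * (B' * I (fun z : V => Lam z * ball_ind 0 (@harmonic R j) z))) @ \oo --> (0 : R).
  rewrite -[X in _ --> X](mulr0 c); apply: cvgMr; rewrite -[X in _ --> X](mulr0 B'); apply: cvgMr; exact: Lam_small.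
have e4 : 0 < ep / 4 by rewrite divr_gt0.
have /(cvgr_lt (0 : R))/(_ _ e4)[j _ /(_ j (leqnn j))/= Hj] := L.
pose e : R := @harmonic R j.
have e01 : 0 < e <= 1 by rewrite /e /harmonic invr_gt0 ltr0n /= invf_le1// ler1n.
have /andP[e0 e1] := e01.
pose M := c * I (fun y => `|F y|).
have M0 : 0 <= M by apply: mulr_ge0 (ltW c0) _; exact: Ig_ge0.
have M1 : 0 < M + 1 by lra.
exists (Num.min 1 (ep / 4 * e / (M + 1))).
  by rewrite lt_min ltr01 /=; apply: divr_gt0 => //; exact: mulr_gt0.
move=> y; rewrite lt_min => /andP[y1 ye].
have h1 : `|ve e x - vp F x| < ep / 4.
  by apply: le_lt_trans Hj; apply: (ve_near (r := enorm x + 1) e01 B'0 HB'); lra.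
have h2 : `|ve e y - vp F y| < ep / 4.
  apply: le_lt_trans Hj; apply: (ve_near (r := enorm x + 1) e01 B'0 HB').
  by have := enormB_ge y x; move: y1; lra.
have h3 : `|ve e y - ve e x| <= M * (enorm (y - x) / e).
  rewrite /ve -mulrBr normrM (gtr0_norm c0) /M -mulrA ler_wpM2l ?(ltW c0)//.
  rewrite -(IgB (ibl_ve y e01) (ibl_ve x e01)) mulrC -(IgZ _ (ibl_norm Fi)).
  apply: Ig_norm_le; [exact: iblB (ibl_ve y e01) (ibl_ve x e01)|exact: iblZ (ibl_norm Fi)|].
  move=> z; rewrite -mulrBl normrM ler_wpM2r//.
  have l1 := Le_lip (x - z) (y - z) e0; have l2 := Le_lip (y - z) (x - z) e0.
  have E1 : x - z - (y - z) = x - y by rewrite opprB addrA subrK.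
  have E2 : y - z - (x - z) = y - x by rewrite opprB addrA subrK.
  rewrite E1 enormBC in l1; rewrite E2 in l2.
  exact: aux.
have h4 : M * (enorm (y - x) / e) <= ep / 4.
  apply: le_trans (_ : (M + 1) * (enorm (y - x) / e) <= _).
    by rewrite ler_wpM2r ?divr_ge0 ?enorm_ge0 ?(ltW e0)// lerDl.
  by rewrite mulrA ler_pdivrMr// mulrC -ler_pdivlMr// ltW.
exact: aux2 h1 h2 (le_trans h3 h4).
Qed.

End potential_continuous.

(** * Rigidity of the remainder *)

Section sequences.
Context {R : realType}.
Implicit Types (g : nat -> R).

Definition dnat g : nat -> R := fun j => g j.+1 - g j.

(** Repeated discrete integration of a lower bound on the highest difference. The constants depend
    on [d], c and C but not on the sequence, so they serve all parallel lines of a tube at once. *)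
Lemma seq_growth d (c C : R) : 0 < c -> exists c' K : R, 0 < c' /\
  forall g, (forall j, c <= iter d.+1 dnat g j) -> (forall l, (l <= d)%N -> `|iter l dnat g 0| <= C) ->
  forall j, c' * j%:R - K <= g j.
Proof.
elim: d c C => [|d IH] c C c0.
  exists c, C; split => // g Hc HC; elim=> [|j IHj].
    by have := HC 0%N isT; rewrite ler_norml => /andP[h _]; rewrite mulr0 sub0r.
  have := Hc j; rewrite /= /dnat -natr1; lra.
have [c' [K [c'0 HK]]] := IH c C c0.
pose b := c' / 2 + K + 1.
exists 1, (C + b ^+ 2 / (2 * c')); split => // g Hc HC.
have Hd j : c' * j%:R - K <= dnat g j.
  apply: HK; first by move=> l; rewrite -iterSr; exact: Hc.
  by move=> l ld; rewrite -iterSr; exact: HC.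
have H j : c' * j%:R ^+ 2 / 2 - (c' / 2 + K) * j%:R - C <= g j.
  elim: j => [|j IHj].
    by have := HC 0%N isT; rewrite ler_norml => /andP[h _]; rewrite expr0n /= mulr0 mul0r mulr0 !sub0r; move: h; rewrite /=; lra.
  have := Hd j; rewrite /dnat -natr1; move: IHj; move: (j%:R : R) => t; nra.
move=> j; apply: le_trans (H j); rewrite -subr_ge0.
have -> : c' * j%:R ^+ 2 / 2 - (c' / 2 + K) * j%:R - C - (1 * j%:R - (C + b ^+ 2 / (2 * c'))) =
   c' / 2 * (j%:R - b / c') ^+ 2 by rewrite /b; field; rewrite gt_eqF.
by rewrite mulr_ge0 ?sqr_ge0// divr_ge0// ltW.
Qed.

Lemma dnat_bounded g (M : R) m : (forall j, `|g j| <= M) -> forall j, `|iter m dnat g j| <= 2 ^+ m * M.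
Proof.
move=> H; elim: m => [|m IH] j; first by rewrite expr0 mul1r; exact: H.
rewrite iterS /dnat; apply: le_trans (ler_normB _ _) _.
by rewrite exprS -mulrA mulr_natl mulr2n lerD.
Qed.

(** Going down in the order of the vanishing difference: if p is the m-th difference and its second
    difference vanishes, p is affine; differences of a bounded sequence are bounded, so the slope of
    p is zero. *)
Lemma dnat_bounded0 g (M : R) k : (forall j, `|g j| <= M) -> (forall j, iter k.+1 dnat g j = 0) ->
  forall j, dnat g j = 0.
Proof.
move=> gM; elim: k => [//|m IH] H; apply: IH => j.
pose p := iter m dnat g; have Hp i : `|p i| <= 2 ^+ m * M by exact: dnat_bounded.
have cst i : dnat p i = dnat p 0%N.
  by elim: i => [//|i <-]; apply/eqP; rewrite -subr_eq0; apply/eqP; exact: H.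
have lin i : p i = p 0%N + i%:R * dnat p 0%N.
  elim: i => [|i IHi]; first by rewrite mul0r addr0.
  by rewrite -natr1 mulrDl mul1r addrA -IHi -(cst i) /dnat addrC subrK.
rewrite -[iter _ _ _ j]/(dnat p j) cst; apply: contrapT => /eqP ne.
have g0 : 0 < `|dnat p 0%N| by rewrite normr_gt0.
pose q := 2 * (2 ^+ m * M) / `|dnat p 0%N|.
have M0 : 0 <= 2 ^+ m * M by apply: le_trans (Hp 0%N).
have q0 : 0 <= q by apply: divr_ge0 => //; exact: mulr_ge0.
have := archi_boundP q0; set N := Num.bound q; rewrite /q ltr_pdivrMr// => h.
have : N%:R * `|dnat p 0%N| <= 2 * (2 ^+ m * M).
  have -> : N%:R * `|dnat p 0%N| = `|p N - p 0%N| by rewrite lin [p 0%N + _]addrC addrK normrM normr_nat.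
  by apply: le_trans (ler_normB _ _) _; rewrite mulr_natl mulr2n lerD.
by rewrite leNgt h.
Qed.

End sequences.

Section rigidity.
Context {R : realType} {n : nat}.
Notation V := 'rV[R]_n.
Implicit Types (x y z a : V) (f : V -> R).

Lemma fdiff_seq a f y l j :
  iter l (fdiff a) f (y + j%:R *: a) = iter l dnat (fun j => f (y + j%:R *: a)) j.
Proof.
elim: l j => [//|l IH] j; rewrite !iterS /fdiff /dnat -!IH -natr1 scalerDl scale1r addrA //.
Qed.

Lemma fdiffC a b f : fdiff a (fdiff b f) = fdiff b (fdiff a f).
Proof.
apply/funext => x; rewrite /fdiff [x + a + b]addrAC; ring.
Qed.

Lemma iter_fdiffC a b f l m : iter l (fdiff a) (iter m (fdiff b) f) = iter m (fdiff b) (iter l (fdiff a) f).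
Proof.
elim: m => [//|m IH]; rewrite !iterS -IH; elim: l {IH} => [//|l IH].
by rewrite !iterS IH fdiffC.
Qed.

Lemma periodic_line_bounded (i : 'I_n) (h : R) f x : h != 0 -> continuous f ->
  (forall y, f (y + h *: ebasis i) = f y) -> exists M, forall t : R, `|f (x + t *: ebasis i)| <= M.
Proof.
move=> h0 cf per; have [M _ HM] := continuous_bounded cf (enorm x + `|h|).
have perN (m : nat) y : f (y + (m%:R * h) *: ebasis i) = f y.
  elim: m => [|m IH]; first by rewrite mul0r scale0r addr0.
  by rewrite -natr1 mulrDl mul1r scalerDl addrA per.
exists M => t; pose q := t / h; have tq : t = q * h by rewrite divfK.
have B s : `|s| <= 1 -> `|f (x + (s * h) *: ebasis i)| <= M.
  move=> s1; apply: HM; apply: le_trans (enorm_triangle _ _) _.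
  by rewrite lerD2l enormZ enorm_ebasis mulr1 normrM ler_piMl.
have [q0|q0] := leP 0 q.
  pose m := Num.truncn q; have /andP[m1 m2] := truncn_itv q0.
  have -> : x + t *: ebasis i = x + ((q - m%:R) * h) *: ebasis i + (m%:R * h) *: ebasis i.
    by rewrite -addrA -scalerDl -mulrDl subrK tq.
  rewrite perN; apply: B; rewrite ger0_norm ?subr_ge0//; move: m2; rewrite -natr1 -/m; lra.
have q1 : 0 <= - q by rewrite oppr_ge0 ltW.
pose m := Num.truncn (- q); have /andP[m1 m2] := truncn_itv q1.
rewrite -(perN m) -addrA -scalerDl tq -mulrDl; apply: B.
by rewrite ler_norml; move: m1 m2; rewrite -natr1 -/m => m1 m2; apply/andP; split; lra.
Qed.

(** Periodicity in the step h bounds [f] on the line. Sampling the line with an arbitrary step t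
    then gives a bounded sequence with vanishing high differences, hence a constant one; this passes
    from multiples of h to all real t. *)
Lemma line_constant (i : 'I_n) (h : R) k f : h != 0 -> continuous f ->
  (forall y, f (y + h *: ebasis i) = f y) ->
  (forall (t : R) y, iter k.+1 (fdiff (t *: ebasis i)) f y = 0) ->
  forall (t : R) x, f (x + t *: ebasis i) = f x.
Proof.
move=> h0 cf per D t x; have [M HM] := periodic_line_bounded x h0 cf per.
have := @dnat_bounded0 R (fun j => f (x + j%:R *: (t *: ebasis i))) M k _ _ 0%N.
rewrite /dnat scale1r scale0r addr0 => H; apply/eqP; rewrite -subr_eq0; apply/eqP; apply: H.
  by move=> j; rewrite scalerA; exact: HM.
by move=> j; rewrite -fdiff_seq; exact: D.
Qed.

(** The difference of order d + 1 is positive at x0, hence at least half its value there at nearby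
    points, and it is constant along lines, so [seq_growth] applies to every nearby line with the
    same constants. A real s is split into its integer part and a remainder that moves the starting
    point by at most |a|. *)
Lemma growth_nbhd (i : 'I_n) (h : R) d f x0 : continuous f ->
  (forall (t : R) x, iter d.+1 (fdiff (h *: ebasis i)) f (x + t *: ebasis i) = iter d.+1 (fdiff (h *: ebasis i)) f x) ->
  0 < iter d.+1 (fdiff (h *: ebasis i)) f x0 ->
  exists c K e : R, [/\ 0 < c, 0 < e & forall y, enorm (y - x0) < e -> forall s, 0 <= s ->
     c * s - K <= f (y + s *: (h *: ebasis i))].
Proof.
move=> cf cG G0; set a := h *: ebasis i in cG G0 *.
have cD l : continuous (iter l (fdiff a) f) by exact: Dk_continuous.
have [|e e0 He] := (continuousVP (iter d.+1 (fdiff a) f) x0).1 (cD d.+1 x0) (iter d.+1 (fdiff a) f x0 / 2); first by rewrite divr_gt0.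
pose r := enorm x0 + e + enorm a.
have [C HC] := choice (fun l => let: ex_intro2 C _ H := continuous_bounded (cD l) r in ex_intro (fun C => forall y, enorm y <= r -> `|iter l (fdiff a) f y| <= C) C H).
pose C0 := \sum_(l < d.+1) `|C l|.
have c0 : 0 < iter d.+1 (fdiff a) f x0 / 2 by rewrite divr_gt0.
have [c [K [cp HK]]] := seq_growth d C0 c0.
exists c, (K + c), e; split => // y ye s s0.
have /andP[m1 m2] := truncn_itv s0; set m := Num.truncn s in m1 m2.
pose y2 := y + (s - m%:R) *: a.
have -> : y + s *: a = y2 + m%:R *: a by rewrite -addrA -scalerDl subrK.
have y2r : enorm y2 <= r.
  apply: le_trans (enorm_triangle _ _) _; rewrite /r lerD//.
    by have := enorm_triangle x0 (y - x0); rewrite [x0 + _]addrC subrK; move: ye; lra.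
  by rewrite enormZ ler_piMl ?enorm_ge0// ger0_norm ?subr_ge0//; move: m2; rewrite -natr1; lra.
have := HK (fun j => f (y2 + j%:R *: a)) _ _ m.
have s1 : c * s <= c * m%:R + c by rewrite -{3}[c]mulr1 -mulrDr ler_pM2l// natr1 ltW.
move=> H; apply: le_trans (H _ _); first by lra.
  move=> j; rewrite -fdiff_seq /y2 -addrA -scalerDl /a scalerA cG -/a.
  have := He y ye; rewrite ltr_norml => /andP[h1 h2]; lra.
move=> l ld; rewrite -fdiff_seq scale0r addr0; apply: le_trans (HC l _ y2r) _.
have ld' : (l < d.+1)%N by [].
rewrite /C0 (bigD1 (Ordinal ld'))//=; apply: le_trans (ler_norm _) _.
by rewrite lerDl sumr_ge0.
Qed.

Variables (H : V -> R) (k : nat).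
Hypothesis cH : continuous H.
Hypothesis DH : forall (i : 'I_n) (h : R) x, iter k.+1 (fdiff (h *: ebasis i)) H x = 0.
Hypothesis no_up : forall (i : 'I_n) (h : R) x0 (c K e : R), h != 0 -> 0 < c -> 0 < e ->
  (forall y, enorm (y - x0) < e -> forall s, 0 <= s -> c * s - K <= H (y + s *: (h *: ebasis i))) -> False.
Hypothesis no_down : forall (i : 'I_n) (h : R) x0 (c K e : R), h != 0 -> 0 < c -> 0 < e ->
  (forall y, enorm (y - x0) < e -> forall s, 0 <= s -> H (y + s *: (h *: ebasis i)) <= - (c * s - K)) -> False.

Lemma iter_fdiffN a f l x : iter l (fdiff a) (fun x => - f x) x = - iter l (fdiff a) f x.
Proof.
elim: l x => [//|l IH] x; rewrite !iterS /fdiff !IH opprB opprK addrC //.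
Qed.

(** Lowers the order of the vanishing difference down to one. When the next order vanishes, the
    current difference G is periodic and thus constant along lines; if G is nonzero somewhere, its
    sign makes H or -H grow linearly on a tube, which one of the two escape hypotheses excludes. *)
Lemma fdiff0_of_iter (i : 'I_n) (h : R) x : fdiff (h *: ebasis i) H x = 0.
Proof.
have [->|h0] := eqVneq h 0; first by rewrite /fdiff scale0r addr0 subrr.
set a := h *: ebasis i.
have Z m l y : (forall z, iter m (fdiff a) H z = 0) -> iter (l + m) (fdiff a) H y = 0.
  move=> h1; elim: l y => [|l IH] y; first exact: h1.
  by rewrite addSn iterS /fdiff !IH subrr.
suff S m : (forall y, iter m.+1 (fdiff a) H y = 0) -> forall y, fdiff a H y = 0.
  by apply: (S k); exact: DH.
elim: m => [//|m IH] Hm; apply: IH => y; apply: contrapT => /eqP Gn.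
pose G := iter m.+1 (fdiff a) H.
have cG : continuous G by exact: Dk_continuous.
have per z : G (z + a) = G z by apply/eqP; rewrite -subr_eq0; apply/eqP; exact: Hm.
have DG (t : R) z : iter k.+1 (fdiff (t *: ebasis i)) G z = 0.
  rewrite /G iter_fdiffC (_ : iter k.+1 (fdiff (t *: ebasis i)) H = fun _ => 0).
    by elim: m.+1 z => [//|l IHl] z; rewrite iterS /fdiff !IHl subrr.
  by apply/funext => w; exact: DH.
have cst := line_constant h0 cG per DG.
have [Gp|Gm] : 0 < G y \/ G y < 0 by move: Gn; rewrite neq_lt => /orP[]; [right|left].
- have [c [K [e [c0 e0 B]]]] := growth_nbhd cH cst Gp.
  exact: (no_up h0 c0 e0 B).
- have cN : continuous (fun x => - H x) by move=> z; apply: continuousN; exact: cH.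
  have [||c [K [e [c0 e0 B]]]] := @growth_nbhd i h m (fun x => - H x) y cN.
  + by move=> t z; rewrite !iter_fdiffN; congr (- _); exact: cst.
  + by rewrite iter_fdiffN oppr_gt0.
  + by apply: (no_down (x0 := y) h0 c0 e0 (K := K)) => z ze s s0; rewrite -[leLHS]opprK lerN2; exact: B z ze s s0.
Qed.

Lemma rigid x : H x = H 0.
Proof.
have S (l : seq 'I_n) : H (\sum_(i <- l) x ord0 i *: ebasis i) = H 0.
  elim: l => [|i l IH]; first by rewrite big_nil.
  rewrite big_cons -IH addrC; apply/eqP; rewrite -subr_eq0; apply/eqP; exact: fdiff0_of_iter.
by rewrite -(S (index_enum 'I_n)) {1}(row_sum_delta x).
Qed.

End rigidity.

(** * Completeness *)

Section completeness.
Context {R : realType} {n : nat}.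
Notation V := 'rV[R]_n.
Notation mu := (@vmeas R n).
Notation I := (Ig mu).
Notation leb := (@lebesgue_measure R).
Implicit Types (x y z a L : V).

Variable u : V -> R.
Hypothesis cu : continuous u.

Let cR (f : R -> R) : continuous f -> measurable_fun [set: R] f.
Proof. exact: continuous_measurable_fun. Qed.

Lemma glength_lower (C : R) L (c : R -> V) (i : 'I_n) (t0 : R) : 0 <= t0 < 1 ->
  (forall t, t0 <= t <= 1 -> - C <= u (c t)) -> (forall t, derivable c t 1) -> continuous (c^`())%classic ->
  ((expR (- C) * `|c 1 ord0 i - c t0 ord0 i|)%:E <= glength u c)%E.
Proof.
move=> /andP[t00 t01] Hu dc cc.
have cc0 : continuous c.
  by move=> t; apply: differentiable_continuous; apply/derivable1_diffP; exact: dc.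
pose ci t := c t ord0 i.
have di t : is_derive t (1 : R) ci ((c^`())%classic t ord0 i).
  constructor; first by have /derivable_mxP := dc t; exact.
  by rewrite derive1E (derive_mx (dc t)) mxE.
have cci : continuous (fun t => (c^`())%classic t ord0 i).
  by move=> t; apply: (@continuous_comp _ _ _ (c^`())%classic (fun v : V => v ord0 i)); [exact: cc|exact: coord_continuous].
have cn' : continuous (fun t => enorm ((c^`())%classic t)).
  by move=> t; apply: (@continuous_comp _ _ _ (c^`())%classic (@enorm R n)); [exact: cc|exact: enorm_continuous].
have ce : continuous (fun t => expR (u (c t))).
  move=> t; apply: (@continuous_comp _ _ _ (fun t => u (c t)) expR); last exact: continuous_expR.
  by apply: (@continuous_comp _ _ _ c u); [exact: cc0|exact: cu].
have mI : measurable_fun [set: R] (fun t => expR (u (c t)) * enorm ((c^`())%classic t)).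
  by apply: measurable_funM; exact: cR.
have ma : measurable_fun [set: R] (fun t => `|(c^`())%classic t ord0 i|).
  by apply: measurableT_comp => //; exact: cR.
have FTC : (\int[leb]_(t in `[t0, 1%R]) ((c^`())%classic t ord0 i)%:E = (ci 1 - ci t0)%:E)%E.
  rewrite (@continuous_FTC2 _ _ ci)//.
  - exact: continuous_subspaceT.
  - have cci0 := der1_continuous di; split.
    + by move=> t _; case: (di t).
    + exact/cvg_at_right_filter/cci0.
    + exact/cvg_at_left_filter/cci0.
  - by move=> t _; rewrite derive1E; apply: derive_val.
apply: (@le_trans _ _ (\int[leb]_(t in `[t0, 1%R]) (expR (- C) * `|(c^`())%classic t ord0 i|)%:E)%E).
  under eq_integral do rewrite EFinM.
  rewrite ge0_integralZl//; last first.
    by apply/measurable_EFinP; apply: measurable_funS ma.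
  rewrite EFinM lee_wpmul2l ?lee_fin ?expR_ge0//.
  have := @le_abse_integral _ _ R leb `[t0, 1%R]%classic (fun t => ((c^`())%classic t ord0 i)%:E) (measurable_itv _).
  rewrite FTC; apply; apply/measurable_EFinP; apply: measurable_funS (cR cci) => //.
apply: (@le_trans _ _ (\int[leb]_(t in `[t0, 1%R]) (expR (u (c t)) * enorm ((c^`())%classic t))%:E)%E).
  apply: ge0_le_integral => //.
  - apply/measurable_EFinP; apply: measurable_funS (measurable_funM (measurable_cst (expR (- C))) ma) => //.
  - by apply/measurable_EFinP; apply: measurable_funS mI.
  - move=> t; rewrite /= in_itv /= => tt; rewrite lee_fin; apply: ler_pM; rewrite ?expR_ge0//.
      by rewrite ler_expR; exact: Hu.
    exact: coord_le_enorm.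
rewrite /glength; apply: ge0_subset_integral => //.
- by apply/measurable_EFinP; apply: measurable_funS mI.
- by move=> t _; rewrite lee_fin mulr_ge0 ?expR_ge0 ?enorm_ge0.
- by move=> t; rewrite /= !in_itv /= => /andP[h1 h2]; rewrite h2 (le_trans t00).
Qed.

(** A path from outside the unit ball around L to L has to cross that ball, and there the conformal
    factor is bounded below. So convergence in the metric implies staying Euclidean-close, which is
    all that completeness will be confronted with. *)
Lemma gdist_far L : exists2 e : R, 0 < e & forall x, 1 <= enorm (x - L) -> (e%:E <= gdist u x L)%E.
Proof.
have [C _ HC] := continuous_bounded cu (enorm L + 1).
exists (expR (- C) * n.+1%:R^-1); first by rewrite mulr_gt0 ?expR_gt0.
move=> x xL; apply: le_ereal_inf_tmp => _ [c [c0 [c1 [dc cc]]] <-].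
have cc0 : continuous c.
  by move=> t; apply: differentiable_continuous; apply/derivable1_diffP; exact: dc.
pose phi t := enorm (c t - L).
have cphi : continuous phi.
  move=> t; apply: (@continuous_comp _ _ _ (fun t => c t - L) (@enorm R n)); last exact: enorm_continuous.
  by apply: continuousB; [exact: cc0|exact: cst_continuous].
pose A := [set t : R | 0 <= t <= 1 /\ 1 <= phi t].
have A0 : A 0 by split; [rewrite lexx ler01|rewrite /phi c0].
have hA : has_sup A by split; [exists 0|exists 1 => t [/andP[]]].
(* The last time at distance at least 1 from L: from then on the path stays in the closed unit ball,
   where u >= - C. *)
pose t0 := sup A.
have t00 : 0 <= t0 by exact: sup_upper_bound.
have t0le1 : t0 <= 1 by apply: ge_sup => [|t [/andP[]]//]; exists 0.
have ed t e : 0 < e -> exists2 d : R, 0 < d & forall s, `|s - t| < d -> `|phi s - phi t| < e.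
  move=> e0; have /cvgrPdist_lt/(_ _ e0)/nbhs_ballP[d d0 Hd] := cphi t; exists d => // s sd.
  by rewrite distrC; apply: Hd; rewrite /ball /= distrC.
have after t : t0 < t -> t <= 1 -> phi t < 1.
  move=> h1 h2; rewrite ltNge; apply/negP => h3; move: (h1); rewrite ltNge => /negP; apply.
  by apply: sup_upper_bound => //; split => //; rewrite h2 andbT (le_trans t00)// ltW.
have p1 : 1 <= phi t0.
  rewrite leNgt; apply/negP => h.
  have [|d d0 Hd] := ed t0 (1 - phi t0); first by rewrite subr_gt0.
  have [t At td] := sup_adherent d0 hA.
  have tt0 : t <= t0 by exact: sup_upper_bound.
  have := Hd t; rewrite ler0_norm ?subr_le0// => /(_ _); move: td; rewrite -/t0 => td.
  move=> /(_ _)/(le_lt_trans (ler_norm _)) H; have {H} := H _; case: At => _ h2 H.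
  by have : phi t - phi t0 < 1 - phi t0; [apply: H; lra|lra].
have t01 : t0 < 1.
  rewrite lt_neqAle t0le1 andbT; apply/eqP => h; move: p1.
  by rewrite h /phi c1 subrr enorm0 leNgt ltr01.
have p2 : phi t0 <= 1.
  rewrite leNgt; apply/negP => h.
  have [|d d0 Hd] := ed t0 (phi t0 - 1); first by rewrite subr_gt0.
  pose t := t0 + Num.min (d / 2) (1 - t0).
  have m0 : 0 < Num.min (d / 2) (1 - t0) by rewrite lt_min divr_gt0//= subr_gt0.
  have m1 : Num.min (d / 2) (1 - t0) <= d / 2 by rewrite ge_min lexx.
  have m2 : Num.min (d / 2) (1 - t0) <= 1 - t0 by rewrite ge_min lexx orbT.
  have tt : phi t < 1 by apply: after; rewrite /t; lra.
  have := Hd t; rewrite /t [t0 + _]addrC addrK gtr0_norm// => H.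
  have {H} := H _; rewrite [_ + t0]addrC -/t ltr_norml => H.
  have hd : Num.min (d / 2) (1 - t0) < d by move: m1; lra.
  by have /andP[h1 h2] := H hd; move: h1 tt; lra.
have Hu t : t0 <= t <= 1 -> - C <= u (c t).
  move=> /andP[h1 h2]; have : phi t <= 1.
    by move: h1; rewrite le_eqVlt => /predU1P[<-//|h1]; exact: ltW (after _ h1 h2).
  move=> pt; suff /andP[//] : - C <= u (c t) <= C.
  rewrite -ler_norml; apply: HC; have := enorm_triangle (c t - L) L; rewrite subrK; move: pt; rewrite /phi; lra.
(* If all coordinates moved by less than 1/(n+1), the Euclidean displacement would be at most
   n/(n+1) < 1. *)
have [i Hi] : exists i, n.+1%:R^-1 <= `|c 1 ord0 i - c t0 ord0 i|.
  apply: contrapT => /forallNP N; move: p1; rewrite leNgt => /negP; apply; rewrite /phi -c1.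
  apply: le_lt_trans (enorm_le_sum _) _; apply: (@le_lt_trans _ _ (\sum_(i < n) n.+1%:R^-1)).
    apply: ler_sum => i _; have := N i; rewrite !mxE distrC => /negP; rewrite -ltNge; exact: ltW.
  by rewrite sumr_const card_ord -[_ *+ n]mulr_natl ltr_pdivrMr// mul1r ltr_nat.
apply: le_trans (glength_lower L i _ Hu dc cc); last by rewrite t00.
by rewrite lee_fin ler_wpM2l// expR_ge0.
Qed.

Lemma line_derive (b v : V) (t : R) : derivable (fun t : R => b + t *: v) t 1 /\ ((fun t : R => b + t *: v)^`())%classic t = v.
Proof.
have D i j : is_derive t (1 : R) (fun t : R => (b + t *: v) i j) (v i j).
  rewrite (_ : (fun t : R => _) = fun t : R => b i j + v i j * t).
    by apply: (der_eq (derD (derC t 1 (b i j)) (derZ (v i j) (is_derive_id t (1 : R))))) => //; rewrite add0r mulr1.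
  by apply/funext => r; rewrite !mxE mulrC.
have d : derivable (fun t : R => b + t *: v) t 1 by apply/derivable_mxP => i j; case: (D i j).
split => //; rewrite derive1E (derive_mx d); apply/matrixP => i j; rewrite !mxE.
by case: (D i j).
Qed.

Lemma line_continuous (b v : V) : continuous (fun t : R => b + t *: v).
Proof. by move=> t; apply: differentiable_continuous; apply/derivable1_diffP; case: (line_derive b v t). Qed.

Definition hl (T s : R) : R := (T <= s)%R%:R.

Lemma measurable_hl T : measurable_fun [set: R] (hl T).
Proof.
rewrite (_ : hl T = \1_`[T, +oo[%classic); first exact: measurable_indic.
by apply/funext => s; rewrite indicE mem_setE in_itv /= andbT.
Qed.

Lemma gdist_line x a (T m k : R) : T <= m -> T <= k ->
  ibl leb (fun s => expR (u (x + s *: a)) * hl T s) ->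
  (gdist u (x + m *: a) (x + k *: a) <= (enorm a * Ig leb (fun s => expR (u (x + s *: a)) * hl T s))%:E)%E.
Proof.
move=> Tm Tk iw.
pose w s := expR (u (x + s *: a)) * hl T s.
have w0 s : 0 <= w s by rewrite mulr_ge0 ?expR_ge0.
have mw : measurable_fun [set: R] w by exact: ibl_meas iw.
pose c t := (x + m *: a) + t *: ((k - m) *: a).
have c'E : (c^`())%classic = fun _ => (k - m) *: a by apply/funext => t; case: (line_derive (x + m *: a) ((k - m) *: a) t).
apply: ge_ereal_inf; exists (glength u c).
  exists c => //; split; first by rewrite /c scale0r addr0.
  split; first by rewrite /c scale1r -addrA -scalerDl [m + _]addrC subrK.
  split; first by move=> t; case: (line_derive (x + m *: a) ((k - m) *: a) t).
  by rewrite c'E; exact: cst_continuous.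
rewrite /glength c'E.
have [->|km] := eqVneq k m.
  rewrite subrr scale0r enorm0 (eq_integral (fun _ => 0%E)); last by move=> t _; rewrite mulr0.
  by rewrite integral0 lee_fin mulr_ge0 ?enorm_ge0// Ig_ge0.
have s0 : k - m != 0 by rewrite subr_eq0.
pose g (r : R) : \bar R := (w r)%:E.
have mg : measurable_fun [set: R] g by exact/measurable_EFinP.
have ma : measurable_fun [set: R] (fun t => g ((k - m) * t + m)).
  by apply: measurableT_comp => //; exact: measurable_affine.
have g0 r : (0 <= g r)%E by rewrite lee_fin.
apply: (@le_trans _ _ (\int[leb]_(t in `[0%R, 1%R]) ((`|k - m| * enorm a)%:E * g ((k - m) * t + m)%R)%E)%E).
  rewrite le_eqVlt; apply/orP; left; apply/eqP; apply: eq_integral => t; rewrite inE /= in_itv /= => /andP[t0 t1].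
  rewrite /g -EFinM /w /hl /c; congr (_%:E).
  have -> : T <= (k - m) * t + m.
    have [h|h] := leP m k.
      have : 0 <= (k - m) * t by rewrite mulr_ge0// subr_ge0.
      by move: Tm; lra.
    have : 0 <= (m - k) * (1 - t) by apply: mulr_ge0; [rewrite subr_ge0 ltW|rewrite subr_ge0].
    by move: Tk; lra.
  by rewrite mulr1 enormZ mulrC -addrA scalerA -scalerDl [t * _]mulrC [m + _]addrC.
apply: (@le_trans _ _ (\int[leb]_t ((`|k - m| * enorm a)%:E * g ((k - m) * t + m)%R)%E)%E).
  apply: ge0_subset_integral => //.
  - by apply: emeasurable_funM => //; exact: measurable_cst.
  - by move=> t _; rewrite mule_ge0// lee_fin mulr_ge0 ?enorm_ge0.
rewrite ge0_integralZl//; last by rewrite lee_fin mulr_ge0 ?enorm_ge0.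
rewrite (lebesgue_affine _ s0 mg g0) muleA -EFinM mulrAC divff ?normr_eq0// mul1r.
by rewrite (ibl_EFin iw) -EFinM.
Qed.

(** On a ray of finite length the points x + k a form a Cauchy sequence, since the lengths of the
    tails tend to 0. They leave every Euclidean ball, so [gdist_far] excludes any limit. *)
Lemma complete_line x a : a != 0 -> gcomplete u -> ibl leb (fun s => expR (u (x + s *: a)) * hl 0 s) -> False.
Proof.
move=> a0 gc iw; have ea : 0 < enorm a by rewrite enorm_gt0.
pose w T s := expR (u (x + s *: a)) * hl T s.
have me : measurable_fun [set: R] (fun s => expR (u (x + s *: a))).
  suff cw : continuous (fun s : R => expR (u (x + s *: a))) by exact: cR cw.
  move=> s; apply: (@continuous_comp _ _ _ (fun s : R => u (x + s *: a)) expR); last exact: continuous_expR.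
  by apply: (@continuous_comp _ _ _ (fun s : R => x + s *: a) u); [exact: line_continuous|exact: cu].
have mw T : measurable_fun [set: R] (w T) by apply: measurable_funM => //; exact: measurable_hl.
have w0 T s : 0 <= w T s by rewrite mulr_ge0 ?expR_ge0.
have wT T s : 0 <= T -> w T s <= w 0 s.
  move=> T0; rewrite ler_wpM2l ?expR_ge0// /hl; case: (leP T s) => h; last by rewrite ler_nat.
  by rewrite (le_trans T0 h).
have iwT (T : R) : 0 <= T -> ibl leb (w T).
  move=> T0; apply: (@ibl_le _ _ _ leb (w T) (w 0)) => //; first exact: mw.
  by move=> s; rewrite ger0_norm// wT.
have [||||_ L0] := @Ig_dct _ _ _ leb (fun (j : nat) s => w j%:R s) (fun _ => 0) (w 0).
- by move=> j; exact: mw.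
- exact: iw.
- by move=> j s; rewrite ger0_norm// wT.
- move=> s; apply: cvg_near_cst; near=> j; rewrite /w /hl leNgt (_ : s < j%:R) ?mulr0//.
  by near: j; exact: nbhs_infty_gtr.
rewrite Ig0 in L0.
have L1 : (fun j : nat => enorm a * Ig leb (w j%:R)) @ \oo --> (0 : R).
  by rewrite -[X in _ --> X](mulr0 (enorm a)); exact: cvgMr.
have [L HL] : exists L : V, forall e : R, 0 < e -> exists N, forall k, (N <= k)%N ->
    (gdist u (x + k%:R *: a) L < e%:E)%E.
  apply: gc => e e0; have /(cvgr_lt (0 : R))/(_ _ e0)[N _ HN] := L1.
  exists N => m k Nm Nk; apply: le_lt_trans (gdist_line (T := N%:R) _ _ _) _; rewrite ?ler_nat//.
    exact: iwT.
  by rewrite lte_fin; apply: HN; rewrite /=.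
have [e e0 He] := gdist_far L.
have [N HN] := HL e e0.
have q0 : 0 <= (1 + enorm (x - L)) / enorm a by rewrite divr_ge0 ?(ltW ea)// addr_ge0 ?enorm_ge0.
have := archi_boundP q0; set M := Num.bound _; rewrite ltr_pdivrMr// => hM.
pose k := maxn N M; have Mk : M%:R <= k%:R :> R by rewrite ler_nat leq_maxr.
have := HN k (leq_maxl _ _); rewrite ltNge => /negP; apply; apply: He.
have h1 : M%:R * enorm a <= k%:R * enorm a by rewrite ler_wpM2r// ltW.
have h2 : enorm (k%:R *: a) = k%:R * enorm a by rewrite enormZ normr_nat.
have := enorm_triangle (x + k%:R *: a - L) (- (x - L)); rewrite enormN.
have -> : x + k%:R *: a - L - (x - L) = k%:R *: a by rewrite opprB addrA subrK addrC addKr.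
by rewrite h2; move: h1 hM; lra.
Unshelve. all: by end_near. Qed.

Lemma ibl_decay (th : R) : 1 < th -> ibl leb (fun s => expR (- th * ln (1 + s)) * hl 0 s).
Proof.
move=> th1; have t0 : 0 < th - 1 by rewrite subr_gt0.
have m1 : measurable_fun [set: R] (fun s => expR (- th * ln (1 + s)) * hl 0 s).
  apply: measurable_funM; last exact: measurable_hl.
  apply: measurableT_comp => //; apply: measurable_funM => //.
  apply: measurableT_comp; first exact: measurable_ln.
  by apply: measurable_funD.
apply: ibl_ge0 => //; first by move=> s; rewrite mulr_ge0 ?expR_ge0.
pose G s : R := - (th - 1)^-1 * expR (- (th - 1) * ln (1 + s)).
have d1 (s : R) : -1 < s -> is_derive s 1 (fun s : R => ln (1 + s)) (1 + s)^-1.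
  move=> s1; have p : 0 < 1 + s by lra.
  have d0 : is_derive s 1 (fun s : R => 1 + s) 1.
    by apply: (der_eq (derD (derC s 1 (1 : R)) (is_derive_id s (1 : R)))) => //; rewrite add0r.
  by apply: (der_eq (der1_comp d0 (is_derive1_ln p))) => //; rewrite mulr1.
have d2 (c s : R) : -1 < s -> is_derive s 1 (fun s : R => expR (c * ln (1 + s))) (c * expR (c * ln (1 + s)) / (1 + s)).
  move=> s1; apply: (der_eq (der1_comp (derZ c (d1 s s1)) (is_derive_expR _))) => //.
  by rewrite mulrCA mulrA.
have dG (s : R) : -1 < s -> is_derive s 1 G (expR (- th * ln (1 + s))).
  move=> s1; have p : 0 < 1 + s by lra.
  apply: (der_eq (derZ (- (th - 1)^-1) (d2 (- (th - 1)) s s1))) => //.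
  have -> : - th * ln (1 + s) = - (th - 1) * ln (1 + s) - ln (1 + s) by ring.
  rewrite expRD expRN lnK ?posrE//; field; rewrite !gt_eqF//.
have cG (s : R) : -1 < s -> {for s, continuous G}.
  by move=> s1; apply: differentiable_continuous; apply/derivable1_diffP; case: (dG s s1).
rewrite (_ : (\int[leb]_x _)%E = (\int[leb]_(s in `[0%R, +oo[) (expR (- th * ln (1 + s)))%:E)%E); last first.
  rewrite [RHS]integral_mkcond; apply: eq_integral => s _; rewrite patchE /hl mem_setE in_itv /= andbT.
  by case: ifP => h; rewrite ?mulr1 ?mulr0.
rewrite (@ge0_continuous_FTC2y _ _ G 0 0).
- by rewrite ltry.
- by move=> s _; rewrite expR_ge0.
- have cf (s : R) : -1 < s -> {for s, continuous (fun s : R => expR (- th * ln (1 + s)))}.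
    by move=> s1; apply: differentiable_continuous; apply/derivable1_diffP; case: (d2 (- th) s s1).
  apply/continuous_within_itvcyP; split; last by apply: cvg_at_right_filter; apply: cf; lra.
  by move=> s; rewrite in_itv /= andbT => s0; apply: cf; lra.
- rewrite -[X in _ --> X](mulr0 (- (th - 1)^-1)); apply: cvgMr; apply/cvgrPdist_lt => e e0; near=> s.
  rewrite sub0r normrN gtr0_norm ?expR_gt0// -[ltRHS]lnK ?posrE// ltr_expR.
  have s1 : expR (- ln e / (th - 1)) < s by near: s; apply: nbhs_pinfty_gt; exact: num_real.
  have p : 0 < s by apply: lt_trans s1; exact: expR_gt0.
  have : - ln e / (th - 1) < ln (1 + s).
    by rewrite -[ltLHS]expRK ltr_ln ?posrE ?expR_gt0//; move: s1 p; lra.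
  by rewrite ltr_pdivrMr// => h; move: h; lra.
- by move=> s s0; case: (dG s _) => //; lra.
- by apply: cvg_at_right_filter; apply: cG; lra.
- by move=> s; rewrite in_itv /= andbT => s0; rewrite derive1E; apply: derive_val; apply: dG; lra.
Unshelve. all: by end_near. Qed.

(* By Tonelli some ray of the tube has finite length. *)
Lemma complete_tube (x0 a : V) (e K th : R) (Psi : V -> R) : a != 0 -> gcomplete u -> 0 < e -> 0 <= K -> 1 < th ->
  ibl mu Psi -> (forall x, 0 <= Psi x) ->
  (forall y, enorm (y - x0) < e -> forall s, 0 <= s ->
     expR (u (y + s *: a)) <= K * expR (- th * ln (1 + s)) * (1 + Psi (y + s *: a))) -> False.
Proof.
move=> a0 gc e0 K0 th1 iP P0 H.
pose f (s : R) (y : V) : R := expR (u (y + s *: a)) * hl 0 s * ball_ind x0 e y.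
have f0 s y : 0 <= f s y by rewrite !mulr_ge0 ?expR_ge0 ?ball_ind_ge0.
have mu' : measurable_fun [set: V] u by exact: continuous_measurable.
have mf : measurable_fun [set: R * V] (fun p => f p.1 p.2).
  apply: measurable_funM; last by apply: (measurableT_comp (f := ball_ind x0 e)) => //; exact: measurable_ball_ind.
  apply: measurable_funM; last by apply: (measurableT_comp (f := hl 0)) => //; exact: measurable_hl.
  apply: measurableT_comp => //; apply: (vcomp mu'); apply: measurable_rVD => //.
  by apply: measurable_rVZ => //; exact: measurable_cst.
have T := @Ig_tonelli _ _ _ _ R leb mu f mf f0.
pose b := I (ball_ind x0 e).
have b0 : 0 < b by rewrite /b Ig_ball_ind// mulr_gt0 ?ballvol_gt0 ?exprn_gt0.
pose M := K * (b + I Psi).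
have M0 : 0 <= M by rewrite mulr_ge0// addr_ge0 ?(ltW b0)// Ig_ge0.
have iD := ibl_decay th1.
have up : (\int[leb]_s \int[mu]_y (f s y)%:E <= (M * Ig leb (fun s => expR (- th * ln (1 + s)) * hl 0 s))%:E)%E.
  rewrite -(IgZ M iD) -(ibl_EFin (iblZ M iD)); apply: ge0_le_integral => //.
  - by move=> s _; apply: integral_ge0 => y _; rewrite lee_fin.
  - apply: (measurable_fun_fubini_tonelli_F (m2 := mu) (fun p => (f p.1 p.2)%:E)).
    + exact/measurable_EFinP.
    + by move=> p; rewrite lee_fin.
  - by apply/measurable_EFinP; exact: ibl_meas (iblZ M iD).
  move=> s _; pose w := K * (expR (- th * ln (1 + s)) * hl 0 s).
  have w0 : 0 <= w by rewrite !mulr_ge0 ?expR_ge0.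
  have iS := ibl_shift (s *: a) iP.
  have iG : ibl mu (fun y => w * (ball_ind x0 e y + Psi (y + s *: a))).
    by apply: iblZ; apply: iblD => //; exact: ibl_ball_ind.
  have -> : M * (expR (- th * ln (1 + s)) * hl 0 s) = I (fun y => w * (ball_ind x0 e y + Psi (y + s *: a))).
    rewrite (IgZ _ (iblD (ibl_ball_ind _ _) iS)) (IgD (ibl_ball_ind _ _) iS) (Ig_shift _ iP) -/b /M /w.
    by rewrite mulrAC.
  rewrite -(ibl_EFin iG); apply: ge0_le_integral => //.
  - by move=> y _; rewrite lee_fin.
  - apply/measurable_EFinP; exact: (measurableT_comp mf (pair1_measurable s)).
  - by apply/measurable_EFinP; exact: ibl_meas iG.
  move=> y _; rewrite lee_fin /f /w /hl; case: (leP 0 s) => s0; last by rewrite !mulr0 !mul0r.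
  rewrite !mulr1 /ball_ind; case: ltP => ye; last by rewrite mulr0 !mulr_ge0 ?expR_ge0 ?addr_ge0.
  by rewrite mulr1; exact: H.
apply: contrapT => _.
(* The bound on the double integral divided by the volume of the ball; with the [+ 1], rays all
   longer than [M2] would make the double integral exceed its own bound by one. *)
pose M2 := (M * Ig leb (fun s => expR (- th * ln (1 + s)) * hl 0 s) + 1) / b.
have [y ye Hy] : exists2 y, enorm (y - x0) < e & (\int[leb]_s (f s y)%:E <= M2%:E)%E.
  apply: contrapT => /forall2NP N.
  have : (\int[mu]_y (M2 * ball_ind x0 e y)%:E <= \int[mu]_y \int[leb]_s (f s y)%:E)%E.
    have m20 : 0 <= M2 by rewrite divr_ge0 ?(ltW b0)// addr_ge0// mulr_ge0// Ig_ge0// => s; rewrite mulr_ge0 ?expR_ge0.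
    apply: ge0_le_integral => //.
    - by move=> y _; rewrite lee_fin mulr_ge0 ?ball_ind_ge0.
    - by apply/measurable_EFinP; apply: measurable_funM => //; exact: measurable_ball_ind.
    - apply: (measurable_fun_fubini_tonelli_G (m1 := leb) (fun p => (f p.1 p.2)%:E)).
      + exact/measurable_EFinP.
      + by move=> p; rewrite lee_fin.
    move=> y _; rewrite /ball_ind; case: ltP => ye; last by rewrite mulr0; apply: integral_ge0 => s _; rewrite lee_fin.
    by rewrite mulr1; case: (N y) => [//|/negP]; rewrite -ltNge => /ltW.
  rewrite -T (ibl_EFin (iblZ M2 (ibl_ball_ind _ _))) (IgZ _ (ibl_ball_ind _ _)) -/b divfK ?gt_eqF//.
  by move=> /le_trans/(_ up); rewrite lee_fin gerDl ler10.
apply: (@complete_line y a a0 gc).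
have E s : f s y = expR (u (y + s *: a)) * hl 0 s by rewrite /f /ball_ind ye mulr1.
apply: ibl_ge0.
- apply: eq_measurable_fun (measurableT_comp mf (pair2_measurable y)) => s _; exact: E.
- by move=> s; rewrite mulr_ge0 ?expR_ge0.
- by under eq_integral do rewrite -E; apply: le_lt_trans Hy _; rewrite ltry.
Qed.

End completeness.

(** * Volume entropy *)

Section limsup.
Context {R : realType}.
Implicit Types f : R -> R.

Lemma limf_esup_le f (c M : R) : (forall r, M < r -> f r <= c) ->
  (limf_esup (fun r => (f r)%:E) +oo%R <= c%:E)%E.
Proof.
move=> H; rewrite limf_esupE; apply: ge_ereal_inf.
exists (ereal_sup ((fun r => (f r)%:E) @` [set r | M < r])).
  by exists [set r | M < r] => //; exists M; split => //; exact: num_real.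
by apply: ge_ereal_sup => _ [r Mr <-]; rewrite lee_fin; exact: H.
Qed.

Lemma limf_esup_ge f (c : R) : (forall M, exists2 r, M < r & c <= f r) ->
  (c%:E <= limf_esup (fun r => (f r)%:E) +oo%R)%E.
Proof.
move=> H; rewrite limf_esupE; apply: le_ereal_inf_tmp => _ [A [M [_ MA]] <-].
have [r Mr cr] := H M; apply: le_ereal_sup_tmp; exists (f r)%:E; last by rewrite lee_fin.
by exists r => //; exact: MA.
Qed.

Lemma limf_esup_lty f : (limf_esup (fun r => (f r)%:E) +oo%R < +oo)%E ->
  exists M c : R, forall r, M < r -> f r <= c.
Proof.
rewrite limf_esupE => /ereal_inf_lt[_ [A [M [_ MA]] <-]] supA.
have fA r : M < r -> ((f r)%:E <= ereal_sup ((fun r => (f r)%:E) @` A))%E.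
  by move=> Mr; apply: ereal_sup_ubound; exists r => //; exact: MA.
have := fA (M + 1); move: supA fA; case: (ereal_sup _) => [c| |] // _ fA _.
  by exists M, c => r /fA; rewrite lee_fin.
by have := fA (M + 1); rewrite ltrDl => /(_ ltr01).
Qed.

(** The tangent line of ln of slope e = c / (A + 1), where the [+ 1] covers A = 0. *)
Lemma ln_linear (A c : R) : 0 <= A -> 0 < c -> exists K : R, forall s, 0 <= s -> A * ln (1 + s) <= c * s + K.
Proof.
move=> A0 c0; pose e := c / (A + 1).
have A1 : 0 < A + 1 by rewrite ltr_wpDl.
have e0 : 0 < e by rewrite divr_gt0.
exists (A * (e - 1 - ln e)) => s s0.
have h : ln (1 + s) <= (1 + s) * e - 1 - ln e.
  have p : 0 < 1 + s by rewrite ltr_pwDl.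
  have E : 1 + ((1 + s) * e - 1) = (1 + s) * e by rewrite addrC subrK.
  have := @le_ln1Dx R ((1 + s) * e - 1); rewrite E lnM ?posrE// => H.
  have pe : 0 < (1 + s) * e by rewrite mulr_gt0.
  have H1 : -1 < (1 + s) * e - 1 by lra.
  by have := H H1; lra.
apply: le_trans (ler_wpM2l A0 h) _.
have : A * (e * s) <= c * s.
  rewrite mulrA ler_wpM2r// /e mulrCA ler_piMr ?(ltW c0)// ler_pdivrMr// mul1r lerDl ler01 //.
by lra.
Qed.

End limsup.

(** * The solution differs from its potential by a constant *)

Section affine_difference.
Context {R : realType} {n : nat}.
Notation V := 'rV[R]_n.
Notation mu := (@vmeas R n).
Notation I := (Ig mu).
Implicit Types (x y z a : V).

Variables u F : V -> R.
Hypothesis n1 : (1 < n)%N.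
Hypothesis su : smooth u.
Hypothesis gc : gcomplete u.
Hypothesis uF : frac_lap_eq u F.
Hypothesis Fi : ibl mu F.
Let n0 : (0 < n)%N := ltnW n1.
Let Fb : lbounded F := F_lbounded n0 su uF.
Let cu : continuous u. Proof. by case: (su [::]). Qed.
Local Notation c := (@cn R n).
Let c0 : 0 < c := @cn_gt0 R n.
Local Notation H := (fun x => u x - vp F x).

Let vp_le x : vp F x <= Sv F x + c * LF F x.
Proof. by have := vp_near n1 Fi Fb x; rewrite ler_norml => /andP[_]; lra. Qed.

Let vp_ge x : Sv F x - c * LF F x <= vp F x.
Proof. by have := vp_near n1 Fi Fb x; rewrite ler_norml => /andP[+ _]; lra. Qed.

Let ray_ln x0 a (e s : R) y : 0 < e -> 0 <= s -> enorm (y - x0) < e ->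
  ln (1 + enorm (y + s *: a)) <= ln (1 + enorm x0 + e + enorm a) + ln (1 + s).
Proof.
move=> e0 s0 ye; have x00 := enorm_ge0 x0; have a0 := enorm_ge0 a; have ys0 := enorm_ge0 (y + s *: a).
apply: ln_le_mul; [lra|lra|lra|].
have h1 := enorm_triangle y (s *: a); rewrite enormZ ger0_norm// in h1.
have h2 := enorm_triangle (y - x0) x0; rewrite subrK in h2.
have : 0 <= s * enorm x0 by rewrite mulr_ge0.
have : 0 <= s * e by rewrite mulr_ge0// ltW.
by move: h1 h2 ye; nra.
Qed.

(** Along the tube u = H + v, where the linear decay of H beats the logarithmic growth of [Sv]; the
    factor exp(c LF) is left to the integrable majorant of [exp_LF], and [complete_tube] contradicts
    completeness. *)
Lemma no_escape_down (i : 'I_n) (h : R) x0 (b K e : R) : h != 0 -> 0 < b -> 0 < e ->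
  (forall y, enorm (y - x0) < e -> forall s, 0 <= s -> H (y + s *: (h *: ebasis i)) <= - (b * s - K)) -> False.
Proof.
move=> h0 b0 e0 HH; set a := h *: ebasis i in HH.
have a0 : a != 0 by rewrite -enorm_gt0 enormZ enorm_ebasis mulr1 normr_gt0.
have [A A0 HA] := Sv_le n1 Fi Fb.
have [C [Psi C0 [iP P0 HP]]] := exp_LF n1 Fi Fb c0.
have A2 : 0 <= A + 2 by lra.
(* Of the A + 2 logarithms absorbed by the linear term, A pay for [Sv] and 2 remain as the decay (1
   + s)^(-2) required along the rays. *)
have [K2 HK2] := ln_linear A2 b0.
pose B := ln (1 + enorm x0 + e + enorm a).
pose K3 := A * (1 + B) + K + K2.
have t1 : 1 < 2 :> R by lra.
apply: (@complete_tube R n u cu x0 a e (expR K3 * C) 2 Psi a0 gc e0 _ t1 iP P0).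
  by rewrite mulr_ge0 ?expR_ge0// ltW.
move=> y ye s s0; pose x := y + s *: a; rewrite -/x.
have h1 := HH y ye s s0; rewrite -/x in h1.
have h2 := ray_ln a e0 s0 ye; rewrite -/x -/B in h2.
have h3 := HK2 s s0; have h4 := vp_le x.
have h5 : Sv F x <= A * (1 + ln (1 + enorm x)) by apply: le_trans (ler_norm _) (HA x).
have h6 : A * ln (1 + enorm x) <= A * (B + ln (1 + s)) by rewrite ler_wpM2l.
have h7 : u x <= K3 + - 2 * ln (1 + s) + c * LF F x.
  move: h1 h3 h4 h5 h6; rewrite /K3; move: (Sv F x) (c * _) (vp F x) (ln (1 + s)) (ln (1 + enorm x)) => S L v l l'.
  by lra.
apply: le_trans (_ : expR (K3 + - 2 * ln (1 + s) + c * LF F x) <= _); first by rewrite ler_expR.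
have G (X Y Z : R) : expR (X + Y + Z) = expR X * expR Y * expR Z by rewrite !expRD.
rewrite G; have := HP x; have := expR_gt0 K3; have := expR_gt0 (- 2 * ln (1 + s)).
move: (expR K3) (expR (- 2 * _)) (expR (c * _)) (Psi x) => p q w P q0 p0 h8.
have : p * q * w <= p * q * (C * (1 + P)) by rewrite ler_pM2l// mulr_gt0.
by move=> h9; apply: le_trans h9 _; rewrite le_eqVlt; apply/orP; left; apply/eqP; ring.
Qed.

(** The ball of radius [e] around x0 + s a lies in the ball of radius B (1 + s) around the origin.
    Jensen makes its volume at least exponential in s, up to powers of 1 + s, while the larger
    volume is polynomial in s. *)
Lemma no_escape_up (i : 'I_n) (h : R) x0 (b K e : R) :
  (exists K p, forall r, 1 <= r -> gv u r <= K * r ^+ p) -> 0 < b -> 0 < e ->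
  (forall y, enorm (y - x0) < e -> forall s, 0 <= s -> b * s - K <= H (y + s *: (h *: ebasis i))) -> False.
Proof.
move=> [K' [p Hp]] b0 e0 HH; set a := h *: ebasis i in HH.
have [A A0 HA] := Sv_le n1 Fi Fb.
pose B := 1 + enorm x0 + e + enorm a.
have B1 : 1 <= B by rewrite /B; have := enorm_ge0 x0; have := enorm_ge0 a; move: e0; lra.
pose L s := b * s - K - A * (1 + ln B + ln (1 + s)).
have nn : 0 < n%:R :> R by rewrite ltr0n.
have cunx : continuous (fun x : V => n%:R * u x).
  by move=> x; apply: (@continuousM _ _ (fun _ : V => n%:R) u x); [exact: cst_continuous|exact: cu].
pose v := @ballvol R n * e ^+ n.
have v0 : 0 < v by rewrite mulr_gt0 ?ballvol_gt0 ?exprn_gt0.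
have K'0 : 0 <= K'.
  by have := Hp 1 (lexx _); rewrite expr1n mulr1; apply: le_trans; apply: Ig_ge0 => x; rewrite mulr_ge0 ?expR_ge0 ?ball_ind_ge0.
have main s : 0 <= s -> v * expR (n%:R * L s - n%:R * c * LM F / v) <= K' * (B * (1 + s)) ^+ p.
  move=> s0; have s1 : 1 <= 1 + s by lra.
  have Bs : 1 <= B * (1 + s) by nra.
  apply: le_trans (Hp _ Bs).
  apply: le_trans (jensen_ball (z := x0 + s *: a) n1 Fi Fb cunx e0 _ _) _.
  - by rewrite mulr_ge0 ?(ltW c0)// ltW.
  - move=> x xe; pose y := x - s *: a.
    have xE : x = y + s *: a by rewrite subrK.
    have ye : enorm (y - x0) < e by rewrite /y -addrA -opprD [s *: a + x0]addrC.
    have h1 := HH y ye s s0; rewrite -xE in h1.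
    have h2 := ray_ln a e0 s0 ye; rewrite -xE -/B in h2.
    have h4 := vp_ge x.
    have h5 : - (A * (1 + ln (1 + enorm x))) <= Sv F x by have := HA x; rewrite ler_norml => /andP[].
    have h6 : A * ln (1 + enorm x) <= A * (ln B + ln (1 + s)) by rewrite ler_wpM2l.
    rewrite -mulrA -mulrBr ler_pM2l// /L.
    move: h1 h4 h5 h6; move: (Sv F x) (c * _) (vp F x) (ln (1 + s)) (ln (1 + enorm x)) => S M w l l'.
    by lra.
  - apply: Ig_le.
    + apply: cont_ibl_ball => x; apply: (@continuous_comp _ _ _ (fun x => n%:R * u x) expR); [exact: cunx|exact: continuous_expR].
    + exact: ibl_gv.
    move=> x; rewrite ler_wpM2l ?expR_ge0// /ball_ind subr0; case: ltP => h1; last by rewrite ler0n.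
    have t1 := enorm_triangle (x - (x0 + s *: a)) (x0 + s *: a); rewrite subrK in t1.
    have t2 := enorm_triangle x0 (s *: a); rewrite enormZ ger0_norm// in t2.
    have q1 : 0 <= s * enorm x0 by rewrite mulr_ge0 ?enorm_ge0.
    have q2 : 0 <= s * e by rewrite mulr_ge0// ltW.
    have q3 := enorm_ge0 a.
    have -> : (enorm x < B * (1 + s))%R by rewrite /B; lra.
    by [].
have nA : 0 <= n%:R * A + p.+1%:R by rewrite addr_ge0// mulr_ge0.
have nb : 0 < n%:R * b by rewrite mulr_gt0.
have [K2 HK2] := ln_linear nA nb.
pose K3 := n%:R * K + n%:R * A * (1 + ln B) + K2 + n%:R * c * LM F / v.
(* One power of 1 + s is kept in reserve ([p.+1] against [p]), so the comparison bounds 1 + s by a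
   constant; choosing s equal to that constant is absurd. *)
have big s : 0 <= s -> (1 + s) <= K' * B ^+ p / (v * expR (- K3)).
  move=> s0; have p1 : 0 < 1 + s by lra.
  have := main s s0; have hs := HK2 s s0.
  have : expR (p.+1%:R * ln (1 + s) - K3) <= expR (n%:R * L s - n%:R * c * LM F / v).
    rewrite ler_expR /K3 /L; move: hs; move: (n%:R * c * LM F / v) (ln (1 + s)) (ln B) => x l q; lra.
  rewrite expRD expRM_natl lnK ?posrE// => h1 h2.
  have {h1 h2} : v * ((1 + s) ^+ p.+1 * expR (- K3)) <= K' * (B * (1 + s)) ^+ p.
    by apply: le_trans h2; rewrite ler_pM2l.
  have d0 : 0 < v * expR (- K3) by exact: mulr_gt0 v0 (expR_gt0 _).
  rewrite exprS exprMn (ler_pdivlMr _ _ d0).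
  have : 0 < (1 + s) ^+ p by rewrite exprn_gt0.
  move: (expR _) ((1 + s) ^+ p) (B ^+ p) => E S T S0 hh.
  rewrite -(ler_pM2r S0); move: hh; lra.
pose s := K' * B ^+ p / (v * expR (- K3)).
have s0 : 0 <= s.
  apply: divr_ge0; last exact: mulr_ge0 (ltW v0) (expR_ge0 _).
  by apply: mulr_ge0 K'0 _; apply: exprn_ge0; exact: le_trans B1.
have := big s s0; rewrite -/s; move: (s) => s'; lra.
Qed.

Lemma u_eq_vp : (exists K p, forall r, 1 <= r -> gv u r <= K * r ^+ p) ->
  exists C, forall x, u x = vp F x + C.
Proof.
move=> pv; have [q ui] := weight_exists n0 su uF Fi pv.
have cH : continuous H by move=> x; apply: continuousB; [exact: cu|exact: vp_continuous].
(* With q + 2 differences both demands of [Dk_represent] are met: at least [q], and more than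
   one. *)
have DH (i : 'I_n) (h : R) y : iter q.+2 (fdiff (h *: ebasis i)) H y = 0.
  have q2 : (q <= q.+2)%N by rewrite leqW.
  have E := Dk_represent n1 Fi Fb i h y (isT : (1 < q.+2)%N) q2 su uF ui.
  have D l z : iter l (fdiff (h *: ebasis i)) H z = iter l (fdiff (h *: ebasis i)) u z - iter l (fdiff (h *: ebasis i)) (vp F) z.
    elim: l z => [//|l IH] z; rewrite !iterS /fdiff !IH; move: (iter l _ _ _) (iter l _ _ _) (iter l _ _ _) (iter l _ _ _) => a1 a2 a3 a4; ring.
  by rewrite D E subrr.
have E := @rigid R n H q.+1 cH DH (fun i h x1 b K e _ => @no_escape_up i h x1 b K e pv) no_escape_down.
by exists (H 0) => x; have <- := E x; rewrite addrC subrK.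
Qed.

End affine_difference.

(** * Two-sided volume estimates *)

Section volume_entropy.
Context {R : realType} {n : nat}.
Notation V := 'rV[R]_n.
Notation mu := (@vmeas R n).
Notation I := (Ig mu).
Implicit Types (x y z a : V).

Variables u F : V -> R.
Hypothesis n1 : (1 < n)%N.
Hypothesis su : smooth u.
Let n0 : (0 < n)%N := ltnW n1.

Let cu : continuous u. Proof. by case: (su [::]). Qed.

Let nn : 0 < n%:R :> R. Proof. by rewrite ltr0n. Qed.

Local Notation bv := (@ballvol R n).

Lemma gv_gt0 r : 0 < r -> 0 < gv u r.
Proof.
move=> r0; have [C C0 HC] := continuous_bounded cu r.
apply: (@lt_le_trans _ _ (expR (- (n%:R * C)) * (bv * r ^+ n))).
  by rewrite mulr_gt0 ?expR_gt0// mulr_gt0 ?ballvol_gt0 ?exprn_gt0.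
rewrite -(Ig_ball_ind 0 r0) -(IgZ _ (ibl_ball_ind 0 r)); apply: Ig_le.
- exact: iblZ (ibl_ball_ind 0 r).
- apply: cont_ibl_ball => x; apply: (@continuous_comp _ _ _ (fun x : V => n%:R * u x) expR); last exact: continuous_expR.
  by apply: (@continuousM _ _ (fun _ : V => n%:R) u x); [exact: cst_continuous|exact: cu].
move=> x; rewrite /ball_ind subr0; case: ltP => xr; last by rewrite !mulr0.
rewrite !mulr1 ler_expR -mulrN ler_pM2l//.
by have := HC x (ltW xr); rewrite ler_norml => /andP[].
Qed.

Let lnvol r : 0 < r -> ln (bv * r ^+ n) = ln bv + n%:R * ln r.
Proof. by move=> r0; rewrite lnM ?posrE ?ballvol_gt0 ?exprn_gt0// lnXn// mulr_natl. Qed.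

Lemma entropy_ratioE r : 0 < r -> ln (gvol u r) / ln (Rn_vol (eball r : set V)) = ln (gv u r) / (ln bv + n%:R * ln r).
Proof. by move=> r0; rewrite (gvolE su) Rn_vol_eball// lnvol. Qed.

Lemma ln_unbounded (K : R) : exists M : R, 1 < M /\ forall r, M <= r -> K <= ln r.
Proof.
exists (expR (Num.max K 1)); split; first by rewrite -[ltLHS]expR0 ltr_expR lt_max ltr01 orbT.
move=> r Mr; have r0 : 0 < r by apply: lt_le_trans Mr; exact: expR_gt0.
by apply: le_trans (_ : Num.max K 1 <= _); [rewrite le_max lexx|rewrite -[leLHS]expRK ler_ln ?posrE ?expR_gt0].
Qed.

(** A limsup below +oo bounds ln V by a multiple of ln |B_r| for large r; a natural number above
    that multiple serves as exponent, and monotonicity of the volume covers the small radii. *)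
Lemma entropy_bound_growth : (vol_entropy u < +oo)%E ->
  exists K p, forall r, 1 <= r -> gv u r <= K * r ^+ p.
Proof.
move=> /limf_esup_lty[M [c Hc]].
(* Beyond [M2] the denominator ln |B_r| = ln bv + n ln r is at least 1, so it can be multiplied
   out. *)
have [M2 [M21 HM2]] := ln_unbounded (1 - ln bv).
pose R1 := Num.max (M + 1) M2.
have R11 : 1 < R1 by rewrite lt_max M21 orbT.
pose p := Num.bound `|c|; have cp : c <= p%:R.
  by apply: le_trans (ler_norm _) (ltW (archi_boundP (normr_ge0 _))).
have big r : R1 <= r -> gv u r <= bv ^+ p * r ^+ (n * p).
  move=> Rr; have r1 : 1 < r by exact: lt_le_trans Rr.
  have r0 : 0 < r by exact: lt_trans r1.
  have Mr : M < r by apply: lt_le_trans Rr; rewrite lt_max ltrDl ltr01.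
  have h := Hc r Mr; rewrite entropy_ratioE// in h.
  have l0 : 0 < ln bv + n%:R * ln r.
    have := HM2 r (le_trans _ Rr); rewrite le_max lexx orbT => /(_ isT) h2.
    have l1 : 0 <= ln r by rewrite ln_ge0// ltW.
    have : ln r <= n%:R * ln r by rewrite ler_peMl// ler1n.
    by move: h2; lra.
  rewrite ler_pdivrMr// in h.
  have h3 : ln (gv u r) <= p%:R * ln (bv * r ^+ n).
    by apply: le_trans h _; rewrite lnvol// ler_pM2r.
  have b0 : 0 < bv * r ^+ n by rewrite mulr_gt0 ?ballvol_gt0 ?exprn_gt0.
  rewrite exprM -exprMn -[leLHS]lnK ?posrE ?gv_gt0// -[leRHS]lnK ?posrE ?exprn_gt0//.
  by rewrite ler_expR lnXn// -mulr_natl.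
exists (bv ^+ p + gv u R1), (n * p)%N => r r1.
have b0 : 0 <= bv ^+ p by rewrite exprn_ge0// ltW ?ballvol_gt0.
have g0 : 0 <= gv u R1 by rewrite ltW// gv_gt0// (lt_trans ltr01).
have [h|h] := leP R1 r.
  by apply: le_trans (big r h) _; rewrite ler_wpM2r ?exprn_ge0 ?(le_trans ler01)// lerDl.
apply: le_trans (_ : gv u R1 <= _); first by apply: (gv_mono su); exact: ltW.
by apply: le_trans (_ : (bv ^+ p + gv u R1) * 1 <= _); [rewrite mulr1 lerDr|rewrite ler_wpM2l ?addr_ge0// exprn_ege1].
Qed.

Hypothesis Fi : ibl mu F.
Hypothesis Fb : lbounded F.
Variable C0 : R.
Hypothesis uE : forall x, u x = vp F x + C0.

Local Notation c := (@cn R n).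
Let c0 : 0 < c := @cn_gt0 R n.
Local Notation al := (alpha F).

Let u_le x : u x <= Sv F x + c * LF F x + C0.
Proof. by have := vp_near n1 Fi Fb x; rewrite uE ler_norml => /andP[_]; lra. Qed.

Let u_ge x : Sv F x - c * LF F x + C0 <= u x.
Proof. by have := vp_near n1 Fi Fb x; rewrite uE ler_norml => /andP[+ _]; lra. Qed.

Let u_le2 (d : R) x : `|Sv F x + al * ln (enorm x)| <= d * ln (enorm x) ->
  u x <= C0 + (d - al) * ln (enorm x) + c * LF F x.
Proof.
rewrite ler_norml => /andP[_ h2]; have h3 := u_le x; move: h2 h3.
by move: (Sv F x) (c * _) (ln _) (u x) al => S L l v A; lra.
Qed.

Let u_ge2 (d : R) x : `|Sv F x + al * ln (enorm x)| <= d * ln (enorm x) ->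
  C0 - (al + d) * ln (enorm x) - c * LF F x <= u x.
Proof.
rewrite ler_norml => /andP[h2 _]; have h3 := u_ge x; move: h2 h3.
by move: (Sv F x) (c * _) (ln _) (u x) al => S L l v A; lra.
Qed.

Let lower_aux (X Y q C : R) : X <= Y + q -> - Y - q + C <= C - X.
Proof. lra. Qed.

Let ratio_aux (g b l N t d k1 k2 K1 K2 E : R) : g <= N * (t + d / 2) * l + k1 -> N * (t - d / 2) * l - k2 <= g ->
  K1 + K2 + E <= d / 2 * (N * l) -> k1 <= K1 -> k2 <= K2 -> 0 <= K1 -> 0 <= K2 -> - E <= (t + d) * b -> (t - d) * b <= E ->
  (t - d) * (b + N * l) <= g <= (t + d) * (b + N * l).
Proof. by move=> *; apply/andP; split; lra. Qed.

Let mul_aux (p q w C P q' : R) : 0 < p -> 0 < q -> 0 < C -> 0 <= P -> q <= q' -> w <= C * (1 + P) ->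
  p * q * w <= p * C * (q + q' * P).
Proof.
move=> p0 q0 Cp Pp E h8; have h9 : p * q * w <= p * q * (C * (1 + P)) by rewrite ler_pM2l// mulr_gt0.
apply: le_trans h9 _.
have : p * C * (q * P) <= p * C * (q' * P) by rewrite ler_pM2l ?mulr_gt0// ler_wpM2r.
by lra.
Qed.

Let sum_aux (g B S P e rn e' : R) : 0 <= g -> 1 <= e' -> e * rn = e' ->
  g + B * (e * (rn * S) + e' * P) <= (g + B * (S + P)) * e'.
Proof.
move=> g0 e1 E; rewrite mulrA E -mulrDr mulrDl; apply: lerD; first exact: ler_peMr.
by rewrite mulrCA mulrC.
Qed.

Let i0 : 'I_n := Ordinal n0.

(** If alpha > 1, choose [th] halfway between 1 and alpha: far out exp(u) is at most |x|^(-th) times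
    a factor with an integrable majorant, so a ray to infinity would have finite length. *)
Lemma alpha_le1 : gcomplete u -> al <= 1.
Proof.
move=> gc; rewrite leNgt; apply/negP => a1.
pose th := (al + 1) / 2; have th1 : 1 < th by rewrite /th; lra.
have d0 : 0 < al - th by rewrite /th; lra.
have [j Hj] := Sv_asym n1 Fi Fb d0.
have [C [Psi Cp [iP P0 HP]]] := exp_LF n1 Fi Fb c0.
pose R0 : R := expR j.+1%:R; have R00 : 0 < R0 by exact: expR_gt0.
pose a : V := ebasis i0.
have a0 : a != 0 by rewrite -enorm_gt0 enorm_ebasis.
(* Centre (R0 + 2) a and radius 1 keep the point at parameter s at distance at least R0 + 1 + s from
   the origin, inside the range of [Sv_asym]. *)
apply: (@complete_tube R n u cu ((R0 + 2) *: a) a 1 (expR C0 * C) th Psi a0 gc ltr01 _ th1 iP P0).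
  by rewrite mulr_ge0 ?expR_ge0// ltW.
move=> y y1 s s0; pose x := y + s *: a; rewrite -/x.
have xl : R0 + 1 + s <= enorm x.
  have t1 := enorm_triangle x ((R0 + 2) *: a - y).
  have E : x + ((R0 + 2) *: a - y) = (R0 + 2 + s) *: a.
    by rewrite /x [_ - y]addrC addrA [y + _]addrC addrK -scalerDl addrC.
  rewrite E enormZ enorm_ebasis mulr1 ger0_norm in t1; last by lra.
  by rewrite enormBC in y1; move: t1 y1; rewrite enormBC; lra.
have xR : R0 <= enorm x by lra.
have p1 : 0 < 1 + s by lra.
have ll : ln (1 + s) <= ln (enorm x) by rewrite ler_ln ?posrE//; lra.
have h5 : u x <= C0 + - th * ln (1 + s) + c * LF F x.
  have -> : - th = al - th - al by ring.
  apply: le_trans (u_le2 (Hj x xR)) _; rewrite lerD2r lerD2l.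
  have -> : al - th - al = - th by ring.
  by rewrite !mulNr lerN2 ler_wpM2l//; lra.
apply: le_trans (_ : expR (C0 + - th * ln (1 + s) + c * LF F x) <= _); first by rewrite ler_expR.
have G (X Y Z : R) : expR (X + Y + Z) = expR X * expR Y * expR Z by rewrite !expRD.
rewrite G; have := HP x; have := expR_gt0 C0; have := expR_gt0 (- th * ln (1 + s)).
move: (expR C0) (expR (- th * _)) (expR (c * _)) (Psi x) => p q w P q0 p0 h8.
have : p * q * w <= p * q * (C * (1 + P)) by rewrite ler_pM2l// mulr_gt0.
by move=> h9; apply: le_trans h9 _; rewrite le_eqVlt; apply/orP; left; apply/eqP; ring.
Qed.

(** Outside a fixed ball exp(n u) is at most a constant times |x|^be (1 + Psi) with be = n (d -
    alpha). Scaling the integral of [sing (- be)] gives r^(be + n) for the first term; it converges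
    because be + n > 0, which is where alpha <= 1 is used. *)
Lemma gv_upper (d : R) : al <= 1 -> 0 < d -> exists K M : R, forall r, M <= r ->
  ln (gv u r) <= n%:R * (1 - al + d) * ln r + K.
Proof.
move=> a1 d0; have [j Hj] := Sv_asym n1 Fi Fb d0.
pose be := n%:R * (d - al).
have g1 : - be < n%:R.
  have : 0 < n%:R * (1 - al + d) by rewrite mulr_gt0//; lra.
  by rewrite /be; lra.
have ben : be + n%:R = n%:R * (1 - al + d) by rewrite /be; ring.
have ben0 : 0 < be + n%:R by move: g1; lra.
have nc : 0 < n%:R * c by rewrite mulr_gt0.
have [C [Psi Cp [iP P0 HP]]] := exp_LF n1 Fi Fb nc.
have iS := @ibl_sing R n _ g1.
pose R0 : R := expR j.+1%:R; have R00 : 0 < R0 by exact: expR_gt0.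
have R01 : 1 <= R0 by rewrite /R0 -[leLHS]expR0 ler_expR.
pose A := expR (n%:R * C0) * C.
have A0 : 0 < A by rewrite mulr_gt0 ?expR_gt0.
pose K := gv u R0 + A * (I (sing (- be)) + I Psi).
have IS0 : 0 <= I (sing (- be)) by apply: Ig_ge0 => x; exact: sing_ge0.
have IP0 : 0 <= I Psi by exact: Ig_ge0.
have K0 : 0 < K.
  by apply: ltr_wpDr (gv_gt0 R00); apply: mulr_ge0 (ltW A0) _; exact: addr_ge0.
exists (ln K), R0 => r Rr.
have r0 : 0 < r by exact: lt_le_trans Rr.
have r1 : 1 <= r by exact: le_trans Rr.
have lr0 : 0 <= ln r by rewrite ln_ge0.
have cg : continuous (fun x => expR (n%:R * u x)).
  move=> x; apply: (@continuous_comp _ _ _ (fun x : V => n%:R * u x) expR); last exact: continuous_expR.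
  by apply: (@continuousM _ _ (fun _ : V => n%:R) u x); [exact: cst_continuous|exact: cu].
have rV0 : r^-1 != 0 by rewrite invr_eq0 gt_eqF.
have iSr : ibl mu (fun x => sing (- be) (r^-1 *: x)).
  by apply: (eq_ibl _ (ibl_affine 0 rV0 iS)) => x; rewrite addr0.
have ISr : I (fun x => sing (- be) (r^-1 *: x)) = r ^+ n * I (sing (- be)).
  have := Ig_affine 0 rV0 iS; rewrite normfV gtr0_norm// exprVn invrK => <-.
  by apply: eq_Ig => x; rewrite addr0.
have iG : ibl mu (fun x => expR (n%:R * u x) * ball_ind 0 R0 x + A * (expR (be * ln r) * sing (- be) (r^-1 *: x) + expR ((be + n%:R) * ln r) * Psi x)).
  apply: iblD; first exact: cont_ibl_ball.
  by apply: iblZ; apply: iblD; exact: iblZ.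
have B : gv u r <= gv u R0 + A * (expR (be * ln r) * (r ^+ n * I (sing (- be))) + expR ((be + n%:R) * ln r) * I Psi).
  rewrite /gv -ISr -(IgZ _ iSr) -(IgZ _ iP) -(IgD (iblZ _ iSr) (iblZ _ iP)) -(IgZ _ (iblD (iblZ _ iSr) (iblZ _ iP))).
  rewrite -(IgD (cont_ibl_ball 0 R0 cg) (iblZ _ (iblD (iblZ _ iSr) (iblZ _ iP)))).
  apply: Ig_le; [exact: cont_ibl_ball|exact: iG|move=> x].
  have T0 : 0 <= A * (expR (be * ln r) * sing (- be) (r^-1 *: x) + expR ((be + n%:R) * ln r) * Psi x).
    by apply: mulr_ge0 (ltW A0) _; apply: addr_ge0; apply: mulr_ge0; rewrite ?expR_ge0 ?sing_ge0.
  rewrite {1 2}/ball_ind !subr0; have [xr|xr] := ltP (enorm x) r; last first.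
    by rewrite mulr0 addr_ge0// mulr_ge0 ?expR_ge0.
  have [xR|xR] := ltP (enorm x) R0; first by rewrite lerDl.
  rewrite mulr0 add0r mulr1.
  have x0 : 0 < enorm x by exact: lt_le_trans xR.
  have h5 : n%:R * u x <= n%:R * C0 + be * ln (enorm x) + n%:R * c * LF F x.
    have : n%:R * u x <= n%:R * (C0 + (d - al) * ln (enorm x) + c * LF F x) by rewrite ler_pM2l// u_le2// Hj.
    by rewrite mulrDr mulrDr !mulrA.
  apply: le_trans (_ : expR (n%:R * C0 + be * ln (enorm x) + n%:R * c * LF F x) <= _); first by rewrite ler_expR.
  have G (X Y Z : R) : expR (X + Y + Z) = expR X * expR Y * expR Z by rewrite !expRD.
  rewrite G.
  have -> : expR (be * ln r) * sing (- be) (r^-1 *: x) = expR (be * ln (enorm x)).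
    have eE : enorm (r^-1 *: x) = enorm x / r by rewrite enormZ gtr0_norm ?invr_gt0// mulrC.
    rewrite /sing opprK /ball_ind subr0 eE ltr_pdivrMr// mul1r xr mulr1 ln_div ?posrE//.
    by rewrite -expRD -mulrDr [ln r + _]addrC subrK.
  (* [be] may be negative, so |x|^be need not be below r^be. As |x| >= 1 and be + n > 0 it is at
     most r^(be + n), which suffices for the [Psi] term. *)
  have E : expR (be * ln (enorm x)) <= expR ((be + n%:R) * ln r).
    rewrite ler_expR; apply: le_trans (_ : (be + n%:R) * ln (enorm x) <= _).
      by rewrite mulrDl lerDl mulr_ge0// ln_ge0// (le_trans R01).
    by rewrite ler_pM2l// ler_ln ?posrE// ltW.
  rewrite /A; have := HP x; have := P0 x; have := expR_gt0 (n%:R * C0); have := expR_gt0 (be * ln (enorm x)).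
  move: E; move: (expR (n%:R * C0)) (expR (be * _)) (expR (_ * LF F x)) (expR (_ * ln r)) (Psi x) => p q w q' P E q0 p0 Pp h8.
  exact: mul_aux.
have E2 : expR (be * ln r) * r ^+ n = expR ((be + n%:R) * ln r).
  by rewrite mulrDl expRD expRM_natl lnK.
have E3 : 1 <= expR ((be + n%:R) * ln r) by rewrite -[leLHS]expR0 ler_expR mulr_ge0// ltW.
have B2 : gv u r <= K * expR ((be + n%:R) * ln r).
  by apply: le_trans B _; exact: sum_aux (ltW (gv_gt0 R00)) E3 E2.
have := gv_gt0 r0 => g0.
rewrite -ben -[X in _ <= X + _]expRK addrC -lnM ?posrE ?expR_gt0// ler_ln ?posrE// mulr_gt0 ?expR_gt0//.
Qed.

(** A ball of radius r/4 centred at distance r/2 lies in B_r and sees only |x| between r/4 and r,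
    where ln|x| is ln r up to ln 4. Jensen on that single ball already yields the full exponent. *)
Lemma gv_lower (d : R) : 0 < d -> exists K M : R, forall r, M <= r ->
  n%:R * (1 - al - d) * ln r - K <= ln (gv u r).
Proof.
move=> d0; have [j Hj] := Sv_asym n1 Fi Fb d0.
pose R0 : R := expR j.+1%:R; have R00 : 0 < R0 by exact: expR_gt0.
have R01 : 1 <= R0 by rewrite /R0 -[leLHS]expR0 ler_expR.
have b0 := @ballvol_gt0 R n.
have cunx : continuous (fun x : V => n%:R * u x).
  by move=> x; apply: (@continuousM _ _ (fun _ : V => n%:R) u x); [exact: cst_continuous|exact: cu].
have cg : continuous (fun x => expR (n%:R * u x)).
  by move=> x; apply: (@continuous_comp _ _ _ (fun x : V => n%:R * u x) expR); [exact: cunx|exact: continuous_expR].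
pose K := n%:R * (`|al| * ln 4 - C0) + n%:R * c * LM F / bv - ln bv + n%:R * ln 4.
exists K, (4 * R0) => r Rr.
have r0 : 0 < r by lra.
pose rh := r / 4; have rh1 : R0 <= rh by rewrite /rh; lra.
have rh0 : 0 < rh by rewrite /rh; lra.
pose z : V := (r / 2) *: ebasis i0.
have ez : enorm z = r / 2 by rewrite enormZ enorm_ebasis mulr1 ger0_norm//; lra.
pose L := n%:R * (- ((al + d) * ln r) - `|al| * ln 4 + C0).
have l4 : 0 <= ln (4 : R) by rewrite ln_ge0// ler1n.
have Hx x : enorm (x - z) < rh -> rh <= enorm x /\ enorm x <= r.
  move=> xz; have t1 := enorm_triangle (x - z) z; rewrite subrK ez in t1.
  have t2 := enormB_ge z x; rewrite enormBC ez in t2.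
  by move: xz t1 t2; rewrite /rh; split; lra.
have nc : 0 <= n%:R * c by rewrite mulr_ge0// ltW.
have J := jensen_ball (f := fun x => n%:R * u x) (z := z) (L := L) n1 Fi Fb cunx rh0 nc.
have {}J : bv * rh ^+ n * expR (L - n%:R * c * LM F / (bv * rh ^+ n)) <= gv u r.
  apply: le_trans (J _) _.
    move=> x /Hx[x1 x2]; have xR : R0 <= enorm x by exact: le_trans x1.
    have x0 : 0 < enorm x by exact: lt_le_trans xR.
    have l1 : ln (enorm x) <= ln r by rewrite ler_ln ?posrE.
    have l2 : ln r - ln 4 <= ln (enorm x).
      by rewrite -ln_div ?posrE// ler_ln ?posrE.
    have h4 : al * ln (enorm x) <= al * ln r + `|al| * ln 4.
      have : al * (ln (enorm x) - ln r) <= `|al| * ln 4.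
        apply: le_trans (ler_norm _) _; rewrite normrM ler_wpM2l// ler_norml; apply/andP; split; lra.
      by lra.
    have h5 : d * ln (enorm x) <= d * ln r by rewrite ler_wpM2l// ltW.
    rewrite /L -mulrA -mulrBr ler_pM2l//.
    apply: le_trans (u_ge2 (Hj x xR)); rewrite lerD2r; apply: lower_aux.
    by rewrite !mulrDl; apply: le_trans (lerD h4 h5) _; rewrite addrAC.
  apply: Ig_le; [exact: cont_ibl_ball|exact: cont_ibl_ball|move=> x].
  rewrite ler_wpM2l ?expR_ge0//; rewrite {1}/ball_ind; have [xz|xz] := ltP (enorm (x - z)) rh; last exact: ball_ind_ge0.
  rewrite /ball_ind subr0 (_ : (enorm x < r)%R)//.
  have t1 := enorm_triangle (x - z) z; rewrite subrK ez in t1.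
  by move: xz t1; rewrite /rh; lra.
have rn1 : 1 <= rh ^+ n by rewrite exprn_ege1// (le_trans R01).
have v0 : 0 < bv * rh ^+ n by rewrite mulr_gt0// exprn_gt0.
have LM0 : 0 <= n%:R * c * LM F by rewrite mulr_ge0// LM_ge0.
have h6 : n%:R * c * LM F / (bv * rh ^+ n) <= n%:R * c * LM F / bv.
  by rewrite ler_wpM2l// lef_pV2 ?posrE// ler_peMr// ltW.
apply: (@le_trans _ _ (ln (bv * rh ^+ n * expR (L - n%:R * c * LM F / (bv * rh ^+ n))))); last first.
  by rewrite ler_ln ?posrE ?gv_gt0// mulr_gt0 ?expR_gt0.
rewrite lnM ?posrE ?expR_gt0// expRK lnvol// /rh ln_div ?posrE//.
move: h6; rewrite -/rh /L /K; move: (_ / (bv * _)) (_ * LM F / bv) (ln r) (ln 4) (ln bv) `|al| al => X Y l q b A A' h6.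
lra.
Qed.

(** The upper and lower volume bounds squeeze the quotient itself, so the limsup is in fact a
    limit. *)
Lemma entropyE : gcomplete u -> vol_entropy u = (1 - al)%:E.
Proof.
move=> gc; have a1 := alpha_le1 gc; pose t := 1 - al.
have near_t (d : R) : 0 < d -> exists M : R, forall r, M < r ->
    t - d <= ln (gvol u r) / ln (Rn_vol (eball r : set V)) <= t + d.
  move=> d0; have d2 : 0 < d / 2 by rewrite divr_gt0.
  have [K1 [M1 H1]] := gv_upper a1 d2; have [K2 [M2 H2]] := gv_lower d2.
  (* Once ln r >= Q, the additive constants of both estimates and the terms with ln bv together are
     at most (d/2) n ln r, and the denominator is positive. *)
  pose Q := (`|K1| + `|K2| + (`|t| + d) * `|ln bv|) * 2 / d + `|ln bv| + 1.
  have [M3 [M31 H3]] := ln_unbounded Q.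
  exists (Num.max M1 (Num.max M2 M3)) => r; rewrite !gt_max => /and3P[r1 r2 r3].
  have r0 : 0 < r by apply: lt_trans r3; exact: lt_trans M31.
  have h1 := H1 r (ltW r1); have h2 := H2 r (ltW r2); have h3 := H3 r (ltW r3).
  rewrite entropy_ratioE//.
  have n1' : 1 <= n%:R :> R by rewrite ler1n.
  have q0 : 0 <= (`|K1| + `|K2| + (`|t| + d) * `|ln bv|) * 2 / d.
    by rewrite divr_ge0 ?(ltW d0)// mulr_ge0// addr_ge0 ?addr_ge0// mulr_ge0 ?addr_ge0 ?(ltW d0).
  have lr0 : 0 <= ln r by apply: le_trans h3; rewrite /Q !addr_ge0.
  have nl : ln r <= n%:R * ln r by rewrite ler_peMl.
  have lb := ler_norm (- ln bv); rewrite normrN in lb.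
  have D0 : 0 < ln bv + n%:R * ln r by move: h3 nl lb q0; rewrite /Q; lra.
  have h4 : (`|K1| + `|K2| + (`|t| + d) * `|ln bv|) <= d / 2 * (n%:R * ln r).
    have : (`|K1| + `|K2| + (`|t| + d) * `|ln bv|) * 2 / d <= n%:R * ln r.
      apply: le_trans nl; apply: le_trans h3; rewrite /Q; move: (_ * 2 / d) (normr_ge0 (ln bv)) => W b0; lra.
    by rewrite ler_pdivrMr// => h; lra.
  have k1 := ler_norm K1; have k2 := ler_norm K2.
  have tb1 : `|(t + d) * ln bv| <= (`|t| + d) * `|ln bv|.
    by rewrite normrM ler_wpM2r// (le_trans (ler_normD _ _))// (gtr0_norm d0).
  have tb2 : `|(t - d) * ln bv| <= (`|t| + d) * `|ln bv|.
    by rewrite normrM ler_wpM2r// (le_trans (ler_normB _ _))// (gtr0_norm d0).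
  rewrite ler_norml in tb1; rewrite ler_norml in tb2.
  have /andP[tb3 _] := tb1; have /andP[_ tb4] := tb2.
  have kn1 := normr_ge0 K1; have kn2 := normr_ge0 K2.
  rewrite -/t in h1 h2; rewrite ler_pdivlMr// ler_pdivrMr//.
  exact: ratio_aux h1 h2 h4 k1 k2 kn1 kn2 tb3 tb4.
apply/eqP; rewrite eq_le; apply/andP; split.
  apply/lee_addgt0Pr => d d0; have [M HM] := near_t d d0.
  by rewrite -EFinD; apply: (limf_esup_le (M := M)) => r /HM/andP[].
apply/lee_subgt0Pr => d d0; have [M HM] := near_t d d0.
rewrite -EFinB; apply: limf_esup_ge => M'; exists (Num.max M M' + 1).
  by rewrite ltr_pwDr// le_max lexx orbT.
by have /HM/andP[] : M < Num.max M M' + 1 by rewrite ltr_pwDr// le_max lexx.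
Qed.

End volume_entropy.

(** * Normal metrics *)

Section normal_metrics.
Context {R : realType} {n : nat}.
Notation V := 'rV[R]_n.
Notation mu := (@vmeas R n).
Notation I := (Ig mu).
Implicit Types (x y : V).

Lemma cnE : @cn R n = 2 / ((n.-1)`!%:R * sphere_vol n).
Proof. by rewrite /cn /cP invfM mulrAC mulrA. Qed.

(** ln(|y| / |x - y|) and ln|y| - ln|x - y| can differ only at y = 0 and y = x, a set without mass;
    the integrability demanded by [normal] follows from that of the difference. *)
Lemma normalP (u Q F : V -> R) : (1 < n)%N -> (fun y => Q y * expR (n%:R * u y)) = F -> ibl mu F -> lbounded F ->
  normal u Q <-> exists C, forall x, u x = vp F x + C.
Proof.
move=> n1 FE Fi Fb; have n0 := ltnW n1.
pose g x y := ln (enorm y / enorm (x - y)) * F y.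
have gE x : ibl mu (g x) /\ Rn_integral (g x) = I (fun y => (ln (enorm y) - ln (enorm (x - y))) * F y).
  have iv := ibl_v n1 Fi Fb x.
  have mg : measurable_fun [set: V] (g x).
    apply: measurable_funM; last exact: ibl_meas Fi.
    apply: measurableT_comp; first exact: measurable_ln.
    apply: measurable_funM; first exact: measurable_enorm.
    exact: measurable_funV (mreflB x (@measurable_enorm R n)).
  have off y : y \notin [:: 0; x] -> g x y - (ln (enorm y) - ln (enorm (x - y))) * F y = 0.
    rewrite !inE negb_or => /andP[y0 yx].
    have py : 0 < enorm y by rewrite enorm_gt0.
    have pxy : 0 < enorm (x - y) by rewrite enorm_gt0 subr_eq0 eq_sym.
    by rewrite /g ln_div ?posrE// subrr.
  have [i1 E1] := @Ig_finite_support R n n0 _ _ (measurable_funB mg (ibl_meas iv)) off.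
  have E y : (ln (enorm y) - ln (enorm (x - y))) * F y + (g x y - (ln (enorm y) - ln (enorm (x - y))) * F y) = g x y.
    by rewrite addrC subrK.
  have ig := eq_ibl E (iblD iv i1); split => //.
  by rewrite (Rn_integralE ig) -(eq_Ig mu E) (IgD iv i1) E1 addr0.
have gQ x : (fun y => ln (enorm y / enorm (x - y)) * (Q y * expR (n%:R * u y))) = g x.
  by apply/funext => y; rewrite /g -FE.
split=> [[C H]|[C H]]; exists C => x.
  by have [_ ->] := H x; rewrite gQ -cnE; have [_ ->] := gE x.
by rewrite gQ -cnE H; have [ig ->] := gE x; split => //; apply/Rn_integrableP.
Qed.

End normal_metrics.

Theorem theorem1p1 (R : realType) (n : nat) (u Q : 'rV[R]_n -> R) :
  (2 <= n)%N ->
  smooth u ->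
  gcomplete u ->
  frac_lap_eq u (fun x => Q x * expR (n%:R * u x)) ->
  Rn_integrable (fun x => Q x * expR (n%:R * u x)) ->
  (normal u Q <-> vol_entropy u \is a fin_num) /\
  (vol_entropy u \is a fin_num ->
     vol_entropy u = (1 - 2 / ((n.-1)`!%:R * sphere_vol n) *
                       Rn_integral (fun x => Q x * expR (n%:R * u x)))%:E).
Proof.
move=> n1 su gc uF /Rn_integrableP Fi.
set F := (fun x => Q x * expR (n%:R * u x)) in uF Fi *.
have n0 : (0 < n)%N := ltnW n1.
have Fb : lbounded F := F_lbounded n0 su uF.
have N := normalP n1 (erefl F) Fi Fb.
(* Used twice: its right side is a real number, so it gives finiteness of the entropy for a normal
   metric, and it is the formula itself. *)
have E : (exists C, forall x, u x = vp F x + C) -> vol_entropy u = (1 - alpha F)%:E.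
  by move=> [C uE]; apply: (entropyE n1 su Fi Fb uE gc).
(* Finite entropy acts through the polynomial growth of the volume of balls. *)
have D : vol_entropy u \is a fin_num -> exists C, forall x, u x = vp F x + C.
  move=> fu; apply: (u_eq_vp n1 su gc uF Fi); apply: (entropy_bound_growth n1 su).
  by move: fu; rewrite fin_numE => /andP[_]; rewrite ltey.
split; first by split=> [/N/E ->//|/D/N].
by move=> /D/E ->; rewrite /alpha cnE Rn_integralE.
Qed.
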